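(* Let $\hat{\mathcal{L}} \subset \hat{\mathcal{X}}_2$ be a real Lie subalgebra of finite dimension, saturable and of rank $1$. Then there exists a real Lie subalgebra $\mathcal{L} \subset \mathcal{X}_2$ of germs of $\mathcal{C}^\infty$ vector fields such that $T_{\underline{0}}(\mathcal{L}) = \hat{\mathcal{L}}$ and $T_{\underline{0}} : \mathcal{L} \to \hat{\mathcal{L}}$ is an isomorphism of Lie algebras.
   Context: $\mathcal{X}_2$ is the real Lie algebra of germs at $\underline{0} \in \mathbb{R}^2$ of $\mathcal{C}^\infty$ vector fields. $\hat{\mathcal{E}}_2 = \mathbb{R}[[x_1,x_2]]$, and $\hat{\mathcal{X}}_2$ is the real Lie algebra of formal vector fields $\hat a_1 \frac{\partial}{\partial x_1} + \hat a_2 \frac{\partial}{\partial x_2}$ with $\hat a_i \in \hat{\mathcal{E}}_2$. $T_{\underline{0}} : \mathcal{X}_2 \to \hat{\mathcal{X}}_2$ is the infinite Taylor expansion at $\underline{0}$. The rank (generic pointwise rank) of a nonzero subalgebra $\hat{\mathcal{L}}$ is the maximal number of elements of $\hat{\mathcal{L}}$ that are linearly independent over $\hat{\mathcal{E}}_2$. A rank-$1$ subalgebra $\hat{\mathcal{L}}$ is saturable if it contains an element $\hat X = \sum \hat a_i \frac{\partial}{\partial x_i}$ with $\gcd(\hat a_1,\hat a_2) = 1$ in $\hat{\mathcal{E}}_2$. *)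

(* Defs.v *)
From HB Require Import structures.
From mathcomp Require Import all_boot all_order all_algebra.
From mathcomp Require Import ring_quotient generic_quotient.
From mathcomp Require Import ring lra.
From mathcomp Require Import mathcomp_extra boolp classical_sets functions.
From mathcomp Require Import reals topology normedtype derive realfun.

Set Implicit Arguments.
Unset Strict Implicit.
Unset Printing Implicit Defensive.
Import Order.TTheory GRing.Theory Num.Theory.
Import numFieldNormedType.Exports.
Local Open Scope classical_set_scope.
Local Open Scope ring_scope.

HB.mixin Record Lmodule_isLie (R : comNzRingType) V of GRing.Lmodule R V := {
  lie : V -> V -> V;
  lie_linearl : forall (a : R) x y z,
    lie (a *: x + y) z = a *: lie x z + lie y z;
  lie_linearr : forall (a : R) x y z,
    lie x (a *: y + z) = a *: lie x y + lie x z;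
  liexx : forall x, lie x x = 0;
  jacobi : forall x y z, lie x (lie y z) + lie y (lie z x) + lie z (lie x y) = 0
}.

#[short(type="lieAlgType")]
HB.structure Definition LieAlgebra (R : comNzRingType) :=
  {V of GRing.Lmodule R V & Lmodule_isLie R V}.

Section LieSubalgebras.
Variables (R : comNzRingType) (V W : lieAlgType R).

Definition is_lie_subalgebra (L : set V) :=
  [/\ L 0, (forall (a : R) x y, L x -> L y -> L (a *: x + y))
     & forall x y, L x -> L y -> L (lie x y)].

Definition finite_dimensional (L : set V) :=
  exists n (e : 'I_n -> V),
    L = [set x | exists c : 'I_n -> R, x = \sum_i c i *: e i].

Definition is_lie_isomorphism (L : set V) (M : set W) (f : V -> W) :=
  [/\ set_bij L M f,
      (forall (a : R) x y, L x -> L y -> f (a *: x + y) = a *: f x + f y)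
    & forall x y, L x -> L y -> f (lie x y) = lie (f x) (f y)].

End LieSubalgebras.

(* The vector field a_0 d/dx_1 + a_1 d/dx_2 is the pair of its coefficients
   (a_0, a_1); D i plays the role of d/dx_(i+1) on the coefficient algebra A. *)
Section VectorFields.
Variables (R : comNzRingType) (A : comAlgType R) (D : 'I_2 -> A -> A).
Implicit Types X Y Z : {ffun 'I_2 -> A}.

Definition vf_apply X (f : A) : A := \sum_i X i * D i f.

Definition vf_bracket X Y : {ffun 'I_2 -> A} :=
  [ffun k => vf_apply X (Y k) - vf_apply Y (X k)].

Hypothesis D_linear : forall i, linear (D i).
Hypothesis DM : forall i f g, D i (f * g) = D i f * g + f * D i g.
Hypothesis DC : forall i j f, D i (D j f) = D j (D i f).

Lemma DD i f g : D i (f + g) = D i f + D i g.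
Proof. by have := D_linear i 1 f g; rewrite !scale1r. Qed.

Lemma vf_apply_linearl a X Y f :
  vf_apply (a *: X + Y) f = a *: vf_apply X f + vf_apply Y f.
Proof.
rewrite /vf_apply scaler_sumr -big_split /=; apply: eq_bigr => i _.
by rewrite !ffunE mulrDl scalerAl.
Qed.

Lemma vf_apply_linearr a X f g :
  vf_apply X (a *: f + g) = a *: vf_apply X f + vf_apply X g.
Proof.
rewrite /vf_apply scaler_sumr -big_split /=; apply: eq_bigr => i _.
by rewrite D_linear mulrDr scalerAr.
Qed.

Lemma vf_applyB X f g : vf_apply X (f - g) = vf_apply X f - vf_apply X g.
Proof. by rewrite -!(addrC (- _)) -!scaleN1r vf_apply_linearr. Qed.

Lemma vf_apply_bracket X Y f :
  vf_apply (vf_bracket X Y) f = vf_apply X (vf_apply Y f) - vf_apply Y (vf_apply X f).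
Proof.
rewrite /vf_bracket /vf_apply !big_ord_recl !big_ord0 !ffunE.
rewrite !big_ord_recl !big_ord0 !addr0 !DD !DM.
set i := ord0; set j := lift _ _; rewrite (DC j i); ring.
Qed.

Lemma vf_bracket_linearl a X Y Z :
  vf_bracket (a *: X + Y) Z = a *: vf_bracket X Z + vf_bracket Y Z.
Proof.
apply/ffunP => k; rewrite !ffunE vf_apply_linearl vf_apply_linearr.
by rewrite opprD addrACA scalerBr.
Qed.

Lemma vf_bracket_linearr a X Y Z :
  vf_bracket X (a *: Y + Z) = a *: vf_bracket X Y + vf_bracket X Z.
Proof.
apply/ffunP => k; rewrite !ffunE vf_apply_linearl vf_apply_linearr.
by rewrite opprD addrACA scalerBr.
Qed.

Lemma vf_bracketxx X : vf_bracket X X = 0.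
Proof. by apply/ffunP => k; rewrite !ffunE subrr. Qed.

Lemma vf_jacobi X Y Z : vf_bracket X (vf_bracket Y Z) +
  vf_bracket Y (vf_bracket Z X) + vf_bracket Z (vf_bracket X Y) = 0.
Proof.
apply/ffunP => k; rewrite [LHS]ffunE [X in X + _]ffunE.
rewrite ![vf_bracket _ (vf_bracket _ _) k]ffunE !vf_apply_bracket.
by rewrite ![vf_bracket _ _ k]ffunE !vf_applyB [RHS]ffunE; ring.
Qed.

End VectorFields.

(* fps_coef f m n is the coefficient of x_1 ^ m * x_2 ^ n in f. *)
Record fps2 (R : Type) := Fps2 { fps_coef : nat -> nat -> R }.

Section Convolution.
Variable V : nmodType.

Lemma conv_assoc (F : nat -> nat -> nat -> V) n :
  \sum_(k < n.+1) \sum_(l < (n - k).+1) F k l (n - k - l)%N =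
  \sum_(k < n.+1) \sum_(l < k.+1) F l (k - l)%N (n - k)%N.
Proof.
transitivity (\sum_(k < n.+1) \sum_(m < n.+1 | (k <= m)%N) F k (m - k)%N (n - m)%N).
  apply: eq_bigr => -[k /= kn] _.
  rewrite -(big_mkord (fun m => k <= m)%N (fun m => F k (m - k)%N (n - m)%N)).
  rewrite -(big_mkord predT (fun l => F k l (n - k - l)%N)).
  rewrite -(big_nat_widenl k 0 _ predT) // -{4}(add0n k) big_addn subSn //.
  by apply: eq_big_nat => l _; rewrite addnK subnDA subnAC.
rewrite (exchange_big_dep xpredT) //=; apply: eq_bigr => -[k /= kn] _.
rewrite -(big_mkord (fun l => l <= k)%N (fun l => F l (k - l)%N (n - k)%N)).
rewrite -(big_mkord predT (fun l => F l (k - l)%N (n - k)%N)).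
rewrite [RHS](big_nat_widen _ _ n.+1) //.
Qed.

Lemma conv_comm (F : nat -> nat -> V) n :
  \sum_(k < n.+1) F k (n - k)%N = \sum_(k < n.+1) F (n - k)%N k.
Proof.
rewrite (reindex_inj rev_ord_inj) /=; apply: eq_bigr => -[k /= kn] _.
by rewrite subSS subKn.
Qed.

Lemma conv_leibniz (F : nat -> nat -> V) n :
  (\sum_(k < n.+2) F k (n.+1 - k)%N) *+ n.+1 =
  \sum_(k < n.+1) F k.+1 (n - k)%N *+ k.+1 +
  \sum_(k < n.+1) F k (n - k).+1 *+ (n - k).+1.
Proof.
transitivity (\sum_(k < n.+2) F k (n.+1 - k)%N *+ k +
              \sum_(k < n.+2) F k (n.+1 - k)%N *+ (n.+1 - k)).
  rewrite -sumrMnl -big_split /=; apply: eq_bigr => -[k /= kn] _.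
  by rewrite -mulrnDr subnKC.
congr (_ + _); first by rewrite big_ord_recl mulr0n add0r.
rewrite big_ord_recr /= subnn mulr0n addr0.
by apply: eq_bigr => -[k /= kn] _; rewrite subSn.
Qed.

End Convolution.

Section PowerSeries.
Variable R : comNzRingType.
Implicit Types f g h : fps2 R.

Lemma fps2P f g : (forall m n, fps_coef f m n = fps_coef g m n) -> f = g.
Proof.
case: f g => [f] [g] /= fg; congr Fps2.
by apply/funext => m; apply/funext => n; apply: fg.
Qed.

HB.instance Definition _ := gen_eqMixin (fps2 R).
HB.instance Definition _ := gen_choiceMixin (fps2 R).

Definition fps_zero : fps2 R := Fps2 (fun _ _ => 0).
Definition fps_opp f := Fps2 (fun m n => - fps_coef f m n).
Definition fps_add f g := Fps2 (fun m n => fps_coef f m n + fps_coef g m n).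

Fact fps_addA : associative fps_add.
Proof. by move=> f g h; apply: fps2P => m n /=; rewrite addrA. Qed.
Fact fps_addC : commutative fps_add.
Proof. by move=> f g; apply: fps2P => m n /=; rewrite addrC. Qed.
Fact fps_add0 : left_id fps_zero fps_add.
Proof. by move=> f; apply: fps2P => m n /=; rewrite add0r. Qed.
Fact fps_addN : left_inverse fps_zero fps_opp fps_add.
Proof. by move=> f; apply: fps2P => m n /=; rewrite addNr. Qed.

HB.instance Definition _ :=
  GRing.isZmodule.Build (fps2 R) fps_addA fps_addC fps_add0 fps_addN.

Definition fps_one : fps2 R :=
  Fps2 (fun m n => ((m == 0%N) && (n == 0%N))%:R).
Definition fps_mul f g := Fps2 (fun m n =>
  \sum_(k < m.+1) \sum_(l < n.+1)
    fps_coef f k l * fps_coef g (m - k) (n - l)).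

Fact fps_mulC : commutative fps_mul.
Proof.
move=> f g; apply: fps2P => m n /=.
rewrite (conv_comm (fun k k' => \sum_(l < n.+1)
  fps_coef f k l * fps_coef g k' (n - l))).
apply: eq_bigr => k _.
rewrite (conv_comm (fun l l' => fps_coef f (m - k) l * fps_coef g k l')).
by apply: eq_bigr => l _; rewrite mulrC.
Qed.

Fact fps_mulA : associative fps_mul.
Proof.
move=> f g h; apply: fps2P => m n /=.
pose F k l k' l' k'' l'' := fps_coef f k l * fps_coef g k' l' * fps_coef h k'' l''.
transitivity (\sum_(k < m.+1) \sum_(k' < (m - k).+1)
   \sum_(l < n.+1) \sum_(l' < (n - l).+1)
      F k l k' l' (m - k - k')%N (n - l - l')%N).
  apply: eq_bigr => k _; rewrite exchange_big /=; apply: eq_bigr => l _.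
  rewrite mulr_sumr; apply: eq_bigr => k' _; rewrite mulr_sumr.
  by apply: eq_bigr => l' _; rewrite mulrA.
rewrite (conv_assoc (fun k k' k'' => \sum_(l < n.+1) \sum_(l' < (n - l).+1)
      F k l k' l' k'' (n - l - l')%N)).
apply: eq_bigr => k _; under [RHS]eq_bigr do rewrite mulr_suml.
rewrite [RHS]exchange_big /=; apply: eq_bigr => k' _.
rewrite (conv_assoc (fun l l' l'' => F k' l (k - k')%N l' (m - k)%N l'')).
by apply: eq_bigr => l _; rewrite mulr_suml.
Qed.

Fact fps_mul1 : left_id fps_one fps_mul.
Proof.
move=> f; apply: fps2P => m n /=.
rewrite big_ord_recl /= [X in _ + X]big1 ?addr0; last first.
  by move=> k _; apply: big1 => l _; rewrite mul0r.
rewrite big_ord_recl /= [X in _ + X]big1 ?addr0.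
  by rewrite mul1r !subn0.
by move=> l _; rewrite mul0r.
Qed.

Fact fps_mulD : left_distributive fps_mul fps_add.
Proof.
move=> f g h; apply: fps2P => m n /=; rewrite -big_split; apply: eq_bigr => k _.
by rewrite -big_split; apply: eq_bigr => l _; rewrite mulrDl.
Qed.

Fact fps_one_neq0 : fps_one != 0.
Proof.
by apply/eqP => /(congr1 (fun f => fps_coef f 0 0)) /= /eqP; rewrite oner_eq0.
Qed.

HB.instance Definition _ := GRing.Zmodule_isComNzRing.Build (fps2 R)
  fps_mulA fps_mulC fps_mul1 fps_mulD fps_one_neq0.

Definition fps_scale (a : R) f := Fps2 (fun m n => a * fps_coef f m n).

Fact fps_scaleA a b f : fps_scale a (fps_scale b f) = fps_scale (a * b) f.
Proof. by apply: fps2P => m n /=; rewrite mulrA. Qed.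
Fact fps_scale1 : left_id 1 fps_scale.
Proof. by move=> f; apply: fps2P => m n /=; rewrite mul1r. Qed.
Fact fps_scaleDr : right_distributive fps_scale +%R.
Proof. by move=> a f g; apply: fps2P => m n /=; rewrite mulrDr. Qed.
Fact fps_scaleDl f : {morph fps_scale^~ f : a b / a + b}.
Proof. by move=> a b; apply: fps2P => m n /=; rewrite mulrDl. Qed.

HB.instance Definition _ := GRing.Zmodule_isLmodule.Build R (fps2 R)
  fps_scaleA fps_scale1 fps_scaleDr fps_scaleDl.

Fact fps_scaleAl (a : R) f g : a *: (f * g) = a *: f * g.
Proof.
apply: fps2P => m n /=; rewrite mulr_sumr; apply: eq_bigr => k _.
by rewrite mulr_sumr; apply: eq_bigr => l _; rewrite mulrA.
Qed.

HB.instance Definition _ :=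
  GRing.Lmodule_isLalgebra.Build R (fps2 R) fps_scaleAl.
HB.instance Definition _ := GRing.Lalgebra_isComAlgebra.Build R (fps2 R).

Definition fps_deriv (i : 'I_2) f : fps2 R := Fps2 (fun m n =>
  if i == ord0 then fps_coef f m.+1 n *+ m.+1 else fps_coef f m n.+1 *+ n.+1).

Fact fps_deriv_linear i : linear (fps_deriv i).
Proof.
move=> a f g; apply: fps2P => m n /=.
by case: ifP => _; rewrite mulrnDl mulrnAr.
Qed.

Fact fps_derivM i f g :
  fps_deriv i (f * g) = fps_deriv i f * g + f * fps_deriv i g.
Proof.
apply: fps2P => m n /=; case: ifP => _.
  rewrite (conv_leibniz (fun k k' => \sum_(l < n.+1)
    fps_coef f k l * fps_coef g k' (n - l))).
  by congr (_ + _); apply: eq_bigr => k _; rewrite -sumrMnl;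
    apply: eq_bigr => l _; rewrite ?mulrnAl ?mulrnAr.
rewrite -sumrMnl -big_split; apply: eq_bigr => k _.
rewrite (conv_leibniz (fun l l' => fps_coef f k l * fps_coef g (m - k) l')).
by congr (_ + _); apply: eq_bigr => l _; rewrite ?mulrnAl ?mulrnAr.
Qed.

Fact fps_derivC i j f :
  fps_deriv i (fps_deriv j f) = fps_deriv j (fps_deriv i f).
Proof.
apply: fps2P => m n /=.
by case: ifP => _; case: ifP => _ //; rewrite -!mulrnA mulnC.
Qed.

End PowerSeries.

Definition formal_vf (R : comNzRingType) := {ffun 'I_2 -> fps2 R}.

HB.instance Definition _ (R : comNzRingType) := GRing.Lmodule.on (formal_vf R).
HB.instance Definition _ (R : comNzRingType) :=
  @Lmodule_isLie.Build R (formal_vf R) (vf_bracket (@fps_deriv R))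
    (vf_bracket_linearl (@fps_deriv_linear R))
    (vf_bracket_linearr (@fps_deriv_linear R))
    (vf_bracketxx (@fps_deriv R))
    (vf_jacobi (@fps_deriv_linear R) (@fps_derivM R) (@fps_derivC R)).

Section FormalVectorFields.
Variable R : comNzRingType.
Implicit Types (f g d : fps2 R) (L : set (formal_vf R)).

Definition fps_linindep k (X : 'I_k -> formal_vf R) :=
  forall c : 'I_k -> fps2 R,
    (forall j, \sum_i c i * X i j = 0) -> forall i, c i = 0.

Definition vf_rank L (r : nat) :=
  (exists X : 'I_r -> formal_vf R, (forall i, L (X i)) /\ fps_linindep X) /\
  (forall k (X : 'I_k -> formal_vf R),
     (forall i, L (X i)) -> fps_linindep X -> (k <= r)%N).

Definition fps_dvd d f := exists g, f = g * d.

(* gcd(f, g) = 1 up to units: every common divisor divides 1. *)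
Definition fps_coprime f g :=
  forall d, fps_dvd d f -> fps_dvd d g -> fps_dvd d 1.

Definition saturable L := exists2 X, L X & fps_coprime (X ord0) (X ord_max).

End FormalVectorFields.

Section SmoothFunctions.
Variable R : realType.
Implicit Types (f g : 'rV[R]_2 -> R) (U : set 'rV[R]_2) (i j : 'I_2).

Definition partial i f : 'rV[R]_2 -> R := 'D_(delta_mx 0 i) f.

Definition partials (s : seq 'I_2) f := foldr partial f s.

(* For U open this is C^oo smoothness on U: all iterated partial derivatives
   exist and are continuous at every point of U. *)
Definition smooth_on U f := forall s x, U x ->
  (forall i, derivable (partials s f) x (delta_mx 0 i)) /\
  {for x, continuous (partials s f)}.

Definition smooth_near0 f := exists2 U, open_nbhs (0 : 'rV[R]_2) U & smooth_on U f.

Lemma near_eq_on U f g x : open U -> (forall y, U y -> f y = g y) -> U x ->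
  \near x, f x = g x.
Proof. by move=> oU fg Ux; apply: (filterS fg); apply: open_nbhs_nbhs. Qed.

Lemma partial_eq_on U f g i : open U -> (forall x, U x -> f x = g x) ->
  forall x, U x -> partial i f x = partial i g x.
Proof.
move=> oU fg x Ux; apply: near_eq_derive.
exact: (near_eq_on oU fg Ux).
Qed.

Lemma partials_eq_on U f g s : open U -> (forall x, U x -> f x = g x) ->
  forall x, U x -> partials s f x = partials s g x.
Proof. by move=> oU fg; elim: s => //= i s IHs; apply: partial_eq_on. Qed.

Lemma derivable_eq_on U f g x v : open U -> (forall y, U y -> f y = g y) ->
  U x -> derivable f x v -> derivable g x v.
Proof.
move=> oU fg Ux dfx; apply: (near_eq_derivable _ dfx).
exact: (near_eq_on oU fg Ux).
Qed.

Lemma continuous_eq_on U f g x : open U -> (forall y, U y -> f y = g y) ->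
  U x -> {for x, continuous f} -> {for x, continuous g}.
Proof.
move=> oU fg Ux; rewrite /prop_for /continuous_at -(fg x Ux) => cf.
apply: cvg_trans cf; apply: (@near_eq_cvg _ _ (nbhs x)).
exact: (near_eq_on oU fg Ux).
Qed.

Lemma smooth_on_partial U f i : smooth_on U f -> smooth_on U (partial i f).
Proof. by move=> fU s x Ux; have := fU (rcons s i) x Ux; rewrite /partials foldr_rcons; apply. Qed.

Lemma smooth_onS U V f : V `<=` U -> smooth_on U f -> smooth_on V f.
Proof. by move=> VU fU s x /VU Ux; exact: (fU s x Ux). Qed.

Lemma smooth_on_eq U f g : open U -> (forall x, U x -> f x = g x) ->
  smooth_on U f -> smooth_on U g.
Proof.
move=> oU fg fU s x Ux; have sfg := partials_eq_on s oU fg.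
have [df cf] := fU s x Ux; split=> [i|]; first exact: (derivable_eq_on oU sfg Ux (df i)).
exact: (continuous_eq_on oU sfg Ux cf).
Qed.

(* The algebra generated by the smooth functions is stable under partial
   derivatives, up to equality on U. *)
Inductive smooth_gen U : ('rV[R]_2 -> R) -> Prop :=
| SgenBase f of smooth_on U f : smooth_gen U f
| SgenCst c : smooth_gen U (cst c)
| SgenAdd f g of smooth_gen U f & smooth_gen U g : smooth_gen U (f + g)
| SgenMul f g of smooth_gen U f & smooth_gen U g : smooth_gen U (f * g).

Lemma smooth_gen_derivable U f x i : smooth_gen U f -> U x ->
  derivable f x (delta_mx 0 i).
Proof.
move=> + Ux; elim=> [{}f /(_ [::] x Ux) [] // |c|{}f g _ df _ dg|{}f g _ df _ dg].
- exact: derivable_cst.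
- exact: derivableD.
- exact: derivableM.
Qed.

Lemma smooth_gen_continuous U f x : smooth_gen U f -> U x -> {for x, continuous f}.
Proof.
move=> + Ux; elim=> [{}f /(_ [::] x Ux) [] // |c|{}f g _ df _ dg|{}f g _ df _ dg].
- exact: cst_continuous.
- exact: continuousD.
- exact: continuousM.
Qed.

Lemma smooth_gen_partial U f i : smooth_gen U f ->
  exists2 g, smooth_gen U g & forall x, U x -> partial i f x = g x.
Proof.
elim=> [{}f fU|c|{}f g sf [f' sf' ff'] sg [g' sg' gg']
       |{}f g sf [f' sf' ff'] sg [g' sg' gg']].
- by exists (partial i f) => //; apply/SgenBase/smooth_on_partial.
- exists (cst 0); first exact: SgenCst.
  by move=> x _; rewrite /partial derive_cst.
- exists (f' + g'); first exact: SgenAdd.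
  move=> x Ux; rewrite /partial deriveD; try exact: smooth_gen_derivable Ux.
  by congr (_ + _); [apply: ff'|apply: gg'].
- exists (f * g' + g * f'); first by apply: SgenAdd; apply: SgenMul.
  move=> x Ux; rewrite /partial deriveM; try exact: smooth_gen_derivable Ux.
  by congr (_ *: _ + _ *: _); [apply: gg'|apply: ff'].
Qed.

Lemma smooth_gen_smooth U f : open U -> smooth_gen U f -> smooth_on U f.
Proof.
move=> oU sf s.
have [g sg fg] : exists2 g, smooth_gen U g & forall x, U x -> partials s f x = g x.
  elim: s => [|i s [g sg fg]]; first by exists f.
  have [h sh gh] := smooth_gen_partial i sg.
  by exists h => // x Ux; rewrite -gh//; apply: partial_eq_on Ux.
have gf x : U x -> g x = partials s f x by move=> /fg.
move=> x Ux; split=> [i|].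
  by apply: (derivable_eq_on oU gf Ux); apply: smooth_gen_derivable Ux.
by apply: (continuous_eq_on oU gf Ux); apply: smooth_gen_continuous Ux.
Qed.

Lemma smooth_on_cst U c : open U -> smooth_on U (cst c).
Proof. by move=> oU; apply/smooth_gen_smooth/SgenCst. Qed.

Lemma smooth_onD U f g : open U ->
  smooth_on U f -> smooth_on U g -> smooth_on U (f + g).
Proof.
by move=> oU fU gU; apply: smooth_gen_smooth => //; apply: SgenAdd; apply: SgenBase.
Qed.

Lemma smooth_onM U f g : open U ->
  smooth_on U f -> smooth_on U g -> smooth_on U (f * g).
Proof.
by move=> oU fU gU; apply: smooth_gen_smooth => //; apply: SgenMul; apply: SgenBase.
Qed.

Lemma smooth_near0_cst c : smooth_near0 (cst c).
Proof.
exists setT; last exact/smooth_on_cst/openT.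
by split=> //; exact: openT.
Qed.

Lemma smooth_near0D f g : smooth_near0 f -> smooth_near0 g -> smooth_near0 (f + g).
Proof.
move=> [U U0 fU] [V V0 gV]; have [oUV _] := open_nbhsI U0 V0.
exists (U `&` V); first exact: open_nbhsI.
by apply: smooth_onD => //; [apply: smooth_onS fU|apply: smooth_onS gV] => x [].
Qed.

Lemma smooth_near0M f g : smooth_near0 f -> smooth_near0 g -> smooth_near0 (f * g).
Proof.
move=> [U U0 fU] [V V0 gV]; have [oUV _] := open_nbhsI U0 V0.
exists (U `&` V); first exact: open_nbhsI.
by apply: smooth_onM => //; [apply: smooth_onS fU|apply: smooth_onS gV] => x [].
Qed.

Lemma smooth_near0_partial f i : smooth_near0 f -> smooth_near0 (partial i f).
Proof. by move=> [U U0 fU]; exists U => //; apply: smooth_on_partial. Qed.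

Lemma smooth_near0_partials f s : smooth_near0 f -> smooth_near0 (partials s f).
Proof. by move=> sf; elim: s => //= i s; apply: smooth_near0_partial. Qed.

Lemma is_derive_line f (y v : 'rV[R]_2) (t : R) : derivable f (y + t *: v) v ->
  is_derive t 1 (fun t => f (y + t *: v)) ('D_v f (y + t *: v)).
Proof.
move=> df; suff E : (fun h : R => h^-1 *:
    (((fun t => f (y + t *: v)) \o shift t) (h *: 1) - f (y + t *: v))) =
    (fun h => h^-1 *: ((f \o shift (y + t *: v)) (h *: v) - f (y + t *: v))).
  by split; rewrite /derivable /derive /= E.
apply/funext => h /=; congr (_ *: (f _ - _)).
by rewrite [h *: 1]mulr1 scalerDl addrCA.
Qed.

Lemma MVT_line f (y v : 'rV[R]_2) (h : R) : 0 < h ->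
  (forall t, 0 <= t <= h -> derivable f (y + t *: v) v) ->
  exists2 t, 0 <= t <= h & f (y + h *: v) - f y = 'D_v f (y + t *: v) * h.
Proof.
move=> h0 df; pose F t := f (y + t *: v).
have dF t : 0 <= t <= h -> is_derive t 1 F ('D_v f (y + t *: v)).
  by move=> /df; apply: is_derive_line.
have [t|//|t] := @MVT R F (fun t => 'D_v f (y + t *: v)) 0 h h0.
- by rewrite in_itv /= => /andP[t0 th]; apply: dF; rewrite !ltW.
- apply: derivable_within_continuous => t; rewrite in_itv /= => /dF dt.
  exact: ex_derive.
- rewrite in_itv /= => /andP[t0 th]; rewrite /F scale0r addr0 subr0 => E.
  by exists t => //; rewrite !ltW.
Qed.

Lemma second_difference U f i j x (h : R) : 0 < h -> smooth_on U f ->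
  (forall a b, 0 <= a <= h -> 0 <= b <= h ->
     U (x + a *: delta_mx 0 i + b *: delta_mx 0 j)) ->
  exists a b, [/\ 0 <= a <= h, 0 <= b <= h &
    f (x + h *: delta_mx 0 i + h *: delta_mx 0 j) - f (x + h *: delta_mx 0 i)
    - (f (x + h *: delta_mx 0 j) - f x) =
    partial j (partial i f) (x + a *: delta_mx 0 i + b *: delta_mx 0 j) * h * h].
Proof.
move=> h0 fU Uab; set u := delta_mx 0 i; set v := delta_mx 0 j.
have h00 : 0 <= (0 : R) <= h by rewrite lexx ltW.
have hhh : 0 <= h <= h by rewrite lexx ltW.
have U0 a : 0 <= a <= h -> U (x + a *: u).
  by move=> /Uab /(_ h00); rewrite scale0r addr0.
have df y : U y -> derivable f y u by move=> Uy; exact: (fU [::] y Uy).1.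
pose g y := f (y + h *: v) - f y.
have dg y : U y -> U (y + h *: v) ->
    is_derive y u g ('D_u f (y + h *: v) - 'D_u f y).
  move=> Uy Uyh; apply: is_deriveB; last exact/derivableP/df.
  have E : (fun k : R => k^-1 *:
      (((fun y => f (y + h *: v)) \o shift y) (k *: u) - f (y + h *: v))) =
      (fun k => k^-1 *: ((f \o shift (y + h *: v)) (k *: u) - f (y + h *: v))).
    by apply/funext => k /=; rewrite addrA.
  by split; rewrite /derivable /derive /= E //; apply: df.
have [a a_h Ea] : exists2 a, 0 <= a <= h & g (x + h *: u) - g x =
    'D_u g (x + a *: u) * h.
  apply: MVT_line => // t th; have := dg _ (U0 t th) (Uab t h th hhh).
  by move=> ?; apply: ex_derive.
have dga := dg _ (U0 a a_h) (Uab a h a_h hhh).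
have [b b_h Eb] : exists2 b, 0 <= b <= h & partial i f (x + a *: u + h *: v) -
    partial i f (x + a *: u) = 'D_v (partial i f) (x + a *: u + b *: v) * h.
  by apply: MVT_line => // t th; exact: (fU [:: i] _ (Uab a t a_h th)).1.
exists a, b; split=> //; rewrite -[LHS]/(g (x + h *: u) - g x) Ea.
by rewrite derive_val -Eb.
Qed.

Lemma dist_half (p q w e : R) :
  `|p - w| < e / 2 -> `|q - w| < e / 2 -> `|p - q| <= e.
Proof.
rewrite !ltr_norml ler_norml => /andP[? ?] /andP[? ?].
by apply/andP; split; lra.
Qed.

Lemma partialC U f i j x : open U -> smooth_on U f -> U x ->
  partial i (partial j f) x = partial j (partial i f) x.
Proof.
move=> oU fU Ux; apply/eqP; rewrite -subr_eq0 -normr_le0.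
apply/ler_addgt0Pl => e e0; rewrite ?addr0 ?add0r.
set F := partial i (partial j f); set G := partial j (partial i f).
have cF : {for x, continuous F} by exact: (fU [:: i; j] x Ux).2.
have cG : {for x, continuous G} by exact: (fU [:: j; i] x Ux).2.
have e20 : 0 < e / 2 by rewrite divr_gt0.
have [d /= d0 dx] : exists2 d : R, 0 < d & forall y, `|x - y| < d ->
    [/\ U y, `|F x - F y| < e / 2 & `|G x - G y| < e / 2].
  have /nbhs_normP[d1 /= d10 Ud] : nbhs x U by exact: open_nbhs_nbhs.
  have /nbhs_normP[d2 /= d20 Fd] : nbhs x [set y | `|F x - F y| < e / 2].
    exact: (cvgrPdist_lt _ _).1 cF _ e20.
  have /nbhs_normP[d3 /= d30 Gd] : nbhs x [set y | `|G x - G y| < e / 2].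
    exact: (cvgrPdist_lt _ _).1 cG _ e20.
  exists (Num.min d1 (Num.min d2 d3)); first by rewrite !lt_min d10 d20 d30.
  move=> y; rewrite lt_min => /andP[y1]; rewrite lt_min => /andP[y2 y3].
  by split; [exact: (Ud y y1)|exact: (Fd y y2)|exact: (Gd y y3)].
set u := delta_mx 0 i : 'rV[R]_2; set v := delta_mx 0 j : 'rV[R]_2.
pose N := `|u| + `|v| + 1; have N0 : 0 < N by rewrite ltr_wpDl ?addr_ge0.
pose h := d / N; have h0 : 0 < h by rewrite divr_gt0.
have small a b : 0 <= a <= h -> 0 <= b <= h -> `|a *: u + b *: v| < d.
  move=> /andP[a0 ah] /andP[b0 bh]; rewrite (le_lt_trans (ler_normD _ _)) //.
  rewrite !normrZ (ger0_norm a0) (ger0_norm b0).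
  have -> : d = h * (`|u| + `|v|) + h.
    by rewrite -[X in _ + X]mulr1 -mulrDr divfK ?gt_eqF.
  by rewrite ltr_pwDr // mulrDr lerD // ler_wpM2r.
have dxuv a b : 0 <= a <= h -> 0 <= b <= h -> [/\ U (x + a *: u + b *: v),
    `|F x - F (x + a *: u + b *: v)| < e / 2 &
    `|G x - G (x + a *: u + b *: v)| < e / 2].
  move=> ah bh; apply: dx; rewrite -addrA opprD addNKr normrN; exact: small.
have [|a [b [ah bh Eab]]] := @second_difference U f i j x h h0 fU.
  by move=> a b ah bh; case: (dxuv a b ah bh).
have [|c [k [ch kh Eck]]] := @second_difference U f j i x h h0 fU.
  by move=> a' b' ah' bh'; rewrite addrAC; case: (dxuv b' a' bh' ah').
have addACuv : forall r t, x + r *: u + t *: v = x + t *: v + r *: u.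
  by move=> r t; rewrite addrAC.
have FG : F (x + k *: u + c *: v) = G (x + a *: u + b *: v).
  apply: (mulIf (lt0r_neq0 h0)); apply: (mulIf (lt0r_neq0 h0)).
  transitivity (f (x + h *: v + h *: u) - f (x + h *: v) -
                (f (x + h *: u) - f x)); first by rewrite addACuv; exact/esym/Eck.
  transitivity (f (x + h *: u + h *: v) - f (x + h *: u) -
                (f (x + h *: v) - f x)); last exact: Eab.
  rewrite (addACuv h h); move: (f _) (f _) (f _) (f _) => p1 p2 p3 p4; ring.
have [_ Fx _] := dxuv k c kh ch; have [_ _ Gx] := dxuv a b ah bh.
by rewrite FG in Fx; apply: dist_half Fx Gx.
Qed.

End SmoothFunctions.

Section Germs.
Variable R : realType.

Definition smooth_near0_pred : {pred 'rV[R]_2 -> R} :=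
  fun f => `[< smooth_near0 f >].

Fact smooth_near0_subring : subring_closed smooth_near0_pred.
Proof.
split=> [|f g /asboolP sf /asboolP sg|f g /asboolP sf /asboolP sg]; apply/asboolP.
- exact: smooth_near0_cst.
- have -> : f - g = f + cst (-1) * g.
    by apply/funext => x; rewrite !fctE mulN1r.
  by apply: smooth_near0D => //; apply: smooth_near0M => //; exact: smooth_near0_cst.
- exact: smooth_near0M.
Qed.

HB.instance Definition _ := GRing.isSubringClosed.Build ('rV[R]_2 -> R)
  smooth_near0_pred smooth_near0_subring.

(* Total functions whose values away from some neighborhood of 0 are arbitrary. *)
Record smooth_fun := SmoothFun {
  smooth_val :> 'rV[R]_2 -> R; _ : smooth_val \in smooth_near0_pred }.

HB.instance Definition _ := [isSub for smooth_val].
HB.instance Definition _ := [Choice of smooth_fun by <:].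
HB.instance Definition _ := [SubChoice_isSubComNzRing of smooth_fun by <:].

Lemma smooth_funP (f : smooth_fun) : smooth_near0 f.
Proof. by case: f => f /= /asboolP. Qed.

Definition mk_smooth (f : 'rV[R]_2 -> R) (sf : smooth_near0 f) : smooth_fun :=
  SmoothFun (introT (asboolP _) sf).

Definition vanish_near0 : {pred smooth_fun} :=
  fun f => `[< \forall x \near (0 : 'rV[R]_2), f x = 0 >].

Fact vanish_near0_idealr : idealr_closed vanish_near0.
Proof.
split.
- by apply/asboolP; apply: (@nearW _ (nbhs (0 : 'rV[R]_2))).
- apply/asboolP => /nbhs_singleton one0.
  by have /eqP : (1 : R) = 0 := one0; rewrite oner_eq0.
- move=> f g h /asboolP g0 /asboolP h0; apply/asboolP.
  near=> x; transitivity (f x * g x + h x) => //.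
  have -> : g x = 0 by near: x.
  have -> : h x = 0 by near: x.
  by rewrite mulr0 addr0.
Unshelve. all: by end_near. Qed.

HB.instance Definition _ := isIdealr.Build smooth_fun vanish_near0
  vanish_near0_idealr.

(* {ideal_quot I} is the quotient ring by the ideal I, so two functions are
   identified iff they agree on a neighborhood of 0 (to_germP). *)
Definition germ := {ideal_quot vanish_near0}.

HB.instance Definition _ := Choice.on germ.
HB.instance Definition _ := GRing.ComNzRing.on germ.

Definition to_germ (f : smooth_fun) : germ := (\pi_{ideal_quot vanish_near0} f)%qT.

Lemma to_germP f g :
  to_germ f = to_germ g <-> \forall x \near (0 : 'rV[R]_2), f x = g x.
Proof.
have -> : (to_germ f = to_germ g) <-> f - g \in vanish_near0.
  by rewrite Quotient.idealrBE; split=> /eqP.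
split=> [/asboolP fg|fg].
  by near=> x; apply/eqP; rewrite -subr_eq0; apply/eqP; near: x.
by apply/asboolP; near=> x; apply/eqP; rewrite subr_eq0; apply/eqP; near: x.
Unshelve. all: by end_near. Qed.

Lemma to_germ_surj (g : germ) : to_germ (repr g) = g.
Proof. exact: reprK. Qed.

Lemma to_germD f g : to_germ (f + g) = to_germ f + to_germ g.
Proof. by rewrite /to_germ rmorphD. Qed.

Lemma to_germM f g : to_germ (f * g) = to_germ f * to_germ g.
Proof. by rewrite /to_germ rmorphM. Qed.

Definition smooth_cst (a : R) : smooth_fun := mk_smooth (smooth_near0_cst a).

Definition germ_scale (a : R) (g : germ) : germ := to_germ (smooth_cst a) * g.

Fact germ_scaleA a b g : germ_scale a (germ_scale b g) = germ_scale (a * b) g.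
Proof.
rewrite /germ_scale mulrA -to_germM; congr (to_germ _ * _).
by apply/val_inj/funext.
Qed.
Fact germ_scale1 : left_id 1 germ_scale.
Proof.
move=> g; rewrite -[RHS]mul1r; congr (_ * _).
by rewrite -[RHS](rmorph1 (\pi_{ideal_quot vanish_near0})%qT); congr (to_germ _); apply/val_inj/funext.
Qed.
Fact germ_scaleDr : right_distributive germ_scale +%R.
Proof. by move=> a f g; rewrite /germ_scale mulrDr. Qed.
Fact germ_scaleDl g : {morph germ_scale^~ g : a b / a + b}.
Proof.
move=> a b; rewrite /germ_scale -mulrDl -to_germD; congr (to_germ _ * _).
by apply/val_inj/funext.
Qed.

HB.instance Definition _ := GRing.Zmodule_isLmodule.Build R germ
  germ_scaleA germ_scale1 germ_scaleDr germ_scaleDl.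

Lemma to_germZ a f : a *: to_germ f = to_germ (smooth_cst a * f).
Proof. by rewrite to_germM. Qed.

Fact germ_scaleAl (a : R) (f g : germ) : a *: (f * g) = a *: f * g.
Proof. by rewrite [LHS]mulrA. Qed.

HB.instance Definition _ := GRing.Lmodule_isLalgebra.Build R germ germ_scaleAl.
HB.instance Definition _ := GRing.Lalgebra_isComAlgebra.Build R germ.

Definition smooth_partial i (f : smooth_fun) : smooth_fun :=
  mk_smooth (smooth_near0_partial i (smooth_funP f)).

(* The values below do not depend on the representative repr g of the germ g:
   see germ_derivE and taylorE. *)
Definition germ_deriv i (g : germ) : germ := to_germ (smooth_partial i (repr g)).

Definition taylor (g : germ) : fps2 R := Fps2 (fun m n =>
  partials (nseq m ord0 ++ nseq n ord_max) (repr g) 0 / (m`! * n`!)%:R).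

Lemma near0_partials (f g : smooth_fun) s :
  (\forall x \near (0 : 'rV[R]_2), f x = g x) ->
  \forall x \near (0 : 'rV[R]_2), partials s f x = partials s g x.
Proof.
move=> fg; have : nbhs (0 : 'rV[R]_2) [set x | f x = g x] by exact: fg.
rewrite nbhsE => -[U [oU U0] UE].
exact: (near_eq_on oU (partials_eq_on s oU UE) U0).
Qed.

Lemma germ_derivE i f : germ_deriv i (to_germ f) = to_germ (smooth_partial i f).
Proof.
apply/to_germP; apply: (near0_partials [:: i]).
by apply/to_germP; rewrite to_germ_surj.
Qed.

Lemma taylorE f m n : fps_coef (taylor (to_germ f)) m n =
  partials (nseq m ord0 ++ nseq n ord_max) f 0 / (m`! * n`!)%:R.
Proof.
congr (_ / _); pose s : seq 'I_2 := nseq m ord0 ++ nseq n ord_max.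
have fE := (to_germP _ _).1 (to_germ_surj (to_germ f)).
exact: (nbhs_singleton (near0_partials s fE)).
Qed.

Lemma near0_smooth (f : smooth_fun) : \forall x \near (0 : 'rV[R]_2),
  forall i, derivable f x (delta_mx 0 i).
Proof.
have [U [oU U0] fU] := smooth_funP f.
suff : nbhs (0 : 'rV[R]_2) [set x | forall i, derivable f x (delta_mx 0 i)] by [].
by rewrite nbhsE; exists U => // x Ux; exact: (fU [::] x Ux).1.
Qed.

Fact germ_deriv_linear i : linear (germ_deriv i).
Proof.
move=> a f g; rewrite -[f]to_germ_surj -[g]to_germ_surj.
move: (repr f) (repr g) => {}f {}g.
rewrite to_germZ -to_germD !germ_derivE to_germZ -to_germD.
apply/to_germP; have := near0_smooth f; have := near0_smooth g.
apply: filterS2 => x dg df.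
transitivity ('D_(delta_mx 0 i) (a \*: (f : 'rV[R]_2 -> R) + g) x) => //.
by rewrite deriveD ?deriveZ //; apply: derivableZ.
Qed.

Fact germ_derivM i f g :
  germ_deriv i (f * g) = germ_deriv i f * g + f * germ_deriv i g.
Proof.
rewrite -[f]to_germ_surj -[g]to_germ_surj.
move: (repr f) (repr g) => {}f {}g.
rewrite -to_germM !germ_derivE -!to_germM -to_germD.
apply/to_germP; have := near0_smooth f; have := near0_smooth g.
apply: filterS2 => x dg df.
transitivity ('D_(delta_mx 0 i) ((f : 'rV[R]_2 -> R) * g) x) => //.
by rewrite deriveM // addrC [X in X + _]mulrC.
Qed.

Fact germ_derivC i j f :
  germ_deriv i (germ_deriv j f) = germ_deriv j (germ_deriv i f).
Proof.
rewrite -[f]to_germ_surj; move: (repr f) => {}f.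
rewrite !germ_derivE; apply/to_germP.
have [U [oU U0] fU] := smooth_funP f.
exact: (near_eq_on oU (fun x => partialC i j oU fU) U0).
Qed.

End Germs.

Definition germ_vf (R : realType) := {ffun 'I_2 -> germ R}.

HB.instance Definition _ (R : realType) := GRing.Lmodule.on (germ_vf R).
HB.instance Definition _ (R : realType) :=
  @Lmodule_isLie.Build R (germ_vf R) (vf_bracket (@germ_deriv R))
    (vf_bracket_linearl (@germ_deriv_linear R))
    (vf_bracket_linearr (@germ_deriv_linear R))
    (vf_bracketxx (@germ_deriv R))
    (vf_jacobi (@germ_deriv_linear R) (@germ_derivM R) (@germ_derivC R)).

Definition taylor_vf (R : realType) (X : germ_vf R) : formal_vf R :=
  [ffun i => taylor (X i)].

(* Main.v *)
(** Write the given algebra as F X, where X has coprime coefficients and F is a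
   finite-dimensional space of series that contains 1 and is closed under
   f X(g) - g X(f). As the powers of a nonconstant series are linearly independent, F is very
   restricted: up to replacing (X, F) by (u X, u^-1 F) for a unit u of F, either X F = 0, or
   F is the sum of the constants and of eigenvectors of X for one eigenvalue l != 0, or
   X w = 1 for some w in F and F is spanned by 1, w, w^2, or by w and elements of ker X.
   By Borel's lemma every series is the Taylor expansion of a germ, so one has to lift X to a
   germ Z for which the first integrals and the eigenvectors of X in F lift to first
   integrals and eigenvectors of Z.

   Let f be a product of powers q_i ^ n_i of irreducible series and p the product of the q_i.
   Then X f = l f says that om(X) = l p, where om = p sum_i n_i dq_i / q_i has coprime
   coefficients; lifts of the q_i give lifts of p and om, and this linear equation can then
   be solved for a lift of X, because a flat function lies in the ideal of the coefficients
   of om. When l = 0, a suitable f generates all first integrals, in the sense that they are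
   the series c(f) for c in R[[t]], and c(f) lifts by Borel's lemma in one variable. When
   l != 0, the eigenvectors are the multiples k g of a single one g, with k a first integral,
   unless the quotient of two of them is indeterminate at 0. In that case X vanishes at 0 and
   has infinitely many invariant curves through 0, and a discussion of its linear part shows
   that there is again such a g, or that X is a node for which the Poincare-Dulac theorem
   provides coordinates that are eigenvectors of X and in which all the eigenvectors are
   polynomials. Lifting X together with g, respectively with the coordinates, lifts
   everything. *)

Require Import Defs.
From HB Require Import structures.
From mathcomp Require Import all_boot all_order all_algebra.
From mathcomp Require Import ring lra zify complex.
From mathcomp Require Import boolp classical_sets functions.
From mathcomp Require Import reals topology normedtype derive realfun sequences exp.

Set Implicit Arguments.
Unset Strict Implicit.
Unset Printing Implicit Defensive.
Import Order.TTheory GRing.Theory Num.Theory.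
Import numFieldNormedType.Exports.
Local Open Scope classical_set_scope.
Local Open Scope complex_scope.
Local Open Scope ring_scope.

(** Lifting a basis series by series is not enough: brackets of the lifts agree with the expected
    combinations only up to flat functions, and no formal argument removes a flat error. So the
    relations X f = 0, X f = 1 and X f = l f must hold exactly for germs, for all the f in F with
    the same lift of X. This is why the classification aims at families governed by one or two
    series.

    What prevents a single governing series is a pencil of invariant curves through 0. A first
    integral vanishing at 0 vanishes on all these curves, so the pencil only matters for l != 0.
    Then the linear part of X is not zero, since it acts on the leading forms of eigenvectors with
    eigenvalue l. Saddles have too few invariant curves for a pencil, foci and Jordan blocks allow
    only one leading form, and nodes remain.

    Conjugate pairs of complex eigenvectors need no lift: with the constants they span a copy of
    sl_2, in which a rescaled field has an element of derivative 1. *)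

Section Constants.
Variable R : comNzRingType.
Implicit Types (f g : fps2 R) (a : R).

Definition fpsC a : fps2 R := a%:A.

Fact fpsC_zmod : zmod_morphism fpsC.
Proof. by move=> a b; rewrite /fpsC scalerBl. Qed.
Fact fpsC_monoid : monoid_morphism fpsC.
Proof. by split=> [|a b]; rewrite /fpsC ?scale1r // -scalerAl mul1r scalerA. Qed.
HB.instance Definition _ := GRing.isZmodMorphism.Build R (fps2 R) fpsC fpsC_zmod.
HB.instance Definition _ := GRing.isMonoidMorphism.Build R (fps2 R) fpsC fpsC_monoid.

Arguments fpsC : simpl never.

Lemma scale_fpsC a f : a *: f = fpsC a * f.
Proof. by rewrite /fpsC mulr_algl. Qed.

Lemma coefD f g m n : fps_coef (f + g) m n = fps_coef f m n + fps_coef g m n.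
Proof. by []. Qed.
Lemma coefN f m n : fps_coef (- f) m n = - fps_coef f m n.
Proof. by []. Qed.
Lemma coefB f g m n : fps_coef (f - g) m n = fps_coef f m n - fps_coef g m n.
Proof. by []. Qed.
Lemma coef0 m n : fps_coef (0 : fps2 R) m n = 0.
Proof. by []. Qed.
Lemma coefZ a f m n : fps_coef (a *: f) m n = a * fps_coef f m n.
Proof. by []. Qed.
Lemma coefM f g m n : fps_coef (f * g) m n =
  \sum_(k < m.+1) \sum_(l < n.+1) fps_coef f k l * fps_coef g (m - k) (n - l).
Proof. by []. Qed.
Lemma coef_fpsC a m n : fps_coef (fpsC a) m n = a *+ ((m == 0%N) && (n == 0%N)).
Proof. by rewrite /fpsC /= mulr_natr. Qed.
Lemma coef1 m n : fps_coef (1 : fps2 R) m n = ((m == 0%N) && (n == 0%N))%:R.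
Proof. by []. Qed.
Lemma coefCM a f m n : fps_coef (fpsC a * f) m n = a * fps_coef f m n.
Proof. by rewrite -scale_fpsC. Qed.
Lemma coef_sum I (r : seq I) (P : pred I) (F : I -> fps2 R) m n :
  fps_coef (\sum_(i <- r | P i) F i) m n = \sum_(i <- r | P i) fps_coef (F i) m n.
Proof. by elim/big_rec2: _ => // i y x _ <-. Qed.

Definition fps_ev0 f : R := fps_coef f 0 0.

Arguments fps_ev0 : simpl never.

Fact ev0_zmod : zmod_morphism fps_ev0. Proof. by []. Qed.
Fact ev0_monoid : monoid_morphism fps_ev0.
Proof. by split=> // f g; rewrite /fps_ev0 coefM !big_ord1 !subn0. Qed.
HB.instance Definition _ := GRing.isZmodMorphism.Build (fps2 R) R fps_ev0 ev0_zmod.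
HB.instance Definition _ := GRing.isMonoidMorphism.Build (fps2 R) R fps_ev0 ev0_monoid.

Lemma ev0D f g : fps_ev0 (f + g) = fps_ev0 f + fps_ev0 g. Proof. by []. Qed.
Lemma ev0B f g : fps_ev0 (f - g) = fps_ev0 f - fps_ev0 g. Proof. by []. Qed.
Lemma ev0M f g : fps_ev0 (f * g) = fps_ev0 f * fps_ev0 g.
Proof. exact: (rmorphM (fps_ev0 : {rmorphism _ -> _})). Qed.
Lemma ev01 : fps_ev0 1 = 1. Proof. by []. Qed.
Lemma ev00 : fps_ev0 0 = 0. Proof. by []. Qed.
Lemma ev0X f n : fps_ev0 (f ^+ n) = fps_ev0 f ^+ n.
Proof. exact: (rmorphXn (fps_ev0 : {rmorphism _ -> _})). Qed.
Lemma ev0_nat n : fps_ev0 n%:R = n%:R.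
Proof. exact: (rmorph_nat (fps_ev0 : {rmorphism _ -> _})). Qed.
Lemma ev0C a : fps_ev0 (fpsC a) = a.
Proof. by rewrite /fps_ev0 coef_fpsC. Qed.

Definition fps_mono i j : fps2 R := Fps2 (fun m n => ((m == i) && (n == j))%:R).

Lemma coef_monoM i j f m n : fps_coef (fps_mono i j * f) m n =
  if (i <= m)%N && (j <= n)%N then fps_coef f (m - i) (n - j) else 0.
Proof.
rewrite coefM; case: ifPn => [/andP[im jn]|].
  rewrite (bigD1 (inord i : 'I_m.+1)) //= (bigD1 (inord j : 'I_n.+1)) //=.
  rewrite !inordK // !eqxx mul1r big1 ?addr0; last first.
    by move=> l; rewrite -val_eqE /= inordK // => /negPf ->; rewrite mul0r.
  rewrite big1 ?addr0 // => k; rewrite -val_eqE /= inordK // => /negPf ->.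
  by apply: big1 => l _; rewrite mul0r.
rewrite negb_and -!ltnNge => ij; apply: big1 => k _; apply: big1 => l _ /=.
case: eqP => [ki|_]; last by rewrite mul0r.
case: eqP => [lj|_]; last by rewrite mul0r.
by have := ltn_ord k; have := ltn_ord l; lia.
Qed.

Definition fpsX : fps2 R := fps_mono 1 0.
Definition fpsY : fps2 R := fps_mono 0 1.

Lemma ev0_fpsX : fps_ev0 fpsX = 0. Proof. by []. Qed.
Lemma ev0_fpsY : fps_ev0 fpsY = 0. Proof. by []. Qed.

Lemma mono00 : fps_mono 0 0 = 1. Proof. exact: fps2P. Qed.

Lemma monoM i j k l : fps_mono i j * fps_mono k l = fps_mono (i + k) (j + l).
Proof.
apply: fps2P => m n; rewrite coef_monoM /=; case: ifP => /=.
  by move=> /andP[im jn]; congr ((_ && _)%:R : R); lia.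
by move=> ij; case: eqP => //=; case: eqP => //= ? ?; lia.
Qed.

Lemma monoE i j : fps_mono i j = fpsX ^+ i * fpsY ^+ j.
Proof.
have -> : fpsX ^+ i = fps_mono i 0.
  by elim: i => [|i IH]; rewrite ?mono00 // exprS IH monoM.
have -> : fpsY ^+ j = fps_mono 0 j.
  by elim: j => [|j IH]; rewrite ?mono00 // exprS IH monoM.
by rewrite monoM; congr (fps_mono _ _); lia.
Qed.

Lemma coefXM f m n : fps_coef (fpsX * f) m n = if m is m'.+1 then fps_coef f m' n else 0.
Proof. by rewrite coef_monoM subn0; case: m => //= m; rewrite subn1. Qed.

Lemma coefYM f m n : fps_coef (fpsY * f) m n = if n is n'.+1 then fps_coef f m n' else 0.
Proof. by rewrite coef_monoM subn0; case: n => //= n; rewrite subn1. Qed.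

Lemma coef_deriv0 f m n : fps_coef (fps_deriv ord0 f) m n = fps_coef f m.+1 n *+ m.+1.
Proof. by []. Qed.
Lemma coef_deriv1 f m n : fps_coef (fps_deriv ord_max f) m n = fps_coef f m n.+1 *+ n.+1.
Proof. by []. Qed.

Lemma ord2_cases (i : 'I_2) : i = ord0 \/ i = ord_max.
Proof. by case: i => [[|[|//]] ?]; [left|right]; apply: val_inj. Qed.

Lemma derivX (i : 'I_2) : fps_deriv i fpsX = (i == ord0)%:R.
Proof.
by case: (ord2_cases i) => ->; apply: fps2P => m n; case: m n => [|m] [|n] //=;
  rewrite ?andbF ?mul0rn ?mulr1n // ?eqSS ?andbT ?mul0rn.
Qed.

Lemma derivY (i : 'I_2) : fps_deriv i fpsY = (i == ord_max)%:R.
Proof.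
by case: (ord2_cases i) => ->; apply: fps2P => m n; case: m n => [|m] [|n] //=;
  rewrite ?andbF ?mul0rn ?mulr1n // ?eqSS ?andbT ?mul0rn.
Qed.

Lemma divX f : (forall n, fps_coef f 0 n = 0) -> exists g, f = fpsX * g.
Proof.
move=> f0; exists (Fps2 (fun m n => fps_coef f m.+1 n)).
by apply: fps2P => -[|m] n; rewrite coefXM.
Qed.

Lemma decXY f : exists g h, f = fpsC (fps_ev0 f) + fpsX * g + fpsY * h.
Proof.
pose g := Fps2 (fun m n => fps_coef f m.+1 n).
pose h : fps2 R := Fps2 (fun m n => if m is 0%N then fps_coef f 0 n.+1 else 0).
exists g, h; apply: fps2P => m n; rewrite !coefD coef_fpsC coefXM coefYM.
by case: m n => [|m] [|n] //=; rewrite ?addr0 ?add0r ?mulr0n ?mulr1n ?add0r.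
Qed.

Definition fps_swap f : fps2 R := Fps2 (fun m n => fps_coef f n m).

Fact swap_zmod : zmod_morphism fps_swap. Proof. by move=> f g; apply: fps2P. Qed.
Fact swap_monoid : monoid_morphism fps_swap.
Proof.
split=> [|f g]; first by apply: fps2P => m n; rewrite /= andbC.
by apply: fps2P => m n; rewrite /= exchange_big.
Qed.
HB.instance Definition _ := GRing.isZmodMorphism.Build (fps2 R) (fps2 R) fps_swap swap_zmod.
HB.instance Definition _ := GRing.isMonoidMorphism.Build (fps2 R) (fps2 R) fps_swap swap_monoid.

Lemma swapK : involutive fps_swap.
Proof. by move=> f; apply: fps2P. Qed.
Lemma swapX : fps_swap fpsX = fpsY.
Proof. by apply: fps2P => m n; rewrite /= andbC. Qed.
End Constants.

(** * Weighted filtrations and successive approximation *)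

Section Filtration.
Variable R : comNzRingType.
Implicit Types (f g : fps2 R).

(* The weighted filtration with weights [w1] and [w2]: weights (1,1) give the
   powers of the maximal ideal, weights (1,0) the powers of the ideal (x). *)
Definition fil w1 w2 k f := forall m n, (w1 * m + w2 * n < k)%N -> fps_coef f m n = 0.

Section Weights.
Variables w1 w2 : nat.
Local Notation fil := (fil w1 w2).

Lemma fil0 f : fil 0 f. Proof. by []. Qed.
Lemma fil_zero k : fil k 0. Proof. by []. Qed.
Lemma filW k l f : (l <= k)%N -> fil k f -> fil l f.
Proof. by move=> lk ff m n mn; apply: ff; apply: leq_trans lk. Qed.
Lemma filD k f g : fil k f -> fil k g -> fil k (f + g).
Proof. by move=> ff fg m n mn; rewrite coefD ff ?fg ?addr0. Qed.
Lemma filN k f : fil k f -> fil k (- f).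
Proof. by move=> ff m n mn; rewrite coefN ff ?oppr0. Qed.
Lemma filB k f g : fil k f -> fil k g -> fil k (f - g).
Proof. by move=> ff fg; apply: filD => //; apply: filN. Qed.
Lemma filBC k f g : fil k (f - g) -> fil k (g - f).
Proof. by move=> h; rewrite -opprB; apply: filN. Qed.
Lemma fil_trans k f g h : fil k (f - g) -> fil k (g - h) -> fil k (f - h).
Proof. by move=> fg gh; rewrite -[f](subrK g) -addrA; apply: filD. Qed.
Lemma filM k l f g : fil k f -> fil l g -> fil (k + l) (f * g).
Proof.
move=> ff fg m n mn; rewrite coefM; apply: big1 => i _; apply: big1 => j _.
have im : (i <= m)%N by rewrite -ltnS.
have jn : (j <= n)%N by rewrite -ltnS.
case: (ltnP (w1 * i + w2 * j) k) => ij; first by rewrite ff ?mul0r.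
rewrite fg ?mulr0 // -(ltn_add2l k) (leq_ltn_trans _ mn) //.
apply: (@leq_trans (w1 * i + w2 * j + (w1 * (m - i) + w2 * (n - j)))).
  by rewrite leq_add2r.
by rewrite addnACA -!mulnDr !subnKC.
Qed.
Lemma filMl k f g : fil k g -> fil k (f * g).
Proof. by move=> fg; rewrite -[k]add0n; apply: filM (fil0 f) fg. Qed.
Lemma filMr k f g : fil k f -> fil k (f * g).
Proof. by move=> ff; rewrite mulrC; apply: filMl. Qed.
Lemma filZ k a f : fil k f -> fil k (a *: f).
Proof. by rewrite scale_fpsC; apply: filMl. Qed.
Lemma fil_sum k I (r : seq I) (P : pred I) (F : I -> fps2 R) :
  (forall i, P i -> fil k (F i)) -> fil k (\sum_(i <- r | P i) F i).
Proof. by move=> fF; elim/big_ind: _ => //; exact: filD. Qed.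
Lemma filX k f n : fil k f -> fil (n * k) (f ^+ n).
Proof.
move=> ff; elim: n => [|n IH]; first exact: fil0.
by rewrite exprS mulSn; apply: filM.
Qed.
Lemma fil_sep f : (forall k, fil k f) -> f = 0.
Proof. by move=> ff; apply: fps2P => m n; apply: (ff (w1 * m + w2 * n).+1). Qed.
Lemma fil_eq f g : (forall k, fil k (f - g)) -> f = g.
Proof. by move=> /fil_sep /eqP; rewrite subr_eq0 => /eqP. Qed.
Lemma filMB k f g f' g' : fil k (f - f') -> fil k (g - g') -> fil k (f * g - f' * g').
Proof.
move=> ff gg; rewrite (_ : _ - _ = (f - f') * g + f' * (g - g')); last by ring.
by apply: filD; [apply: filMr|apply: filMl].
Qed.
Lemma filBB k f g f' g' : fil k (f - f') -> fil k (g - g') -> fil k (f - g - (f' - g')).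
Proof. by move=> ff gg; rewrite (_ : _ - _ = (f - f') - (g - g')); [apply: filB|ring]. Qed.
(** Completeness: a coefficient of weight d is constant along the sequence from index d + 1 on, and
    the limit takes this value. *)
Lemma fil_lim (F : nat -> fps2 R) : (forall k, fil k (F k.+1 - F k)) ->
  exists f, forall k, fil k (f - F k).
Proof.
move=> dF; have FF k l : (k <= l)%N -> fil k (F l - F k).
  move=> kl; elim: l kl => [|l IH]; first by rewrite leqn0 => /eqP->; rewrite subrr.
  rewrite leq_eqVlt => /predU1P[->|]; first by rewrite subrr.
  rewrite ltnS => kl; apply: (@fil_trans _ _ (F l)); last exact: IH.
  exact: filW (dF l).
exists (Fps2 (fun m n => fps_coef (F (w1 * m + w2 * n).+1) m n)) => k m n mn.
rewrite coefB /=; have := FF _ _ mn m n (ltnSn _); rewrite coefB => /eqP.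
by rewrite subr_eq0 => /eqP ->; rewrite subrr.
Qed.

(* Successive approximation in the complete filtered ring: the equation
   [Phi s t = 0] is solved as soon as each approximate solution can be improved. *)
Lemma fil_approx d k0 (Phi : fps2 R -> fps2 R -> fps2 R) s0 t0 :
  (forall k (s t s' t' : fps2 R), fil k (s - s') -> fil k (t - t') ->
     fil k (Phi s t - Phi s' t')) ->
  (forall k s t, (k0 <= k)%N -> fil k0 (s - s0) -> fil k0 (t - t0) ->
     fil (k + d) (Phi s t) -> exists s' t' : fps2 R,
     [/\ fil k (s' - s), fil k (t' - t) & fil (k + d).+1 (Phi s' t')]) ->
  fil (k0 + d) (Phi s0 t0) ->
  exists s t : fps2 R, [/\ fil k0 (s - s0), fil k0 (t - t0) & Phi s t = 0].
Proof.
move=> cPhi step start.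
(* The order reached by the equation runs [d] ahead of the order to which the unknowns are known,
   since [Phi] may raise the order. *)
pose good (p : nat * (fps2 R * fps2 R)) := [/\ (k0 <= p.1)%N, fil k0 (p.2.1 - s0),
  fil k0 (p.2.2 - t0) & fil (p.1 + d) (Phi p.2.1 p.2.2)].
have /boolp.choice[g gP] : forall p : nat * (fps2 R * fps2 R), exists q : fps2 R * fps2 R,
    good p ->
    [/\ fil p.1 (q.1 - p.2.1), fil p.1 (q.2 - p.2.2) & fil (p.1 + d).+1 (Phi q.1 q.2)].
  move=> [k [s t]] /=; have [[k0k ss tt Pst]|] := pselect (good (k, (s, t))); last first.
    by move=> nk; exists (s, t) => ?; case: nk.
  by have [s' [t' []]] := step k s t k0k ss tt Pst; exists (s', t').
pose S := fix S k := if k is k'.+1 then g ((k0 + k')%N, S k') else (s0, t0).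
have SP k : good ((k0 + k)%N, S k).
  elim: k => [|k IH]; first by split; rewrite ?subrr ?addn0.
  have [g1 g2 g3] := gP _ IH; have [_ s1 t1 _] := IH.
  split; [exact: leq_addr| | |by rewrite addnS].
  + exact: fil_trans (filW (leq_addr _ _) g1) s1.
  + exact: fil_trans (filW (leq_addr _ _) g2) t1.
have dS k : fil (k0 + k) ((S k.+1).1 - (S k).1) /\ fil (k0 + k) ((S k.+1).2 - (S k).2).
  by have [] := gP _ (SP k).
have [|s sP] := @fil_lim (fun k => (S k).1).
  by move=> k; apply: filW (dS k).1; rewrite leq_addl.
have [|t tP] := @fil_lim (fun k => (S k).2).
  by move=> k; apply: filW (dS k).2; rewrite leq_addl.
have [_ s1 t1 _] := SP k0; exists s, t; split.
- exact: fil_trans (sP k0) s1.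
- exact: fil_trans (tP k0) t1.
apply: fil_sep => k; rewrite -[Phi s t](subrK (Phi (S k).1 (S k).2)).
apply: filD; first exact: cPhi.
by have [_ _ _ h] := SP k; apply: filW h; rewrite -addnA addnCA leq_addr.
Qed.

End Weights.

Lemma fil_deriv k i f : fil 1 1 k.+1 f -> fil 1 1 k (fps_deriv i f).
Proof.
move=> ff m n mn /=; case: ifP => _; rewrite ff ?mul0rn //; lia.
Qed.

Lemma fil_ev0 f : fps_ev0 f = 0 <-> fil 1 1 1 f.
Proof.
split=> [f0 [|m] [|n]|ff]; rewrite ?mul1n //; exact: ff.
Qed.

Definition fps_hom w1 w2 k f : fps2 R :=
  Fps2 (fun m n => if (w1 * m + w2 * n == k)%N then fps_coef f m n else 0).

Lemma fil_hom w1 w2 k f : fil w1 w2 k f -> fil w1 w2 k.+1 (f - fps_hom w1 w2 k f).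
Proof.
move=> ff m n mn; rewrite coefB /=; case: eqP => [_|mnk]; first by rewrite subrr.
by rewrite ff ?subrr //; lia.
Qed.
Lemma hom_fil w1 w2 k f : fil w1 w2 k (fps_hom w1 w2 k f).
Proof. by move=> m n mn /=; case: eqP => // ?; lia. Qed.

End Filtration.

(** * Inverses and integrality *)

Section Domain.
Variable R : fieldType.
Implicit Types (f g : fps2 R).

(** The index (m, n) is lexicographically first. In a product, the two first coefficients then give
    the only nonzero term at the sum of their indices, so the ring is a domain. *)
Lemma fps_neq0P f : f <> 0 -> exists m n, [/\ fps_coef f m n != 0,
  (forall k l, (k < m)%N -> fps_coef f k l = 0) &
  (forall l, (l < n)%N -> fps_coef f m l = 0)].
Proof.
move=> f0; have exm : exists m, `[< exists n, fps_coef f m n != 0 >].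
  apply: contrapT => H; apply: f0; apply: fps2P => m n; apply/eqP/negPn/negP => mn.
  by apply: H; exists m; apply/asboolP; exists n.
case: (ex_minnP exm) => m /asboolP exn minm.
case: (ex_minnP exn) => n mn minn; exists m, n; split=> // [k l km|l ln].
  apply/eqP/negPn/negP => kl; move: km; rewrite ltnNge => /negP; apply.
  by apply: minm; apply/asboolP; exists l.
by apply/eqP/negPn/negP => kl; move: ln; rewrite ltnNge => /negP; apply; apply: minn.
Qed.

Lemma fps_mulf f g : f * g = 0 -> f = 0 \/ g = 0.
Proof.
move=> fg; apply: contrapT => /not_orP[/fps_neq0P[m [n [fmn fm fn]]]].
move=> /fps_neq0P[m' [n' [gmn gm gn]]].
have := congr1 (fun h => fps_coef h (m + m') (n + n')) fg.
rewrite coefM (bigD1 (inord m : 'I_(m + m').+1)) //= [X in _ + X]big1 ?addr0; last first.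
  move=> k; rewrite -val_eqE /= inordK ?ltnS ?leq_addr // => km.
  apply: big1 => l _; case: (ltngtP k m) km => // km _; first by rewrite fm ?mul0r.
  by rewrite gm ?mulr0 //; have := ltn_ord k; lia.
rewrite inordK ?ltnS ?leq_addr // (bigD1 (inord n : 'I_(n + n').+1)) //=.
rewrite [X in _ + X]big1 ?addr0.
  rewrite inordK ?ltnS ?leq_addr // !addKn => /eqP; rewrite mulf_eq0.
  by rewrite (negPf fmn) (negPf gmn).
move=> k; rewrite -val_eqE /= inordK ?ltnS ?leq_addr // => km.
case: (ltngtP k n) km => // km _; first by rewrite fn ?mul0r.
by rewrite addKn gn ?mulr0 //; have := ltn_ord k; lia.
Qed.

Lemma fps_ex_inv f : fps_ev0 f != 0 -> exists g, g * f = 1.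
Proof.
move=> f0.
have [|k s t _ _ _|//|g [t [_ _ /eqP]]] := @fil_approx _ 1 1 0 0 (fun g _ => g * f - 1) 0 0.
- move=> k s t s' t' ss _; rewrite (_ : _ - _ = (s - s') * f); last by ring.
  exact: filMr.
(* Since f agrees with its constant term to order 1, dividing the leading form of the error by this
   constant gives a correction that cancels it. *)
- move=> /= sk; exists (s - fpsC (fps_ev0 f)^-1 * fps_hom 1 1 k (s * f - 1)), t.
  rewrite addn0 in sk *; set e := s * f - 1 in sk *; set h := fps_hom 1 1 k e.
  split; rewrite ?subrr //; first by rewrite addrAC subrr sub0r; apply: filN;
    apply/filMl/hom_fil.
  rewrite (_ : _ - 1 = (e - h) + (1 - fpsC (fps_ev0 f)^-1 * f) * h); last first.
    by rewrite /e; ring.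
  apply: filD; first exact: fil_hom.
  rewrite -[k.+1]add1n; apply: filM; last exact: hom_fil.
  apply/fil_ev0; rewrite ev0B ev0M ev0C ev01 mulVf ?subrr //.
- by rewrite subr_eq0 => /eqP gf; exists g.
Qed.

Definition fps_unit : {pred fps2 R} := fun f => fps_ev0 f != 0.
Definition fps_inv f : fps2 R :=
  if fps_ev0 f != 0 then xget f [set g | g * f = 1] else f.

Fact fps_mulVr : {in fps_unit, left_inverse 1 fps_inv *%R}.
Proof.
move=> f f0; have {}f0 : fps_ev0 f != 0 := f0; rewrite /fps_inv f0.
have [g gf] := fps_ex_inv f0.
exact: (xgetPex f (P := [set g | g * f = 1]) (ex_intro _ g gf)).
Qed.
Fact fps_unitP f g : g * f = 1 -> f \in fps_unit.
Proof.
move=> /(congr1 (@fps_ev0 R)); rewrite ev0M ev01 => gf; apply/eqP => f0.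
by move/eqP: gf; rewrite f0 mulr0 eq_sym oner_eq0.
Qed.
Fact fps_inv_out : {in [predC fps_unit], fps_inv =1 id}.
Proof. by move=> f nf; rewrite /fps_inv; have /negPf -> : ~~ (fps_ev0 f != 0) := nf. Qed.

HB.instance Definition _ := GRing.ComNzRing_hasMulInverse.Build (fps2 R)
  fps_mulVr fps_unitP fps_inv_out.

Fact fps_integral (f g : fps2 R) : f * g = 0 -> (f == 0) || (g == 0).
Proof. by move=> /fps_mulf[] ->; rewrite eqxx ?orbT. Qed.
HB.instance Definition _ := GRing.ComUnitRing_isIntegral.Build (fps2 R) fps_integral.

Lemma fps_unitE f : (f \is a GRing.unit) = (fps_ev0 f != 0).
Proof. by []. Qed.

End Domain.

(** * Divisibility, coprimality and irreducible factors *)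

Section Divisibility.
Variable R : fieldType.
Implicit Types (a b d f g h p q u v : fps2 R).

Lemma dvd_refl d : fps_dvd d d. Proof. by exists 1; rewrite mul1r. Qed.
Lemma dvd0 d : fps_dvd d 0. Proof. by exists 0; rewrite mul0r. Qed.
Lemma dvd_trans d f g : fps_dvd d f -> fps_dvd f g -> fps_dvd d g.
Proof. by move=> [a ->] [b ->]; exists (b * a); rewrite mulrA. Qed.
Lemma dvdD d f g : fps_dvd d f -> fps_dvd d g -> fps_dvd d (f + g).
Proof. by move=> [a ->] [b ->]; exists (a + b); rewrite mulrDl. Qed.
Lemma dvdN d f : fps_dvd d f -> fps_dvd d (- f).
Proof. by move=> [a ->]; exists (- a); rewrite mulNr. Qed.
Lemma dvdB d f g : fps_dvd d f -> fps_dvd d g -> fps_dvd d (f - g).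
Proof. by move=> df dg; apply: dvdD => //; apply: dvdN. Qed.
Lemma dvdMl d f g : fps_dvd d g -> fps_dvd d (f * g).
Proof. by move=> [a ->]; exists (f * a); rewrite mulrA. Qed.
Lemma dvdMr d f g : fps_dvd d f -> fps_dvd d (f * g).
Proof. by rewrite mulrC; apply: dvdMl. Qed.
Lemma dvdMm d e f g : fps_dvd d f -> fps_dvd e g -> fps_dvd (d * e) (f * g).
Proof. by move=> [a ->] [b ->]; exists (a * b); ring. Qed.
Lemma dvd_addl d f g : fps_dvd d (f + g) -> fps_dvd d g -> fps_dvd d f.
Proof. by move=> fg dg; rewrite -[f](addrK g); apply: dvdB. Qed.
Lemma dvd1P d : fps_dvd d 1 <-> d \is a GRing.unit.
Proof.
split=> [[g g1]|du]; last by exists d^-1; rewrite mulVr.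
by apply/unitrP; exists g; rewrite -g1 mulrC -g1.
Qed.
Lemma unit_dvd d f : d \is a GRing.unit -> fps_dvd d f.
Proof. by move=> du; exists (f * d^-1); rewrite mulrVK. Qed.
Lemma dvd_unit d f : fps_dvd d f -> f \is a GRing.unit -> d \is a GRing.unit.
Proof. by move=> [g ->]; rewrite unitrM => /andP[]. Qed.
Lemma dvdMul_cancel d f g : d != 0 -> fps_dvd (d * f) (d * g) -> fps_dvd f g.
Proof.
move=> d0 [h E]; exists h; apply: (mulfI d0); rewrite E; ring.
Qed.
Lemma dvd_Mul_unit d f u : u \is a GRing.unit -> fps_dvd d (u * f) -> fps_dvd d f.
Proof. by move=> uu df; rewrite -[f](mulKr uu); apply: dvdMl. Qed.
Lemma nunitP f : reflect (fps_ev0 f = 0) (f \isn't a GRing.unit).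
Proof. by rewrite fps_unitE negbK; apply: eqP. Qed.

(** The restriction f(0, y) to the axis x = 0. *)
Definition fps_row0 f : fps2 R := Fps2 (fun m n => if m is 0%N then fps_coef f 0 n else 0).

Lemma row0B f g : fps_row0 (f - g) = fps_row0 f - fps_row0 g.
Proof. by apply: fps2P => -[|m] n; rewrite ?coefB //= subrr. Qed.
Lemma row0_dec f : exists g, f = fps_row0 f + fpsX R * g.
Proof.
have [|g E] := @divX R (f - fps_row0 f); first by move=> n; rewrite coefB subrr.
by exists g; rewrite -E addrC subrK.
Qed.
Lemma row0XM g : fps_row0 (fpsX R * g) = 0.
Proof. by apply: fps2P => -[|m] n //; exact: (coefXM g 0 n). Qed.
Lemma row0M f g : fps_row0 (f * g) = fps_row0 f * fps_row0 g.
Proof.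
apply: fps2P => -[|m] n /=; first by rewrite !big_ord1.
symmetry; apply: big1 => -[k km] _; apply: big1 => l _ /=.
by case: k km => [|k] km; rewrite ?subn0 ?mulr0 ?mul0r.
Qed.
Lemma row0_eq0 f : fps_row0 f = 0 <-> fps_dvd (fpsX R) f.
Proof.
split=> [f0|[g ->]]; last by rewrite mulrC row0XM.
by have [g ->] := row0_dec f; exists g; rewrite f0 add0r mulrC.
Qed.
Lemma X_prime f g : fps_dvd (fpsX R) (f * g) -> fps_dvd (fpsX R) f \/ fps_dvd (fpsX R) g.
Proof.
move=> /row0_eq0; rewrite row0M => /eqP; rewrite mulf_eq0.
by case/orP => /eqP /row0_eq0; [left|right].
Qed.
Lemma X_neq0 : fpsX R != 0.
Proof.
apply/eqP => /(congr1 (fun f => fps_coef f 1 0)) /eqP.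
by rewrite /= oner_eq0.
Qed.
Lemma Xn_prime k f g : ~ fps_dvd (fpsX R) g -> fps_dvd (fpsX R ^+ k) (f * g) ->
  fps_dvd (fpsX R ^+ k) f.
Proof.
move=> ng; elim: k f => [|k IH] f; first by exists f; rewrite mulr1.
move=> Hd; have /X_prime[[f' E]|//] : fps_dvd (fpsX R) (f * g).
  by apply: dvd_trans Hd; rewrite exprSr; apply/dvdMl/dvd_refl.
rewrite E exprSr; apply: dvdMm; last exact: dvd_refl.
by apply: IH; move: Hd; rewrite E exprS -mulrA mulrCA; apply/dvdMul_cancel/X_neq0.
Qed.
Lemma fil10P k f : fil 1 0 k f <-> fps_dvd (fpsX R ^+ k) f.
Proof.
split=> [|[g ->]]; last first.
  rewrite -[k]add0n; apply: filM; first exact: fil0.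
  by rewrite -[X in fil _ _ X _]muln1; apply: filX => m n; rewrite mul0n addn0 mul1n; case: m.
elim: k f => [|k IH] f; first by exists f; rewrite mulr1.
move=> ff; have [|g gf] := @divX R f; first by move=> n; apply: ff.
rewrite gf exprS; apply: dvdMm; first exact: dvd_refl.
apply: IH => m n mn; have := ff m.+1 n; rewrite gf coefXM; apply; lia.
Qed.

(** Modulo x everything lives in R[[y]], where divisibility is comparison of orders, and [u0] has
    the least order n there. *)
Lemma syzygy_step a b u0 v0 n u v : u0 * a = v0 * b -> fps_coef u0 0 n != 0 ->
  (forall u v l, u * a = v * b -> (l < n)%N -> fps_coef u 0 l = 0) ->
  u * a = v * b -> exists t, fps_dvd (fpsX R) (u - t * u0).
Proof.
move=> M0 u0n min M.
(* This is f(0, y) / y^n, a unit for f = [u0]. *)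
pose S f := Fps2 (fun m l => if m is 0%N then fps_coef f 0 (n + l) else 0) : fps2 R.
have SP f : (forall l, (l < n)%N -> fps_coef f 0 l = 0) ->
    fps_dvd (fpsX R) (f - fps_mono R 0 n * S f).
  move=> fl; apply/row0_eq0/fps2P => -[|m] l //.
  rewrite -[LHS]/(fps_coef (f - fps_mono R 0 n * S f) 0 l) coefB coef_monoM coef0 /=.
  case: ifP => [nl|/negbT].
    by rewrite subnKC ?subrr.
  by rewrite -ltnNge => /fl ->; rewrite subrr.
have W : S u0 \is a GRing.unit by rewrite fps_unitE /fps_ev0 /= addn0.
exists (S u * (S u0)^-1).
have -> : u - S u * (S u0)^-1 * u0 = (u - fps_mono R 0 n * S u) -
    S u * (S u0)^-1 * (u0 - fps_mono R 0 n * S u0).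
  rewrite -[X in X - S u * _ * (_ - _)](_ : u - fps_mono R 0 n * (S u * (S u0)^-1 * S u0) = _).
    ring.
  by rewrite mulrVK.
by apply: dvdB; [|apply: dvdMl]; apply: SP => l; [apply: min M|apply: min M0].
Qed.

Lemma syzygy_cross a b u0 v0 u v : (a != 0) || (b != 0) -> u0 * a = v0 * b ->
  u * a = v * b -> v * u0 = u * v0.
Proof.
move=> ab M0 M; case/orP: ab => z; apply: (mulfI z).
  by rewrite mulrCA [a * u0]mulrC M0 [RHS]mulrA [a * u]mulrC M; ring.
by rewrite mulrA [b * v]mulrC -M mulrCA [b * v0]mulrC -M0; ring.
Qed.

Lemma syzygy_gen_aux a b u0 v0 n : (a != 0) || (b != 0) ->
  u0 * a = v0 * b -> fps_coef u0 0 n != 0 ->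
  (forall u v l, u * a = v * b -> (l < n)%N -> fps_coef u 0 l = 0) ->
  forall u v, u * a = v * b -> exists t, u = t * u0 /\ v = t * v0.
Proof.
move=> ab M0 u0n min u v M.
have u00 : u0 != 0 by apply: contraNneq u0n => ->.
have cross w z := @syzygy_cross a b u0 v0 w z ab M0.
have nXu0 : ~ fps_dvd (fpsX R) u0.
  move=> /row0_eq0 /(congr1 (fun f => fps_coef f 0 n)) /= /eqP.
  by rewrite (negPf u0n).
have [|k s t _ _ _|//|t [_ [_ _ /eqP]]] := @fil_approx _ 1 0 0 0 (fun t _ => u - t * u0) 0 0.
- move=> k s t s' t' ss _; rewrite (_ : _ - _ = (s' - s) * u0); last by ring.
  by apply: filMr; apply: filBC.
- rewrite addn0 => /fil10P [u1 E].
  (* The relation v u0 = u v0 carries the factor x^k over to the second entry. Divided by x^k, the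
     error is a syzygy again, to which [syzygy_step] applies. *)
  have /(@Xn_prime k _ u0 nXu0)[v1 E'] : fps_dvd (fpsX R ^+ k) ((v - s * v0) * u0).
    rewrite mulrBl (cross _ _ M) (_ : _ - _ = (u - s * u0) * v0); last by ring.
    by rewrite E; apply/dvdMr/dvdMl/dvd_refl.
  have M1 : u1 * a = v1 * b.
    apply: (mulIf (expf_neq0 k X_neq0)); rewrite mulrAC -E [RHS]mulrAC -E'.
    by rewrite !mulrBl M -!mulrA M0.
  have [t1 [u2 E2]] := syzygy_step M0 u0n min M1.
  exists (s + fpsX R ^+ k * t1), t; split; rewrite ?subrr //.
    by rewrite addrAC subrr add0r; apply/fil10P/dvdMr/dvd_refl.
  apply/fil10P; exists u2; rewrite mulrDl opprD addrA E -mulrA [u1 * _]mulrC -mulrBr E2.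
  by rewrite exprS; ring.
- rewrite subr_eq0 => /eqP E; exists t; split=> //; apply: (mulIf u00).
  by rewrite (cross _ _ M) E; ring.
Qed.

(* The syzygies of a pair form a free module of rank one: modulo x it is a
   rank one submodule over the discrete valuation ring R[[y]], and generators lift
   x-adically. *)
Lemma syzygy_gen a b : (a != 0) || (b != 0) -> exists u0 v0,
  u0 * a = v0 * b /\ (forall u v, u * a = v * b -> exists t, u = t * u0 /\ v = t * v0).
Proof.
move=> ab.
have [m [n [u [v [M nz]]]]] : exists m n u v, u * a = v * b /\
    ((fps_coef u m n != 0) || (fps_coef v m n != 0)).
  suff: exists m n, (fps_coef b m n != 0) || (fps_coef a m n != 0).
    by move=> [m [n h]]; exists m, n, b, a; rewrite mulrC.
  by case/orP: ab => /eqP /fps_neq0P[m [n [h _ _]]]; exists m, n; rewrite h ?orbT.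
have exn : exists n, `[< exists u v, u * a = v * b /\
    ((fps_coef u 0 n != 0) || (fps_coef v 0 n != 0)) >].
  (* A syzygy whose two entries both vanish on x = 0 can be divided by x. *)
  elim: m u v M nz => [|m IH] u v M nz; first by exists n; apply/asboolP; exists u, v.
  have [[l ul]|nl] := pselect (exists l, (fps_coef u 0 l != 0) || (fps_coef v 0 l != 0)).
    by exists l; apply/asboolP; exists u, v.
  have z w : w = u \/ w = v -> forall l, fps_coef w 0 l = 0.
    move=> h l; apply/eqP/negPn/negP => wl; apply: nl; exists l.
    by case: h => <-; rewrite wl ?orbT.
  have [u' Eu] := divX (z u (or_introl erefl)).
  have [v' Ev] := divX (z v (or_intror erefl)).
  apply: (IH u' v'); last by move: nz; rewrite Eu Ev !coefXM.
  by apply: (mulfI X_neq0); rewrite !mulrA -Eu -Ev.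
case: (ex_minnP exn) => {nz}n /asboolP[u0 [v0 [M0 nz]]] min.
have minu u' v' l : u' * a = v' * b -> (l < n)%N -> fps_coef u' 0 l = 0 /\ fps_coef v' 0 l = 0.
  move=> M' ln; split; apply/eqP/negPn/negP => h; move: ln; rewrite ltnNge => /negP;
    by apply; apply: min; apply/asboolP; exists u', v'; rewrite h ?orbT.
exists u0, v0; split=> // u' v' M'; case/orP: nz => nz.
  by apply: syzygy_gen_aux M0 nz _ _ _ M' => // ? ? ? /minu h /h[].
have [||t [-> ->]] := @syzygy_gen_aux b a v0 u0 n _ (esym M0) nz _ _ _ (esym M').
- by rewrite orbC.
- by move=> u2 v2 l /esym /minu h /h[].
- by exists t.
Qed.

Lemma coprime_sym a b : fps_coprime a b -> fps_coprime b a.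
Proof. by move=> ab d da db; apply: ab. Qed.

Lemma coprime_neq0 a b : fps_coprime a b -> (a != 0) || (b != 0).
Proof.
move=> ab; apply/negPn; rewrite negb_or !negbK; apply/negP => /andP[/eqP a0 /eqP b0].
have [||g /eqP] := ab 0; rewrite ?a0 ?b0; try exact: dvd0.
by rewrite mulr0 oner_eq0.
Qed.

(** The trivial syzygy (b, a) is a multiple t of the generator, and t divides both a and b, hence is
    a unit. *)
Lemma coprime_syzygy a b u v : fps_coprime a b -> u * a = v * b ->
  exists t, u = t * b /\ v = t * a.
Proof.
move=> ab M; have [u0 [v0 [M0 gen]]] := syzygy_gen (coprime_neq0 ab).
have [t [Eb Ea]] := gen b a (mulrC _ _).
have tu : t \is a GRing.unit.
  by apply/dvd1P/ab; rewrite ?Ea ?Eb; apply/dvdMr/dvd_refl.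
have [s [-> ->]] := gen u v M; exists (s * t^-1).
by rewrite Eb Ea !mulrA !(mulrVK tu).
Qed.

Lemma coprime_dvdM a b c : fps_coprime a b -> fps_dvd a (b * c) -> fps_dvd a c.
Proof.
move=> ab [u E]; have [|t [_ ->]] := @coprime_syzygy a b u c ab.
  by rewrite -E mulrC.
exact/dvdMl/dvd_refl.
Qed.

(** The gcd is the factor by which the trivial syzygy (b, a) exceeds the generator; no factorization
    is involved. *)
Lemma gcd_ex a b : exists d a' b', [/\ a = d * a', b = d * b' & fps_coprime a' b'].
Proof.
have [/eqP a0|a0] := boolP (a == 0); last first.
  have ab : (a != 0) || (b != 0) by rewrite a0.
  have [u0 [v0 [M0 gen]]] := syzygy_gen ab.
  have [t [Eb Ea]] := gen b a (mulrC _ _).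
  exists t, v0, u0; split=> // e [v1 Ev] [u1 Eu]; apply/dvd1P.
  have e0 : e != 0 by apply: contraNneq a0 => e0; rewrite Ea Ev e0 !mulr0.
  have [|s [_ Es]] := gen u1 v1.
    by apply: (mulIf e0); rewrite mulrAC -Eu M0 Ev mulrAC.
  have v10 : v1 != 0 by apply: contraNneq a0 => v0'; rewrite Ea Ev v0' mul0r mulr0.
  apply/unitrP; exists s; rewrite [e * s]mulrC; suff -> : s * e = 1 by [].
  by apply: (mulIf v10); rewrite mul1r {2}Es Ev; ring.
exists b, 0, 1; split; rewrite ?mulr0 ?mulr1 //.
Qed.

Definition fps_irr q := [/\ fps_ev0 q = 0, q != 0 &
  forall g h, q = g * h -> g \is a GRing.unit \/ h \is a GRing.unit].

Lemma irr_nunit q : fps_irr q -> q \isn't a GRing.unit.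
Proof. by move=> [q0 _ _]; apply/nunitP. Qed.

Lemma irr_coprime q f : fps_irr q -> ~ fps_dvd q f -> fps_coprime q f.
Proof.
move=> [q0 qn0 qi] nqf d [g Eq] [h Ef].
have [gu|/dvd1P //] := qi _ _ Eq.
case: nqf; rewrite Ef; apply: dvdMl; exists g^-1; rewrite Eq.
by rewrite mulKr.
Qed.

Lemma irr_prime q f g : fps_irr q -> fps_dvd q (f * g) -> fps_dvd q f \/ fps_dvd q g.
Proof.
move=> qi qfg; have [|nqf] := pselect (fps_dvd q f); [by left|right].
exact: coprime_dvdM (irr_coprime qi nqf) qfg.
Qed.

Lemma irr_dvd_irr p q : fps_irr p -> fps_irr q -> fps_dvd p q -> fps_dvd q p.
Proof.
move=> pi [_ _ qi] [g Eq]; have [gu|pu] := qi _ _ Eq.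
  by exists g^-1; rewrite Eq mulKr.
by have := irr_nunit pi; rewrite pu.
Qed.

Lemma irr_primeX q f n : fps_irr q -> fps_dvd q (f ^+ n) -> fps_dvd q f.
Proof.
move=> qi; elim: n => [/dvd1P qu|n IH]; first by have := irr_nunit qi; rewrite qu.
by rewrite exprS => /(irr_prime qi)[].
Qed.

(** Such a k bounds the order of f. It is the measure for inductions on factors, because removing a
    nonunit factor lowers the order. *)
Lemma nfil_ex f : f != 0 -> exists k, ~ fil 1 1 k f.
Proof.
move=> /eqP f0; apply: contrapT => H; apply: f0; apply: (@fil_sep R 1 1) => k.
by apply: contrapT => nf; apply: H; exists k.
Qed.

Lemma nunit_fil q f k : fps_ev0 q = 0 -> fil 1 1 k f -> fil 1 1 k.+1 (q * f).
Proof. by move=> /fil_ev0 q1 ff; rewrite -[k.+1]add1n; apply: filM. Qed.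

Lemma ex_irr f : f != 0 -> fps_ev0 f = 0 -> exists2 q, fps_irr q & fps_dvd q f.
Proof.
move=> f0; have [k nk] := nfil_ex f0; elim: k f f0 nk => [|k IH] f f0 nk fe.
  by case: nk.
have [fi|nfi] := pselect (fps_irr f); first by exists f => //; apply: dvd_refl.
have [g [h [E ng nh]]] : exists g h, [/\ f = g * h, fps_ev0 g = 0 & fps_ev0 h = 0].
  apply: contrapT => H; apply: nfi; split=> // g h E.
  have [gu|/nunitP g0] := boolP (g \is a GRing.unit); first by left.
  have [hu|/nunitP h0] := boolP (h \is a GRing.unit); first by right.
  by case: H; exists g, h.
have [g0 h0] : g != 0 /\ h != 0 by apply/andP; rewrite -negb_or -mulf_eq0 -E.
have [|q qi qh] := IH h h0 _ nh; last first.
  by exists q => //; rewrite E; apply: dvdMl.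
by move=> fh; apply: nk; rewrite E; apply: nunit_fil.
Qed.

Lemma max_power q f : fps_ev0 q = 0 -> f != 0 ->
  exists n f', f = q ^+ n * f' /\ ~ fps_dvd q f'.
Proof.
move=> q0 f0; have [k nk] := nfil_ex f0; elim: k f f0 nk => [|k IH] f f0 nk.
  by case: nk.
have [[g E]|nqf] := pselect (fps_dvd q f); last by exists 0%N, f; rewrite mul1r.
have [||n [f' [E' nq]]] := IH g.
- by apply: contraNneq f0 => g0; rewrite E g0 mul0r.
- by move=> fg; apply: nk; rewrite E mulrC; apply: nunit_fil.
by exists n.+1, f'; rewrite E E' exprS mulrC mulrA.
Qed.

(** The whole power of q is split off at once, so that q is prime to the remaining f; the
    logarithmic derivative in [log_rep] is built along this induction. *)
Lemma factor_ind (P : fps2 R -> Prop) :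
  (forall u, u \is a GRing.unit -> P u) ->
  (forall q n f, fps_irr q -> f != 0 -> ~ fps_dvd q f -> P f -> P (q ^+ n.+1 * f)) ->
  forall f, f != 0 -> P f.
Proof.
move=> Pu PM f f0; have [k nk] := nfil_ex f0; elim: k f f0 nk => [|k IH] f f0 nk.
  by case: nk.
have [/Pu //|/nunitP fe] := boolP (f \is a GRing.unit).
have [q qi qf] := ex_irr f0 fe; have [q0 qn0 _] := qi.
have [[|n] [f' [E nq]]] := max_power q0 f0; first by case: nq; move: qf; rewrite E mul1r.
have f'0 : f' != 0 by apply: contraNneq f0 => f'0; rewrite E f'0 mulr0.
rewrite E; apply: PM => //; apply: IH => // ff; apply: nk; rewrite E exprS -mulrA.
by apply: nunit_fil => //; apply: filMl.
Qed.

Lemma coprime_irr a b : (a != 0) || (b != 0) ->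
  (forall q, fps_irr q -> fps_dvd q a -> fps_dvd q b -> False) -> fps_coprime a b.
Proof.
move=> ab H d da db; apply/dvd1P; case: (boolP (d \is a GRing.unit)) => // /nunitP d0.
exfalso.
have dn0 : d != 0.
  by case/orP: ab; [case: da|case: db] => g ->; apply: contraNneq => ->; rewrite mulr0.
have [q qi qd] := ex_irr dn0 d0.
exact: (H q qi (dvd_trans qd da) (dvd_trans qd db)).
Qed.

End Divisibility.

(** * Derivations and vector fields *)

Section DerivC.
Variable R : comNzRingType.

HB.instance Definition _ (i : 'I_2) :=
  GRing.isLinear.Build R (fps2 R) (fps2 R) *:%R (@fps_deriv R i) (fps_deriv_linear i).

Lemma fps_derivD i (f g : fps2 R) : fps_deriv i (f + g) = fps_deriv i f + fps_deriv i g.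
Proof. exact: raddfD. Qed.
Lemma fps_derivB i (f g : fps2 R) : fps_deriv i (f - g) = fps_deriv i f - fps_deriv i g.
Proof. exact: raddfB. Qed.
Lemma fps_deriv_fpsC i a : fps_deriv i (fpsC a : fps2 R) = 0.
Proof.
rewrite /fpsC linearZ /=; apply/eqP; rewrite (_ : fps_deriv i 1 = 0) ?scaler0 //.
have := fps_derivM i (1 : fps2 R) 1; rewrite !mulr1 mul1r => /eqP.
by rewrite -subr_eq0 opprD addNKr oppr_eq0 => /eqP.
Qed.

End DerivC.

Section Derivatives.
Variable R : realFieldType.
Implicit Types (f g q : fps2 R).

(** Characteristic 0 enters here. Many identities between series below are proved by induction on k
    through this lemma, the derivatives of the defect being defects of the same kind. *)
Lemma fil_intr k f : fps_ev0 f = 0 -> (forall i, fil 1 1 k (fps_deriv i f)) ->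
  fil 1 1 k.+1 f.
Proof.
move=> f0 df [|m] n; rewrite !mul1n => mn.
  case: n mn => [//|n mn]; have := df ord_max 0 n; rewrite /= !mul1n => /(_ mn) /eqP.
  by rewrite mulrn_eq0 => /eqP.
have := df ord0 m n; rewrite /= !mul1n => /(_ mn) /eqP.
by rewrite mulrn_eq0 => /eqP.
Qed.

Lemma deriv_eq0 f : (forall i, fps_deriv i f = 0) -> f = fpsC (fps_ev0 f).
Proof.
move=> df; apply: (@fil_eq R 1 1) => k; apply: (@filW _ 1 1 k.+1) => //.
apply: fil_intr; first by rewrite ev0B ev0C subrr.
move=> i; have -> : fps_deriv i (f - fpsC (fps_ev0 f)) = 0; last exact: fil_zero.
by rewrite fps_derivB df fps_deriv_fpsC subr0.
Qed.

(** If q divided its derivatives, order k of q would give order k of the derivatives and then order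
    k + 1 of q, so q would be 0. *)
Lemma irr_deriv q : fps_irr q -> ~ (forall i, fps_dvd q (fps_deriv i q)).
Proof.
move=> [q0 /negP qn0 _] dq; apply: qn0; apply/eqP/(@fil_sep R 1 1); elim=> // k IH.
by apply: fil_intr => // i; have [g ->] := dq i; apply: filMl.
Qed.

End Derivatives.

Section Derivations.
Variables (R : comNzRingType) (A : comAlgType R) (D : 'I_2 -> A -> A).
Hypothesis D_linear : forall i, linear (D i).
Hypothesis DM : forall i f g, D i (f * g) = D i f * g + f * D i g.
Implicit Types (X : {ffun 'I_2 -> A}) (f g : A).

Lemma vf_applyE X f : vf_apply D X f = X ord0 * D ord0 f + X ord_max * D ord_max f.
Proof.
rewrite /vf_apply big_ord_recl big_ord1.
by rewrite (_ : lift ord0 ord0 = ord_max); last exact: val_inj.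
Qed.

Lemma vf_applyD X f g : vf_apply D X (f + g) = vf_apply D X f + vf_apply D X g.
Proof. by have := vf_apply_linearr D_linear 1 X f g; rewrite !scale1r. Qed.
Lemma vf_apply0 X : vf_apply D X 0 = 0.
Proof. by apply: (addrI (vf_apply D X 0)); rewrite -vf_applyD !addr0. Qed.
Lemma vf_applyZ a X f : vf_apply D X (a *: f) = a *: vf_apply D X f.
Proof. by rewrite -[a *: f]addr0 vf_apply_linearr // vf_apply0 addr0. Qed.
Lemma vf_applyM X f g : vf_apply D X (f * g) = vf_apply D X f * g + f * vf_apply D X g.
Proof. by rewrite !vf_applyE !DM; ring. Qed.
Lemma vf_apply1 X : vf_apply D X 1 = 0.
Proof. by apply: (addrI (vf_apply D X 1)); rewrite addr0 -{3}[1]mulr1 vf_applyM mulr1 mul1r. Qed.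
Lemma vf_applyX X f n : vf_apply D X (f ^+ n.+1) = n.+1%:R * f ^+ n * vf_apply D X f.
Proof.
elim: n => [|n IH]; first by rewrite !expr0 !mul1r expr1.
rewrite exprS vf_applyM IH (exprS f n) -[n.+2]addn1 natrD; ring.
Qed.
Lemma vf_apply_sum X I (r : seq I) (P : pred I) (F : I -> A) :
  vf_apply D X (\sum_(i <- r | P i) F i) = \sum_(i <- r | P i) vf_apply D X (F i).
Proof.
by elim/big_rec2: _ => [|i y x _ <-]; [exact: vf_apply0|rewrite vf_applyD].
Qed.
Lemma vf_applyMl X f g : vf_apply D [ffun i => g * X i] f = g * vf_apply D X f.
Proof. by rewrite !vf_applyE !ffunE; ring. Qed.

End Derivations.

Notation vfd := (vf_apply (@fps_deriv _)).

Section FormalDerivation.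
Variable R : comNzRingType.
Implicit Types (X : formal_vf R) (f g : fps2 R).

Definition vfdD X f g : vfd X (f + g) = vfd X f + vfd X g :=
  vf_applyD (@fps_deriv_linear R) X f g.
Definition vfdB X f g : vfd X (f - g) = vfd X f - vfd X g :=
  vf_applyB (@fps_deriv_linear R) X f g.
Definition vfd0 X : vfd X 0 = 0 := vf_apply0 (@fps_deriv_linear R) X.
Definition vfdM X f g : vfd X (f * g) = vfd X f * g + f * vfd X g :=
  vf_applyM (@fps_derivM R) X f g.
Definition vfdZ a X f : vfd X (a *: f) = a *: vfd X f :=
  vf_applyZ (@fps_deriv_linear R) a X f.
Definition vfdX X f n : vfd X (f ^+ n.+1) = n.+1%:R * f ^+ n * vfd X f :=
  vf_applyX (@fps_derivM R) X f n.
Lemma vfdC X a : vfd X (fpsC a) = 0.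
Proof. by rewrite vf_applyE !fps_deriv_fpsC !mulr0 addr0. Qed.
Lemma vfd_nat X n : vfd X n%:R = 0.
Proof. by rewrite -(rmorph_nat (@fpsC R)) vfdC. Qed.
Lemma vfd_fpsX X : vfd X (fpsX R) = X ord0.
Proof. by rewrite vf_applyE !derivX mulr1 mulr0 addr0. Qed.
Lemma vfd_fpsY X : vfd X (fpsY R) = X ord_max.
Proof. by rewrite vf_applyE !derivY mulr1 mulr0 add0r. Qed.

End FormalDerivation.

(** * Relations over R[[x]] modulo a series regular in y *)

Section Weierstrass.
Variable R : fieldType.
Implicit Types (a b c f g q : fps2 R) (P : {poly fps2 R}).

(* f(x, y) |-> f(x, 0); the fixed points are the series in x alone. *)
Definition fps_col0 f : fps2 R := Fps2 (fun m n => if n is 0%N then fps_coef f m 0 else 0).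

Lemma col0E f : fps_col0 f = fps_swap (fps_row0 (fps_swap f)).
Proof. exact: fps2P. Qed.

Fact col0_zmod : zmod_morphism fps_col0.
Proof. by move=> f g; rewrite !col0E rmorphB row0B rmorphB. Qed.
Fact col0_monoid : monoid_morphism fps_col0.
Proof.
split=> [|f g]; first by apply: fps2P => -[|m] [|n].
by rewrite !col0E rmorphM row0M rmorphM.
Qed.
HB.instance Definition _ := GRing.isZmodMorphism.Build (fps2 R) (fps2 R) fps_col0 col0_zmod.
HB.instance Definition _ := GRing.isMonoidMorphism.Build (fps2 R) (fps2 R) fps_col0 col0_monoid.

Lemma col0_form c : fps_col0 c = c -> c != 0 ->
  exists N u, u \is a GRing.unit /\ c = fpsX R ^+ N * u.
Proof.
move=> cc /eqP /fps_neq0P[m [n [cmn cm cn]]].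
have n0 : n = 0%N by move: cmn; rewrite -cc; case: n {cn} => //= n; rewrite eqxx.
have [|u E] := (fil10P m c).1; first by move=> k l; rewrite mul1n mul0n addn0; apply: cm.
exists m, u; split; last by rewrite mulrC.
have E0 : fps_mono R m 0 = fpsX R ^+ m by rewrite monoE mulr1.
move: cmn; rewrite n0 E mulrC -E0 coef_monoM leqnn subnn.
by rewrite fps_unitE.
Qed.

Definition y_regular n a := (forall l, (l < n)%N -> fps_coef a 0 l = 0) /\ fps_coef a 0 n != 0.

Lemma y_regularP a : fps_row0 a <> 0 -> exists n, y_regular n a.
Proof.
move=> /fps_neq0P[[|m] [n [an am al]]]; last by move: an; rewrite eqxx.
by exists n.
Qed.

Lemma weierstrass_div_algebra (f r s a h p q m c d : fps2 R) : h = p + m * q ->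
  c * d = 1 -> f - (r + p) - (s + d * q) * a = f - r - s * a - h + d * q * (c * m - a).
Proof.
move=> -> cd; rewrite mulrBr (_ : d * q * (c * m) = (c * d) * (q * m)); last by ring.
by rewrite cd; ring.
Qed.

(** The unknown r enters only through [pr r], its part of degree less than n in y, so the condition
    on the remainder holds by construction. *)
Lemma weierstrass_div n a f : y_regular n a -> exists r s,
  (forall m l, (n <= l)%N -> fps_coef r m l = 0) /\ f = r + s * a.
Proof.
move=> [an0 ann].
pose pr f := Fps2 (fun m l => if (l < n)%N then fps_coef f m l else 0) : fps2 R.
pose sh f := Fps2 (fun m l => fps_coef f m (l + n)) : fps2 R.
have prB f1 f2 : pr f1 - pr f2 = pr (f1 - f2).
  by apply: fps2P => m l; rewrite coefB /=; case: ifP; rewrite ?subrr.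
have pr_sh e : e = pr e + fps_mono R 0 n * sh e.
  apply: fps2P => m l; rewrite coefD coef_monoM /= subn0; case: ltnP => nl.
    by rewrite addr0.
  by rewrite add0r subnK.
have fpr k e : fil n.+1 1 k e -> fil n.+1 1 k (pr e).
  by move=> fe m l ml /=; case: ifP => // _; apply: fe.
have fsh k e : fil n.+1 1 (k + n) e -> fil n.+1 1 k (sh e).
  by move=> fe m l ml /=; apply: fe; lia.
pose Phi r s := f - pr r - s * a.
(* With weights n + 1 for x and 1 for y, the leading form of [a] is its term in y^n: lower powers of
   y are absent and every term containing x is heavier. Hence the shift [d] = n. *)
have [|k r s _ _ _ ef||r [s [_ _ /eqP E]]] := @fil_approx _ n.+1 1 n 0 Phi f 0.
- move=> k r s r' s' rr ss; rewrite /Phi.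
  rewrite (_ : _ - _ = (pr r' - pr r) + (s' - s) * a); last by ring.
  apply: filD; last by apply/filMr/filBC.
  by rewrite prB; apply/fpr/filBC.
- pose e := Phi r s; pose h := fps_hom n.+1 1 (k + n) e; pose c := fps_coef a 0 n.
  have fh : fil n.+1 1 (k + n) h by exact: hom_fil.
  exists (r + pr h), (s + fpsC c^-1 * sh h); split.
  + rewrite addrAC subrr add0r; apply/fpr/(filW (leq_addr _ _) fh).
  + by rewrite addrAC subrr add0r; apply/filMl/fsh.
  have cc : fpsC c * fpsC c^-1 = 1 :> fps2 R by rewrite -rmorphM mulfV ?rmorph1.
  have -> : Phi (r + pr h) (s + fpsC c^-1 * sh h) =
      (e - h) + fpsC c^-1 * sh h * (fpsC c * fps_mono R 0 n - a).
    have E : pr (r + pr h) = pr r + pr h.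
      apply: fps2P => m l; rewrite -[RHS]/(fps_coef (pr r) m l + fps_coef (pr h) m l) /=.
      by case: (l < n)%N; rewrite ?addr0.
    by rewrite /e /Phi E; apply: weierstrass_div_algebra.
  apply: filD; first exact: fil_hom.
  rewrite -addnS; apply: filM; first by apply/filMl/fsh.
  move=> [|m] l; last by lia.
  rewrite muln0 add0n mul1n ltnS coefB coefCM /= leq_eqVlt => /predU1P[->|ln].
    by rewrite eqxx mulr1 subrr.
  by rewrite an0 // (ltn_eqF ln) mulr0 subrr.
- by rewrite add0n /Phi mul0r subr0 => m l ml; rewrite coefB /= ifT ?subrr //; lia.
- exists (pr r), s; split; first by move=> m l nl /=; rewrite ltnNge nl.
  by move/eqP: E => E; rewrite -[RHS]add0r -E /Phi; ring.
Qed.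

Lemma weierstrass_span n a f : y_regular n a -> exists (c : 'I_n -> fps2 R) s,
  (forall i, fps_col0 (c i) = c i) /\ f = \sum_i c i * fpsY R ^+ i + s * a.
Proof.
move=> /(@weierstrass_div n a f)[r [s [rn ->]]].
exists (fun i => Fps2 (fun m l => if l is 0%N then fps_coef r m i else 0)), s.
split=> [i|]; first by apply: fps2P => m [|l].
congr (_ + _); apply: fps2P => m l; rewrite coef_sum.
have E (i : 'I_n) (g : fps2 R) : fps_coef (g * fpsY R ^+ i) m l =
    if (i <= l)%N then fps_coef g m (l - i) else 0.
  by rewrite mulrC -[_ ^+ _]mul1r -(expr0 (fpsX R)) -monoE coef_monoM subn0.
under eq_bigr do rewrite E; case: (ltnP l n) => ln; last first.
  rewrite rn // big1 // => i _; case: leqP => //= il.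
  by case E' : (l - i)%N => [|//]; have := ltn_ord i; lia.
rewrite (bigD1 (Ordinal ln)) //= leqnn subnn big1 ?addr0 // => i.
rewrite -val_eqE /= => il; case: leqP => // li.
by case E' : (l - i)%N => [|//]; lia.
Qed.

Lemma horner_char_poly (B : comNzRingType) n (M : 'M[B]_n) x :
  (char_poly M).[x] = \det (x%:M - M).
Proof.
rewrite /char_poly -[LHS]/(horner_eval x _) -det_map_mx; congr (\det _).
apply/matrixP => i j; rewrite !mxE /= /horner_eval.
by rewrite hornerD hornerN hornerC hornerMn hornerX.
Qed.

(** Cayley-Hamilton for multiplication by f on the quotient by [a], which 1, y, ..., y^(n-1) span
    over R[[x]]. *)
Lemma weierstrass_rel n a f : y_regular n a -> exists P,
  [/\ P \is monic, map_poly fps_col0 P = P & fps_dvd a P.[f]].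
Proof.
move=> an; case: n an => [|n] an.
  exists 1; split; rewrite ?monic1 ?rmorph1 // hornerC; apply/dvd1P.
  by rewrite fps_unitE; have [] := an.
have /boolp.choice[c cP] : forall i : 'I_n.+1, exists c : ('I_n.+1 -> fps2 R) * fps2 R,
    (forall j, fps_col0 (c.1 j) = c.1 j) /\
    f * fpsY R ^+ i = \sum_j c.1 j * fpsY R ^+ j + c.2 * a.
  by move=> i; have [c [s h]] := weierstrass_span (f * fpsY R ^+ i) an; exists (c, s).
pose M := \matrix_(i, j) (c i).1 j; exists (char_poly M); split.
- exact: char_poly_monic.
- rewrite map_char_poly; congr char_poly; apply/matrixP => i j.
  by rewrite !mxE; apply: (cP i).1.
pose v : 'cV[fps2 R]_n.+1 := \col_i fpsY R ^+ i.
have E : (f%:M - M) *m v = a *: \col_i (c i).2.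
  apply/matrixP => i j; rewrite ord1 mulmxBl mul_scalar_mx !mxE (cP i).2.
  under [X in _ - X]eq_bigr do rewrite !mxE.
  by rewrite addrAC subrr add0r mulrC.
(* The first entry of v is 1, so the first entry of the product with the adjugate is the
   characteristic polynomial at f. *)
have := congr1 (fun w => (\adj (f%:M - M) *m w) ord0 ord0) E.
rewrite mulmxA mul_adj_mx mul_scalar_mx mxE mxE expr0 mulr1 -horner_char_poly => ->.
by rewrite -scalemxAr mxE; apply/dvdMr/dvd_refl.
Qed.

Definition rel_mod a f P := [/\ P != 0, map_poly fps_col0 P = P & fps_dvd a P.[f]].

Lemma rel_min n a f : y_regular n a -> exists P, rel_mod a f P /\
  forall Q, rel_mod a f Q -> (size P <= size Q)%N.
Proof.
move=> an; have ex : exists k, `[< exists2 P, rel_mod a f P & size P = k >].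
  have [P [Pm Pc Pa]] := weierstrass_rel f an.
  by exists (size P); apply/asboolP; exists P => //; split=> //; apply: monic_neq0.
case: (ex_minnP ex) => k /asboolP[P rP <-] min; exists P; split=> // Q rQ.
by apply: min; apply/asboolP; exists Q.
Qed.

Lemma poly_dec (B : nzRingType) (P : {poly B}) : exists Q, P = Q * 'X + (P`_0)%:P.
Proof.
exists (drop_poly 1 P); apply/polyP => i; rewrite poly.coefD coefMX coef_drop_poly coefC.
by case: i => [|i]; rewrite ?add0r //= addr0 addn1.
Qed.

(* The constant coefficient of a minimal relation of b over R[[x]] modulo a is nonzero, as
   otherwise b could be divided out. *)
Lemma X_ideal_aux n a b : y_regular n a -> fps_coprime a b ->
  exists N u v, fpsX R ^+ N = u * a + v * b.
Proof.
move=> an ab; have [P [[P0 Pc Pa] min]] := rel_min b an.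
have [Q EP] := poly_dec P.
have [P00|P00] := eqVneq (P`_0) 0.
  have EQ : P = Q * 'X by rewrite {1}EP P00 polyC0 addr0.
  have Q0 : Q != 0 by apply: contraNneq P0 => Q0; rewrite EQ Q0 mul0r.
  have /min : rel_mod a b Q.
    split=> //; last first.
      by apply: (coprime_dvdM ab); move: Pa; rewrite EQ hornerM hornerX mulrC.
    apply: (mulIf (_ : 'X != 0)); first by rewrite polyX_eq0.
    by rewrite -[RHS]EQ -Pc EQ rmorphM /= map_polyX.
  by rewrite EQ size_mulX // ltnn.
have [||N [u [uu E]]] := @col0_form P`_0.
- by rewrite -{2}Pc coef_map.
- exact: P00.
have [s Es] := Pa; exists N, (u^-1 * s), (- u^-1 * Q.[b]).
have -> : fpsX R ^+ N = u^-1 * P`_0 by rewrite E mulrCA mulVr ?mulr1.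
have -> : P`_0 = P.[b] - Q.[b] * b.
  by rewrite [in P.[b]]EP hornerD hornerM hornerX hornerC addrAC subrr add0r.
by rewrite Es; ring.
Qed.

(** The common zero of a coprime pair is at most the origin; with [Y_ideal], the ideal contains a
    power of each coordinate. One of a, b is regular in y because x does not divide both. *)
Lemma X_ideal a b : fps_coprime a b -> exists N u v, fpsX R ^+ N = u * a + v * b.
Proof.
move=> ab; have [/row0_eq0 Xa|/y_regularP[n an]] := pselect (fps_row0 a = 0); last first.
  exact: X_ideal_aux an ab.
have [/row0_eq0 Xb|/y_regularP[n bn]] := pselect (fps_row0 b = 0).
  by have /dvd1P := ab _ Xa Xb; rewrite fps_unitE /fps_ev0 /= eqxx.
have [N [u [v E]]] := X_ideal_aux bn (coprime_sym ab).
by exists N, v, u; rewrite E addrC.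
Qed.

Lemma swap_dvd d f : fps_dvd (fps_swap d) (fps_swap f) <-> fps_dvd d f.
Proof.
split=> [[g /(congr1 (@fps_swap R))]|[g ->]]; last by exists (fps_swap g); rewrite rmorphM.
by rewrite rmorphM !swapK => ->; apply/dvdMl/dvd_refl.
Qed.

Lemma swap_coprime a b : fps_coprime a b -> fps_coprime (fps_swap a) (fps_swap b).
Proof.
move=> ab d; rewrite -[d]swapK => /swap_dvd da /swap_dvd db.
by have /swap_dvd := ab _ da db; rewrite rmorph1.
Qed.

Lemma Y_ideal a b : fps_coprime a b -> exists N u v, fpsY R ^+ N = u * a + v * b.
Proof.
move=> /swap_coprime /X_ideal[N [u [v /(congr1 (@fps_swap R))]]].
rewrite rmorphD !rmorphM rmorphXn /= swapX !swapK => E.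
by exists N, (fps_swap u), (fps_swap v).
Qed.

End Weierstrass.

(** * Invariant curves *)

Section Curves.
Variable R : realFieldType.
Implicit Types (a b c f g q : fps2 R) (P : {poly fps2 R}) (X : formal_vf R).

Definition real_horner (chi : {poly R}) f : fps2 R := (map_poly (@fpsC R) chi).[f].

Lemma real_horner_form chi f : fps_ev0 f = 0 -> chi != 0 ->
  exists n u, u \is a GRing.unit /\ real_horner chi f = f ^+ n * u.
Proof.
move=> f0; have [n] := ubnP (size chi); elim: n chi => // n IH chi chin chi0.
have [Q EQ] := poly_dec chi.
have E : real_horner chi f = real_horner Q f * f + fpsC chi`_0.
  by rewrite {1}EQ /real_horner rmorphD rmorphM /= map_polyX map_polyC hornerMXaddC.
have [c0|c0] := eqVneq chi`_0 0; last first.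
  by exists 0%N, (real_horner chi f); rewrite mul1r fps_unitE E ev0D ev0M f0 mulr0 add0r ev0C.
have EQ' : chi = Q * 'X by rewrite {1}EQ c0 polyC0 addr0.
have Q0 : Q != 0 by apply: contraNneq chi0 => Q0; rewrite EQ' Q0 mul0r.
have [|m [u [uu Eu]]] := IH Q _ Q0; first by move: chin; rewrite EQ' size_mulX.
by exists m.+1, u; split=> //; rewrite E c0 rmorph0 addr0 Eu exprS; ring.
Qed.

(** Translating by the constant term of k leaves a series f without constant term, on which a
    nonzero polynomial takes the form f^n times a unit. *)
Lemma real_horner_eq0 chi k : chi != 0 -> real_horner chi k = 0 -> k = fpsC (fps_ev0 k).
Proof.
move=> chi0 E; pose f := k - fpsC (fps_ev0 k).
have f0 : fps_ev0 f = 0 by rewrite ev0B ev0C subrr.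
pose psi := chi \Po ('X + (fps_ev0 k)%:P).
have psi0 : psi != 0.
  apply: contraNneq chi0 => psi0; rewrite -(comp_polyXr chi).
  rewrite (_ : 'X = ('X + (fps_ev0 k)%:P) \Po ('X - (fps_ev0 k)%:P)).
    by rewrite comp_polyA -/psi psi0 comp_poly0.
  by rewrite comp_polyD comp_polyX comp_polyC subrK.
have [n [u [uu]]] := real_horner_form f0 psi0.
rewrite /real_horner map_comp_poly horner_comp rmorphD /= map_polyX map_polyC /=.
rewrite hornerD hornerX hornerC subrK -/(real_horner chi k) E => /esym/eqP.
rewrite mulf_eq0 expf_eq0 => /orP[/andP[_]|/eqP u0]; first by rewrite subr_eq0 => /eqP.
by move: uu; rewrite u0 unitr0.
Qed.

Lemma irr_X : fps_irr (fpsX R).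
Proof.
split; [by []|exact: X_neq0|move=> g h E].
have /X_prime[] : fps_dvd (fpsX R) (g * h) by rewrite -E; apply: dvd_refl.
  move=> [k Ek]; right; apply/dvd1P; exists k; apply: (mulIf (@X_neq0 R)).
  by rewrite mul1r {1}E Ek; ring.
move=> [k Ek]; left; apply/dvd1P; exists k; apply: (mulIf (@X_neq0 R)).
by rewrite mul1r {1}E Ek; ring.
Qed.

Lemma col0_deriv c : fps_col0 c = c -> fps_deriv ord_max c = 0.
Proof.
move=> cc; apply: fps2P => m n; rewrite -cc -[LHS]/(fps_coef (fps_col0 c) m n.+1 *+ n.+1).
by rewrite mul0rn.
Qed.

Lemma col0_deriv0 c : fps_col0 c = c -> fps_col0 (fps_deriv ord0 c) = fps_deriv ord0 c.
Proof. by move=> cc; rewrite -{2}cc; apply: fps2P => m [|n] //=; rewrite mul0rn. Qed.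

Lemma vfd_col0 X c : fps_col0 c = c -> vfd X c = X ord0 * fps_deriv ord0 c.
Proof. by move=> cc; rewrite vf_applyE col0_deriv // mulr0 addr0. Qed.

Lemma deriv0_Xn m : fpsX R * fps_deriv ord0 (fpsX R ^+ m) = m%:R * fpsX R ^+ m.
Proof.
elim: m => [|m IH]; first by rewrite expr0 -(rmorph1 (@fpsC R)) fps_deriv_fpsC mulr0 mul0r.
rewrite exprS fps_derivM derivX eqxx mul1r mulrDr mulrCA IH -addn1 natrD; ring.
Qed.

(** The difference e of c and a real multiple of l is chosen without the term x^m, where m is the
    order of l. If e had order k, the lowest coefficient of the Wronskian would be k - m times a
    nonzero number, which forces k = m, a contradiction. *)
Lemma wronskian_col0 l c : fps_col0 l = l -> fps_col0 c = c -> l != 0 ->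
  l * fps_deriv ord0 c = fps_deriv ord0 l * c -> exists a : R, c = fpsC a * l.
Proof.
move=> ll cc l0 W; have [m [u [uu El]]] := col0_form ll l0.
pose a := fps_coef c m 0 / fps_coef l m 0; exists a; apply/eqP.
rewrite -subr_eq0; set e := c - fpsC a * l.
have lm : fps_coef l m 0 != 0.
  have := coef_monoM m 0 u m 0; rewrite monoE expr0 mulr1 -El leqnn !subnn /= => ->.
  by rewrite -/(fps_ev0 u) -fps_unitE.
have em : fps_coef e m 0 = 0 by rewrite coefB coefCM divfK ?subrr.
have We : l * fps_deriv ord0 e = fps_deriv ord0 l * e.
  by rewrite /e fps_derivB fps_derivM fps_deriv_fpsC mul0r add0r !mulrBr W; ring.
have ee : fps_col0 e = e.
  rewrite /e rmorphB rmorphM /= ll cc; congr (_ - _ * _).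
  by apply: fps2P => i [|j] //=; rewrite andbF mulr0.
apply/negPn/negP => e0; have [k [v [vu Ee]]] := col0_form ee e0.
have XD w n : fpsX R * fps_deriv ord0 (fpsX R ^+ n * w) =
    fpsX R ^+ n * (n%:R * w + fpsX R * fps_deriv ord0 w).
  by rewrite fps_derivM mulrDr mulrA deriv0_Xn; ring.
have : fpsX R ^+ m * fpsX R ^+ k * (k%:R * (u * v) - m%:R * (u * v) +
    fpsX R * (u * fps_deriv ord0 v - v * fps_deriv ord0 u)) = 0.
  have D1 := XD v k; have D2 := XD u m; rewrite -Ee -El in D1 D2.
  transitivity (l * (fpsX R * fps_deriv ord0 e) - (fpsX R * fps_deriv ord0 l) * e).
    by rewrite D1 D2 El Ee; ring.
  by rewrite mulrCA We; ring.
move=> /eqP; rewrite !mulf_eq0 !expf_eq0 (negPf (@X_neq0 R)) !andbF /= => /eqP.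
move=> /(congr1 (@fps_ev0 R)); rewrite ev0D ev0B !ev0M ev00 [fps_ev0 (fpsX R)](_ : _ = 0) //.
have u0 : fps_ev0 u != 0 := uu; have v0 : fps_ev0 v != 0 := vu.
rewrite mul0r addr0 -mulrBl => /eqP; rewrite mulf_eq0 (negPf (mulf_neq0 u0 v0)) orbF.
rewrite subr_eq0 !ev0_nat eqr_nat => /eqP km.
rewrite {}km in Ee *; have := coef_monoM m 0 v m 0.
rewrite monoE expr0 mulr1 -Ee em leqnn !subnn /=.
by move=> /esym /eqP; rewrite -/(fps_ev0 v) (negPf v0).
Qed.

Lemma vfd_horner X P f : vfd X P.[f] = (map_poly (vfd X) P).[f] + P^`().[f] * vfd X f.
Proof.
elim/poly_ind: P => [|P c IH].
  by rewrite map_poly0 deriv0 !horner0 mul0r vfd0 addr0.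
rewrite hornerMXaddC vfdD vfdM IH derivMXaddC hornerD hornerMX.
have -> : map_poly (vfd X) (P * 'X + c%:P) = map_poly (vfd X) P * 'X + (vfd X c)%:P.
  apply/polyP => i; rewrite coef_map_id0 ?vfd0 //.
  rewrite !poly.coefD !coefMX !coefC coef_map_id0 ?vfd0 // vfdD.
  by case: i => [|i] /=; rewrite ?vfd0 ?add0r.
rewrite hornerMXaddC; ring.
Qed.

(** A function with zero derivative along X is constant on the invariant curve q = 0. Indeed,
    differentiating the minimal relation of f over R[[x]] modulo q gives another relation,
    proportional to it by minimality; so up to a factor in R[[x]] the relation has real
    coefficients. *)
Lemma curve_y X q f n : y_regular n q -> fps_irr q -> fps_dvd q (vfd X q) ->
  ~ (fps_dvd q (X ord0) /\ fps_dvd q (X ord_max)) -> fps_dvd q (vfd X f) ->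
  fps_ev0 f = 0 -> fps_dvd q f.
Proof.
move=> qn qi Dq nX Df f0; have [qq1 qq2] := qn; have [qe q0 _] := qi.
(* On x = 0, the y-derivative of q has order n - 1, less than the order n of q. *)
have nqy : ~ fps_dvd q (fps_deriv ord_max q).
  case: n qn qq1 qq2 => [|n] qn qq1 qq2 [g E]; first by move: qq2; rewrite -/(fps_ev0 q) qe eqxx.
  have := congr1 (fun h => fps_coef h 0 n) E.
  rewrite -[LHS]/(fps_coef q 0 n.+1 *+ n.+1) coefM big1 => [/eqP|k _].
    by rewrite mulrn_eq0 (negPf qq2).
  by apply: big1 => l _; rewrite qq1 ?mulr0 // ltnS leq_subr.
have nqX0 : ~ fps_dvd q (X ord0).
  move=> qX0; have : fps_dvd q (X ord_max * fps_deriv ord_max q).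
    have := Dq; rewrite vf_applyE addrC => /dvd_addl; apply; exact: dvdMr.
  by move=> /(irr_prime qi)[qX1|//]; apply: nX.
have [P [[P0 Pc Pq] min]] := rel_min f qn.
have Pcc i : fps_col0 P`_i = P`_i by rewrite -{2}Pc coef_map.
pose dP := map_poly (fps_deriv ord0) P.
have cdP i : dP`_i = fps_deriv ord0 P`_i by rewrite coef_map_id0 ?linear0.
have qdP : fps_dvd q dP.[f].
  have : fps_dvd q (vfd X P.[f]) by have [g ->] := Pq; rewrite vfdM; apply: dvdD; [apply/dvdMl/dvd_refl|exact: dvdMl].
  rewrite vfd_horner => /dvd_addl /(_ (dvdMl _ Df)).
  rewrite (_ : map_poly _ P = X ord0 *: dP); last first.
    by apply/polyP => i; rewrite poly.coefZ coef_map_id0 ?vfd0 // cdP vfd_col0.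
  by rewrite hornerZ => /(irr_prime qi)[].
pose l := lead_coef P; have l0 : l != 0 by rewrite lead_coef_eq0.
have lE : l = P`_(size P).-1 by [].
have ll : fps_col0 l = l by rewrite lE Pcc.
(* The leading coefficients cancel, so by minimality this relation is zero, and each coefficient of
   P has zero Wronskian with l. *)
pose P2 := l *: dP - fps_deriv ord0 l *: P.
have cP2 i : P2`_i = l * fps_deriv ord0 P`_i - fps_deriv ord0 l * P`_i.
  by rewrite poly.coefB !poly.coefZ cdP.
have P20 : P2 = 0.
  apply/eqP/negPn/negP => P2n0; have /min : rel_mod q f P2.
    split=> //; last first.
      by rewrite hornerD hornerN !hornerZ; apply: dvdB; apply: dvdMl.
    apply/polyP => i; rewrite coef_map /= cP2 rmorphB !rmorphM /= ll Pcc.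
    by rewrite !col0_deriv0.
  rewrite leqNgt => /negP; apply; rewrite -(prednK (_ : 0 < size P)%N) ?size_poly_gt0 //.
  rewrite ltnS; apply/leq_sizeP => j; rewrite leq_eqVlt => /predU1P[<-|jP].
    by rewrite cP2 -lE; ring.
  have Pj : P`_j = 0 by rewrite nth_default // -(prednK (_ : 0 < size P)%N) ?size_poly_gt0.
  by rewrite cP2 Pj linear0 !mulr0 subrr.
have /boolp.choice[ga gaP] : forall i, exists a : R, P`_i = fpsC a * l.
  move=> i; apply: wronskian_col0 => //; apply/eqP; rewrite -subr_eq0 -cP2.
  by rewrite P20 poly.coef0.
have nql : ~ fps_dvd q l.
  have [N [u [uu ->]]] := col0_form ll l0; rewrite mulrC => /(dvd_Mul_unit uu).
  move=> /(irr_primeX qi) /(irr_dvd_irr qi irr_X) /row0_eq0 /(congr1 (fun h => fps_coef h 0 n)).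
  by move=> /eqP; rewrite (negPf qq2).
pose chi := \poly_(i < size P) ga i.
have EP : P = l *: map_poly (@fpsC R) chi.
  apply/polyP => i; rewrite poly.coefZ coef_map coef_poly /=; case: ltnP => iP.
    by rewrite gaP mulrC.
  by rewrite nth_default // rmorph0 mulr0.
have chi0 : chi != 0.
  by apply: contraNneq P0 => c0; rewrite EP c0 rmorph0 scaler0.
move: Pq; rewrite EP hornerZ => /(irr_prime qi)[//|].
have [m [u [uu ]]] := real_horner_form f0 chi0; rewrite /real_horner => ->.
by rewrite mulrC => /(dvd_Mul_unit uu) /(irr_primeX qi).
Qed.

(** If q is not regular in y, it is x up to a unit; then the hypothesis says directly that the
    y-derivative of f(0, y) vanishes. *)
Lemma curve_dvd X q f : fps_irr q -> fps_dvd q (vfd X q) ->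
  ~ (fps_dvd q (X ord0) /\ fps_dvd q (X ord_max)) -> fps_dvd q (vfd X f) ->
  fps_ev0 f = 0 -> fps_dvd q f.
Proof.
move=> qi Dq nX Df f0.
have [/row0_eq0 Xq|/y_regularP[n qn]] := pselect (fps_row0 q = 0); last first.
  exact: curve_y qn qi Dq nX Df f0.
have qX := irr_dvd_irr irr_X qi Xq; apply: (dvd_trans qX).
have XX0 : fps_dvd (fpsX R) (X ord0).
  rewrite -vfd_fpsX; have [g E] := qX; rewrite {2}E vfdM.
  apply: dvdD; first exact: dvdMl.
  exact/dvdMl/(dvd_trans Xq).
have nXX1 : ~ fps_dvd (fpsX R) (X ord_max).
  by move=> h; apply: nX; split; apply: (dvd_trans qX).
have : fps_dvd (fpsX R) (X ord_max * fps_deriv ord_max f).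
  have := dvd_trans Xq Df; rewrite vf_applyE addrC => /dvd_addl; apply; exact: dvdMr.
move=> /X_prime[//|] /row0_eq0 fy; apply/row0_eq0/fps2P => -[|m] [|n] //.
have := congr1 (fun h => fps_coef h 0 n) fy.
rewrite -[LHS]/(fps_coef f 0 n.+1 *+ n.+1) => /eqP; rewrite mulrn_eq0 => /eqP.
exact.
Qed.

End Curves.

(** * Formal first integrals *)

Section FirstIntegrals.
Variables (R : realFieldType) (X : formal_vf R).
Hypothesis X_coprime : fps_coprime (X ord0) (X ord_max).
Implicit Types (a b d f g h q : fps2 R).
Local Notation D := (vfd X).

Lemma coprime_nirr a b q : fps_coprime a b -> fps_irr q -> ~ (fps_dvd q a /\ fps_dvd q b).
Proof. by move=> ab qi [/ab h /h /dvd1P]; apply/negP/irr_nunit. Qed.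

Lemma irr_invariant g q : g != 0 -> fps_dvd g (D g) -> fps_irr q -> fps_dvd q g ->
  fps_dvd q (D q).
Proof.
move=> g0 [k Dg] qi qg; have [q0 qn0 _] := qi.
have [[|n] [h [E nqh]]] := max_power q0 g0; first by case: nqh; move: qg; rewrite E mul1r.
have qn : q ^+ n != 0 by rewrite expf_neq0.
have : fps_dvd q (n.+1%:R * D q * h).
  exists (k * h - D h); apply: (mulfI qn).
  have := Dg; rewrite E vfdM vfdX exprS => E'.
  transitivity (n.+1%:R * q ^+ n * D q * h + q * q ^+ n * D h - q * q ^+ n * D h).
    by ring.
  by rewrite E'; ring.
move=> /(irr_prime qi)[|//] /(irr_prime qi)[|//].
move=> /dvd_unit; rewrite (negPf (irr_nunit qi)) => h1.
by have := h1; rewrite fps_unitE ev0_nat pnatr_eq0 => /(_ isT).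
Qed.

Lemma curve_first_integral q f g : fps_irr q -> g != 0 -> fps_dvd g (D g) -> fps_dvd q g ->
  D f = 0 -> fps_ev0 f = 0 -> fps_dvd q f.
Proof.
move=> qi g0 Dg qg Df f0; apply: (@curve_dvd R X) => //.
- exact: irr_invariant Dg qi qg.
- exact: coprime_nirr.
- by rewrite Df; apply: dvd0.
Qed.

Lemma cofactor_ex a b : fps_coprime a b -> b * D a = a * D b ->
  exists k, D a = k * a /\ D b = k * b.
Proof.
move=> ab E; have [|k [-> ->]] := @coprime_syzygy _ b a (D a) (D b) (coprime_sym ab).
  by rewrite mulrC E mulrC.
by exists k.
Qed.

(* The members b + t a of the pencil would give infinitely many invariant curves, all
   contained in the zero set of f. *)
Lemma no_dicritical_first_integral a b k f : fps_coprime a b -> fps_ev0 a = 0 ->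
  fps_ev0 b = 0 -> D a = k * a -> D b = k * b -> D f = 0 -> fps_ev0 f = 0 -> f = 0.
Proof.
move=> ab a0 b0 Da Db Df f0.
pose s (t : nat) := b + t%:R * a.
have Ds t : D (s t) = k * s t.
  by rewrite /s vfdD vfdM vfd_nat Db Da; ring.
have nau : ~ fps_dvd a b.
  by move=> /(ab _ (dvd_refl a)) /dvd1P; apply/negP/nunitP.
have s0 t : s t != 0.
  apply/eqP => st0; apply: nau; exists (- t%:R); apply/eqP.
  by rewrite mulNr -addr_eq0 -st0.
have /boolp.choice[q qP] : forall t, exists q, fps_irr q /\ fps_dvd q (s t).
  move=> t; have [|q qi qs] := ex_irr (s0 t); last by exists q.
  by rewrite ev0D ev0M a0 b0 mulr0 addr0.
have qf t : fps_dvd (q t) f.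
  have [qi qs] := qP t; apply: curve_first_integral qi (s0 t) _ qs Df f0.
  by rewrite Ds; apply/dvdMl/dvd_refl.
have qq i j : (i < j)%N -> ~ fps_dvd (q j) (q i).
  move=> ij qji; have [qi qs] := qP j.
  have : fps_dvd (q j) ((j - i)%:R * a).
    have -> : (j - i)%:R * a = s j - s i by rewrite /s natrB 1?ltnW //; ring.
    apply: dvdB => //; exact: dvd_trans qji (qP i).2.
  move=> /(irr_prime qi)[|qa].
    move=> /dvd_unit; rewrite (negPf (irr_nunit qi)) => h1.
    by have := h1; rewrite fps_unitE ev0_nat pnatr_eq0 -lt0n subn_gt0 => /(_ ij).
  apply: (coprime_nirr ab qi); split=> //.
  by apply: (dvd_addl qs); apply: dvdMl.
(* The q i are pairwise inequivalent irreducibles, so f is divisible by products of arbitrarily high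
   order. *)
apply: (@fil_sep R 1 1) => N.
have : fps_dvd (\prod_(i < N) q i) f.
  elim: N => [|N [h E]]; first by rewrite big_ord0; exists f; rewrite mulr1.
  have qi := (qP N).1; have := qf N; rewrite {1}E => /(irr_prime qi)[].
    move=> [h' Eh]; exists h'; rewrite E Eh big_ord_recr /=; ring.
  suff nP n : (n <= N)%N -> ~ fps_dvd (q N) (\prod_(i < n) q i) by move/nP; case.
  elim: n => [|n IH] nN; rewrite ?big_ord0 ?big_ord_recr /=.
    by move=> /dvd1P; apply/negP/irr_nunit.
  by move=> /(irr_prime qi)[|]; [apply/IH/ltnW|apply: qq].
move=> [h ->]; apply: filMl; elim: N => [|N IH]; first exact: fil0.
rewrite big_ord_recr /= mulrC; apply: nunit_fil => //.
by have [[]] := qP N.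
Qed.

(** Write the quotient of f and g in lowest terms as a / b. Both terms have the same cofactor, so if
    neither were a unit they would span a pencil of invariant curves, and f would be 0. *)
Lemma first_integrals_dvd f g : D f = 0 -> D g = 0 -> fps_ev0 f = 0 ->
  fps_dvd f g \/ fps_dvd g f.
Proof.
move=> Df Dg f0; have [d [a [b [Ef Eg ab]]]] := gcd_ex f g.
have [d0|d0] := eqVneq d 0.
  by left; rewrite Eg d0 mul0r; apply: dvd0.
have E : b * D a = a * D b.
  apply: (mulfI d0); apply/eqP; rewrite -subr_eq0; apply/eqP.
  transitivity (b * D (d * a) - a * D (d * b)); first by rewrite !vfdM; ring.
  by rewrite -Ef -Eg Df Dg; ring.
have [k [Da Db]] := cofactor_ex ab E.
have [au|/nunitP a0] := boolP (a \is a GRing.unit).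
  left; rewrite Ef Eg; apply: dvdMm; [exact: dvd_refl|exact: unit_dvd].
have [bu|/nunitP b0] := boolP (b \is a GRing.unit).
  right; rewrite Ef Eg; apply: dvdMm; [exact: dvd_refl|exact: unit_dvd].
have -> := no_dicritical_first_integral ab a0 b0 Da Db Df f0.
by right; apply: dvd0.
Qed.

(** Take f of least order among the nonzero first integrals vanishing at 0. It divides all the
    others and the quotients are first integrals again; repeated division yields the coefficients
    c. *)
Lemma first_integral_generator : (exists2 f, D f = 0 & f <> fpsC (fps_ev0 f)) ->
  exists f, [/\ D f = 0, fps_ev0 f = 0, f != 0 &
    forall g, D g = 0 -> exists c : nat -> R, forall k,
      fil 1 1 k (g - \sum_(i < k) c i *: f ^+ i)].
Proof.
move=> [f1 Df1 f1c].
pose S f := [/\ D f = 0, fps_ev0 f = 0 & f != 0].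
have ex : exists k, `[< exists2 f, S f & ~ fil 1 1 k f >].
  have S1 : S (f1 - fpsC (fps_ev0 f1)).
    split; rewrite ?vfdB ?Df1 ?vfdC ?subrr ?ev0B ?ev0C ?subrr // subr_eq0.
    exact/eqP.
  have [_ _ /nfil_ex[k nk]] := S1.
  by exists k; apply/asboolP; exists (f1 - fpsC (fps_ev0 f1)).
case: (ex_minnP ex) => k /asboolP[f [Df f0 fn0] nk] min; exists f; split=> //.
have fdvd g : D g = 0 -> fps_ev0 g = 0 -> fps_dvd f g.
  move=> Dg g0; have [//|[c Ef]] := first_integrals_dvd Df Dg f0.
  have gn0 : g != 0 by apply: contraNneq fn0 => z; rewrite Ef z mulr0.
  have [cu|/nunitP c0] := boolP (c \is a GRing.unit).
    by exists c^-1; rewrite Ef mulKr.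
  case: k nk min => [|k] nk min; first by case: nk.
  suff /min : `[< exists2 f, S f & ~ fil 1 1 k f >] by rewrite ltnn.
  apply/asboolP; exists g => // gk; apply: nk; rewrite Ef; exact: nunit_fil.
have /boolp.choice[nx nxP] : forall h, exists p : R * fps2 R, D h = 0 ->
    h = fpsC p.1 + f * p.2 /\ D p.2 = 0.
  move=> h; have [Dh|nD] := pselect (D h = 0); last by exists (0, 0).
  have [||h' E] := fdvd (h - fpsC (fps_ev0 h)); rewrite ?vfdB ?Dh ?vfdC ?subrr //.
    by rewrite ev0B ev0C subrr.
  exists (fps_ev0 h, h') => _ /=; split; first by rewrite mulrC -E addrC subrK.
  apply: (mulfI fn0); rewrite mulr0; transitivity (D (h' * f)).
    by rewrite vfdM Df mulr0 addr0 mulrC.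
  by rewrite -E vfdB Dh vfdC subrr.
move=> g Dg; pose H := fix H n := if n is n'.+1 then (nx (H n')).2 else g.
have HP n : D (H n) = 0 by elim: n => // n IH; exact: (nxP _ IH).2.
exists (fun n => (nx (H n)).1) => n.
have -> : g - \sum_(i < n) (nx (H i)).1 *: f ^+ i = f ^+ n * H n.
  elim: n => [|n IH]; first by rewrite big_ord0 subr0 mul1r.
  rewrite big_ord_recr /= opprD addrA IH {1}(nxP _ (HP n)).1 scale_fpsC exprS; ring.
rewrite -[X in fil _ _ X _]muln1; apply/filMr/filX.
by apply/fil_ev0.
Qed.

End FirstIntegrals.

(** * Smooth functions near the origin *)

Section SmoothTools.
Variable R : realType.
Local Notation V := 'rV[R]_2.
Implicit Types (f g h : V -> R) (U : set V) (i : 'I_2) (s : seq 'I_2).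

Definition axis i : V := delta_mx 0 i.

Lemma is_derive_of_line f (x v : V) (d : R) :
  is_derive (0 : R) 1 (fun t => f (x + t *: v)) d -> is_derive x v f d.
Proof.
suff E : (fun k : R => k^-1 *: (((fun t => f (x + t *: v)) \o shift 0) (k *: 1) -
      f (x + 0 *: v))) = (fun k => k^-1 *: ((f \o shift x) (k *: v) - f x)).
  by move=> [df dfE]; split; move: df dfE; rewrite /derivable /derive /= E.
apply/funext => k /=; rewrite scale0r !addr0; congr (_ *: (f _ - _)).
by rewrite [k *: 1]mulr1 addrC.
Qed.

Lemma is_derive_comp1 f (phi : R -> R) (x v : V) (df dphi : R) :
  is_derive x v f df -> is_derive (f x) 1 phi dphi ->
  is_derive x v (phi \o f) (dphi * df).
Proof.
move=> [dfx <-] dph; apply: is_derive_of_line.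
have E : x = x + 0 *: v by rewrite scale0r addr0.
have L : is_derive (0 : R) 1 (fun t => f (x + t *: v)) ('D_v f x).
  by rewrite {2}E; apply: is_derive_line; rewrite -E.
rewrite E in dph.
exact: (@is_derive1_comp _ phi (fun t => f (x + t *: v))).
Qed.

(** As with [smooth_gen], once the first derivatives of the generators lie in the algebra, all the
    derivatives do. This reduces the smoothness of a composite to the chain rule. *)
Inductive alg_gen (G : set (V -> R)) : (V -> R) -> Prop :=
| AgBase f of G f : alg_gen G f
| AgCst c : alg_gen G (cst c)
| AgAdd f g of alg_gen G f & alg_gen G g : alg_gen G (f + g)
| AgMul f g of alg_gen G f & alg_gen G g : alg_gen G (f * g).

Definition deriv_closed U G := forall f, G f ->
  (forall x, U x -> {for x, continuous f} /\ forall i, derivable f x (axis i)) /\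
  forall i, exists2 g, alg_gen G g & forall x, U x -> partial i f x = g x.

Section AlgGen.
Variables (U : set V) (G : set (V -> R)).
Hypotheses (oU : open U) (HG : deriv_closed U G).

Lemma alg_gen_derivable f x i : alg_gen G f -> U x -> derivable f x (axis i).
Proof.
move=> + Ux; elim=> [{}f /HG[/(_ x Ux)[_]] //|c|{}f g _ df _ dg|{}f g _ df _ dg].
- exact: derivable_cst.
- exact: derivableD.
- exact: derivableM.
Qed.

Lemma alg_gen_continuous f x : alg_gen G f -> U x -> {for x, continuous f}.
Proof.
move=> + Ux; elim=> [{}f /HG[/(_ x Ux)[]] //|c|{}f g _ df _ dg|{}f g _ df _ dg].
- exact: cst_continuous.
- exact: continuousD.
- exact: continuousM.
Qed.

Lemma alg_gen_partial f i : alg_gen G f ->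
  exists2 g, alg_gen G g & forall x, U x -> partial i f x = g x.
Proof.
elim=> [{}f /HG[_] //|c|{}f g sf [f' sf' ff'] sg [g' sg' gg']
       |{}f g sf [f' sf' ff'] sg [g' sg' gg']].
- by exists (cst 0); [exact: AgCst|move=> x _; rewrite /partial derive_cst].
- exists (f' + g'); first exact: AgAdd.
  move=> x Ux; rewrite /partial deriveD; try exact: alg_gen_derivable Ux.
  by congr (_ + _); [apply: ff'|apply: gg'].
- exists (f * g' + g * f'); first by apply: AgAdd; apply: AgMul.
  move=> x Ux; rewrite /partial deriveM; try exact: alg_gen_derivable Ux.
  by congr (_ *: _ + _ *: _); [apply: gg'|apply: ff'].
Qed.

Lemma alg_gen_partials f s : alg_gen G f ->
  exists2 g, alg_gen G g & forall x, U x -> partials s f x = g x.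
Proof.
move=> sf; elim: s => [|i s [g sg fg]]; first by exists f.
have [h sh gh] := alg_gen_partial i sg.
by exists h => // x Ux; rewrite -gh//; apply: partial_eq_on Ux.
Qed.

Lemma alg_gen_smooth f : alg_gen G f -> smooth_on U f.
Proof.
move=> sf s x Ux; have [g sg fg] := alg_gen_partials s sf.
have gf y : U y -> g y = partials s f y by move=> /fg.
split=> [i|].
  by apply: (derivable_eq_on oU gf Ux); apply: alg_gen_derivable Ux.
by apply: (continuous_eq_on oU gf Ux); apply: alg_gen_continuous Ux.
Qed.

End AlgGen.

(** A smooth function of one variable given together with all its derivatives. *)
Definition tower (W : set R) (phi : nat -> R -> R) :=
  forall n t, W t -> is_derive t 1 (phi n) (phi n.+1 t).

Lemma tower_continuous W phi n t : tower W phi -> W t -> {for t, continuous (phi n)}.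
Proof.
move=> tp Wt; have [d _] := tp n t Wt.
by apply: differentiable_continuous; apply/derivable1_diffP.
Qed.

Lemma smooth_on_continuous U f x : smooth_on U f -> U x -> {for x, continuous f}.
Proof. by move=> /(_ [::] x) fU /fU[]. Qed.

Lemma smooth_on_derivable U f x i : smooth_on U f -> U x -> derivable f x (axis i).
Proof. by move=> /(_ [::] x) fU /fU[/(_ i)]. Qed.

Lemma tower_comp_partial U W phi f n i x : open U -> smooth_on U f ->
  (forall x, U x -> W (f x)) -> tower W phi -> U x ->
  is_derive x (axis i) (phi n \o f) (phi n.+1 (f x) * partial i f x).
Proof.
move=> oU fU fW tp Ux; apply: is_derive_comp1; last exact/tp/fW.
rewrite /partial -/(axis i); apply: derivableP.
exact: smooth_on_derivable fU Ux.
Qed.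

Lemma smooth_on_comp U W phi f n : open U -> smooth_on U f ->
  (forall x, U x -> W (f x)) -> tower W phi -> smooth_on U (phi n \o f).
Proof.
move=> oU fU fW tp.
pose G : set (V -> R) := [set g | smooth_on U g \/ exists n, g = phi n \o f].
apply: (@alg_gen_smooth U G oU); last by apply: AgBase; right; exists n.
move=> g [gU|[m ->]]; (split=> [x Ux|i]).
- split=> [|i]; [exact: smooth_on_continuous Ux|exact: smooth_on_derivable Ux].
- exists (partial i g) => //; apply: AgBase; left; exact: smooth_on_partial.
- split=> [|i].
    apply: continuous_comp; first exact: smooth_on_continuous Ux.
    by apply: tower_continuous tp _; apply: fW.
  by have [] := tower_comp_partial m i oU fU fW tp Ux.
- exists ((phi m.+1 \o f) * partial i f).
    by apply: AgMul; apply: AgBase; [right; exists m.+1|left; exact: smooth_on_partial].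
  move=> x Ux; rewrite -[RHS]/(phi m.+1 (f x) * partial i f x).
  by have [_ <-] := tower_comp_partial m i oU fU fW tp Ux.
Qed.

(** By the mean value theorem the difference quotient at 0 is a value of [dg] at a point no farther
    from 0. *)
Lemma is_derive_limit (g dg : R -> R) (d : R) : 0 < d ->
  (forall t : R, `|t| < d -> {for t, continuous g}) ->
  (forall t : R, `|t| < d -> t != 0 -> is_derive t 1 g (dg t)) ->
  {for (0 : R), continuous dg} -> is_derive (0 : R) 1 g (dg 0).
Proof.
move=> d0 cg hg cdg.
have cgw (a b : R) : `|a| < d -> `|b| < d -> {within `[a, b], continuous g}.
  move=> ad bd; apply: continuous_in_subspaceT => t.
  rewrite inE /= in_itv /= => /andP[at0 tb]; apply: cg.
  by rewrite ltr_norml; move: ad bd; rewrite !ltr_norml => /andP[? ?] /andP[? ?]; lra.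
have mv t : `|t| < d -> t != 0 -> exists2 c, `|c| <= `|t| & g t - g 0 = dg c * t.
  move=> td; have d00 : `|0 : R| < d by rewrite normr0.
  move: (td); rewrite ltr_norml => /andP[td1 td2].
  rewrite neq_lt => /orP[t0|t0].
    have [||c] := @MVT R g dg t 0 t0.
    - move=> u; rewrite in_itv /= => /andP[tu u0]; apply: hg; last by rewrite lt_eqF.
      by rewrite ltr_norml; lra.
    - exact: cgw.
    rewrite in_itv /= sub0r => /andP[tc c0] E; exists c; last by rewrite -opprB E; ring.
    by rewrite (ltr0_norm t0) (ltr0_norm c0); lra.
  have [||c] := @MVT R g dg 0 t t0.
  - move=> u; rewrite in_itv /= => /andP[tu u0]; apply: hg; last by rewrite gt_eqF.
    by rewrite ltr_norml; lra.
  - exact: cgw.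
  rewrite in_itv /= subr0 => /andP[tc c0] E; exists c; last by [].
  by rewrite (gtr0_norm t0) (gtr0_norm tc); lra.
suff cv : k^-1 *: ((g \o shift 0) (k *: 1) - g 0) @[k --> (0 : R)^'] --> dg 0.
  by split; [exact: cvgP cv|exact: cvg_lim cv].
apply/cvgrPdist_lt => e e0.
have /nbhs_normP[b /= b0 bP] : nbhs (0 : R) [set t | `|dg 0 - dg t| < e].
  exact: (cvgrPdist_lt _ _).1 cdg _ e0.
near=> k.
have k0 : k != 0 by near: k; exact: nbhs_dnbhs_neq.
have kd : `|k| < d by near: k; apply: dnbhs0_lt.
have kb : `|k| < b by near: k; apply: dnbhs0_lt.
have [c ck E] := mv k kd k0.
rewrite /= addr0 [k *: 1]mulr1 E [k^-1 *: _]mulrC mulfK //; apply: bP => /=.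
by rewrite sub0r normrN (le_lt_trans ck).
Unshelve. all: by end_near. Qed.

Lemma coord_le (x : V) i : `|x 0 i| <= `|x|.
Proof. by rewrite [leRHS]/Num.norm /= mx_normrE; apply/bigmax_geP; right; exists (0, i). Qed.

Lemma norm_attained (x : V) : exists i, `|x| = `|x 0 i|.
Proof.
have [->|x0] := eqVneq x 0; first by exists 0; rewrite mxE !normr0.
have [|[i j] E] := @mx_norm_neq0 _ _ _ x; first by rewrite -[mx_norm x]/`|x| normr_eq0.
by exists j; rewrite {1}/Num.norm /= E /= ord1.
Qed.

Lemma norm_axis i : `|axis i| = 1 :> R.
Proof.
apply/eqP; rewrite eq_le; apply/andP; split.
  by have [j ->] := norm_attained (axis i); rewrite mxE eqxx /=; case: eqP; rewrite ?normr1 ?normr0.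
by have := coord_le (axis i) i; rewrite mxE !eqxx normr1.
Qed.

Lemma open_ballP U (x : V) : open U -> U x -> exists2 d : R, 0 < d &
  forall y, `|x - y| < d -> U y.
Proof.
move=> oU Ux; have /nbhs_normP[d /= d0 dU] : nbhs x U by exact: open_nbhs_nbhs.
by exists d => // y; apply: dU.
Qed.

Lemma continuous_ballP (W : normedModType R) (f : W -> R) (x : W) :
  {for x, continuous f} <-> forall eps : R, 0 < eps ->
    exists2 d : R, 0 < d & forall y, `|x - y| < d -> `|f x - f y| < eps.
Proof.
split=> [cf eps e0|H].
  have /nbhs_normP[d /= d0 dP] : nbhs x [set y | `|f x - f y| < eps].
    exact: (cvgrPdist_lt _ _).1 cf _ e0.
  by exists d => // y; apply: dP.
apply/(@cvgrPdist_lt _ _ _ (nbhs x) (nbhs_filter x) f) => eps /H[d d0 dP].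
suff : nbhs x [set y | `|f x - f y| < eps] by [].
have [_ H'] := nbhs_normP x (fun y => `|f x - f y| < eps).
by apply: H'; exists d.
Qed.

(* A coherent family of continuous functions that are successive partial derivatives of
   each other off the origin is so at the origin too, by the mean value theorem. *)
Lemma smooth_family U (F : seq 'I_2 -> V -> R) : open U ->
  (forall s x, U x -> {for x, continuous (F s)}) ->
  (forall s i x, U x -> x != 0 -> is_derive x (axis i) (F s) (F (i :: s) x)) ->
  smooth_on U (F [::]) /\ forall s x, U x -> partials s (F [::]) x = F s x.
Proof.
move=> oU cF dF.
have dF0 s i : U 0 -> is_derive (0 : V) (axis i) (F s) (F (i :: s) 0).
  move=> U0; apply: is_derive_of_line.
  set g := fun t : R => F s (0 + t *: axis i).
  have gE t : g t = F s (t *: axis i) by rewrite /g add0r.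
  have [d d0 dU] := open_ballP oU U0.
  have Ut (t : R) : `|t| < d -> U (t *: axis i).
    by move=> td; apply: dU; rewrite sub0r normrN normrZ norm_axis mulr1.
  have lin (t : R) : {for t, continuous (fun t : R => 0 + t *: axis i)}.
    by apply: continuousD; [exact: cst_continuous|exact: scalel_continuous].
  have cg (t : R) : `|t| < d -> {for t, continuous g}.
    move=> td; apply: (@continuous_comp _ _ _ (fun t : R => 0 + t *: axis i)).
      exact: lin.
    by apply: cF; rewrite add0r; exact: Ut.
  have dg (t : R) : `|t| < d -> t != 0 -> is_derive t 1 g (F (i :: s) (t *: axis i)).
    move=> td t0; rewrite -[X in F _ X]add0r.
    have [dd <-] : is_derive (0 + t *: axis i) (axis i) (F s) (F (i :: s) (0 + t *: axis i)).
      rewrite add0r; apply: dF; first exact: Ut.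
      by rewrite scaler_eq0 negb_or t0 -normr_eq0 norm_axis oner_neq0.
    exact: is_derive_line.
  rewrite -(scale0r (axis i)).
  apply: (@is_derive_limit g (fun t => F (i :: s) (t *: axis i)) d) => //.
  apply: (@continuous_comp _ _ _ (fun t : R => t *: axis i)); first exact: scalel_continuous.
  by apply: cF; rewrite scale0r.
have {}dF s i x : U x -> is_derive x (axis i) (F s) (F (i :: s) x).
  move=> Ux; have [x0|x0] := eqVneq x 0; last exact: dF.
  by rewrite x0 in Ux *; apply: dF0.
have pF s x : U x -> partials s (F [::]) x = F s x.
  elim: s x => //= i s IH x Ux; rewrite (@partial_eq_on _ U _ (F s)) //.
  by have [_] := dF s i x Ux.
split=> // s x Ux; split=> [i|].
  apply: (@derivable_eq_on _ U (F s)) => //; first by move=> y /pF.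
  by have [] := dF s i x Ux.
by apply: (@continuous_eq_on _ U (F s)) => //; [move=> y /pF|apply: cF].
Qed.

End SmoothTools.

(** * Flat functions and their quotients *)

Section FlatFunctions.
Variable R : realType.
Local Notation V := 'rV[R]_2.
Local Notation e := (@axis R).
Implicit Types (f g h r : V -> R) (U : set V) (i : 'I_2) (s : seq 'I_2) (x y v : V).

Lemma MVT_line_signed f y v (k : R) :
  (forall t, `|t| <= `|k| -> derivable f (y + t *: v) v) ->
  exists2 t, `|t| <= `|k| & f (y + k *: v) - f y = 'D_v f (y + t *: v) * k.
Proof.
move=> df; have [k0|k0|k0] := ltgtP k 0; last first.
- by exists 0; rewrite ?normr0 ?normr_ge0 // k0 scale0r addr0 subrr mulr0.
- have [t /andP[t0 tk]|t /andP[t0 tk] E] := @MVT_line R f y v k k0.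
    by apply: df; rewrite !ger0_norm // ltW.
  by exists t; rewrite // !ger0_norm // ltW.
have nk0 : 0 < - k by rewrite oppr_gt0.
have [t /andP[t0 tk]|t /andP[t0 tk] E] := @MVT_line R f (y + k *: v) v (- k) nk0.
  rewrite -addrA -scalerDl; apply: df; rewrite (ltr0_norm k0) ler0_norm; lra.
exists (k + t); first by rewrite (ltr0_norm k0) ler0_norm; lra.
by move: E; rewrite scaleNr addrK -addrA -scalerDl => E; rewrite -opprB E mulrN opprK.
Qed.

Lemma rV2_dec x : x = x 0 ord0 *: e ord0 + x 0 ord_max *: e ord_max.
Proof.
apply/rowP => j; rewrite !mxE /=.
by case: (ord2_cases j) => ->; rewrite /= ?mulr1 ?mulr0 ?addr0 ?add0r.
Qed.

Definition flat0 f := forall s, partials s f 0 = 0.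

Lemma flat0_at f : flat0 f -> f 0 = 0. Proof. by move=> /(_ [::]). Qed.

Lemma flat0_partial f i : flat0 f -> flat0 (partial i f).
Proof. by move=> ff s; have := ff (rcons s i); rewrite /partials foldr_rcons. Qed.

Lemma partialsD U f g s x : open U -> smooth_on U f -> smooth_on U g -> U x ->
  partials s (f + g) x = partials s f x + partials s g x.
Proof.
move=> oU fU gU; elim: s x => // i s IH x Ux /=.
rewrite (@partial_eq_on _ U _ (partials s f + partials s g)) //.
by rewrite /partial deriveD //; [have [] := fU s x Ux|have [] := gU s x Ux].
Qed.

Lemma partialM U f g i x : smooth_on U f -> smooth_on U g -> U x ->
  partial i (f * g) x = f x * partial i g x + g x * partial i f x.
Proof.
move=> fU gU Ux; rewrite /partial deriveM //; exact: smooth_on_derivable Ux.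
Qed.

Lemma flat0D U f g : open U -> U 0 -> smooth_on U f -> smooth_on U g ->
  flat0 f -> flat0 g -> flat0 (f + g).
Proof. by move=> oU U0 fU gU ff fg s; rewrite (partialsD s oU) // ff fg addr0. Qed.

Lemma flat0M U f g : open U -> U 0 -> smooth_on U f -> smooth_on U g ->
  flat0 f -> flat0 (f * g).
Proof.
move=> oU U0 fU gU ff s; elim/last_ind: s f g fU gU ff => [|s i IH] f g fU gU ff.
  by rewrite -[LHS]/(f 0 * g 0) (flat0_at ff) mul0r.
rewrite /partials foldr_rcons -[LHS]/(partials s (partial i (f * g)) 0).
have dfU : smooth_on U (partial i f) by exact: smooth_on_partial.
have dgU : smooth_on U (partial i g) by exact: smooth_on_partial.
rewrite (@partials_eq_on _ U _ (f * partial i g + partial i f * g)) //; last first.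
  by move=> x Ux; rewrite (partialM i fU gU Ux) [X in _ + X]mulrC.
rewrite (partialsD s oU) // ?IH ?addr0 //; try exact: smooth_onM.
exact: flat0_partial.
Qed.

(** Going from 0 to x along two segments parallel to the axes, on which the sup norm does not exceed
    that of x, bounds f by |x| times its first derivatives, which are flat as well. *)
Lemma flat_bound K U f : open U -> U 0 -> smooth_on U f -> flat0 f ->
  exists d C : R, [/\ 0 < d, 0 <= C &
    forall x, `|x| < d -> U x /\ `|f x| <= C * `|x| ^+ K].
Proof.
move=> oU U0; elim: K f => [|K IH] f fU ff.
  have [d d0 dU] := open_ballP oU U0.
  have /nbhs_normP[d' /= d'0 dP] : nbhs (0 : V) [set x | `|f 0 - f x| < 1].
    exact: (cvgrPdist_lt _ _).1 (smooth_on_continuous fU U0) _ ltr01.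
  exists (Num.min d d'), 1; split=> //; first by rewrite lt_min d0.
  move=> x; rewrite lt_min => /andP[xd xd']; split.
    by apply: dU; rewrite sub0r normrN.
  have := dP x; rewrite /= sub0r normrN => /(_ xd').
  by rewrite (flat0_at ff) sub0r normrN expr0 mulr1 => /ltW.
have B i := IH _ (@smooth_on_partial _ _ _ i fU) (flat0_partial i ff).
have [d0 [C0 [d00 C00 B0]]] := B ord0.
have [d1 [C1 [d10 C10 B1]]] := B ord_max.
exists (Num.min d0 d1), (C0 + C1); split; [by rewrite lt_min d00|exact: addr_ge0|].
move=> x; rewrite lt_min => /andP[xd0 xd1]; split; first exact: (B0 x xd0).1.
have n0 (t : R) : `|t| <= `|x 0 ord0| -> `|0 + t *: e ord0| <= `|x|.
  move=> tx; rewrite add0r normrZ norm_axis mulr1 (le_trans tx) //; exact: coord_le.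
have n1 (t : R) : `|t| <= `|x 0 ord_max| -> `|x 0 ord0 *: e ord0 + t *: e ord_max| <= `|x|.
  move=> tx; have [j ->] := norm_attained (x 0 ord0 *: e ord0 + t *: e ord_max).
  rewrite !mxE; case: (ord2_cases j) => ->; rewrite /= ?mulr1 ?mulr0 ?addr0 ?add0r.
    exact: coord_le.
  exact: (le_trans tx (coord_le _ _)).
have [t tx E0] : exists2 t, `|t| <= `|x 0 ord0| &
    f (0 + x 0 ord0 *: e ord0) - f 0 = 'D_(e ord0) f (0 + t *: e ord0) * x 0 ord0.
  apply: MVT_line_signed => t tx; apply: (@smooth_on_derivable R U) => //.
  by apply: (B0 _ _).1; apply: le_lt_trans xd0; exact: n0.
have [u ux E1] : exists2 t, `|t| <= `|x 0 ord_max| &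
    f (x 0 ord0 *: e ord0 + x 0 ord_max *: e ord_max) - f (x 0 ord0 *: e ord0) =
    'D_(e ord_max) f (x 0 ord0 *: e ord0 + t *: e ord_max) * x 0 ord_max.
  apply: MVT_line_signed => u ux; apply: (@smooth_on_derivable R U) => //.
  by apply: (B0 _ _).1; apply: le_lt_trans xd0; exact: n1.
have bnd i C y : 0 <= C -> `|y| <= `|x| -> `|partial i f y| <= C * `|y| ^+ K ->
    `|partial i f y * x 0 i| <= C * `|x| ^+ K.+1.
  move=> C_0 yx Cy; rewrite normrM exprSr mulrA; apply: ler_pM => //; last exact: coord_le.
  by apply: (le_trans Cy); rewrite ler_wpM2l // lerXn2r // nnegrE.
have -> : f x = (f x - f (x 0 ord0 *: e ord0)) + (f (0 + x 0 ord0 *: e ord0) - f 0).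
  by rewrite add0r (flat0_at ff) subr0 subrK.
rewrite {1}[x]rV2_dec E0 E1 (le_trans (ler_normD _ _)) // mulrDl addrC.
apply: lerD; apply: bnd => //; try exact: n0; try exact: n1.
- by apply: (B0 _ _).2; apply: le_lt_trans xd0; exact: n0.
- by apply: (B1 _ _).2; apply: le_lt_trans xd1; exact: n1.
Qed.

(** The n-th derivative of 1 / t. *)
Definition inv_tower n (t : R) := (-1) ^+ n * n`!%:R * t^-1 ^+ n.+1.

Lemma tower_inv : tower [set t : R | t != 0] inv_tower.
Proof.
move=> n t /= t0; have dV := @is_deriveV R id t 1 1 t0 (is_derive_id _ _).
have dX := is_deriveX n.+1 dV; have dZ := is_deriveZ ((-1) ^+ n * n`!%:R) dX.
have -> : inv_tower n = ((-1) ^+ n * n`!%:R) \*: ((fun t : R => t^-1) ^+ n.+1).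
  by apply/funext => u; rewrite /inv_tower /= fctE /=.
apply: (is_derive_eq dZ); rewrite /inv_tower factS natrM /= -exprVn !exprS expr0.
rewrite /GRing.scale /=; ring.
Qed.

Lemma is_derive_inv f x v (df : R) : f x != 0 -> is_derive x v f df ->
  is_derive x v (fun y => (f y)^-1) (- (f x) ^- 2 * df).
Proof.
move=> fx0 dfx; have := @is_deriveV R id (f x) 1 1 fx0 (is_derive_id _ _).
rewrite /GRing.scale /= mulr1; exact: is_derive_comp1.
Qed.

Lemma smooth_on_inv U f : open U -> smooth_on U f -> (forall x, U x -> f x != 0) ->
  smooth_on U (fun x => (f x)^-1).
Proof.
move=> oU fU f0; have := @smooth_on_comp R U _ inv_tower f 0 oU fU f0 tower_inv.
apply: smooth_on_eq => // x _ /=.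
by rewrite /inv_tower expr0 mul1r expr1 fact0 mul1r.
Qed.

Lemma open_neq0 U : open U -> open (U `&` [set x | x != 0]).
Proof.
move=> oU; apply: openI => //.
have -> : [set x : V | x != 0] = ~` [set 0].
  by apply/seteqP; split=> x /= => [/eqP|/eqP].
by apply: closed_openC; apply: accessible_closed_set1; apply: hausdorff_accessible.
Qed.

Lemma flat_div_partials U f r q : open U -> U 0 -> smooth_on U f -> flat0 f -> smooth_on U r ->
  (forall x, U x -> x != 0 -> r x != 0) ->
  (forall x, U x -> x != 0 -> q x = f x * (r x)^-1) ->
  forall s, exists h m, [/\ smooth_on U h, flat0 h &
    forall x, U x -> x != 0 -> partials s q x = h x * (r x)^-1 ^+ m].
Proof.
move=> oU U0 fU ff rU r0 qE; elim=> [|i s [h [m [hU hf IH]]]].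
  by exists f, 1%N; split=> // x Ux x0; rewrite expr1 qE.
exists (partial i h * r + (cst (- m%:R)) * (h * partial i r)), m.+1; split.
- apply: smooth_onD => //; apply: smooth_onM => //.
  + exact: smooth_on_partial.
  + exact: smooth_on_cst.
  + by apply: smooth_onM => //; exact: smooth_on_partial.
- apply: (flat0D oU U0); last first.
  + rewrite mulrC; apply: (flat0M oU U0) => //; last first.
      by apply: (flat0M oU U0) => //; apply: smooth_on_partial.
    exact: smooth_on_cst.
    by apply: smooth_onM => //; apply: smooth_on_partial.
  + apply: (flat0M oU U0) => //; [exact: smooth_on_partial|exact: flat0_partial].
  + apply: smooth_onM => //; [exact: smooth_on_cst|apply: smooth_onM => //].
    exact: smooth_on_partial.
  + by apply: smooth_onM => //; apply: smooth_on_partial.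
move=> x Ux x0 /=.
rewrite (@partial_eq_on _ (U `&` [set x | x != 0]) _ (h * ((fun x => (r x)^-1) ^+ m))) //.
- have dh : is_derive x (e i) h (partial i h x).
    by apply: derivableP; apply: smooth_on_derivable hU Ux.
  have dr : is_derive x (e i) r (partial i r x).
    by apply: derivableP; apply: smooth_on_derivable rU Ux.
  have dM := is_deriveM dh (is_deriveX m (is_derive_inv (r0 x Ux x0) dr)).
  rewrite /partial -/(e i) (@derive_val _ _ _ _ _ _ _ dM) /=.
  have rw : r x * (r x)^-1 = 1 by rewrite mulfV // r0.
  rewrite -[RHS]/((partial i h x * r x + - m%:R * (h x * partial i r x)) * (r x)^-1 ^+ m.+1).
  rewrite /GRing.scale /= -exprVn !fctE; move: (r x)^-1 rw => w rw.
  rewrite [in RHS]mulrDl [w ^+ m.+1 in X in _ = X + _]exprS -mulrA [r x * _]mulrA rw mul1r.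
  by case: m {IH dM} => [|m] /=; rewrite ?exprS; ring.
- exact: open_neq0.
- by move=> y [Uy y0]; rewrite IH // !fctE.
Qed.

(** A flat numerator beats every power of r, as r is at least |x|^N. So all derivatives of f / r
    tend to 0 at the origin, and extending them by 0 gives a coherent family. *)
Lemma flat_div N U f r : open U -> U 0 -> smooth_on U f -> flat0 f -> smooth_on U r ->
  (forall x, U x -> `|x| ^+ N <= r x) ->
  exists g, [/\ smooth_on U g, flat0 g & forall x, U x -> f x = r x * g x].
Proof.
move=> oU U0 fU ff rU rN.
have r0 x : U x -> x != 0 -> 0 < r x.
  by move=> Ux x0; apply: lt_le_trans (rN x Ux); rewrite exprn_gt0 // normr_gt0.
have r0' x : U x -> x != 0 -> r x != 0 by move=> Ux x0; rewrite gt_eqF // r0.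
pose q x := f x * (r x)^-1.
have qs := flat_div_partials (q := q) oU U0 fU ff rU r0' (fun _ _ _ => erefl).
pose F s x := if x == 0 then 0 else partials s q x.
pose U' := U `&` [set x : V | x != 0].
have oU' : open U' by exact: open_neq0.
have U'U : U' `<=` U by move=> x [].
have qU' : smooth_on U' q.
  apply: (@smooth_onM R U' f (fun x => (r x)^-1)) => //; first exact: smooth_onS fU.
  by apply: smooth_on_inv => //; [apply: smooth_onS rU|move=> x [? ?]; apply: r0'].
have FU' s x : U' x -> partials s q x = F s x.
  by move=> [_ x0]; rewrite /F (negPf x0).
have [] := @smooth_family R U F oU.
- move=> s x Ux; have [->|x0] := eqVneq x 0; last first.
    apply: (@continuous_eq_on _ U' (partials s q)) => //; first exact: FU'.
    by have [] := qU' s x (conj Ux x0).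
  have [h [m [hU hf hE]]] := qs s.
  (* The denominator r^m costs N m powers of |x|; one more is kept to tend to 0. *)
  have [d [C [d0 C0 dC]]] := flat_bound (N * m).+1 oU U0 hU hf.
  have FC x' : `|x'| < d -> `|F s x'| <= C * `|x'|.
    move=> xd; rewrite /F; case: eqVneq => [->|x'0]; first by rewrite !normr0 mulr0.
    have [Ux' hx] := dC _ xd; rewrite hE // normrM normrX normfV.
    have p0 : 0 < `|r x'| ^+ m by rewrite exprn_gt0 // normr_gt0 r0'.
    rewrite exprVn ler_pdivrMr // (le_trans hx) // exprS mulrA ler_wpM2l ?mulr_ge0 //.
    by rewrite exprM lerXn2r ?nnegrE ?exprn_ge0 // (le_trans (rN _ Ux')) // ler_norm.
  apply/continuous_ballP => eps eps0; exists (Num.min d (eps / (C + 1))).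
    by rewrite lt_min d0 divr_gt0 //; lra.
  move=> y; rewrite {1}/F eqxx !sub0r !normrN lt_min => /andP[yd ye].
  apply: le_lt_trans (FC y yd) _; apply: le_lt_trans (_ : (C + 1) * `|y| < _).
    by rewrite ler_wpM2r // lerDl.
  by rewrite mulrC -ltr_pdivlMr //; lra.
- move=> s i x Ux x0; have [dq _] := qU' s x (conj Ux x0).
  split; first exact: (derivable_eq_on oU' (FU' s) (conj Ux x0) (dq i)).
  rewrite -(FU' (i :: s) x (conj Ux x0)); apply/esym.
  exact: (partial_eq_on i oU' (FU' s) (conj Ux x0)).
move=> gU gs; exists (F [::]); split=> //.
  by move=> s; rewrite gs // /F eqxx.
move=> x Ux; rewrite /F; case: eqVneq => [->|x0]; first by rewrite mulr0 flat0_at.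
by rewrite /= /q mulrCA mulfV ?mulr1 // r0'.
Qed.

End FlatFunctions.

(** * Borel's lemma *)

Section Bump.
Variable R : realType.
Local Notation V := 'rV[R]_2.
Local Notation e := (@axis R).
Implicit Types (f g : V -> R) (U : set V) (i : 'I_2) (s : seq 'I_2) (x : V) (p : {poly R}).

Lemma horner_bound p : exists2 C : R, 0 <= C & forall z, 1 <= z -> `|p.[z]| <= C * z ^+ size p.
Proof.
exists (\sum_(i < size p) `|p`_i|); first exact: sumr_ge0.
move=> z z1; have z0 : 0 <= z := le_trans ler01 z1.
rewrite horner_coef (le_trans (ler_norm_sum _ _ _)) // mulr_suml; apply: ler_sum => i _.
rewrite normrM normrX (ger0_norm z0) ler_wpM2l // ler_weXn2l //; exact: ltnW.
Qed.

(** With z = 1 / t, the derivative of p(z) exp(-z) with respect to t is z^2 (p - p')(z) exp(-z). *)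
Fixpoint flatexp_poly n : {poly R} :=
  if n is n'.+1 then 'X^2 * (flatexp_poly n' - (flatexp_poly n')^`()) else 1.

Definition flatexp n (t : R) := if 0 < t then (flatexp_poly n).[t^-1] * expR (- t^-1) else 0.

(** The term of degree k + 2 in the series of exp(1 / t) absorbs the polynomial, bounded by a
    multiple of t^(-k), and leaves t^2. *)
Lemma flatexp_bound n : exists2 C : R, 0 <= C & forall t, `|t| <= 1 -> `|flatexp n t| <= C * t ^+ 2.
Proof.
have [C C0 CP] := horner_bound (flatexp_poly n).
set k := size _ in CP; exists (C * k.+2`!%:R); first by rewrite mulr_ge0.
move=> t; rewrite ler_norml => /andP[_ t1]; rewrite /flatexp; case: ltP => t0; last first.
  by rewrite normr0; apply: mulr_ge0; rewrite ?sqr_ge0 // mulr_ge0.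
have z1 : 1 <= t^-1 by rewrite invf_ge1.
have z0 : 0 < t^-1 by rewrite invr_gt0.
rewrite normrM expRN normfV (ger0_norm (expR_ge0 _)) ler_pdivrMr ?expR_gt0 //.
apply: (le_trans (CP _ z1)); rewrite -!mulrA ler_wpM2l //.
have := expR_ge1Dxn k.+1 (ltW z0) => E.
have {}E : t^-1 ^+ k.+2 / k.+2`!%:R <= expR t^-1 by apply: le_trans E; rewrite lerDr.
rewrite ler_pdivrMr ?ltr0n ?fact_gt0 // in E.
rewrite (_ : t^-1 ^+ k = t ^+ 2 * t^-1 ^+ k.+2); last first.
  by rewrite !exprS expr0; field; rewrite gt_eqF.
apply: (le_trans (ler_wpM2l (sqr_ge0 t) E)).
by rewrite le_eqVlt; apply/orP; left; apply/eqP; ring.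
Qed.

Lemma flatexp_tower : tower [set: R] flatexp.
Proof.
have E0 n : flatexp n 0 = 0 by rewrite /flatexp ltxx.
have c0 n : {for (0 : R), continuous (flatexp n)}.
  apply/continuous_ballP => eps eps0; have [C C0 CP] := flatexp_bound n.
  exists (Num.min 1 (eps / (C + 1))); first by rewrite lt_min ltr01 divr_gt0 //; lra.
  move=> t; rewrite E0 !sub0r !normrN lt_min => /andP[t1 te].
  apply: le_lt_trans (CP t (ltW t1)) _; apply: le_lt_trans (_ : (C + 1) * `|t| < _).
    rewrite -real_normK ?num_real // expr2 mulrA ler_wpM2r //.
    rewrite -[X in _ <= X]mulr1; apply: ler_pM => //; lra.
  by rewrite mulrC -ltr_pdivlMr //; lra.
have d0 n (t : R) : t != 0 -> is_derive t 1 (flatexp n) (flatexp n.+1 t).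
  rewrite neq_lt => /orP[t0|t0].
    have E : flatexp n.+1 t = 0 by rewrite /flatexp ltNge ltW.
    have nE : \near t, cst 0 t = flatexp n t.
      near=> u; rewrite /flatexp ltNge (_ : u <= 0) //; apply: ltW.
      by near: u; exact: lt_nbhsl.
    rewrite E; split; first by apply: near_eq_derivable nE _; exact: derivable_cst.
    by rewrite -(near_eq_derive _ nE) derive_cst.
  have tn0 : t != 0 by rewrite gt_eqF.
  have dV := @is_deriveV R id t 1 1 tn0 (is_derive_id _ _).
  have dp := is_derive1_comp (is_derive_poly (flatexp_poly n) t^-1) dV.
  have dx := @is_derive1_comp R expR (- (fun y : R => y^-1)) t _ _
    (is_derive_expR (- t^-1)) (is_deriveN dV).
  have [d1 d2] := is_deriveM dp dx.
  have nE : \near t, ((horner (flatexp_poly n) \o (fun y : R => y^-1)) *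
      (expR \o - (fun y : R => y^-1))) t = flatexp n t.
    near=> u; have u0 : 0 < u by near: u; exact: lt_nbhsr.
    by rewrite /flatexp u0.
  split; first exact: near_eq_derivable nE d1.
  rewrite -(near_eq_derive _ nE) d2 /flatexp t0 /= !hornerE.
  rewrite /GRing.scale /= !fctE; field; exact: tn0.
move=> n t _; have [->|t0] := eqVneq t 0; last exact: d0.
apply: (@is_derive_limit R (flatexp n) (flatexp n.+1) 1) => // [u _].
have [->|u0] := eqVneq u 0; first exact: c0.
have [d _] := d0 n u u0.
by apply: differentiable_continuous; apply/derivable1_diffP.
Unshelve. all: by end_near. Qed.

Lemma flatexp0_gt0 t : (0 < flatexp 0 t) = (0 < t).
Proof. by rewrite /flatexp; case: ifP => t0; rewrite ?ltxx //= hornerC mul1r expR_gt0. Qed.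

Lemma flatexp0_ge0 t : 0 <= flatexp 0 t.
Proof. by rewrite /flatexp; case: ifP => t0 //=; rewrite hornerC mul1r expR_ge0. Qed.

Lemma flatexp0_eq0 t : t <= 0 -> flatexp 0 t = 0.
Proof. by rewrite /flatexp ltNge => ->. Qed.

Lemma is_derive_coord i j x : is_derive x (e j) (fun x : V => x 0 i) ((i == j)%:R).
Proof.
apply: is_derive_of_line; have -> : (fun t : R => (x + t *: e j) 0 i) =
    cst (x 0 i) + (i == j)%:R \*: id.
  by apply/funext => t; rewrite !mxE /= mulrC fctE /=.
apply: is_derive_eq (is_deriveD (is_derive_cst _ _ _) (is_deriveZ _ (is_derive_id _ _))) _.
by rewrite add0r /GRing.scale /= mulr1.
Qed.

Lemma smooth_coord U i : open U -> smooth_on U (fun x => x 0 i).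
Proof.
move=> oU; pose G : set (V -> R) := [set (fun x : V => x 0 i)].
apply: (@alg_gen_smooth R U G oU); last exact: AgBase.
have dc x j := is_derive_coord i j x.
move=> f ->; split=> [x _|j]; first split=> [|j]; first exact: coord_continuous.
  by have [] := dc x j.
exists (cst (i == j)%:R); first exact: AgCst.
by move=> x _; have [_] := dc x j.
Qed.

Definition sqnorm : V -> R := (fun x => x 0 ord0) ^+ 2 + (fun x => x 0 ord_max) ^+ 2.

Lemma sqnormE x : sqnorm x = x 0 ord0 ^+ 2 + x 0 ord_max ^+ 2.
Proof. by []. Qed.

Lemma smooth_sqnorm : smooth_on setT sqnorm.
Proof.
rewrite /sqnorm !expr2; apply: smooth_onD; try exact: openT;
  by apply: smooth_onM; try exact: openT; apply: smooth_coord; exact: openT.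
Qed.

(** The quotient a / (a + b), where a > 0 exactly for a squared norm below 1 and b > 0 exactly for
    one above 1/4, so that a + b has no zero. *)
Lemma bump_exists : exists chi : V -> R, [/\ smooth_on setT chi,
  (forall x, sqnorm x <= 1 / 4 -> chi x = 1) & (forall x, 1 <= sqnorm x -> chi x = 0)].
Proof.
pose a x := flatexp 0 (1 - sqnorm x); pose b x := flatexp 0 (sqnorm x - 1 / 4).
have oT := @openT V.
have sa : smooth_on setT a.
  apply: (@smooth_on_comp R setT setT flatexp (fun x => 1 - sqnorm x) 0) => //; last exact: flatexp_tower.
  have -> : (fun x => 1 - sqnorm x) = cst 1 + cst (-1) * sqnorm.
    by apply/funext => x; rewrite !fctE mulN1r.
  apply: smooth_onD => //; first exact: smooth_on_cst.
  by apply: smooth_onM => //; [exact: smooth_on_cst|exact: smooth_sqnorm].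
have sb : smooth_on setT b.
  apply: (@smooth_on_comp R setT setT flatexp (fun x => sqnorm x - 1 / 4) 0) => //; last exact: flatexp_tower.
  have -> : (fun x => sqnorm x - 1 / 4) = sqnorm + cst (- (1 / 4)) by [].
  by apply: smooth_onD => //; [exact: smooth_sqnorm|exact: smooth_on_cst].
have ab0 x : 0 < a x + b x.
  have [h|h] := ltP (sqnorm x) 1.
    by rewrite ltr_pwDl ?flatexp0_ge0 // flatexp0_gt0; lra.
  by rewrite ltr_wpDl ?flatexp0_ge0 // flatexp0_gt0; lra.
exists (a * (fun x => (a x + b x)^-1)); split.
- apply: smooth_onM => //; apply: (@smooth_on_inv R setT (a + b)) => //.
    exact: smooth_onD.
  by move=> x _; rewrite gt_eqF // ab0.
- move=> x hx; rewrite fctE; have -> : b x = 0 by apply: flatexp0_eq0; lra.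
  by rewrite addr0 mulfV // gt_eqF // flatexp0_gt0; lra.
- by move=> x hx; rewrite fctE; have -> : a x = 0; [apply: flatexp0_eq0; lra|rewrite mul0r].
Qed.

End Bump.

Section Borel.
Variable R : realType.
Local Notation V := 'rV[R]_2.
Local Notation e := (@axis R).
Implicit Types (f g F : V -> R) (U : set V) (i : 'I_2) (s : seq 'I_2) (x y : V).

Lemma smooth_setT_derivable F s i x : smooth_on setT F -> derivable (partials s F) x (e i).
Proof. by move=> /(_ s x I)[/(_ i)]. Qed.

Lemma smooth_setT_continuous F s x : smooth_on setT F -> {for x, continuous (partials s F)}.
Proof. by move=> /(_ s x I)[]. Qed.

Lemma is_derive_scale F (a b : R) x (v : V) : derivable F (a *: x) v ->
  is_derive x v (fun y => b * F (a *: y)) (b * (a * 'D_v F (a *: x))).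
Proof.
move=> dF; apply: is_derive_of_line.
have -> : (fun t : R => b * F (a *: (x + t *: v))) =
    b \*: ((fun t => F (a *: x + t *: v)) \o (a \*: id)).
  by apply/funext => t; rewrite /= scalerDr scalerA.
have dl : is_derive ((a \*: id) (0 : R)) 1 (fun t => F (a *: x + t *: v)) ('D_v F (a *: x)).
  have := @is_derive_line R F (a *: x) v 0; rewrite /= scaler0 scale0r addr0; exact.
have da : is_derive (0 : R) 1 (a \*: id : R -> R) a.
  by apply: is_derive_eq (is_deriveZ a (is_derive_id _ _)) _; rewrite /GRing.scale /= mulr1.
rewrite [a * _]mulrC.
exact: (is_deriveZ b (@is_derive1_comp _ _ (a \*: id) 0 _ _ dl da)).
Qed.

Lemma partials_scale F (a b : R) s : smooth_on setT F ->
  partials s (fun x => b * F (a *: x)) =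
  (fun x => b * a ^+ size s * partials s F (a *: x)).
Proof.
move=> sF; elim: s => [|i s IH]; first by rewrite expr0 mulr1.
apply/funext => x; rewrite /= IH.
have [_] := is_derive_scale (b * a ^+ size s) (@smooth_setT_derivable F s i (a *: x) sF).
by rewrite /partial => ->; rewrite exprS; ring.
Qed.

Lemma smooth_scale F (a b : R) : smooth_on setT F -> smooth_on setT (fun x => b * F (a *: x)).
Proof.
move=> sF s x _; rewrite partials_scale //; split=> [i|].
  by have [] := is_derive_scale (b * a ^+ size s) (@smooth_setT_derivable F s i (a *: x) sF).
apply: continuousM; first exact: cst_continuous.
apply: (@continuous_comp _ _ _ (fun x : V => a *: x)); first exact: scaler_continuous.
exact: smooth_setT_continuous.
Qed.

Definition supported F := smooth_on setT F /\ forall x, 1 < `|x| -> F x = 0.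

Lemma open_out : open [set x : V | 1 < `|x|].
Proof.
apply: (@open_comp _ _ (fun x : V => `|x|) [set t | 1 < t]); last exact: open_gt.
by move=> x _; exact: norm_continuous.
Qed.

Lemma supported_partials F s : supported F -> supported (partials s F).
Proof.
move=> [sF F0]; elim: s => [//|i s [sG G0]]; split; first exact: smooth_on_partial.
move=> x x1; rewrite /= (@partial_eq_on _ [set x | 1 < `|x|] _ (cst 0)) //; last exact: open_out.
by rewrite /partial derive_cst.
Qed.

Lemma supported_bounded F : supported F -> exists2 M : R, 0 <= M & forall x, `|F x| <= M.
Proof.
move=> [sF F0].
have cB : compact [set x : V | `|x| <= 1].
  apply: bounded_closed_compact.
    exists 1; split; first exact: num_real.
    by move=> M M1 x /= x1; rewrite (le_trans x1) // ltW.
  apply: (@closed_comp _ _ (fun x : V => `|x|) [set t | t <= 1]); last exact: closed_le.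
  by move=> x _; exact: norm_continuous.
have cF : {within [set x : V | `|x| <= 1], continuous F}.
  apply: continuous_subspaceT => x; exact: (@smooth_setT_continuous F [::]).
have [M [_ MP]] := compact_bounded (continuous_compact cF cB).
exists (`|M| + 1) => [|x]; first by rewrite addr_ge0.
have [x1|x1] := leP `|x| 1; last by rewrite F0 // normr0 addr_ge0.
apply: (MP (`|M| + 1)); last by exists x.
by rewrite (le_lt_trans (ler_norm M)) // ltrDl.
Qed.

Lemma supported_bounded_partials F n : supported F -> exists2 M : R, 0 <= M &
  forall s x, (size s <= n)%N -> `|partials s F x| <= M.
Proof.
elim: n F => [|n IH] F sF.
  have [M M0 MP] := supported_bounded sF; exists M => // s x.
  by rewrite leqn0 => /nilP ->; exact: MP.
have [M M0 MP] := IH F sF.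
have [M1 M10 M1P] := IH _ (supported_partials [:: ord0] sF).
have [M2 M20 M2P] := IH _ (supported_partials [:: ord_max] sF).
exists (M + M1 + M2); first by rewrite !addr_ge0.
move=> s x; case/lastP: s => [|s i] sn.
  by rewrite (le_trans (MP [::] x _)) // -addrA lerDl addr_ge0.
rewrite size_rcons ltnS in sn.
rewrite /partials foldr_rcons -[foldr _ _ _]/(partials s (partial i F)).
case: (ord2_cases i) => ->.
  by rewrite (le_trans (M1P s x sn)) // -addrA addrCA lerDl addr_ge0.
by rewrite (le_trans (M2P s x sn)) // lerDr addr_ge0.
Qed.

Lemma continuous_sum_ord n (h : 'I_n -> V -> R) x : (forall k, {for x, continuous (h k)}) ->
  {for x, continuous (fun y => \sum_(k < n) h k y)}.
Proof.
elim: n h => [|n IH] h ch.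
  rewrite (_ : (fun _ => _) = cst 0); first exact: cst_continuous.
  by apply/funext => y; rewrite big_ord0.
rewrite (_ : (fun _ => _) =
    (fun y => \sum_(k < n) h (widen_ord (leqnSn n) k) y) + h ord_max).
  by apply: continuousD => //; apply: IH.
by apply/funext => y; rewrite big_ord_recr.
Qed.

(* The terms vanish outside balls shrinking to the origin, so the sum is finite near each
   point other than the origin, where the uniform bounds give continuity. *)
Lemma smooth_series (f : nat -> V -> R) : (forall k, smooth_on setT (f k)) ->
  (forall k s x, (size s < k)%N -> `|partials s (f k) x| <= 2^-1 ^+ k) ->
  (forall k s x, k.+1%:R^-1 < `|x| -> partials s (f k) x = 0) ->
  (forall k s, (size s < k)%N -> partials s (f k) 0 = 0) ->
  exists2 g, smooth_on setT g &
    forall s, partials s g 0 = \sum_(k < (size s).+1) partials s (f k) 0.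
Proof.
move=> sf bf ff f0.
pose S n s x := \sum_(k < n) partials s (f k) x.
have SS n m s x : (n <= m)%N -> (forall k, (n <= k)%N -> partials s (f k) x = 0) ->
    S m s x = S n s x.
  move=> nm z; rewrite /S -!(big_mkord xpredT (fun k => partials s (f k) x)).
  rewrite (big_cat_nat (n := n)) //= [X in _ + X]big_nat_cond [X in _ + X]big1 ?addr0 //.
  by move=> k /andP[/andP[nk _] _]; exact: z.
have /boolp.choice[K KP] : forall x, exists K : nat, x != 0 ->
    forall y, `|x - y| < `|x| / 2 -> forall k s, (K <= k)%N -> partials s (f k) y = 0.
  move=> x; have [->|x0] := eqVneq x 0; first by exists 0%N.
  have xp : 0 < `|x| / 2 by rewrite divr_gt0 // normr_gt0.
  exists (Num.truncn (`|x| / 2)^-1).+1 => _ y xy k s Kk; apply: ff.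
  have yx : `|x| / 2 < `|y|.
    by have := ler_normD (x - y) y; rewrite subrK; move: xy; move: `|_| `|_| `|_| => p q r; lra.
  apply: lt_trans yx; rewrite -[X in _ < X]invrK ltf_pV2 ?posrE ?invr_gt0 ?ltr0n //.
  by apply: (lt_le_trans (truncnS_gt _)); rewrite ler_nat ltnW.
(* At the origin no neighbourhood kills the tail; there the last hypothesis bounds the number of
   terms that contribute to the derivative [s]. *)
pose N s x := if x == 0 then (size s).+1 else K x.
have NP s x k : (N s x <= k)%N -> partials s (f k) x = 0.
  rewrite /N; case: eqVneq => [->|x0] nk; first exact: f0.
  by apply: (KP x x0) => //; rewrite subrr normr0 divr_gt0 // normr_gt0.
pose F s x := S (N s x) s x.
have FE s x n : (forall k, (n <= k)%N -> partials s (f k) x = 0) -> F s x = S n s x.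
  move=> nz; transitivity (S (maxn n (N s x)) s x); last by apply: SS => //; exact: leq_maxl.
  by apply/esym/SS; [exact: leq_maxr|move=> k; exact: NP].
pose B x := [set y : V | `|x - y| < `|x| / 2].
have oB x : open (B x).
  apply: (@open_comp _ _ (fun y : V => `|x - y|) [set t | t < `|x| / 2]); last exact: open_lt.
  move=> y _; apply: (@continuous_comp _ _ _ (fun y : V => x - y)); last exact: norm_continuous.
  by apply: continuousB; [exact: cst_continuous|exact: cvg_id].
have Bx x : x != 0 -> B x x.
  by move=> x0; rewrite /B /= subrr normr0 divr_gt0 // normr_gt0.
have FB x s : x != 0 -> forall y, B x y -> S (K x) s y = F s y.
  by move=> x0 y By; apply/esym/FE => k; exact: (KP x x0 y By).
have cF s x : {for x, continuous (F s)}.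
  have [->|x0] := eqVneq x 0; last first.
    apply: (continuous_eq_on (oB x) (FB x s x0) (Bx x x0)).
    by apply: continuous_sum_ord => k; exact: smooth_setT_continuous.
  apply/continuous_ballP => eps eps0.
  (* The condition size s < n gives both the geometric bound on the tail from n on and its vanishing
     at 0. *)
  have [n [sn neps]] : exists n : nat, (size s < n)%N /\ 2 * 2^-1 ^+ n < eps / 2.
    have h0 : (0 : R) < eps / 4 by rewrite divr_gt0.
    have [n0 n0P] : exists n0 : nat, 2^-1 ^+ n0 < eps / 4.
      exists (Num.truncn (eps / 4)^-1).+1.
      rewrite exprVn -[X in _ < X]invrK ltf_pV2 ?posrE ?invr_gt0 ?exprn_gt0 //.
      apply: (lt_le_trans (truncnS_gt _)); rewrite -natrX ler_nat.
      by apply: ltnW; exact: ltn_expl.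
    exists (maxn n0 (size s).+1); split; first exact: leq_maxr.
    have : 2^-1 ^+ maxn n0 (size s).+1 <= 2^-1 ^+ n0 :> R.
      by apply: ler_wiXn2l; rewrite ?leq_maxl //; lra.
    lra.
  have tail m y : (n <= m)%N -> `|S m s y - S n s y| <= 2 * 2^-1 ^+ n - 2 * 2^-1 ^+ m.
    elim: m => [|m IH]; first by rewrite leqn0 => /eqP ->; rewrite !subrr normr0.
    rewrite leq_eqVlt => /predU1P[->|]; first by rewrite !subrr normr0.
    rewrite ltnS => nm; rewrite /S big_ord_recr /= addrAC.
    rewrite (le_trans (ler_normD _ _)) // (le_trans (lerD (IH nm) (bf _ _ _ _))) //.
      exact: leq_trans sn nm.
    by rewrite exprS; lra.
  have cS : {for 0, continuous (S n s)}.
    by apply: continuous_sum_ord => k; exact: smooth_setT_continuous.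
  have e20 : 0 < eps / 2 by rewrite divr_gt0.
  have [d d0 dP] := (continuous_ballP (S n s) 0).1 cS _ e20.
  have Sb y : `|F s y - S n s y| <= 2 * 2^-1 ^+ n.
    have -> : F s y = S (maxn n (N s y)) s y.
      by apply/esym/SS; [exact: leq_maxr|move=> k; exact: NP].
    apply: (le_trans (tail _ _ (leq_maxl _ _))).
    by rewrite gerBl; apply: mulr_ge0 => //; apply: exprn_ge0; rewrite invr_ge0.
  exists d => // y xy; have F0 : F s 0 = S n s 0.
    by apply: FE => k nk; apply: f0; exact: leq_trans sn nk.
  have := dP y xy; have := Sb y; rewrite F0.
  have -> : S n s 0 - F s y = (S n s 0 - S n s y) - (F s y - S n s y) by ring.
  by move=> h1 h2; apply: (le_lt_trans (ler_normB _ _)); lra.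
have dF s i x : setT x -> x != 0 -> is_derive x (e i) (F s) (F (i :: s) x).
  move=> _ x0; have dS : is_derive x (e i) (S (K x) s) (S (K x) (i :: s) x).
    have -> : S (K x) s = \sum_(k < K x) partials s (f k).
      by apply/funext => y; rewrite fct_sumE.
    apply: is_derive_sum => k; apply: derivableP; exact: smooth_setT_derivable.
  split; first by apply: (derivable_eq_on (oB x) (FB x s x0) (Bx x x0)); case: dS.
  rewrite -(FB x (i :: s) x0 x (Bx x x0)); have [_ <-] := dS.
  exact/esym/(partial_eq_on i (oB x) (FB x s x0) (Bx x x0)).
have [gs gE] := @smooth_family R setT F openT (fun s x _ => cF s x) dF.
by exists (F [::]) => // s; rewrite gE // /F /N eqxx.
Qed.

End Borel.

(** * Homogeneous polynomials and the realization of Taylor series *)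

Section HomogeneousPolynomials.
Variable R : realType.
Local Notation V := 'rV[R]_2.
Implicit Types (f g : V -> R) (U : set V) (s : seq 'I_2) (x : V) (a : nat -> nat -> R).

Lemma smooth_onX U f n : open U -> smooth_on U f -> smooth_on U (f ^+ n).
Proof.
move=> oU fU; elim: n => [|n IH]; first by rewrite expr0; exact: smooth_on_cst.
by rewrite exprS; exact: smooth_onM.
Qed.

Lemma smooth_on_sum U n (F : 'I_n -> V -> R) : open U -> (forall k, smooth_on U (F k)) ->
  smooth_on U (\sum_k F k).
Proof.
move=> oU FU; elim/big_ind: _ => // [|f g]; first exact: smooth_on_cst.
exact: smooth_onD.
Qed.

Definition hpoly a k : V -> R :=
  \sum_(i < k.+1) cst (a i (k - i)%N) *
    ((fun x => x 0 ord0) ^+ i * (fun x => x 0 ord_max) ^+ (k - i)).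

Lemma smooth_hpoly a k : smooth_on setT (hpoly a k).
Proof.
have oT := @openT V; apply: smooth_on_sum => // i; apply: smooth_onM => //.
  exact: smooth_on_cst.
by apply: smooth_onM => //; apply: smooth_onX => //; exact: smooth_coord.
Qed.

Lemma hpolyE a k x : hpoly a k x =
  \sum_(i < k.+1) a i (k - i)%N * (x 0 ord0 ^+ i * x 0 ord_max ^+ (k - i)).
Proof. by rewrite /hpoly fct_sumE; apply: eq_bigr => i _; rewrite !fctE. Qed.

Lemma hpoly_homogeneous a k (c : R) x : hpoly a k (c *: x) = c ^+ k * hpoly a k x.
Proof.
rewrite !hpolyE mulr_sumr; apply: eq_bigr => i _; rewrite !mxE !exprMn.
have -> : c ^+ k = c ^+ i * c ^+ (k - i) by rewrite -exprD subnKC // -ltnS.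
ring.
Qed.

(** Differentiating p(2 x) = 2^k p(x) at 0 multiplies the same number by 2^(size s) on one side and
    by 2^k on the other. *)
Lemma hpoly_partials0 a k s : size s <> k -> partials s (hpoly a k) 0 = 0.
Proof.
move=> sk; have E1 := congr1 (fun f => f 0) (partials_scale 2 1 s (smooth_hpoly a k)).
have E2 := congr1 (fun f => f 0) (partials_scale 1 (2 ^+ k) s (smooth_hpoly a k)).
have E : (fun x => 1 * hpoly a k (2 *: x)) = (fun x => 2 ^+ k * hpoly a k (1 *: x)).
  by apply/funext => x; rewrite !hpoly_homogeneous expr1n; ring.
move: E1; rewrite E {}E2 !scaler0 expr1n mulr1 mul1r => /eqP.
rewrite -subr_eq0 -mulrBl mulf_eq0 subr_eq0 => /orP[|/eqP //].
rewrite -!natrX eqr_nat eqn_exp2l // => /eqP ks; by case: sk.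
Qed.

Lemma sqnorm_small x : `|x| < 1 / 4 -> sqnorm x <= 1 / 4.
Proof.
move=> x4; rewrite sqnormE.
have c i : x 0 i ^+ 2 <= 1 / 16.
  have := le_lt_trans (coord_le x i) x4 => h.
  by rewrite -real_normK ?num_real // expr2; have := normr_ge0 (x 0 i); nra.
have := c ord0; have := c ord_max; lra.
Qed.

Lemma sqnorm_big x : 1 < `|x| -> 1 <= sqnorm x.
Proof.
have [i ->] := norm_attained x => x1; rewrite sqnormE.
have h : 1 <= x 0 i ^+ 2 by rewrite -real_normK ?num_real // expr2; nra.
have p0 := sqr_ge0 (x 0 ord0); have p1 := sqr_ge0 (x 0 ord_max).
by case: (ord2_cases i) h => -> h; lra.
Qed.

(** The k-th term is ep^k F(x / ep), with F the cut-off form of degree k. By homogeneity the scaling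
    does not change its derivatives of order k at 0, while those of lower order become small
    everywhere. *)
Lemma borel a : exists2 g, smooth_on setT g & forall s,
  partials s g 0 = partials s (hpoly a (size s)) 0.
Proof.
have [chi [schi chi1 chi0]] := bump_exists R; have oT := @openT V.
pose F k := hpoly a k * chi.
have sF k : supported (F k).
  split; first by apply: smooth_onM => //; exact: smooth_hpoly.
  by move=> x x1; rewrite /F fctE chi0 ?mulr0 //; exact: sqnorm_big.
have F0 k s : partials s (F k) 0 = partials s (hpoly a k) 0.
  have oB : open [set x : V | `|x| < 1 / 4].
    apply: (@open_comp _ _ (fun x : V => `|x|) [set t | t < 1 / 4]); last exact: open_lt.
    by move=> x _; exact: norm_continuous.
  apply: (partials_eq_on s oB); last by rewrite /= normr0; lra.
  by move=> x /sqnorm_small x4; rewrite /F fctE chi1 // mulr1.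
have /boolp.choice[ep epP] : forall k, exists ep : R, [/\ 0 < ep, ep <= k.+1%:R^-1 &
    forall s x, (size s < k)%N ->
      `|ep ^+ k * ep^-1 ^+ size s * partials s (F k) (ep^-1 *: x)| <= 2^-1 ^+ k].
  move=> k; have [M M0 MP] := supported_bounded_partials k (sF k).
  have M1 : 0 < M + 1 by lra.
  have h : 0 < 2^-1 ^+ k / (M + 1) :> R by rewrite divr_gt0 // exprn_gt0 // invr_gt0.
  (* The first bound shrinks the supports to the origin. The second one makes ep M at most 2^(-k),
     and derivatives of order less than k keep at least one factor ep. *)
  exists (Num.min k.+1%:R^-1 (2^-1 ^+ k / (M + 1))).
  set ep := Num.min _ _; have ep0 : 0 < ep by rewrite lt_min h invr_gt0 ltr0n.
  have ep1 : ep <= k.+1%:R^-1 by rewrite ge_min lexx.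
  have ep2 : ep <= 2^-1 ^+ k / (M + 1) by rewrite ge_min lexx orbT.
  split=> // s x sk.
  have -> : ep ^+ k * ep^-1 ^+ size s = ep ^+ (k - size s).
    rewrite -{1}(subnK (ltnW sk)) exprD -mulrA -exprMn divff ?gt_eqF //.
    by rewrite expr1n mulr1.
  have epw : ep ^+ (k - size s) <= ep.
    have e1 : ep <= 1 by rewrite (le_trans ep1) // invf_le1 ?ltr0n // ler1n.
    rewrite -[X in _ <= X]expr1; apply: ler_wiXn2l; rewrite ?subn_gt0 //; exact: ltW.
  rewrite normrM ger0_norm; last by rewrite exprn_ge0 // ltW.
  apply: (@le_trans _ _ (ep * M)).
    by apply: ler_pM => //; [rewrite exprn_ge0 // ltW|apply: MP; exact: ltnW].
  rewrite ler_pdivlMr // in ep2; apply: le_trans ep2; rewrite ler_wpM2l //; lra.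
pose f k x := ep k ^+ k * F k ((ep k)^-1 *: x).
have pf k s : partials s (f k) =
    (fun x => ep k ^+ k * (ep k)^-1 ^+ size s * partials s (F k) ((ep k)^-1 *: x)).
  exact/partials_scale/(sF k).1.
have pf0 k s : size s <> k -> partials s (f k) 0 = 0.
  by move=> sk; rewrite pf scaler0 F0 hpoly_partials0 // mulr0.
have [|||| g gs gE] := @smooth_series R f.
- by move=> k; apply: smooth_scale; exact: (sF k).1.
- by move=> k s x sk; rewrite pf; have [_ _] := epP k; apply.
- move=> k s x kx; rewrite pf; have [ep0 ep1 _] := epP k.
  rewrite (supported_partials s (sF k)).2 ?mulr0 // normrZ gtr0_norm ?invr_gt0 //.
  by rewrite ltr_pdivlMl // mulr1 (le_lt_trans ep1).
- by move=> k s sk; apply: pf0 => E; move: sk; rewrite E ltnn.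
exists g => // s; rewrite gE big_ord_recr /= big1 ?add0r => [|k _].
  have [ep0 _ _] := epP (size s).
  by rewrite pf scaler0 F0 -exprMn divff ?gt_eqF // expr1n mul1r.
by apply: pf0 => E; have := ltn_ord k; rewrite -E ltnn.
Qed.

End HomogeneousPolynomials.

(** * The Taylor morphism *)

Section Taylor.
Variable R : realType.
Local Notation V := 'rV[R]_2.
Implicit Types (f g h : smooth_fun R) (u v w : germ R) (s : seq 'I_2).

Arguments taylor : simpl never.

Lemma germ_ind (P : germ R -> Prop) : (forall f, P (to_germ f)) -> forall u, P u.
Proof. by move=> Pf u; rewrite -[u]to_germ_surj. Qed.

Lemma common_nbhs (F G : V -> R) : smooth_near0 F -> smooth_near0 G ->
  exists U : set V, [/\ open U, U 0, smooth_on U F & smooth_on U G].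
Proof.
move=> [U [oU U0] fU] [W [oW W0] gW]; exists (U `&` W).
by split; [exact: openI|split|apply: smooth_onS fU => x []|apply: smooth_onS gW => x []].
Qed.

Lemma taylorD u v : taylor (u + v) = taylor u + taylor v.
Proof.
elim/germ_ind: u => f; elim/germ_ind: v => g; rewrite -to_germD.
apply: fps2P => m n; rewrite coefD !taylorE -mulrDl; congr (_ / _).
have [U [oU U0 fU gU]] := common_nbhs (smooth_funP f) (smooth_funP g).
exact: (partialsD _ oU fU gU U0).
Qed.

Lemma partials_rcons U (F : V -> R) s i x : open U -> smooth_on U F -> U x ->
  partials (rcons s i) F x = partial i (partials s F) x.
Proof.
move=> oU FU; elim: s x => // j s IH x Ux.
rewrite /= (partial_eq_on j oU IH Ux).
have sU : smooth_on U (partials s F).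
  by elim: s {IH} => //= k s; apply: smooth_on_partial.
exact: (partialC j i oU sU Ux).
Qed.

Lemma div_natM (p : R) (d k : nat) : (0 < d)%N -> p / d%:R = p / (k.+1 * d)%:R *+ k.+1.
Proof.
move=> d0; rewrite -[RHS]mulr_natr natrM -mulrA; congr (_ * _).
by rewrite invfM mulrAC mulVf ?mul1r // pnatr_eq0.
Qed.

Lemma taylor_deriv i u : taylor (germ_deriv i u) = fps_deriv i (taylor u).
Proof.
elim/germ_ind: u => f; rewrite germ_derivE; apply: fps2P => m n; rewrite taylorE.
have [U [oU U0] fU] := smooth_funP f.
set s := nseq m ord0 ++ nseq n ord_max.
have E : partials s (smooth_partial i f) 0 = partials (rcons s i) f 0.
  by rewrite /partials foldr_rcons.
rewrite E; case: (ord2_cases i) => ->.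
  rewrite (partials_rcons s ord0 oU fU U0) coef_deriv0 taylorE factS -mulnA.
  by apply: div_natM; rewrite muln_gt0 !fact_gt0.
have -> : rcons s ord_max = nseq m ord0 ++ nseq n.+1 ord_max.
  by rewrite /s rcons_cat; congr (_ ++ _); elim: n {s E} => //= n ->.
rewrite coef_deriv1 taylorE factS mulnCA.
by apply: div_natM; rewrite muln_gt0 !fact_gt0.
Qed.

Lemma taylor_ev0 f : fps_ev0 (taylor (to_germ f)) = f 0.
Proof. by rewrite /fps_ev0 taylorE /= fact0 muln1 divr1. Qed.

Lemma taylorB u v : taylor (u - v) = taylor u - taylor v.
Proof. by apply: (addIr (taylor v)); rewrite -taylorD !subrK. Qed.

Lemma taylor0 : taylor (0 : germ R) = 0.
Proof. by rewrite -(subrr (0 : germ R)) taylorB subrr. Qed.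

(* The defect T(uv) - T(u)T(v) is a biderivation without constant term, hence vanishes to
   all orders. *)
Lemma taylorM u v : taylor (u * v) = taylor u * taylor v.
Proof.
pose B u v := taylor (u * v) - taylor u * taylor v.
have B0 u1 v1 : fps_ev0 (B u1 v1) = 0.
  elim/germ_ind: u1 => f; elim/germ_ind: v1 => g.
  by rewrite /B -to_germM ev0B ev0M !taylor_ev0 subrr.
have dB i u1 v1 : fps_deriv i (B u1 v1) = B (germ_deriv i u1) v1 + B u1 (germ_deriv i v1).
  rewrite /B fps_derivB fps_derivM -!taylor_deriv germ_derivM taylorD; ring.
apply: (@fil_eq R 1 1) => k; rewrite -/(B u v).
elim: k u v => [|k IH] u v; first exact: fil0.
by apply: fil_intr => // i; rewrite dB; apply: filD.
Qed.

Lemma taylor1 : taylor (1 : germ R) = 1.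
Proof.
have -> : (1 : germ R) = to_germ (smooth_cst 1).
  rewrite -[LHS](rmorph1 (\pi_{ideal_quot (@vanish_near0 R)})%qT); congr (to_germ _).
  exact/val_inj/funext.
apply: fps2P => m n; rewrite taylorE coef1.
have z s : (0 < size s)%N -> partials s (cst (1 : R) : V -> R) = cst 0.
  elim: s => // i s IH _; rewrite /=; case: s IH => [_|j s ->] //.
    by apply/funext => x; rewrite /= /partial derive_cst.
  by apply/funext => x; rewrite /partial derive_cst.
case: (posnP (m + n)) => [/eqP|mn].
  by rewrite addn_eq0 => /andP[/eqP -> /eqP ->]; rewrite /= fact0 divr1.
rewrite -[X in partials _ X](_ : cst 1 = _) // z ?mul0r; last by rewrite size_cat !size_nseq.
by case: m n mn => [|m] [|n].
Qed.

HB.instance Definition _ := GRing.isZmodMorphism.Build (germ R) (fps2 R) (@taylor R) taylorB.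
HB.instance Definition _ := GRing.isMonoidMorphism.Build (germ R) (fps2 R) (@taylor R)
  (taylor1, taylorM).

Lemma taylorX u n : taylor (u ^+ n) = taylor u ^+ n. Proof. exact: rmorphXn. Qed.
Lemma taylor_sum n (F : 'I_n -> germ R) : taylor (\sum_k F k) = \sum_k taylor (F k).
Proof. exact: rmorph_sum. Qed.

Definition germC (c : R) : germ R := to_germ (smooth_cst c).

Lemma scale_germC c u : c *: u = germC c * u. Proof. by []. Qed.

End Taylor.

(** * Surjectivity, inverses, flat division and composition for germs *)

Section GermInterface.
Variable R : realType.
Local Notation V := 'rV[R]_2.
Local Notation T := (@taylor R).
Implicit Types (f g h : smooth_fun R) (u v w : germ R) (s : seq 'I_2).

Lemma smooth_near0T (F : V -> R) : smooth_on setT F -> smooth_near0 F.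
Proof. by move=> sF; exists setT => //; split=> //; exact: openT. Qed.

Definition gcoord i : germ R := to_germ (mk_smooth (smooth_near0T (smooth_coord i (@openT V)))).
Local Notation gX := (gcoord ord0).
Local Notation gY := (gcoord ord_max).

Lemma germ_derivC0 i c : germ_deriv i (germC c) = 0 :> germ R.
Proof.
rewrite germ_derivE -[RHS](rmorph0 (\pi_{ideal_quot (@vanish_near0 R)})%qT).
apply/to_germP; apply: (@nearW _ (nbhs (0 : V))) => x.
by rewrite /= /partial derive_cst.
Qed.

Lemma taylorC c : T (germC c) = fpsC c.
Proof.
rewrite [LHS]deriv_eq0 ?taylor_ev0 // => i.
by rewrite -taylor_deriv germ_derivC0 taylor0.
Qed.

Lemma germ_deriv_coord i j : germ_deriv i (gcoord j) = germC (j == i)%:R.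
Proof.
rewrite germ_derivE; apply/to_germP; apply: (@nearW _ (nbhs (0 : V))) => x.
by have [_ <-] := is_derive_coord j i x.
Qed.

Lemma taylor_gX : T gX = fpsX R.
Proof.
apply/eqP; rewrite -subr_eq0; apply/eqP; rewrite [LHS]deriv_eq0 => [|i].
  rewrite ev0B taylor_ev0 ev0_fpsX /= mxE subr0.
  exact: rmorph0.
rewrite fps_derivB -taylor_deriv germ_deriv_coord taylorC derivX.
by rewrite eq_sym rmorph_nat subrr.
Qed.

Lemma taylor_gY : T gY = fpsY R.
Proof.
apply/eqP; rewrite -subr_eq0; apply/eqP; rewrite [LHS]deriv_eq0 => [|i].
  rewrite ev0B taylor_ev0 ev0_fpsY /= mxE subr0.
  exact: rmorph0.
rewrite fps_derivB -taylor_deriv germ_deriv_coord taylorC derivY.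
by rewrite eq_sym rmorph_nat subrr.
Qed.

Lemma to_germ_sum n (F : 'I_n -> smooth_fun R) :
  to_germ (\sum_k F k) = \sum_k to_germ (F k).
Proof. exact: (rmorph_sum (\pi_{ideal_quot (@vanish_near0 R)})%qT). Qed.

Lemma to_germX f n : to_germ (f ^+ n) = to_germ f ^+ n.
Proof. exact: (rmorphXn (\pi_{ideal_quot (@vanish_near0 R)})%qT). Qed.

Lemma smooth_val_sum n (F : 'I_n -> smooth_fun R) :
  smooth_val (\sum_k F k) = \sum_k smooth_val (F k).
Proof. exact: (rmorph_sum (\val : smooth_fun R -> _)). Qed.

Lemma smooth_valX f n : smooth_val (f ^+ n) = smooth_val f ^+ n.
Proof. exact: (rmorphXn (\val : smooth_fun R -> _)). Qed.

Lemma to_germ_hpoly a k : to_germ (mk_smooth (smooth_near0T (@smooth_hpoly R a k))) =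
  \sum_(i < k.+1) germC (a i (k - i)%N) * (gX ^+ i * gY ^+ (k - i)).
Proof.
transitivity (to_germ (\sum_(i < k.+1) smooth_cst (a i (k - i)%N) *
    (mk_smooth (smooth_near0T (smooth_coord ord0 (@openT V))) ^+ i *
     mk_smooth (smooth_near0T (smooth_coord ord_max (@openT V))) ^+ (k - i)))).
  congr to_germ; apply: val_inj; rewrite /= smooth_val_sum; apply: eq_bigr => i _.
  rewrite -[RHS]/(cst (a i (k - i)%N) * (smooth_val (_ ^+ _) * smooth_val (_ ^+ _))).
  by rewrite !smooth_valX.
by rewrite to_germ_sum; apply: eq_bigr => i _; rewrite !to_germM !to_germX.
Qed.

Lemma taylor_surj (a : fps2 R) : exists u, T u = a.
Proof.
have [g sg gE] := borel (fps_coef a).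
exists (to_germ (mk_smooth (smooth_near0T sg))); apply: fps2P => m n.
rewrite taylorE /= gE size_cat !size_nseq.
set f := mk_smooth (smooth_near0T (@smooth_hpoly R (fps_coef a) (m + n))).
rewrite -[LHS](taylorE f m n) to_germ_hpoly taylor_sum coef_sum.
have E (i : 'I_(m + n).+1) : fps_coef (T (germC (fps_coef a i (m + n - i)) *
    (gX ^+ i * gY ^+ (m + n - i)))) m n = (i == m :> nat)%:R * fps_coef a m n.
  rewrite !taylorM !taylorX taylorC taylor_gX taylor_gY -monoE coefCM /=.
  case: (eqVneq m i) => [<-|im]; last by rewrite mulr0 mul0r.
  by rewrite addKn !eqxx mulr1 mul1r.
under eq_bigr do rewrite E.
have mn : (m < (m + n).+1)%N by rewrite ltnS leq_addr.
rewrite (bigD1 (Ordinal mn)) //= eqxx mul1r big1 ?addr0 // => i.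
by rewrite -val_eqE /= => /negPf ->; rewrite mul0r.
Qed.

Lemma germ_inv u : fps_ev0 (T u) != 0 -> exists w, w * u = 1.
Proof.
elim/germ_ind: u => f; rewrite taylor_ev0 => f0.
have [U [oU U0] fU] := smooth_funP f.
have cf := smooth_on_continuous fU U0.
have [d d0 dP] := (continuous_ballP f 0).1 cf `|f 0| (ltac:(by rewrite normr_gt0)).
pose W := U `&` [set x : V | `|0 - x| < d].
have oW : open W.
  apply: openI => //.
  apply: (@open_comp _ _ (fun y : V => `|0 - y|) [set t | t < d]); last exact: open_lt.
  move=> y _; apply: (@continuous_comp _ _ _ (fun y : V => 0 - y)); last exact: norm_continuous.
  by apply: continuousB; [exact: cst_continuous|exact: cvg_id].
have fW x : W x -> f x != 0.
  by move=> [_ xd]; apply: contraTneq (dP x xd) => ->; rewrite subr0 ltxx.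
have sW : smooth_on W (fun x => (f x)^-1).
  by apply: smooth_on_inv => //; apply: smooth_onS fU => x [].
have W0 : W 0 by split=> //=; rewrite subrr normr0.
have sF : smooth_near0 (fun x => (f x)^-1) by exists W.
exists (to_germ (mk_smooth sF)); rewrite -to_germM.
rewrite -[RHS](rmorph1 (\pi_{ideal_quot (@vanish_near0 R)})%qT).
apply/to_germP; apply: (near_eq_on oW _ W0) => x Wx.
by rewrite -[LHS]/((f x)^-1 * f x) mulVf // fW.
Qed.

Lemma iter_germ_deriv s f : exists g, smooth_val g = partials s f /\
  to_germ g = foldr (@germ_deriv R) (to_germ f) s.
Proof.
elim: s => [|i s [g [gE gT]]]; first by exists f.
by exists (smooth_partial i g); rewrite /= -germ_derivE gT gE.
Qed.

Lemma taylor_flat f : T (to_germ f) = 0 <-> flat0 f.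
Proof.
split=> [f0 s|ff]; last by apply: fps2P => m n; rewrite taylorE ff mul0r.
have [g [gE gT]] := iter_germ_deriv s f.
rewrite -gE -taylor_ev0 gT; have -> : T (foldr (@germ_deriv R) (to_germ f) s) = 0.
  by elim: s {g gE gT} => //= i s IH; rewrite taylor_deriv IH raddf0.
by [].
Qed.

Lemma flat_divide N u : T u = 0 -> exists w, T w = 0 /\ u = (gX ^+ (2 * N) + gY ^+ (2 * N)) * w.
Proof.
elim/germ_ind: u => f /taylor_flat ff.
have [U [oU U0] fU] := smooth_funP f.
(* The exponents are even so that r is at least the power 2 N of the sup norm. *)
pose r : V -> R := (fun x : V => x 0 ord0) ^+ (2 * N) + (fun x : V => x 0 ord_max) ^+ (2 * N).
have rU : smooth_on U r.
  by apply: smooth_onD => //; apply: smooth_onX => //; exact: smooth_coord.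
have rN x : U x -> `|x| ^+ (2 * N) <= r x.
  have -> : r x = x 0 ord0 ^+ (2 * N) + x 0 ord_max ^+ (2 * N) by rewrite /r !fctE.
  move=> _.
  have p i : x 0 i ^+ (2 * N) = `|x 0 i| ^+ (2 * N).
    by rewrite !exprM real_normK ?num_real.
  have p0 i : 0 <= x 0 i ^+ (2 * N) by rewrite p exprn_ge0.
  have [i ->] := norm_attained x; rewrite -p.
  by case: (ord2_cases i) => ->; rewrite ?lerDl ?lerDr.
have [g [gU gf fE]] := flat_div oU U0 fU ff rU rN.
have sg : smooth_near0 g by exists U.
exists (to_germ (mk_smooth sg)); split; first exact/taylor_flat.
rewrite -!to_germX -to_germD -to_germM; apply/to_germP.
apply: (near_eq_on oU _ U0) => x /fE ->.
by rewrite -[RHS]/((smooth_val (_ ^+ _) x + smooth_val (_ ^+ _) x) * g x) !smooth_valX.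
Qed.

Lemma fps_derivX i (a : fps2 R) n :
  fps_deriv i (a ^+ n.+1) = n.+1%:R * a ^+ n * fps_deriv i a.
Proof.
elim: n => [|n IH]; first by rewrite !mul1r.
by rewrite exprS fps_derivM IH exprS -[n.+2]addn1 natrD; ring.
Qed.

(** Here v = phi(u) and w = phi'(u), where phi is the restriction to an axis of a smooth function
    with Taylor coefficients c along that axis. *)
Lemma germ_compose u (c : nat -> R) : fps_ev0 (T u) = 0 -> exists v w,
  (forall k, fil 1 1 k (T v - \sum_(j < k) c j *: T u ^+ j)) /\
  forall i, germ_deriv i v = w * germ_deriv i u.
Proof.
elim/germ_ind: u => f; rewrite taylor_ev0 => f0.
have [U [oU U0] fU] := smooth_funP f.
have [B sB BE] := borel (fun i j => if j == 0%N then c i else 0).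
pose phi n (t : R) := partials (nseq n ord0) B (0 + t *: axis R ord0).
have phiT : tower [set: R] phi.
  by move=> n t _; apply: is_derive_line; exact: smooth_setT_derivable.
have phi0 n : phi n 0 = n`!%:R * c n.
  rewrite /phi scale0r addr0; have := BE (nseq n ord0); rewrite size_nseq => ->.
  set h := mk_smooth (smooth_near0T (@smooth_hpoly R (fun i j => if j == 0%N then c i else 0) n)).
  have := taylorE h n 0; rewrite cats0 fact0 muln1 => E.
  have -> : partials (nseq n ord0) (hpoly (fun i j => if j == 0%N then c i else 0) n) 0 =
      fps_coef (T (to_germ h)) n 0 * n`!%:R.
    by rewrite E divfK // pnatr_eq0 -lt0n fact_gt0.
  rewrite mulrC to_germ_hpoly taylor_sum coef_sum (bigD1 ord_max) //.
  rewrite -[nat_of_ord ord_max]/n subnn eqxx big1.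
    rewrite !taylorM !taylorX taylorC taylor_gX !expr0 mulr1 coefCM.
    by have := monoE R n 0; rewrite expr0 mulr1 => <-; rewrite /= !eqxx mulr1 addr0.
  move=> i; rewrite andTb => ni; have -> : (n - i == 0)%N = false.
    apply/negP; rewrite subn_eq0 => ni'; case/negP: ni; rewrite -val_eqE /= eqn_leq ni' andbT.
    by rewrite -ltnS.
  by rewrite taylorM taylorC rmorph0 mul0r.
have sphi n : smooth_on U (phi n \o f) by apply: (@smooth_on_comp R U setT phi f n).
have nphi n : smooth_near0 (phi n \o f) by exists U.
pose G n := to_germ (mk_smooth (nphi n)).
have dG n i : germ_deriv i (G n) = G n.+1 * germ_deriv i (to_germ f).
  rewrite /G !germ_derivE -to_germM; apply/to_germP.
  apply: (near_eq_on oU _ U0) => x Ux.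
  rewrite -[RHS]/(phi n.+1 (f x) * partial i f x).
  by have [_ <-] := tower_comp_partial n i oU fU (fun _ _ => Logic.I) phiT Ux.
(* The Taylor coefficients of the n-th derivative of phi. *)
pose d n j : R := c (n + j)%N * (n + j)`!%:R / j`!%:R.
have dS n j : d n j.+1 * j.+1%:R = d n.+1 j.
  rewrite /d factS natrM addnS addSn; field.
  by rewrite nat1r !pnatr_eq0 -!lt0n fact_gt0.
set F := T (to_germ f).
have F0 : fps_ev0 F = 0 by rewrite /F taylor_ev0.
(* All n are treated together, because differentiating phi^(n)(u) produces phi^(n+1)(u). *)
have main k n : fil 1 1 k (T (G n) - \sum_(j < k) d n j *: F ^+ j).
  elim: k n => [|k IH] n; first exact: fil0.
  apply: fil_intr => [|i].
    rewrite big_ord_recl expr0 ev0B ev0D taylor_ev0 /= f0 phi0.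
    rewrite (raddf_sum (@fps_ev0 R)) big1 ?addr0.
      by rewrite /d addn0 fact0 divr1 mulr1 mulrC subrr.
    move=> j _; rewrite -[LHS]/(d n j.+1 * fps_ev0 (F ^+ j.+1)) ev0X F0.
    by rewrite expr0n mulr0.
  rewrite fps_derivB -taylor_deriv dG taylorM taylor_deriv -/F linear_sum /=.
  rewrite big_ord_recl expr0 scale_fpsC mulr1 fps_deriv_fpsC add0r.
  have -> : \sum_(j < k) fps_deriv i (d n (lift ord0 j) *: F ^+ lift ord0 j) =
      (\sum_(j < k) d n.+1 j *: F ^+ j) * fps_deriv i F.
    rewrite mulr_suml; apply: eq_bigr => j _; rewrite linearZ /= fps_derivX -dS.
    by rewrite -scalerA scaler_nat -[bump 0 j]/j.+1 -!scalerAl mulr_natl.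
  by rewrite -mulrBl; apply: filMr.
exists (G 0%N), (G 1%N); split=> [k|i]; last exact: dG.
have := main k 0%N; have -> // : \sum_(j < k) d 0%N j *: F ^+ j = \sum_(j < k) c j *: F ^+ j.
apply: eq_bigr => j _; rewrite /d add0n mulfK // pnatr_eq0 -lt0n fact_gt0 //.
Qed.

End GermInterface.

(** * Substitution of power series *)

Section Substitution.
Variable R : realFieldType.
Implicit Types (f g h u v : fps2 R).
Local Notation fil := (fil 1 1).
Local Notation x := (fpsX R).
Local Notation y := (fpsY R).

Definition psubst u v k f : fps2 R :=
  \sum_(i < k) \sum_(j < k) fps_coef f i j *: (u ^+ i * v ^+ j).

Lemma psubst_linear u v k a f g : psubst u v k (a *: f + g) = a *: psubst u v k f + psubst u v k g.
Proof.
rewrite /psubst scaler_sumr -big_split; apply: eq_bigr => i _.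
rewrite scaler_sumr -big_split; apply: eq_bigr => j _ /=.
by rewrite scalerDl scalerA.
Qed.

Lemma psubst_mono u v k i j : (i < k)%N -> (j < k)%N ->
  psubst u v k (fps_mono R i j) = u ^+ i * v ^+ j.
Proof.
move=> ik jk; rewrite /psubst (bigD1 (Ordinal ik)) //= [X in _ + X]big1 ?addr0.
  rewrite (bigD1 (Ordinal jk)) //= !eqxx scale1r big1 ?addr0 // => l.
  by rewrite -val_eqE /= => /negPf ->; rewrite scale0r.
move=> l; rewrite -val_eqE /= => /negPf lj; apply: big1 => m _.
by rewrite lj scale0r.
Qed.

Lemma coef_psubst k f m n : fps_coef (psubst x y k f) m n =
  if (m < k)%N && (n < k)%N then fps_coef f m n else 0.
Proof.
have c i j : fps_coef (fps_coef f i j *: (x ^+ i * y ^+ j)) m n =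
    fps_coef f i j * ((m == i) && (n == j))%:R by rewrite -monoE.
rewrite coef_sum; case: ltnP => [mk|km]; rewrite ?andTb ?andFb; last first.
  apply: big1 => i _; rewrite coef_sum; apply: big1 => j _; rewrite c.
  by rewrite gtn_eqF ?mulr0 // (leq_trans _ km).
rewrite (bigD1 (Ordinal mk)) // -[RHS]addr0; congr (_ + _); last first.
  apply: big1 => i; rewrite -val_eqE /= eq_sym => /negPf im.
  by rewrite coef_sum; apply: big1 => j _; rewrite c im mulr0.
rewrite coef_sum; case: ltnP => [nk|kn]; last first.
  by apply: big1 => j _; rewrite c /= andbC gtn_eqF ?mulr0 // (leq_trans _ kn).
rewrite (bigD1 (Ordinal nk)) // -[RHS]addr0; congr (_ + _).
  by rewrite c !eqxx mulr1.
apply: big1 => j; rewrite c -val_eqE /= eq_sym => /negPf ->.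
by rewrite andbF mulr0.
Qed.

Lemma psubst_id k f : fil k (f - psubst x y k f).
Proof.
move=> m n; rewrite !mul1n => mn; rewrite coefB coef_psubst ifT ?subrr //.
by apply/andP; split; lia.
Qed.

(** Polynomials are dense for the adic topology, so identities that are linear and continuous in a
    series need only be checked on monomials. *)
Lemma continuous_eq0 (L : fps2 R -> fps2 R) : linear L ->
  (forall k, exists l, forall f, fil l f -> fil k (L f)) ->
  (forall i j, L (x ^+ i * y ^+ j) = 0) -> forall f, L f = 0.
Proof.
move=> Ll Lc Lm f; apply: (@fil_sep R 1 1) => k; have [l lP] := Lc k.
have LD g h : L (g + h) = L g + L h by have := Ll 1 g h; rewrite !scale1r.
have L0 : L 0 = 0 by apply: (addrI (L 0)); rewrite -LD !addr0.
have Lsum I (r : seq I) F : L (\sum_(i <- r) F i) = \sum_(i <- r) L (F i).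
  exact: (big_morph L LD L0).
rewrite -[f](subrK (psubst x y l f)) LD; apply: filD; first exact/lP/psubst_id.
rewrite /psubst Lsum; apply: fil_sum => i _; rewrite Lsum; apply: fil_sum => j _.
by rewrite -[_ *: _]addr0 Ll Lm L0 scaler0 addr0.
Qed.

Section Maximal.
Variables u v : fps2 R.
Hypotheses (u0 : fps_ev0 u = 0) (v0 : fps_ev0 v = 0).

Lemma fil_uv i j : fil (i + j) (u ^+ i * v ^+ j).
Proof.
apply: filM; [rewrite -[X in fil X]muln1|rewrite -[X in fil X]muln1]; apply: filX; exact/fil_ev0.
Qed.

Lemma psubst_cauchy k f : fil k (psubst u v k.+1 f - psubst u v k f).
Proof.
rewrite /psubst big_ord_recr /= addrAC -sumrB; apply: filD; apply: fil_sum => i _.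
  rewrite big_ord_recr /= addrAC subrr add0r; apply: filZ.
  by apply: (filW (leq_addl i k)); exact: fil_uv.
by apply: filZ; apply: (filW (leq_addr i k)); exact: fil_uv.
Qed.

Lemma subst_ex f : exists h, forall k, fil k (h - psubst u v k f).
Proof. by apply: fil_lim => k; exact: psubst_cauchy. Qed.

Definition fps_subst f : fps2 R := projT1 (cid (subst_ex f)).
Local Notation phi := fps_subst.

Lemma substP f k : fil k (phi f - psubst u v k f).
Proof. exact: (projT2 (cid (subst_ex f))). Qed.

Lemma subst_linear : linear phi.
Proof.
move=> a f g; apply: (@fil_eq R 1 1) => k; have h := @substP (a *: f + g) k.
apply: (fil_trans h); rewrite psubst_linear; apply: filBC; rewrite opprD addrACA -scalerBr; apply: filD; last exact: substP.
exact/filZ/substP.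
Qed.
HB.instance Definition _ := GRing.isLinear.Build R (fps2 R) (fps2 R) _ phi subst_linear.

Lemma subst_fil k f : fil k f -> fil k (phi f).
Proof.
move=> kf; rewrite -[phi f](subrK (psubst u v k f)); apply: filD; first exact: substP.
apply: fil_sum => i _; apply: fil_sum => j _; case: (ltnP (i + j) k) => ij.
  by rewrite kf ?mul1n // scale0r.
by apply: filZ; apply: (filW ij); exact: fil_uv.
Qed.

Lemma subst_mono i j : phi (x ^+ i * y ^+ j) = u ^+ i * v ^+ j.
Proof.
apply: (@fil_eq R 1 1) => k; apply: (filW (leq_addr (i + j).+1 k)).
by rewrite -monoE -(@psubst_mono u v (k + (i + j).+1)); [exact: substP|lia|lia].
Qed.

Lemma substX : phi x = u. Proof. by have := subst_mono 1 0; rewrite !expr1 !expr0 !mulr1. Qed.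
Lemma substY : phi y = v. Proof. by have := subst_mono 0 1; rewrite !expr1 !expr0 !mul1r. Qed.

Lemma subst_is_monoid_morphism : monoid_morphism phi.
Proof.
have one : phi 1 = 1 by have := subst_mono 0 0; rewrite !expr0 !mulr1.
split=> // f g; apply/eqP; rewrite -subr_eq0; apply/eqP.
apply: (@continuous_eq0 (fun g => phi (f * g) - phi f * phi g)) => [a g1 g2|k|i j].
- by rewrite mulrDr -scalerAr !linearP /= mulrDr -scalerAr scalerBr opprD addrACA.
- by exists k => h kh; apply: filB; [apply: subst_fil; apply: filMl|apply: filMl; apply: subst_fil].
apply: (@continuous_eq0 (fun f => phi (f * (x ^+ i * y ^+ j)) - phi f * phi (x ^+ i * y ^+ j))) => [a g1 g2|k|m n].
- by rewrite mulrDl -scalerAl !linearP /= mulrDl -scalerAl scalerBr opprD addrACA.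
- by exists k => h kh; apply: filB; [apply: subst_fil; apply: filMr|apply: filMr; apply: subst_fil].
rewrite mulrACA -!exprD !subst_mono !exprD; apply/eqP; rewrite subr_eq0; apply/eqP; ring.
Qed.
HB.instance Definition _ := GRing.isMonoidMorphism.Build (fps2 R) (fps2 R) phi subst_is_monoid_morphism.

Lemma subst_psubst p q k f : phi (psubst p q k f) = psubst (phi p) (phi q) k f.
Proof.
rewrite /psubst raddf_sum; apply: eq_bigr => i _; rewrite raddf_sum; apply: eq_bigr => j _.
by rewrite [LHS]linearZZ rmorphM !rmorphXn.
Qed.

Lemma subst_ev0 f : fps_ev0 (phi f) = fps_ev0 f.
Proof.
have [g [h {1}->]] := decXY f.
have -> : phi (fpsC (fps_ev0 f) + x * g + y * h) = fpsC (fps_ev0 f) + u * phi g + v * phi h.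
  rewrite 2!raddfD /= !rmorphM /= substX substY; congr (_ + _ + _).
  by rewrite -[fpsC _]mulr1 -scale_fpsC linearZ /= rmorph1.
by rewrite 2!ev0D !ev0M u0 v0 !mul0r !addr0 ev0C.
Qed.

Lemma subst_chain l f : fps_deriv l (phi f) =
  phi (fps_deriv ord0 f) * fps_deriv l u + phi (fps_deriv ord_max f) * fps_deriv l v.
Proof.
(* The defect of the chain rule is a derivation along [phi], so it vanishes once it does so on x and
   y. *)
have [L LE] : exists L : fps2 R -> fps2 R, forall f, L f = fps_deriv l (phi f) -
    (phi (fps_deriv ord0 f) * fps_deriv l u + phi (fps_deriv ord_max f) * fps_deriv l v).
  by eexists.
have LM g h : L (g * h) = L g * phi h + phi g * L h.
  by rewrite !LE !fps_derivM !raddfD /= !rmorphM /= fps_derivM; ring.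
have L1 : L 1 = 0.
  have d1 i : fps_deriv i (1 : fps2 R) = 0 by rewrite -(rmorph1 (@fpsC R)) fps_deriv_fpsC.
  by rewrite LE rmorph1 !d1 !raddf0 !mul0r addr0 subrr.
have LX g n : L g = 0 -> L (g ^+ n) = 0.
  by move=> g0; elim: n => [|n IH]; [rewrite expr0|rewrite exprS LM g0 IH mul0r mulr0 addr0].
apply/eqP; rewrite -subr_eq0; apply/eqP; rewrite -LE; apply: continuous_eq0 f => [a g h|k|i j].
- rewrite !LE !linearP /= !mulrDl -!scalerAl !scalerBr !scalerDr.
  set a1 := _ *: _; set a2 := _ *: _; set a3 := _ *: _; ring.
- exists k.+1 => h kh; rewrite LE; apply: filB; first exact/fil_deriv/subst_fil.
  by apply: filD; apply/filMr/subst_fil/fil_deriv.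
- rewrite LM (LX x) ?(LX y) ?mul0r ?mulr0 ?addr0 //.
    by rewrite LE substY !derivY /= rmorph0 rmorph1 mul0r mul1r add0r subrr.
  by rewrite LE substX !derivX /= rmorph0 rmorph1 mul0r mul1r addr0 subrr.
Qed.

Lemma subst_vfd (X Y : formal_vf R) f : phi (Y ord0) = vfd X u -> phi (Y ord_max) = vfd X v ->
  vfd X (phi f) = phi (vfd Y f).
Proof.
move=> Y0 Y1; rewrite !vf_applyE !subst_chain rmorphD !rmorphM /= Y0 Y1 !vf_applyE; ring.
Qed.

End Maximal.

(** [chi] is given only by its constant terms and the chain rule, which also hold for a composite of
    substitutions; tangency to the identity makes it fix leading forms. *)
Lemma chain_near_id (chi : fps2 R -> fps2 R) u v :
  (forall f, fps_ev0 (chi f) = fps_ev0 f) ->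
  (forall l f, fps_deriv l (chi f) =
     chi (fps_deriv ord0 f) * fps_deriv l u + chi (fps_deriv ord_max f) * fps_deriv l v) ->
  fil 2 (u - x) -> fil 2 (v - y) -> forall k f, fil k f -> fil k.+1 (chi f - f).
Proof.
move=> chi0 chi1 ux vy; elim=> [|k IH] f kf.
  by apply/fil_ev0; rewrite ev0B chi0 subrr.
apply: fil_intr => [|l]; first by rewrite ev0B chi0 subrr.
have fl : fps_deriv l f = fps_deriv ord0 f * fps_deriv l x + fps_deriv ord_max f * fps_deriv l y.
  by rewrite derivX derivY; case: (ord2_cases l) => ->; rewrite /= ?mulr1 ?mulr0 ?addr0 ?add0r.
have E : fps_deriv l (chi f - f) =
    (chi (fps_deriv ord0 f) - fps_deriv ord0 f) * fps_deriv l u +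
    (chi (fps_deriv ord_max f) - fps_deriv ord_max f) * fps_deriv l v +
    fps_deriv ord0 f * fps_deriv l (u - x) + fps_deriv ord_max f * fps_deriv l (v - y).
  by rewrite !fps_derivB chi1 fl; ring.
have kdf i : fil k (fps_deriv i f) by exact: fil_deriv.
rewrite E; apply: filD; [apply: filD; [apply: filD|]|].
- by apply: filMr; apply: IH.
- by apply: filMr; apply: IH.
- by rewrite -[k.+1]addn1; apply: filM => //; apply: fil_deriv.
- by rewrite -[k.+1]addn1; apply: filM => //; apply: fil_deriv.
Qed.

Definition jac u v : fps2 R :=
  fps_deriv ord0 u * fps_deriv ord_max v - fps_deriv ord_max u * fps_deriv ord0 v.

Section Coordinates.
Variables u v : fps2 R.
Hypotheses (u0 : fps_ev0 u = 0) (v0 : fps_ev0 v = 0) (J : fps_ev0 (jac u v) != 0).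
Local Notation phi := (fps_subst u0 v0).

(** Cramer's rule with the invertible Jacobian recovers the images under [phi] of the derivatives of
    f from the derivatives of [phi f]. *)
Lemma subst_fil_inv k f : fil k (phi f) -> fil k f.
Proof.
elim: k f => [|k IH] f kf; first exact: fil0.
apply: fil_intr => [|i].
  by rewrite -(subst_ev0 u0 v0); apply/fil_ev0; apply: filW kf.
have Ju : jac u v \is a GRing.unit by rewrite fps_unitE.
have e l : fil k (phi (fps_deriv ord0 f) * fps_deriv l u + phi (fps_deriv ord_max f) * fps_deriv l v).
  by rewrite -subst_chain; apply: fil_deriv.
apply: IH; rewrite -[phi _](mulrK Ju); apply: filMr; rewrite /jac.
case: (ord2_cases i) => ->; move: (phi _) (phi _) e => a b e.
  rewrite (_ : b * (_ - _) = fps_deriv ord_max v * (b * fps_deriv ord0 u + a * fps_deriv ord0 v) -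
    fps_deriv ord0 v * (b * fps_deriv ord_max u + a * fps_deriv ord_max v)); last by ring.
  by apply: filB; apply: filMl.
rewrite (_ : a * (_ - _) = fps_deriv ord0 u * (b * fps_deriv ord_max u + a * fps_deriv ord_max v) -
  fps_deriv ord_max u * (b * fps_deriv ord0 u + a * fps_deriv ord0 v)); last by ring.
by apply: filB; apply: filMl.
Qed.

Lemma subst_inj : injective phi.
Proof.
move=> f g fg; apply/eqP; rewrite -subr_eq0; apply/eqP; apply: (@fil_sep R 1 1) => k.
by apply: subst_fil_inv; rewrite raddfB /= fg subrr.
Qed.

(** [psi] inverts the linear part of [phi], so phi o psi is tangent to the identity, and the
    correction [psi] of the error cancels its leading form. *)
Lemma subst_surj h : exists f, phi f = h.
Proof.
pose m (w : fps2 R) i := fps_ev0 (fps_deriv i w).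
pose c : R := (fps_ev0 (jac u v))^-1.
have cJ : c * (m u ord0 * m v ord_max - m u ord_max * m v ord0) = 1.
  by rewrite -!ev0M -ev0B mulVf.
have phiC a : phi (fpsC a) = fpsC a by rewrite -[fpsC a]mulr1 -scale_fpsC linearZ /= rmorph1.
have phil a b : phi (fpsC a * x - fpsC b * y) = fpsC a * u - fpsC b * v.
  by rewrite rmorphB 2!rmorphM /= substX substY !phiC.
have l0 a b : fps_ev0 (fpsC a * x - fpsC b * y) = 0.
  by rewrite ev0B !ev0M ev0_fpsX ev0_fpsY !mulr0 subrr.
have lin a b w : fps_ev0 w = 0 -> (forall i, a * m u i - b * m v i = m w i) ->
    fil 2 (phi (fpsC a * x - fpsC b * y) - w).
  move=> w0 abw; rewrite phil; apply: fil_intr => [|i].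
    by rewrite 2!ev0B !ev0M u0 v0 w0 !mulr0 !subrr.
  apply/fil_ev0; rewrite 2!fps_derivB !fps_derivM !fps_deriv_fpsC !mul0r !add0r.
  by rewrite 2!ev0B !ev0M !ev0C -[fps_ev0 (fps_deriv i w)]/(m w i) -abw subrr.
pose psi := fps_subst (l0 (c * m v ord_max) (c * m u ord_max))
                      (l0 (- c * m v ord0) (- c * m u ord0)).
have near k f : fil k f -> fil k.+1 (phi (psi f) - f).
  apply: (@chain_near_id (phi \o psi) (phi (fpsC (c * m v ord_max) * x - fpsC (c * m u ord_max) * y))
     (phi (fpsC (- c * m v ord0) * x - fpsC (- c * m u ord0) * y))) => [{}f|l {}f||].
  - by rewrite /= !subst_ev0.
  - by rewrite /= subst_chain !subst_chain !rmorphD !rmorphM /=; ring.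
  - apply: lin => // i; rewrite /(m x) derivX ev0_nat; case: (ord2_cases i) => -> /=.
      by rewrite -cJ; ring.
    by ring.
  - apply: lin => // i; rewrite /(m y) derivY ev0_nat; case: (ord2_cases i) => -> /=.
      by ring.
    by rewrite -cJ; ring.
have [|k s t _ _ _|//|f [_ [_ _ /eqP]]] := @fil_approx R 1 1 0 0 (fun s _ => phi s - h) 0 0.
- move=> k s t s' t' ss _; have -> : phi s - h - (phi s' - h) = phi (s - s').
    by rewrite rmorphB; ring.
  exact: subst_fil.
- rewrite addn0 => kh; exists (s - psi (phi s - h)), t; split; rewrite ?subrr //.
    by rewrite addrAC subrr add0r; apply/filN/subst_fil.
  rewrite rmorphB (_ : _ - _ - _ = - (phi (psi (phi s - h)) - (phi s - h))); last by ring.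
  exact/filN/near.
by rewrite subr_eq0 => /eqP <-; exists f.
Qed.

End Coordinates.
End Substitution.

(** * Eigenvectors of a formal vector field *)

Section Dichotomy.
Variable R : rcfType.
Implicit Types (f g h u v : fps2 R) (X Y : formal_vf R) (G : set (fps2 R)) (l : R).
Local Notation fil := (fil 1 1).
Local Notation x := (fpsX R).
Local Notation y := (fpsY R).

Definition eigspace X l G := [/\ forall (a : R) f g, G f -> G g -> G (a *: f + g),
  forall g, G g -> fps_ev0 g = 0 & forall g, G g -> vfd X g = l *: g].

Definition has_factor G := exists g, [/\ G g, g != 0 & forall h, G h -> fps_dvd g h].

(* The zero sets of the series a + t b, t in R, are then infinitely many invariant curves. *)
Definition dicritical X := exists a b k, [/\ fps_coprime a b, fps_ev0 a = 0,
  fps_ev0 b = 0, vfd X a = k * a & vfd X b = k * b].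

(* The elements of G are polynomials in two coordinates u, v that are eigenvectors of X. *)
Definition eigen_monomials X l G := exists u v (a b : R),
  [/\ fps_ev0 (jac u v) != 0, vfd X u = a *: u, vfd X v = b *: v &
    forall g, G g -> exists N h, g = psubst u v N h /\
      forall i j, fps_coef h i j != 0 -> i%:R * a + j%:R * b = l].

Lemma order_ex f : f != 0 -> exists n, fil n f /\ ~ fil n.+1 f.
Proof.
move=> /nfil_ex[k kf]; have ex : exists k, `[< ~ fil k f >] by exists k; apply/asboolP.
have [[|n] /asboolP nf nmin] := ex_minnP ex; first by case: nf; exact: fil0.
exists n; split=> //; apply: contrapT => nf'; have := nmin n (introT (asboolP _) nf').
by rewrite ltnn.
Qed.

(** Take g of least order in G. If it does not divide some h, the quotient of g and h in lowest
    terms has two nonunits, the denominator by minimality, and they share a cofactor since g and h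
    have the same eigenvalue. *)
Lemma factor_or_dicritical X l G : eigspace X l G -> (exists2 g, G g & g != 0) ->
  has_factor G \/ dicritical X.
Proof.
move=> [Glin Gm GD] [g0 Gg0 /nfil_ex[k0 kg0]].
have ex : exists k, `[< exists2 g, G g & ~ fil k g >].
  by exists k0; apply/asboolP; exists g0.
have [[|k] /asboolP [g Gg kg] kmin] := ex_minnP ex; first by case: kg; exact: fil0.
have Gk h : G h -> fil k h.
  move=> Gh; apply: contrapT => kh.
  have := kmin k (introT (asboolP _) (ex_intro2 _ _ h Gh kh)); by rewrite ltnn.
have gn0 : g != 0 by apply: contra_notN kg => /eqP ->.
case: (pselect (forall h, G h -> fps_dvd g h)) => [gh|]; first by left; exists g.
move=> /existsNP[h /not_implyP[Gh ngh]]; right.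
have [d [a [b [gE hE ab]]]] := gcd_ex g h.
have d0 : d != 0 by apply: contraNneq gn0 => d0; rewrite gE d0 mul0r.
have am : fps_ev0 a = 0.
  apply/eqP; apply/negPn/negP; rewrite -fps_unitE => au; apply: ngh.
  by exists (b * a^-1); rewrite gE hE -[LHS]mulr1 -(divrr au); ring.
have bm : fps_ev0 b = 0.
  apply/eqP; apply/negPn/negP; rewrite -fps_unitE => bu; apply: kg.
  have -> : g = (a * b^-1) * h by rewrite gE hE -[LHS]mulr1 -(divrr bu); ring.
  by apply: nunit_fil; [rewrite ev0M am mul0r|exact: Gk].
have bDa : b * vfd X a = a * vfd X b.
  have := GD _ Gg; have := GD _ Gh; rewrite gE hE !vfdM => Eb Ea; apply: (mulfI d0).
  apply/eqP; rewrite -subr_eq0; apply/eqP.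
  transitivity (b * (vfd X d * a + d * vfd X a) - a * (vfd X d * b + d * vfd X b)); first by ring.
  by rewrite Ea Eb !scale_fpsC; ring.
by have [k' [Da Db]] := cofactor_ex ab bDa; exists a, b, k'.
Qed.

(** The ideal of a and b is stable under X and contains a power of each coordinate z. Were X z a
    unit, differentiating z^N would put z^(N-1) into the ideal, and in the end 1. *)
Lemma dicritical_ev0 X : dicritical X -> fps_ev0 (X ord0) = 0 /\ fps_ev0 (X ord_max) = 0.
Proof.
move=> [a [b [k [ab am bm Da Db]]]].
suff aux z : (exists N u v, z ^+ N = u * a + v * b) -> fps_ev0 (vfd X z) = 0.
  by split; [rewrite -vfd_fpsX|rewrite -vfd_fpsY]; apply: aux; [exact: X_ideal|exact: Y_ideal].
move=> [N]; apply: contraPP => /eqP; rewrite -fps_unitE => zu.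
elim: N => [|N IH] [u [v]].
  move=> /(congr1 (@fps_ev0 _)); rewrite expr0 ev01 ev0D !ev0M am bm !mulr0 addr0.
  by move/eqP; rewrite oner_eq0.
move=> /(congr1 (vfd X)); rewrite vfdX vfdD !vfdM Da Db => E; apply: IH.
pose w : fps2 R := N.+1%:R * vfd X z.
have wu : w \is a GRing.unit by rewrite unitrM zu andbT fps_unitE ev0_nat pnatr_eq0.
exists ((vfd X u + u * k) * w^-1), ((vfd X v + v * k) * w^-1).
rewrite -[LHS](mulrK wu) (_ : _ * w = N.+1%:R * z ^+ N * vfd X z); last by rewrite /w; ring.
by rewrite E; ring.
Qed.

Definition linear_part X p0 q0 p1 q1 :=
  fil 2 (X ord0 - (p0 *: x + q0 *: y)) /\ fil 2 (X ord_max - (p1 *: x + q1 *: y)).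

Lemma vfd_leading X p0 q0 p1 q1 g n : linear_part X p0 q0 p1 q1 -> fil n g ->
  fil n.+1 (vfd X g - ((p0 *: x + q0 *: y) * fps_deriv ord0 g +
                       (p1 *: x + q1 *: y) * fps_deriv ord_max g)).
Proof.
move=> [X0 X1] ng; rewrite vf_applyE (_ : _ - _ =
  (X ord0 - (p0 *: x + q0 *: y)) * fps_deriv ord0 g +
  (X ord_max - (p1 *: x + q1 *: y)) * fps_deriv ord_max g); last by ring.
have dg i : fil n.-1 (fps_deriv i g).
  by case: n ng => [|n] ng; [exact: fil0|exact: fil_deriv].
have le : (n.+1 <= 2 + n.-1)%N by case: (n).
by apply: filD; apply: (filW le); apply: filM.
Qed.

Lemma coef_vfd_leading X p0 q0 p1 q1 g n i j : linear_part X p0 q0 p1 q1 ->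
  fil n g -> (i + j = n)%N ->
  fps_coef (vfd X g) i j = p0 * (i%:R * fps_coef g i j) +
    q0 * (if j is j'.+1 then i.+1%:R * fps_coef g i.+1 j' else 0) +
    (p1 * (if i is i'.+1 then j.+1%:R * fps_coef g i' j.+1 else 0) +
     q1 * (j%:R * fps_coef g i j)).
Proof.
move=> lX ng ij; have := vfd_leading lX ng; move/(_ i j); rewrite !mul1n ij ltnSn => /(_ isT).
rewrite coefB => /eqP; rewrite subr_eq0 => /eqP ->; rewrite coefD 2!mulrDl !coefD -!scalerAl !coefZ !coefXM !coefYM.
congr (_ * _ + _ * _ + (_ * _ + _ * _)).
- by case: (i) => [|i']; rewrite ?mul0r // coef_deriv0 mulr_natl.
- by case: (j) => [//|j']; rewrite coef_deriv0 mulr_natl.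
- by case: (i) => [//|i']; rewrite coef_deriv1 mulr_natl.
- by case: (j) => [|j']; rewrite ?mul0r // coef_deriv1 mulr_natl.
Qed.

Lemma fil_top n g : fil n g -> (forall j, (j <= n)%N -> fps_coef g (n - j) j = 0) -> fil n.+1 g.
Proof.
move=> ng gj i j; rewrite !mul1n ltnS leq_eqVlt => /orP[/eqP ij|ij]; last by rewrite ng ?mul1n.
by rewrite -(gj j) -ij ?leq_addl // addnK.
Qed.

(** The coefficient of x^n is an injective linear form, so G is a line. *)
Lemma functional_factor G : (forall (a : R) f g, G f -> G g -> G (a *: f + g)) ->
  (exists2 g, G g & g != 0) ->
  (exists n, forall g, G g -> fps_coef g n 0 = 0 -> g = 0) -> has_factor G.
Proof.
move=> Glin [g Gg g0] [n nP]; exists g; split=> // h Gh.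
have c0 : fps_coef g n 0 != 0 by apply: contraNneq g0 => /(nP g Gg) ->.
pose a : R := - (fps_coef h n 0 / fps_coef g n 0).
have /eqP : a *: g + h = 0.
  by apply: nP; [exact: Glin|rewrite coefD coefZ /a mulNr divfK // addNr].
rewrite addrC addr_eq0 => /eqP ->; rewrite scale_fpsC -mulNr.
by exists (- fpsC a).
Qed.

(** * Jordan blocks and foci *)

Section Cyclic.
Variables (X : formal_vf R) (l al de : R).
Hypotheses (de0 : de <= 0) (lX : linear_part X al de 1 al).

(** The linear part has eigenvalues al +- sqrt(de). Its Euler part multiplies forms of degree n by n
    al and is moved to the left; de y d/dx + x d/dy maps a monomial to its two neighbours. *)
Lemma cyclic_recurrence g n j : fil n g -> vfd X g = l *: g -> (j <= n)%N ->
  (l - n%:R * al) * fps_coef g (n - j) j =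
  de * (if j is j'.+1 then (n - j')%:R * fps_coef g (n - j') j' else 0) +
  (if (j < n)%N then j.+1%:R * fps_coef g (n - j.+1) j.+1 else 0).
Proof.
move=> ng Dg jn; have ij : (n - j + j = n)%N by rewrite subnK.
have nE : n%:R = (n - j)%:R + j%:R :> R by rewrite -natrD ij.
rewrite mulrBl -coefZ -Dg (coef_vfd_leading lX ng ij) nE.
have -> : (if j is j'.+1 then (n - j).+1%:R * fps_coef g (n - j).+1 j' else 0) =
    (if j is j'.+1 then (n - j')%:R * fps_coef g (n - j') j' else 0) :> R.
  by case: j jn {ij nE} => // j jn; rewrite -subSn.
have -> : (if (n - j)%N is i'.+1 then j.+1%:R * fps_coef g i' j.+1 else 0) =
    (if (j < n)%N then j.+1%:R * fps_coef g (n - j.+1) j.+1 else 0) :> R.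
  by rewrite -subn_gt0; case E: (n - j)%N => [//|i']; rewrite subnS E.
by move: (if _ is _.+1 then _ else _) (if _ then _ else _) => s t; ring.
Qed.

(* The infinitesimal rotation is skew for the inner product on homogeneous
   polynomials of degree n with squared norms i! j! (-de)^i. *)
Lemma cyclic_degree g n : fil n g -> ~ fil n.+1 g -> vfd X g = l *: g -> l = n%:R * al.
Proof.
move=> ng ng' Dg; apply/eqP; rewrite -subr_eq0; apply/negPn/negP => e0; apply: ng'.
apply: fil_top => // j jn; have rec := cyclic_recurrence ng Dg.
have := de0; rewrite le_eqVlt => /orP[/eqP d0|dn].
  (* For a Jordan block the recurrence is triangular and is solved from j = n downwards. *)
  rewrite -(subKn jn); move: (n - j)%N (leq_subr j n) => m {jn j}.
  elim: m => [|m IH] mn; apply: (mulfI e0); rewrite mulr0 rec ?leq_subr // d0 mul0r add0r.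
    by rewrite subn0 ltnn.
  by rewrite ltn_subrL /= (leq_trans _ mn) // -subSn // subSS IH ?mulr0 // ltnW.
pose c j := fps_coef g (n - j) j.
pose w j : R := (n - j)`!%:R * j`!%:R * (- de) ^+ (n - j).
have w0 k : 0 < w k by rewrite !mulr_gt0 ?ltr0n ?fact_gt0 // exprn_gt0 // oppr_gt0.
pose F k := w k * c k * (de * (if k is k'.+1 then (n - k')%:R * c k' else 0)).
pose B k := w k * c k * (if (k < n)%N then k.+1%:R * c k.+1 else 0).
have FB k : (k < n)%N -> F k.+1 = - B k.
  move=> kn; rewrite /F /B kn /w; have -> : (n - k = (n - k.+1).+1)%N by rewrite -subSn.
  by rewrite !factS !natrM exprS; ring.
have : (l - n%:R * al) * \sum_(k < n.+1) w k * c k ^+ 2 = 0.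
  transitivity (\sum_(k < n.+1) (F k + B k)).
    rewrite mulr_sumr; apply: eq_bigr => -[k /= kn] _.
    by rewrite /F /B -mulrDr -rec //; rewrite /c; ring.
  rewrite big_split /= big_ord_recl [X in _ + X]big_ord_recr /= {1}/F {2}/B ltnn !mulr0 add0r addr0.
  by rewrite -big_split big1 // => -[k /= kn] _; rewrite /bump /= add1n FB // addNr.
move/eqP; rewrite mulf_eq0 (negPf e0) /= psumr_eq0 => [/allP /(_ (Ordinal (jn : (j < n.+1)%N)))|i _].
  by rewrite mem_index_enum /= => /(_ isT); rewrite mulf_eq0 gt_eqF //= sqrf_eq0 => /eqP.
by rewrite mulr_ge0 ?sqr_ge0 // ltW.
Qed.

(** All nonzero elements of G have the order n with l = n al. The left side of the recurrence is
    then 0, so the coefficient of x^n determines the whole leading form. *)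
Lemma cyclic_functional G : eigspace X l G -> l != 0 ->
  exists n, forall g, G g -> fps_coef g n 0 = 0 -> g = 0.
Proof.
move=> [_ Gm GD] l0; case: (pselect (exists2 g, G g & g != 0)) => [[g Gg g0]|nG]; last first.
  exists 0%N => g Gg _; apply/eqP/negPn/negP => g0; by apply: nG; exists g.
have [n [ng ng']] := order_ex g0; have ln := cyclic_degree ng ng' (GD _ Gg).
exists n => h Gh hn; apply/eqP/negPn/negP => h0.
have [m [mh mh']] := order_ex h0; have lm := cyclic_degree mh mh' (GD _ Gh).
have al0 : al != 0 by apply: contraNneq l0 => al0; rewrite ln al0 mulr0.
have nm : m = n by apply/eqP; rewrite -(eqr_nat R); apply/eqP/(mulIf al0); rewrite -ln -lm.
subst m; apply: mh'; apply: fil_top => //.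
have rec := cyclic_recurrence mh (GD _ Gh); rewrite -ln subrr in rec.
suff aux j : ((j <= n)%N -> fps_coef h (n - j) j = 0) /\ ((j.+1 <= n)%N -> fps_coef h (n - j.+1) j.+1 = 0).
  by move=> j; have [] := aux j.
elim: j => [|j [IH1 IH2]]; split=> // jn; first by rewrite subn0.
  have := rec 0%N isT; rewrite mul0r mulr0 add0r jn mul1r => <- //.
have := rec j.+1 (ltnW jn); rewrite mul0r jn IH1 ?(ltnW (ltnW jn)) // !mulr0 add0r.
by move/esym/eqP; rewrite mulf_eq0 pnatr_eq0 /= => /eqP.
Qed.

End Cyclic.
End Dichotomy.

(** * Changes of coordinates *)

Section CoordinateChanges.
Variable R : rcfType.
Implicit Types (f g h u v : fps2 R) (X Y : formal_vf R) (G : set (fps2 R)) (l : R).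
Local Notation fil := (fil 1 1).
Local Notation x := (fpsX R).
Local Notation y := (fpsY R).

Definition factor_or_monomials X l G := has_factor G \/ eigen_monomials X l G.

Definition dicritical_eigspace X l G :=
  [/\ eigspace X l G, exists2 g, G g & g != 0 & dicritical X].

(** Y and G' are X and G in the coordinates u, v. The last clause sends the hypotheses to the new
    coordinates and brings the conclusion back, so normal forms may be assumed. *)
Lemma coordinates_wlog X l G u v (u0 : fps_ev0 u = 0) (v0 : fps_ev0 v = 0) :
  fps_ev0 (jac u v) != 0 -> exists Y G',
  [/\ fps_subst u0 v0 (Y ord0) = vfd X u, fps_subst u0 v0 (Y ord_max) = vfd X v,
      forall f, vfd X (fps_subst u0 v0 f) = fps_subst u0 v0 (vfd Y f),
      dicritical X -> dicritical Y &
      (dicritical_eigspace X l G -> dicritical_eigspace Y l G') /\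
      (factor_or_monomials Y l G' -> factor_or_monomials X l G)].
Proof.
move=> J; set phi := fps_subst u0 v0.
have [[Y0 Y0E] [Y1 Y1E]] := (subst_surj u0 v0 J (vfd X u), subst_surj u0 v0 J (vfd X v)).
pose Y : formal_vf R := [ffun i => if i == ord0 then Y0 else Y1].
have YX f : vfd X (phi f) = phi (vfd Y f) by apply: subst_vfd; rewrite ffunE.
have inj : injective phi by exact: subst_inj.
have phiZ (a : R) f : phi (a *: f) = a *: phi f by exact: linearZZ.
have phiM f g : phi (f * g) = phi f * phi g by exact: rmorphM.
have phi1 : phi 1 = 1 by exact: rmorph1.
have phi0 : phi 0 = 0 by exact: raddf0.
have phiD f g : phi (f + g) = phi f + phi g by exact: raddfD.
have phi_ev0 f : fps_ev0 (phi f) = fps_ev0 f by exact: subst_ev0.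
have dic : dicritical X -> dicritical Y.
  move=> [a [b [k [ab am bm Da Db]]]].
  have [[a' aE] [b' bE]] := (subst_surj u0 v0 J a, subst_surj u0 v0 J b).
  have [k' kE] := subst_surj u0 v0 J k; rewrite -/phi in aE bE kE.
  exists a', b', k'; split.
  - move=> d [p pE] [q qE].
    have [||r rE] := ab (phi d).
    + by exists (phi p); rewrite -aE pE.
    + by exists (phi q); rewrite -bE qE.
    have [r' r'E] := subst_surj u0 v0 J r.
    by exists r'; apply: inj; rewrite phi1 phiM rE -r'E.
  - by rewrite -phi_ev0 aE.
  - by rewrite -phi_ev0 bE.
  - by apply: inj; rewrite -YX aE Da phiM kE aE.
  - by apply: inj; rewrite -YX bE Db phiM kE bE.
exists Y, [set f | G (phi f)]; split=> //; rewrite ?ffunE //; split.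
  move=> [[Glin Gm GD] [g Gg g0] dX]; split; [split|..].
  - by move=> a f h /= Gf Gh; rewrite phiD phiZ; apply: Glin.
  - by move=> f /= /Gm; rewrite phi_ev0.
  - by move=> f /= /GD; rewrite YX -phiZ => /inj.
  - have [g' gE] := subst_surj u0 v0 J g; exists g'; first by rewrite /= /phi gE.
    by apply: contraNneq g0 => g'0; rewrite -gE -/phi g'0 phi0.
  - exact: dic.
case=> [[g [Gg g0 gh]]|[u' [v' [a [b [J' Du Dv mono]]]]]]; [left|right].
  exists (phi g); split=> //; first by rewrite -(inj_eq inj) phi0 in g0.
  move=> h Gh; have [h' hE] := subst_surj u0 v0 J h.
  have [|k kE] := gh h'; first by rewrite /= /phi hE.
  by exists (phi k); rewrite -hE kE -phiM.
exists (phi u'), (phi v'), a, b; split.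
- have -> : jac (phi u') (phi v') = phi (jac u' v') * jac u v.
    by rewrite /jac /phi !subst_chain rmorphB !rmorphM /=; ring.
  by rewrite ev0M mulf_neq0 // subst_ev0.
- by rewrite YX Du phiZ.
- by rewrite YX Dv phiZ.
- move=> g Gg; have [g' gE] := subst_surj u0 v0 J g.
  have [|N [h [g'E hE]]] := mono g'; first by rewrite /= /phi gE.
  exists N, h; split; last exact: hE.
  by rewrite -gE g'E; exact: subst_psubst.
Qed.

Lemma linear_part_ev0 X p0 q0 p1 q1 : linear_part X p0 q0 p1 q1 ->
  fil 1 (X ord0) /\ fil 1 (X ord_max).
Proof.
move=> [X0 X1]; have aux (p q : R) : fil 1 (p *: x + q *: y).
  by apply/fil_ev0; rewrite ev0D !scale_fpsC !ev0M ev0_fpsX ev0_fpsY !mulr0 addr0.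
split; [rewrite -[X ord0](subrK (p0 *: x + q0 *: y))|
        rewrite -[X ord_max](subrK (p1 *: x + q1 *: y))]; apply: filD => //; exact: filW (_ : 1 <= 2)%N _.
Qed.

Lemma linear_part_ex X : fps_ev0 (X ord0) = 0 -> fps_ev0 (X ord_max) = 0 ->
  exists p0 q0 p1 q1, linear_part X p0 q0 p1 q1.
Proof.
suff aux f : fps_ev0 f = 0 -> fil 2 (f - (fps_coef f 1 0 *: x + fps_coef f 0 1 *: y)).
  by move=> /aux X0 /aux X1; do 4 eexists; split; eassumption.
move=> f0 [|[|m]] [|[|n]] //= _; rewrite ?mulr0 ?mulr1 ?addr0 ?add0r ?subrr ?subr0 //.
Qed.

Lemma vfd_fil X k f : fil 1 (X ord0) -> fil 1 (X ord_max) -> fil k f -> fil k (vfd X f).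
Proof.
move=> X0 X1 kf; case: k kf => [|k] kf; first exact: fil0.
by rewrite vf_applyE -[k.+1]add1n; apply: filD; apply: filM => //; apply: fil_deriv.
Qed.

(** The four equations say P M = M' P, where P has rows (a, b) and (c, d) and M, M' are the linear
    parts. *)
Lemma linear_coordinates X p0 q0 p1 q1 l G (a b c d r0 s0 r1 s1 : R) :
  linear_part X p0 q0 p1 q1 -> dicritical_eigspace X l G -> a * d - b * c != 0 ->
  a * p0 + b * p1 = r0 * a + s0 * c -> a * q0 + b * q1 = r0 * b + s0 * d ->
  c * p0 + d * p1 = r1 * a + s1 * c -> c * q0 + d * q1 = r1 * b + s1 * d ->
  (forall Y G', linear_part Y r0 s0 r1 s1 -> dicritical_eigspace Y l G' ->
     factor_or_monomials Y l G') -> factor_or_monomials X l G.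
Proof.
move=> lX dX J E1 E2 E3 E4 IH.
have lin0 p q : fps_ev0 (p *: x + q *: y) = 0.
  by rewrite ev0D !scale_fpsC !ev0M ev0_fpsX ev0_fpsY !mulr0 addr0.
have dl p q i : fps_deriv i (p *: x + q *: y) = fpsC (if i == ord0 then p else q).
  rewrite fps_derivD !linearZ /= derivX derivY.
  by case: (ord2_cases i) => ->; rewrite /= ?scaler0 ?addr0 ?add0r scale_fpsC mulr1.
pose u : fps2 R := a *: x + b *: y; pose v : fps2 R := c *: x + d *: y.
have J' : fps_ev0 (jac u v) != 0 by rewrite /jac ev0B !ev0M /u /v !dl !ev0C.
have [Y [G' [Y0 Y1 YX _ [dYG concl]]]] := coordinates_wlog X l G (lin0 a b) (lin0 c d) J'.
apply: concl; apply: IH (dYG dX).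
have Dl p q : fil 2 (vfd X (p *: x + q *: y) - ((p * p0 + q * p1) *: x + (p * q0 + q * q1) *: y)).
  have [X0 X1] := lX; rewrite vfdD !vfdZ vfd_fpsX vfd_fpsY.
  rewrite (_ : _ - _ = p *: (X ord0 - (p0 *: x + q0 *: y)) + q *: (X ord_max - (p1 *: x + q1 *: y))).
    by apply: filD; apply: filZ.
  by rewrite !scale_fpsC !rmorphD !rmorphM /=; ring.
have comb r s : fps_subst (lin0 a b) (lin0 c d) (r *: x + s *: y) =
    (r * a + s * c) *: x + (r * b + s * d) *: y.
  rewrite raddfD /= 2!linearZ /= substX substY /u /v !scale_fpsC !rmorphD !rmorphM /=; ring.
have inv2 f : fil 2 (fps_subst (lin0 a b) (lin0 c d) f) -> fil 2 f.
  exact: (@subst_fil_inv R u v (lin0 a b) (lin0 c d) J' 2 f).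
split; apply: inv2.
  by rewrite rmorphB /= comb Y0 -E1 -E2; exact: Dl.
by rewrite rmorphB /= comb Y1 -E3 -E4; exact: Dl.
Qed.
End CoordinateChanges.

(** * Separatrices and saddles *)

Section Linearization.
Variable R : rcfType.
Implicit Types (f g h u v : fps2 R) (X Y : formal_vf R) (G : set (fps2 R)) (l : R).
Local Notation fil := (fil 1 1).
Local Notation x := (fpsX R).
Local Notation y := (fpsY R).

Lemma fil_x : fil 1 x. Proof. exact/fil_ev0/ev0_fpsX. Qed.
Lemma fil_y : fil 1 y. Proof. exact/fil_ev0/ev0_fpsY. Qed.

Lemma linear_part_swap X m1 m2 l G : linear_part X m1 0 0 m2 ->
  dicritical_eigspace X l G ->
  (forall Y G', linear_part Y m2 0 0 m1 -> dicritical_eigspace Y l G' ->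
     factor_or_monomials Y l G') -> factor_or_monomials X l G.
Proof.
move=> lX dX; apply: (@linear_coordinates _ X m1 0 0 m2 l G 0 1 1 0) => //.
  by rewrite mul0r mul1r sub0r oppr_eq0 oner_neq0.
all: by rewrite ?(mul0r, mulr0, mul1r, mulr1, addr0, add0r).
Qed.

Local Notation sw := (fps_subst (@ev0_fpsY R) (@ev0_fpsX R)).

Lemma jac_swap : fps_ev0 (jac y x) != 0.
Proof.
by rewrite /jac ev0B !ev0M !derivX !derivY !ev0_nat !(mul0r, mul1r) sub0r oppr_eq0 oner_neq0.
Qed.

Lemma swap_coordinates X : exists Y : formal_vf R,
  [/\ sw (Y ord0) = X ord_max, sw (Y ord_max) = X ord0 &
      forall f, vfd X (sw f) = sw (vfd Y f)].
Proof.
have [[Y0 Y0E] [Y1 Y1E]] := (subst_surj (@ev0_fpsY R) (@ev0_fpsX R) jac_swap (X ord_max),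
  subst_surj (@ev0_fpsY R) (@ev0_fpsX R) jac_swap (X ord0)).
exists [ffun i => if i == ord0 then Y0 else Y1]; split; rewrite ?ffunE //.
by move=> f; apply: subst_vfd; rewrite ffunE /= ?Y0E ?Y1E (vfd_fpsX, vfd_fpsY).
Qed.

Lemma linear_part_swapped X Y m1 m2 : linear_part X m1 0 0 m2 ->
  sw (Y ord0) = X ord_max -> sw (Y ord_max) = X ord0 -> linear_part Y m2 0 0 m1.
Proof.
move=> [X0 X1] Y0 Y1.
have inv2 f : fil 2 (sw f) -> fil 2 f.
  exact: (@subst_fil_inv R y x (@ev0_fpsY R) (@ev0_fpsX R) jac_swap 2 f).
have sl (p q : R) : sw (p *: x + q *: y) = q *: x + p *: y.
  by rewrite raddfD /= 2!linearZ /= substX substY addrC.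
by split; apply: inv2; rewrite [sw (_ - _)]raddfB /= sl ?Y0 ?Y1.
Qed.

Lemma fil_row_top k p : fil k.+1 p -> exists g, fil k g /\
  fil k.+2 (p - x * g - fps_coef p 0 k.+1 *: y ^+ k.+1).
Proof.
move=> kp; exists (Fps2 (fun m n => fps_coef p m.+1 n)); split.
  by move=> m n mn; apply: kp; move: mn; rewrite !mul1n addSn ltnS.
move=> m n; rewrite !mul1n ltnS => mn; rewrite 2!coefB coefXM coefZ.
have := monoE R 0 k.+1; rewrite expr0 mul1r => <-.
case: m mn => [|m] mn /=; last by rewrite subrr mulr0 subr0.
rewrite subr0; case: (ltngtP n k.+1) => [nk|kn|->]; last by rewrite mulr1 subrr.
  by rewrite kp ?mul1n // mulr0 subr0.
by move: mn; rewrite add0n leqNgt kn.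
Qed.

(** The unknowns are s in u = x + y s and the cofactor t. In the leading form of the error,
    multiples of x are absorbed by t, and the remaining power of y by s, because its exponent times
    m2 differs from m1. *)
Lemma separatrix X m1 m2 : linear_part X m1 0 0 m2 ->
  (forall k, (2 <= k)%N -> k%:R * m2 != m1) ->
  exists u k, [/\ fil 2 (u - x), fps_ev0 k = m1 & vfd X u = k * u].
Proof.
move=> lX nr; have [X0 X1] := lX; have [fX0 fX1] := linear_part_ev0 lX.
rewrite !scale0r addr0 add0r in X0 X1.
pose Phi s t : fps2 R := vfd X (x + y * s) - t * (x + y * s).
have [|k s t k1 s1 t1 Pst||s [t [s1 t1 /eqP]]] := @fil_approx R 1 1 1 1 Phi 0 (fpsC m1).
- move=> k s t s' t' ss tt; rewrite /Phi; apply: filBB.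
    rewrite -vfdB; apply: vfd_fil => //.
    by rewrite (_ : _ - _ = y * (s - s')); [apply: filMl|ring].
  apply: filMB => //; rewrite (_ : _ - _ = y * (s - s')); last by ring.
  exact: filMl.
- rewrite addn1 in Pst *; rewrite subr0 in s1; set p := Phi s t in Pst.
  have [g [gk pg]] := fil_row_top Pst; move: (fps_coef p 0 k.+1) pg => c pg.
  pose e : R := k.+1%:R * m2 - m1; have e0 : e != 0 by rewrite subr_eq0 nr.
  have yk n : fil n (y ^+ n) by rewrite -[X in fil X]muln1; apply: filX; exact: fil_y.
  have Dyk : fil k.+2 (vfd X (y ^+ k.+1) - (k.+1%:R * m2) *: y ^+ k.+1).
    rewrite vfdX vfd_fpsY (_ : _ - _ = k.+1%:R * (y ^+ k * (X ord_max - m2 *: y))).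
      by apply: filMl; rewrite -[k.+2]addn2; apply: filM.
    by rewrite exprS !scale_fpsC rmorphM rmorph_nat; ring.
  pose a := - (c / e); exists (s + a *: y ^+ k), (t + g); split.
  + by rewrite addrAC subrr add0r; apply: filZ.
  + by rewrite addrAC subrr add0r.
  have ce : c *: y ^+ k.+1 = - (a *: (e *: y ^+ k.+1)).
    by rewrite scalerA -scaleNr /a mulNr opprK divfK.
  rewrite (_ : Phi _ _ = (p - x * g - c *: y ^+ k.+1) +
      a *: (vfd X (y ^+ k.+1) - (k.+1%:R * m2) *: y ^+ k.+1) -
      (t - fpsC m1) * (a *: y ^+ k.+1) - g * (y * s) - g * (a *: y ^+ k.+1)); last first.
    rewrite ce /Phi /p /Phi (_ : x + y * (s + a *: y ^+ k) = x + y * s + a *: y ^+ k.+1).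
      rewrite [vfd X (x + y * s + _)]vfdD [vfd X (a *: _)]vfdZ /e !scale_fpsC rmorphB; ring.
    by rewrite exprS !scale_fpsC; ring.
  apply: filB; last first.
    apply: (@filW _ 1 1 (k + k.+1)); first by lia.
    by apply: filM => //; apply: filZ.
  apply: filB; last first.
    rewrite -[k.+2]addn2; apply: filM => //; rewrite -[2%N]/(1 + 1)%N.
    by apply: filM => //; exact: fil_y.
  apply: filB; last by rewrite -[k.+2]add1n; apply: filM => //; apply: filZ.
  by apply: filD => //; apply: filZ.
- rewrite /Phi mulr0 addr0 vfd_fpsX -scale_fpsC; exact: X0.
rewrite subr_eq0 => /eqP E; exists (x + y * s), t; split=> //.
  rewrite addrAC subrr add0r -[2%N]/(1 + 1)%N; apply: filM; first exact: fil_y.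
  by rewrite subr0 in s1.
by have /fil_ev0 := t1; rewrite ev0B ev0C => /eqP; rewrite subr_eq0 => /eqP.
Qed.

Lemma row0_form a : fps_ev0 a = 0 -> ~ fps_dvd x a ->
  exists n w d, a = y ^+ n.+1 * w + x * d /\ fps_ev0 w != 0.
Proof.
move=> a0 xa; have [|[|n] [an0 an]] := @y_regularP _ a.
- by move=> /row0_eq0.
- by move: an; rewrite -[fps_coef a 0 0]/(fps_ev0 a) a0 eqxx.
exists n, (Fps2 (fun i j => if i is 0%N then fps_coef a 0 (n.+1 + j) else 0)),
  (Fps2 (fun i j => fps_coef a i.+1 j)); split; last by rewrite /fps_ev0 /= addn0.
have := monoE R 0 n.+1; rewrite expr0 mul1r => <-.
apply: fps2P => i j; rewrite coefD coefXM coef_monoM subn0.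
case: i => [|i] /=; last by rewrite if_same add0r.
by rewrite addr0; case: ltnP => [nj|/an0 //]; rewrite subnKC.
Qed.

(** On the invariant axis x = 0 the series a has some order n + 1 in y, and comparing lowest terms
    in Y a = k a gives the constant term of k. *)
Lemma axis_eigenvalue Y A B a k : fil 1 (Y ord0) -> fil 1 (Y ord_max) ->
  Y ord0 = A * x -> Y ord_max = B * y -> fps_ev0 a = 0 -> ~ fps_dvd x a ->
  vfd Y a = k * a -> exists n : nat, fps_ev0 k = n.+1%:R * fps_ev0 B.
Proof.
move=> fY0 fY1 Y0 Y1 a0 xa Da; have [n [w [d [aE w0]]]] := row0_form a0 xa; exists n.
have xy : ~ fps_dvd x (y ^+ n.+1).
  move=> /row0_eq0; have := monoE R 0 n.+1; rewrite expr0 mul1r => <-.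
  by move=> /(congr1 (fun f => fps_coef f 0 n.+1)) /= /eqP; rewrite eqxx oner_eq0.
have : fps_dvd x (y ^+ n.+1 * (n.+1%:R * B * w + vfd Y w - k * w)).
  exists (k * d - A * d - vfd Y d).
  have : vfd Y a - k * a = 0 by rewrite Da subrr.
  rewrite aE vfdD !vfdM vfdX vfd_fpsX vfd_fpsY Y0 Y1 => E.
  apply/eqP; rewrite -subr_eq0 -[X in _ == X]E; apply/eqP; rewrite exprS; ring.
case/X_prime => // -[q /(congr1 (@fps_ev0 R))]; rewrite ev0M ev0_fpsX mulr0.
rewrite ev0B ev0D !ev0M ev0_nat (_ : fps_ev0 (vfd Y w) = 0); last first.
  by apply/fil_ev0; rewrite vf_applyE; apply: filD; apply: filMr.
move=> /eqP; rewrite addr0 -mulrBl mulf_eq0 (negPf w0) orbF subr_eq0 => /eqP <- //.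
Qed.

Lemma near_coordinates u v : fil 2 (u - x) -> fil 2 (v - y) ->
  [/\ fps_ev0 u = 0, fps_ev0 v = 0 & fps_ev0 (jac u v) = 1].
Proof.
move=> ux vy; have near (a b : fps2 R) : fil 2 (a - b) -> fps_ev0 a = fps_ev0 b /\
    forall i, fps_ev0 (fps_deriv i a) = fps_ev0 (fps_deriv i b).
  move=> ab; split=> [|i]; apply/eqP; rewrite -subr_eq0; apply/eqP.
    by rewrite -ev0B; apply/fil_ev0; apply: filW ab.
  by rewrite -ev0B -fps_derivB; apply/fil_ev0; apply: fil_deriv.
have [u0 du] := near _ _ ux; have [v0 dv] := near _ _ vy; split; rewrite ?u0 ?v0 //.
by rewrite /jac ev0B !ev0M !du !dv !derivX !derivY !ev0_nat !(mul0r, mulr1) subr0.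
Qed.

(** One of a, b does not vanish on the axis x = 0, so k(0) is a positive multiple of B(0); the axis
    y = 0 makes it a positive multiple of A(0). *)
Lemma axes_not_dicritical Y A B : Y ord0 = A * x -> Y ord_max = B * y ->
  0 < fps_ev0 A -> fps_ev0 B <= 0 -> ~ dicritical Y.
Proof.
move=> Y0 Y1 A0 B0 [a [b [k [ab am bm Da Db]]]].
have fY0 : fil 1 (Y ord0) by rewrite Y0; apply: filMl; exact: fil_x.
have fY1 : fil 1 (Y ord_max) by rewrite Y1; apply: filMl; exact: fil_y.
have knonpos : fps_ev0 k <= 0.
  have [n ->] : exists n : nat, fps_ev0 k = n.+1%:R * fps_ev0 B.
    case: (pselect (fps_dvd x a)) => [xa|xa]; last exact: (axis_eigenvalue fY0 fY1 Y0 Y1 am xa Da).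
    apply: (axis_eigenvalue fY0 fY1 Y0 Y1 bm _ Db) => xb.
    by have /dvd1P := ab x xa xb; rewrite fps_unitE ev0_fpsX eqxx.
  by rewrite pmulr_rle0 // ltr0n.
have [Z [Z0 Z1 YZ]] := swap_coordinates Y.
have surj h := subst_surj (@ev0_fpsY R) (@ev0_fpsX R) jac_swap h.
have inj : injective sw by exact: subst_inj jac_swap.
have [[a' aE] [b' bE]] := (surj a, surj b); have [[A' AE] [B' BE]] := (surj A, surj B).
have [k' kE] := surj k.
have swM f g : sw (f * g) = sw f * sw g by exact: rmorphM.
have evs f : fps_ev0 (sw f) = fps_ev0 f by exact: subst_ev0.
have Z0' : Z ord0 = B' * x by apply: inj; rewrite swM Z0 Y1 BE substX.
have Z1' : Z ord_max = A' * y by apply: inj; rewrite swM Z1 Y0 AE substY.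
have fZ0 : fil 1 (Z ord0) by rewrite Z0'; apply: filMl; exact: fil_x.
have fZ1 : fil 1 (Z ord_max) by rewrite Z1'; apply: filMl; exact: fil_y.
have D' c c' : sw c' = c -> vfd Y c = k * c -> vfd Z c' = k' * c'.
  by move=> cE Dc; apply: inj; rewrite swM -YZ kE cE.
suff : 0 < fps_ev0 k by rewrite ltNge knonpos.
have [n] : exists n : nat, fps_ev0 k' = n.+1%:R * fps_ev0 A'.
  case: (pselect (fps_dvd x a')) => [[c cE]|xa].
    apply: (axis_eigenvalue fZ0 fZ1 Z0' Z1' _ _ (D' _ _ bE Db)).
      by rewrite -evs bE.
    move=> [d dE]; have /dvd1P : fps_dvd y 1.
      apply: ab; [exists (sw c)|exists (sw d)].
        by rewrite -aE cE swM substX.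
      by rewrite -bE dE swM substX.
    by rewrite fps_unitE ev0_fpsY eqxx.
  by apply: (axis_eigenvalue fZ0 fZ1 Z0' Z1' _ xa (D' _ _ aE Da)); rewrite -evs aE.
by rewrite -(evs k') kE -(evs A') AE => ->; rewrite mulr_gt0 // ltr0n.
Qed.

(** The signs exclude the resonances in [separatrix] for both axes, also for a saddle-node m2 = 0.
    The two separatrices taken as coordinates make the axes invariant. *)
Lemma saddle_not_dicritical X m1 m2 : linear_part X m1 0 0 m2 -> 0 < m1 -> m2 <= 0 ->
  ~ dicritical X.
Proof.
move=> lX m1p m2n dX.
have [|u [k1 [ux k10 Du]]] := separatrix lX.
  move=> k k2; rewrite lt_eqF // (le_lt_trans _ m1p) // mulr_ge0_le0 //.
have [Z [Z0 Z1 ZX]] := swap_coordinates X.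
have lZ := linear_part_swapped lX Z0 Z1.
have [|v' [k2 [vy k20 Dv']]] := separatrix lZ.
  by move=> k k2; rewrite gt_eqF // (le_lt_trans m2n) // mulr_gt0 // ltr0n; lia.
pose v := sw v'; have {}vy : fil 2 (v - y).
  have <- : sw (v' - x) = v - y by rewrite /v [LHS]raddfB /= substX.
  exact: subst_fil.
have Dv : vfd X v = sw k2 * v by rewrite /v ZX Dv' rmorphM.
have [u0 v0 J] := near_coordinates ux vy.
have J0 : fps_ev0 (jac u v) != 0 by rewrite J oner_neq0.
have [Y [_ [Y0 Y1 YX dic _]]] := coordinates_wlog X 0 setT u0 v0 J0.
have [[A AE] [B BE]] := (subst_surj u0 v0 J0 k1, subst_surj u0 v0 J0 (sw k2)).
have inj : injective (fps_subst u0 v0) by exact: subst_inj.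
apply: (@axes_not_dicritical Y A B) (dic dX).
- by apply: inj; rewrite Y0 Du rmorphM /= substX AE.
- by apply: inj; rewrite Y1 Dv rmorphM /= substY BE.
- by rewrite -(subst_ev0 u0 v0) AE k10.
- by rewrite -(subst_ev0 u0 v0) BE subst_ev0 k20.
Qed.

End Linearization.

(** * Nodes and the discussion of the linear part *)

Section PoincareDomain.
Variable R : archiRcfType.
Implicit Types (f g h u v c : fps2 R) (X Y : formal_vf R) (G : set (fps2 R)) (l : R).
Local Notation fil := (fil 1 1).
Local Notation x := (fpsX R).
Local Notation y := (fpsY R).

Lemma coef_diagonal X m1 m2 g n i j : linear_part X m1 0 0 m2 -> fil n g ->
  (i + j = n)%N -> fps_coef (vfd X g) i j = (i%:R * m1 + j%:R * m2) * fps_coef g i j.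
Proof.
by move=> lX ng ij; rewrite (coef_vfd_leading lX ng ij) !mul0r add0r addr0; ring.
Qed.

Lemma homological_step X m1 m2 nu n c : linear_part X m1 0 0 m2 -> fil n c ->
  (forall i j, (i + j = n)%N -> i%:R * m1 + j%:R * m2 = nu -> fps_coef c i j = 0) ->
  exists s, fil n s /\ fil n.+1 (vfd X s - nu *: s - c).
Proof.
move=> lX nc res; have [fX0 fX1] := linear_part_ev0 lX.
(* The divisor is 0 only at a resonance, where the coefficient of c vanishes. *)
exists (Fps2 (fun i j => if (i + j == n)%N then
  fps_coef c i j / (i%:R * m1 + j%:R * m2 - nu) else 0)); set s := Fps2 _.
have ns : fil n s by move=> i j; rewrite !mul1n /= => ij; rewrite ltn_eqF.
split=> //; apply: fil_top => [|j jn].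
  by apply: filB => //; apply: filB; [apply: vfd_fil|apply: filZ].
have ij : (n - j + j = n)%N by rewrite subnK.
rewrite 2!coefB coefZ (coef_diagonal lX ns ij) -mulrBl /= ij eqxx.
have [e|e] := eqVneq ((n - j)%:R * m1 + j%:R * m2) nu.
  by rewrite (res _ _ ij e) mul0r mulr0 subrr.
by rewrite mulrC divfK ?subrr // subr_eq0.
Qed.

Lemma homological_solve X m1 m2 nu n c : linear_part X m1 0 0 m2 -> fil n c ->
  (forall i j, (n <= i + j)%N -> i%:R * m1 + j%:R * m2 != nu) ->
  exists s, fil n s /\ vfd X s - nu *: s = c.
Proof.
move=> lX nc nr; have [fX0 fX1] := linear_part_ev0 lX.
have [|k s t nk _ _ Pst||s [t [ns _ /eqP]]] :=
    @fil_approx R 1 1 0 n (fun s _ => vfd X s - nu *: s - c) 0 0.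
- move=> k s t s' t' ss _; rewrite (_ : _ - _ = vfd X (s - s') - nu *: (s - s')).
    by apply: filB; [apply: vfd_fil|apply: filZ].
  by rewrite vfdB scalerBr; ring.
- rewrite addn0 in Pst *.
  have [|r [kr Pr]] := homological_step lX Pst (nu := nu).
    by move=> i j ij e; have := nr i j; rewrite ij nk e eqxx => /(_ isT).
  exists (s - r), t; split; rewrite ?subrr //; first by rewrite addrAC subrr add0r; apply: filN.
  rewrite (_ : _ - _ - _ = - (vfd X r - nu *: r - (vfd X s - nu *: s - c))); first exact: filN.
  by rewrite vfdB scalerBr; ring.
- by rewrite addn0 vfd0 scaler0 subrr sub0r; apply: filN.
by rewrite subr0 in ns; rewrite subr_eq0 => /eqP; exists s.
Qed.

Lemma resonance (m1 m2 : R) i j : 0 < m1 -> m1 <= m2 -> (2 <= i + j)%N ->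
  i%:R * m1 + j%:R * m2 = m2 -> j = 0%N.
Proof.
move=> m1p m12 ij; have m2p := lt_le_trans m1p m12; case: j ij => // j ij e.
have : i%:R * m1 + j%:R * m2 = 0 by rewrite -[RHS](subrr m2) -{2}e -natr1; ring.
move/eqP; rewrite paddr_eq0 ?mulr_ge0 ?ler0n ?(ltW m1p) ?(ltW m2p) //.
by rewrite !mulf_eq0 !pnatr_eq0 (gt_eqF m1p) (gt_eqF m2p) !orbF; lia.
Qed.

Lemma eigencoordinate X m1 m2 nu z : linear_part X m1 0 0 m2 -> fil 2 (vfd X z - nu *: z) ->
  (forall i j, (2 <= i + j)%N -> i%:R * m1 + j%:R * m2 != nu) ->
  exists u, fil 2 (u - z) /\ vfd X u = nu *: u.
Proof.
move=> lX z2 nr; have [s [s2 Ds]] := homological_solve lX (filN z2) nr.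
exists (z + s); split; first by rewrite addrAC subrr add0r.
apply/eqP; rewrite -subr_eq0 vfdD scalerDr; apply/eqP.
rewrite -(subrr (vfd X z - nu *: z)) -{2}[vfd X z - _]opprK -Ds; ring.
Qed.

(* Poincare-Dulac normal form of a node: the only possible resonance is k m1 = m2. *)
Lemma node_normal_form X m1 m2 : linear_part X m1 0 0 m2 -> 0 < m1 -> m1 <= m2 ->
  exists u v e k, [/\ fil 2 (u - x), fil 2 (v - y), vfd X u = m1 *: u,
    vfd X v = m2 *: v + e *: u ^+ k & e != 0 -> (2 <= k)%N /\ k%:R * m1 = m2].
Proof.
move=> lX m1p m12; have [X0 X1] := lX; have m2p := lt_le_trans m1p m12.
rewrite !scale0r addr0 add0r in X0 X1.
have [||u [ux Du]] := @eigencoordinate X m1 m2 m1 x lX; first by rewrite vfd_fpsX.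
  move=> i j ij; rewrite gt_eqF //; apply: (@lt_le_trans _ _ (2 * m1)); first by lra.
  apply: (@le_trans _ _ ((i + j)%:R * m1)); first by rewrite ler_pM2r // ler_nat.
  by rewrite natrD mulrDl lerD2l; apply: ler_wpM2l; rewrite ?ler0n.
case: (pselect (exists2 k, (2 <= k)%N & k%:R * m1 = m2)) => [[k k2 km]|nk]; last first.
  have [||v [vy Dv]] := @eigencoordinate X m1 m2 m2 y lX; first by rewrite vfd_fpsY.
    move=> i j ij; apply/eqP => e; have j0 := resonance m1p m12 ij e; apply: nk.
    by exists i; [move: ij; rewrite j0 addn0|move: e; rewrite j0 mul0r addr0].
  by exists u, v, 0, 0%N; split; rewrite ?scale0r ?addr0 // eqxx.
have only i j : (2 <= i + j)%N -> i%:R * m1 + j%:R * m2 = m2 -> i = k /\ j = 0%N.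
  move=> ij e; have j0 := resonance m1p m12 ij e; split=> //.
  move: e; rewrite j0 mul0r addr0 -km => /(mulIf (lt0r_neq0 m1p)) /eqP.
  by rewrite eqr_nat => /eqP.
(* Below degree k there is no resonance, so all terms can be removed. *)
have [r [r2 Pr]] : exists r, fil 2 r /\ fil k (vfd X (y + r) - m2 *: (y + r)).
  have stage n : (n <= k - 2)%N ->
      exists r, fil 2 r /\ fil (2 + n) (vfd X (y + r) - m2 *: (y + r)).
    elim: n => [|n IH] nk; first by exists 0; rewrite addr0 vfd_fpsY; split; [exact: fil_zero|].
    have [r [r2 Pr]] := IH (ltnW nk).
    have [|s [s2 Ds]] := homological_step lX Pr (nu := m2).
      move=> i j ij /only; rewrite ij => /(_ isT) [ik j0]; exfalso; move: ij nk; lia.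
    exists (r - s); split; first by apply: filB => //; apply: filW s2.
    rewrite addnS (_ : _ - _ = - (vfd X s - m2 *: s - (vfd X (y + r) - m2 *: (y + r)))).
      exact: filN.
    by rewrite addrA vfdB scalerBr; ring.
  by have [r [r2 Pr]] := stage (k - 2)%N (leqnn _); exists r; rewrite subnKC in Pr.
(* The only resonant monomial is x^k; its coefficient is kept as e. *)
set p := vfd X (y + r) - m2 *: (y + r) in Pr; pose e := fps_coef p k 0.
have xk : fil k (x ^+ k) by rewrite -[X in fil X]muln1; apply: filX; exact: fil_x.
have [||s [ks Ds]] := @homological_step X m1 m2 m2 k (p - e *: x ^+ k) lX.
- by apply: filB => //; apply: filZ.
- move=> i j ij /only; rewrite ij => /(_ k2) [ik j0].
  have := monoE R k 0; rewrite expr0 mulr1 => E; subst i j.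
  by rewrite coefB coefZ -E /= !eqxx mulr1 subrr.
(* Replacing x^k by u^k costs only terms of order k + 1, where no resonance is left. *)
have uk : fil k.+1 (u ^+ k - x ^+ k).
  clear - ux; elim: k => [|k IH]; first by rewrite !expr0 subrr.
  have fu : fil 1 u.
    by rewrite -(subrK x u); apply: filD; [apply: filW ux|exact: fil_x].
  rewrite !exprS (_ : _ - _ = (u - x) * x ^+ k + u * (u ^+ k - x ^+ k)); last by ring.
  apply: filD; last by rewrite -[k.+2]add1n; apply: filM.
  rewrite -[k.+2]add2n; apply: filM => //.
  by rewrite -[X in fil X]muln1; apply: filX; exact: fil_x.
have kc : fil k.+1 (p - e *: u ^+ k - (vfd X s - m2 *: s)).
  rewrite (_ : _ - _ = - (vfd X s - m2 *: s - (p - e *: x ^+ k)) - e *: (u ^+ k - x ^+ k)).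
    by apply: filB; [apply: filN|apply: filZ].
  by rewrite scalerBr; ring.
have [|t [kt Dt]] := homological_solve lX kc (nu := m2).
  move=> i j kij; apply/eqP => /only [|ik j0]; first by apply: leq_trans k2 _; apply: ltnW.
  by move: kij; rewrite ik j0 addn0 ltnn.
exists u, (y + r - s - t), e, k; split=> //.
  rewrite (_ : _ - y = r - s - t); last by ring.
  by apply: filB; [apply: filB => //; apply: filW ks|apply: filW kt; apply: ltnW].
have Dz : vfd X (y + r) = p + m2 *: (y + r) by rewrite /p subrK.
have Dt' := Dt; move/eqP: Dt'; rewrite subr_eq => /eqP Dt'.
by rewrite 2!vfdB Dz Dt' 2!scalerBr; ring.
Qed.

Section NormalNode.
Variables (Y : formal_vf R) (m1 m2 e : R) (k : nat).
Hypotheses (m1p : 0 < m1) (Y0 : Y ord0 = m1 *: x) (Y1 : Y ord_max = m2 *: y + e *: x ^+ k).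

Lemma coef_normal_node f i j : fps_coef (vfd Y f) i j =
  (i%:R * m1 + j%:R * m2) * fps_coef f i j +
  e * (if (k <= i)%N then j.+1%:R * fps_coef f (i - k) j.+1 else 0).
Proof.
rewrite vf_applyE Y0 Y1 mulrDl -!scalerAl !coefD !coefZ coefXM coefYM.
have := monoE R k 0; rewrite expr0 mulr1 => <-; rewrite coef_monoM subn0 andbT coef_deriv1.
rewrite addrA; congr (_ + _ * _); last by case: ifP => // _; rewrite mulr_natl.
rewrite mulrDl; congr (_ + _).
  by case: i => [|i']; rewrite ?mulr0 ?mul0r // coef_deriv0 mulr_natl; ring.
by case: j => [|j']; rewrite ?mulr0 ?mul0r // coef_deriv1 mulr_natl; ring.
Qed.

(** Give x weight 1 and y weight k. The field is m1 times the weighted Euler field plus e x^k d/dy,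
    which preserves weights and lowers the power of y. So an eigenvector lives in one weight, and
    there e != 0 kills every coefficient with a positive power of y. *)
Lemma resonant_node_functional l G : e != 0 -> (0 < k)%N -> k%:R * m1 = m2 ->
  eigspace Y l G -> exists n, forall g, G g -> fps_coef g n 0 = 0 -> g = 0.
Proof.
move=> e0 k0 km [_ _ GD].
have rec g i j : G g -> (l - (i + k * j)%:R * m1) * fps_coef g i j =
    e * (if (k <= i)%N then j.+1%:R * fps_coef g (i - k) j.+1 else 0).
  move=> /GD /(congr1 (fun f => fps_coef f i j)); rewrite coef_normal_node coefZ -km.
  by rewrite natrD natrM mulrBl => <-; ring.
have zero g i j : G g -> (i + k * j)%:R * m1 != l -> fps_coef g i j = 0.
  move=> Gg; elim/ltn_ind: i j => i IH j w.
  have := rec g i j Gg; case: leqP => ki.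
    rewrite (IH (i - k)%N) ?mulr0; [|lia|by rewrite (_ : (_ + _ = i + k * j)%N) //; nia].
    by move/eqP; rewrite mulf_eq0 subr_eq0 eq_sym (negPf w) => /eqP.
  by rewrite mulr0 => /eqP; rewrite mulf_eq0 subr_eq0 eq_sym (negPf w) => /eqP.
have zero1 g i j : G g -> fps_coef g i j.+1 = 0.
  move=> Gg; have [w|w] := eqVneq ((i + k * j.+1)%:R * m1) l; last exact: zero w.
  have := rec g (i + k)%N j Gg; rewrite leq_addl addnK -addnA -mulnS w subrr mul0r.
  by move/esym/eqP; rewrite !mulf_eq0 (negPf e0) pnatr_eq0 /= => /eqP.
case: (pselect (exists n : nat, n%:R * m1 = l)) => [[n nl]|nn].
  exists n => g Gg gn; apply: fps2P => i [|j]; last exact: zero1.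
  have [->//|ni] := eqVneq i n; apply: zero => //; rewrite muln0 addn0 -nl.
  by rewrite (inj_eq (mulIf (lt0r_neq0 m1p))) eqr_nat.
exists 0%N => g Gg _; apply: fps2P => i [|j]; last exact: zero1.
by apply: zero => //; apply/eqP => il; apply: nn; eexists; exact: il.
Qed.

End NormalNode.

Lemma diagonal_support l m1 m2 f Y : 0 < m1 -> m1 <= m2 -> Y ord0 = m1 *: x ->
  Y ord_max = m2 *: y -> vfd Y f = l *: f -> exists N, f = psubst x y N f /\
    forall i j, fps_coef f i j != 0 -> i%:R * m1 + j%:R * m2 = l.
Proof.
move=> m1p m12 Y0 Y1 Df; have m2p := lt_le_trans m1p m12.
have supp i j : fps_coef f i j != 0 -> i%:R * m1 + j%:R * m2 = l.
  have Y1' : Y ord_max = m2 *: y + 0 *: x ^+ 0 by rewrite scale0r addr0.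
  have := coef_normal_node Y0 Y1' f i j; rewrite Df coefZ mul0r addr0.
  by move=> E f0; apply/esym/(mulIf f0).
(* Positivity and the Archimedean property bound the exponents with i m1 + j m2 = l, so the
   eigenvector is a polynomial. *)
have [N lN] : exists N : nat, l < N%:R * m1.
  exists (Num.bound `|l / m1|); rewrite -ltr_pdivrMr //.
  by apply: le_lt_trans (ler_norm _) _; apply: archi_boundP.
exists N; split=> //; apply: fps2P => i j; rewrite coef_psubst.
case: ifP => // /negbT; rewrite negb_and -!leqNgt => Nij; apply/eqP; apply: contraTT lN => /supp <-.
rewrite -leNgt; have mono : (i + j)%:R * m1 <= i%:R * m1 + j%:R * m2.
  by rewrite natrD mulrDl lerD2l; apply: ler_wpM2l; rewrite ?ler0n.
apply: le_trans mono; rewrite ler_pM2r // ler_nat.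
by case/orP: Nij => Nij; apply: leq_trans Nij _; rewrite ?leq_addr ?leq_addl.
Qed.

Lemma node_dichotomy X m1 m2 l G : linear_part X m1 0 0 m2 -> 0 < m1 -> m1 <= m2 ->
  dicritical_eigspace X l G -> factor_or_monomials X l G.
Proof.
move=> lX m1p m12 dX; have [u [v [e [k [ux vy Du Dv ek]]]]] := node_normal_form lX m1p m12.
have [u0 v0 J] := near_coordinates ux vy.
have J0 : fps_ev0 (jac u v) != 0 by rewrite J oner_neq0.
have inj : injective (fps_subst u0 v0) by exact: subst_inj.
have phiZ (a : R) f : fps_subst u0 v0 (a *: f) = a *: fps_subst u0 v0 f by exact: linearZZ.
have [Y [G' [Y0 Y1 YX _ [dYG concl]]]] := coordinates_wlog X l G u0 v0 J0.
have Y0' : Y ord0 = m1 *: x by apply: inj; rewrite Y0 Du phiZ substX.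
have Y1' : Y ord_max = m2 *: y + e *: x ^+ k.
  by apply: inj; rewrite Y1 Dv raddfD /= !phiZ rmorphXn /= substX substY.
have [eigY [g G'g g0] _] := dYG dX.
have [e0|e0] := eqVneq e 0; last first.
  have [k2 km] := ek e0; apply: concl; left; have [Glin _ _] := eigY.
  apply: functional_factor => //; first by exists g.
  exact: (resonant_node_functional m1p Y0' Y1' e0 (ltnW k2) km eigY).
rewrite e0 scale0r addr0 in Dv; rewrite e0 scale0r addr0 in Y1'; right; exists u, v, m1, m2; split=> // h Gh.
have [h' hE] := subst_surj u0 v0 J0 h.
have Dh' : vfd Y h' = l *: h'.
  by have [[_ _ GD] _ _] := dX; apply: inj; rewrite -YX hE phiZ hE; exact: GD.
have [N [h'N supp]] := diagonal_support m1p m12 Y0' Y1' Dh'.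
exists N, h'; split; last exact: supp.
by have := congr1 (fps_subst u0 v0) h'N; rewrite subst_psubst substX substY hE.
Qed.

Lemma vfdNl X f : vfd (- X) f = - vfd X f.
Proof. by rewrite !vf_applyE !ffunE; ring. Qed.

Lemma dicritical_eigspaceN X l G : dicritical_eigspace X l G ->
  dicritical_eigspace (- X) (- l) G.
Proof.
move=> [[Glin Gm GD] G0 [a [b [k [ab am bm Da Db]]]]]; split=> //.
  by split=> // g /GD Dg; rewrite vfdNl Dg scaleNr.
by exists a, b, (- k); split; rewrite // vfdNl ?Da ?Db mulNr.
Qed.

Lemma factor_or_monomialsN X l G : factor_or_monomials (- X) (- l) G ->
  factor_or_monomials X l G.
Proof.
case=> [|[u [v [a [b [J Du Dv mono]]]]]]; [by left|right].
exists u, v, (- a), (- b); split=> //.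
- by rewrite scaleNr -Du vfdNl opprK.
- by rewrite scaleNr -Dv vfdNl opprK.
move=> g /mono[N [h [gh hab]]]; exists N, h; split=> // i j /hab E.
by rewrite !mulrN -opprD E opprK.
Qed.

Lemma linear_partN X p0 q0 p1 q1 : linear_part X p0 q0 p1 q1 ->
  linear_part (- X) (- p0) (- q0) (- p1) (- q1).
Proof.
by move=> [X0 X1]; split; rewrite ffunE !scaleNr -!opprD; apply: filN.
Qed.

Lemma diagonal_dichotomy X m1 m2 l G : linear_part X m1 0 0 m2 -> l != 0 ->
  dicritical_eigspace X l G -> factor_or_monomials X l G.
Proof.
have pos Y n1 n2 l' G' : linear_part Y n1 0 0 n2 -> 0 < n1 -> 0 < n2 ->
    dicritical_eigspace Y l' G' -> factor_or_monomials Y l' G'.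
  move=> lY n1p n2p dY; case: (leP n1 n2) => n12; first exact: node_dichotomy lY n1p n12 dY.
  by apply: (linear_part_swap lY dY) => Z G'' lZ; exact: node_dichotomy lZ n2p (ltW n12).
have saddle Y n1 n2 l' G' : linear_part Y n1 0 0 n2 -> 0 < n1 -> n2 <= 0 ->
    dicritical_eigspace Y l' G' -> factor_or_monomials Y l' G'.
  by move=> lY n1p n2n [_ _ /(saddle_not_dicritical lY n1p n2n)].
have half Y n1 n2 l' G' : linear_part Y n1 0 0 n2 -> 0 < n1 ->
    dicritical_eigspace Y l' G' -> factor_or_monomials Y l' G'.
  by move=> lY n1p dY; case: (ltP 0 n2) => n2s; [exact: pos lY _ _ dY|exact: saddle lY _ _ dY].
have nonneg Y n1 n2 l' G' : linear_part Y n1 0 0 n2 -> n1 != 0 ->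
    dicritical_eigspace Y l' G' -> factor_or_monomials Y l' G'.
  move=> lY n10 dY; have [n1n|n1p|n1e] := ltgtP n1 0; last by rewrite n1e eqxx in n10.
    apply: factor_or_monomialsN; apply: (half _ (- n1) (- n2)); last exact: dicritical_eigspaceN.
      by have := linear_partN lY; rewrite oppr0.
    by rewrite oppr_gt0.
  exact: half lY n1p dY.
move=> lX l0 dX; have [m10|] := eqVneq m1 0; last by move=> m10; exact: nonneg lX m10 dX.
have [m20|m20] := eqVneq m2 0; last first.
  by apply: (linear_part_swap lX dX) => Y G' lY; apply: nonneg lY m20.
(* With zero linear part X raises the order, which contradicts X g = l g with l != 0. *)
have [[_ _ GD] [g Gg g0] _] := dX; have [n [ng ng']] := order_ex g0.
case: ng'; apply: fil_top => // j jn; apply: (mulfI l0); rewrite mulr0.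
have ij : (n - j + j = n)%N by rewrite subnK.
by rewrite -coefZ -(GD g Gg) (coef_diagonal lX ng ij) m10 m20 !mulr0 addr0 mul0r.
Qed.

Lemma cyclic_dichotomy X al de l G : linear_part X al de 1 al -> l != 0 ->
  dicritical_eigspace X l G -> factor_or_monomials X l G.
Proof.
move=> lX l0 dX; case: (leP de 0) => de0.
  have [eX G0 _] := dX; have [Glin _ _] := eX; left; apply: functional_factor => //.
  exact: (cyclic_functional de0 lX eX l0).
(* The eigenvectors x + s y and x - s y, with eigenvalues al + s and al - s, diagonalize the linear
   part. *)
have s2 := sqr_sqrtr (ltW de0); have s0 : 0 < Num.sqrt de by rewrite sqrtr_gt0.
move: (Num.sqrt de) s2 s0 => s s2 s0; rewrite expr2 in s2.
apply: (@linear_coordinates _ X al de 1 al l G 1 s 1 (- s) (al + s) 0 0 (al - s) lX dX).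
- by rewrite !mul1r mulr1 -opprD oppr_eq0 gt_eqF // addr_gt0.
- ring.
- by rewrite -s2; ring.
- ring.
- by rewrite -s2; ring.
by move=> Y G' lY; apply: diagonal_dichotomy lY l0.
Qed.

Lemma eigspace_dichotomy X l G : l != 0 -> eigspace X l G -> (exists2 g, G g & g != 0) ->
  factor_or_monomials X l G.
Proof.
move=> l0 eX G0; case: (factor_or_dicritical eX G0) => [|dic]; first by left.
have dX : dicritical_eigspace X l G by [].
have [X0 X1] := dicritical_ev0 dic; have [p0 [q0 [p1 [q1 lX]]]] := linear_part_ex X0 X1.
(* With al half the trace, the square of M - al is a scalar. If a coordinate v is not an eigenvector
   of M, then (M - al) v and v are coordinates in which the linear part is cyclic. *)
pose al := (p0 + q1) / 2.
have [p10|p10] := eqVneq p1 0; last first.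
  apply: (@linear_coordinates _ X p0 q0 p1 q1 l G p1 (q1 - al) 0 1 al
    (p1 * q0 + (q1 - al) * (q1 - al)) 1 al lX dX).
  - by rewrite mulr1 mulr0 subr0.
  - by rewrite /al; field.
  - by rewrite /al; field.
  - by ring.
  - by ring.
  by move=> Y G' lY; apply: cyclic_dichotomy lY l0.
have [q00|q00] := eqVneq q0 0.
  by subst p1 q0; exact: diagonal_dichotomy lX l0 dX.
subst p1; apply: (@linear_coordinates _ X p0 q0 0 q1 l G (p0 - al) q0 1 0 al
  ((p0 - al) * (p0 - al)) 1 al lX dX).
- by rewrite mulr0 mulr1 sub0r oppr_eq0.
- by ring.
- by rewrite /al; field.
- by ring.
- by ring.
by move=> Y G' lY; apply: cyclic_dichotomy lY l0.
Qed.

End PoincareDomain.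

(** * Classification of the coefficient algebras *)

Section FiniteDimension.
Variables (R : realType) (V : lmodType R).
Implicit Types (F S : set V) (f g h : V).

Definition subspace F := F 0 /\ forall (a : R) f g, F f -> F g -> F (a *: f + g).

Definition rank_le N F := forall f : 'I_N.+1 -> V, (forall i, F (f i)) ->
  exists c : 'I_N.+1 -> R, (exists i, c i != 0) /\ \sum_i c i *: f i = 0.

Lemma subspaceZ F a f : subspace F -> F f -> F (a *: f).
Proof. by move=> [F0 Fl] Ff; rewrite -[_ *: _]addr0; apply: Fl. Qed.
Lemma subspaceD F f g : subspace F -> F f -> F g -> F (f + g).
Proof. by move=> [F0 Fl] Ff Fg; rewrite -[f]scale1r; apply: Fl. Qed.
Lemma subspaceN F f : subspace F -> F f -> F (- f).
Proof. by move=> sF Ff; rewrite -scaleN1r; apply: subspaceZ. Qed.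
Lemma subspaceB F f g : subspace F -> F f -> F g -> F (f - g).
Proof. by move=> sF Ff Fg; apply: subspaceD => //; apply: subspaceN. Qed.
Lemma subspace_sum F n (f : 'I_n -> V) : subspace F -> (forall i, F (f i)) -> F (\sum_i f i).
Proof. by move=> sF Ff; elim/big_ind: _ => //; [exact: sF.1|move=> *; exact: subspaceD]. Qed.
Lemma subspaceZV F a f : subspace F -> a != 0 -> F (a *: f) -> F f.
Proof. by move=> sF a0 Ff; rewrite -[f](scalerK a0); apply: subspaceZ. Qed.

Lemma span_rank_le n (e : 'I_n -> V) :
  rank_le n [set f | exists c : 'I_n -> R, f = \sum_i c i *: e i].
Proof.
move=> f /= fE; have /boolp.choice[M ME] := fE.
pose A := \matrix_(i < n.+1, j < n) M i j.
have /rowV0Pn[c /sub_kermxP cA c0] : kermx A != 0.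
  by rewrite kermx_eq0 /row_free ltn_eqF // ltnS rank_leq_col.
have /existsP[i ci] : [exists i, c 0 i != 0].
  apply: contraNT c0 => /existsPn c0; apply/eqP/rowP => i; rewrite mxE.
  by apply/eqP; have := c0 i; rewrite negbK.
exists (fun i => c 0 i); split; first by exists i.
under eq_bigr do rewrite ME scaler_sumr; rewrite exchange_big big1 //= => j _.
under eq_bigr do rewrite scalerA; rewrite -scaler_suml.
have := congr1 (fun B : 'rV_n => B 0 j) cA; rewrite !mxE => E.
rewrite (_ : \sum_i _ = 0) ?scale0r //; rewrite -[RHS]E.
by apply: eq_bigr => k _; rewrite mxE.
Qed.

Definition free_family n (e : 'I_n -> V) :=
  forall c : 'I_n -> R, \sum_i c i *: e i = 0 -> forall i, c i = 0.

Lemma basis_ex N F : subspace F -> rank_le N F -> exists n (e : 'I_n -> V),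
  [/\ forall i, F (e i), free_family e &
      forall f, F f -> exists c : 'I_n -> R, f = \sum_i c i *: e i].
Proof.
move=> sF FN; pose P n := `[< exists e : 'I_n -> V, (forall i, F (e i)) /\ free_family e >].
have P0 : exists n, P n by exists 0%N; apply/asboolP; exists (fun=> 0); split=> [[]|c _ []].
have Pn n : P n -> (n <= N)%N.
  move=> /asboolP[e [Fe fe]]; rewrite leqNgt; apply/negP => Nn.
  have [c [[i ci] E]] := FN (fun i => e (widen_ord Nn i)) (fun i => Fe _).
  pose c' (j : 'I_n) := if insub (val j) is Some i then c i else 0.
  have c'E k : c' (widen_ord Nn k) = c k by rewrite /c' /= valK.
  case/eqP: ci; rewrite -c'E; apply: fe; rewrite -[RHS]E.
  rewrite (bigID (fun j : 'I_n => (j < N.+1)%N)) /= [X in _ + X]big1 ?addr0; last first.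
    by move=> j jN; rewrite /c' insubN ?scale0r.
  rewrite [RHS](eq_bigr (fun k => c' (widen_ord Nn k) *: e (widen_ord Nn k))); last first.
    by move=> k _; rewrite c'E.
  by rewrite (big_ord_narrow Nn).
have [n /asboolP[e [Fe fe]] nmax] := ex_maxnP P0 Pn.
exists n, e; split=> // f Ff; apply: contrapT => nf.
suff : (n.+1 <= n)%N by rewrite ltnn.
apply: nmax; apply/asboolP; exists (fun i => oapp e f (unlift ord_max i)); split.
  by move=> i; case: unlift => /=.
move=> c; rewrite big_ord_recr /= unlift_none /=.
have wl i : widen_ord (leqnSn n) i = lift ord_max i.
  by apply: val_inj; rewrite /= /bump leqNgt ltn_ord.
under eq_bigr do rewrite wl liftK.
move=> /= E; have c0 : c ord_max = 0.
  apply/eqP/negPn/negP => c0; apply: nf.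
  exists (fun i => - (c ord_max)^-1 * c (lift ord_max i)).
  under eq_bigr do rewrite -scalerA; rewrite -scaler_sumr.
  have /eqP := E; rewrite addr_eq0 => /eqP ->.
  by rewrite scalerN scaleNr opprK scalerK.
move: E; rewrite c0 scale0r addr0 => /fe E i; case: (unliftP ord_max i) => [j|] -> //.
Qed.

(* A complex eigenvector g + i h of the complexified operator. *)
Lemma eigen_pair_ex (D : V -> V) N S : linear D -> subspace S -> rank_le N S ->
  (forall f, S f -> S (D f)) -> (exists2 f, S f & f != 0) ->
  exists (a b : R) g h, [/\ S g, S h, (g != 0) || (h != 0),
    D g = a *: g - b *: h & D h = b *: g + a *: h].
Proof.
move=> Dl sS SN SD [f Sf f0]; have [n [e [Se fe gen]]] := basis_ex sS SN.
have DD u v : D (u + v) = D u + D v by have := Dl 1 u v; rewrite !scale1r.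
have D0 : D 0 = 0 by apply: (addrI (D 0)); rewrite -DD !addr0.
have DZ c g : D (c *: g) = c *: D g by rewrite -[c *: g]addr0 Dl D0 addr0.
have Dsum (F : 'I_n -> V) : D (\sum_i F i) = \sum_i D (F i) by apply: (big_morph D DD D0).
have /boolp.choice[M ME] : forall i, exists c : 'I_n -> R, D (e i) = \sum_j c j *: e j.
  by move=> i; apply: gen; apply: SD.
have Dcomb (c : 'I_n -> R) : D (\sum_i c i *: e i) = \sum_j (\sum_i c i * M i j) *: e j.
  rewrite Dsum; under eq_bigr do rewrite DZ ME scaler_sumr.
  rewrite exchange_big; apply: eq_bigr => j _ /=; rewrite scaler_suml.
  by apply: eq_bigr => i _; rewrite scalerA.
case: n => [|n] in e Se fe gen Dsum M ME Dcomb *.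
  by have [c fE] := gen f Sf; rewrite fE big_ord0 eqxx in f0.
pose A : 'M[R[i]]_n.+1 := \matrix_(i, j) (Complex (M i j) 0).
have /closed_rootP[z] : size (char_poly A) != 1%N by rewrite size_char_poly.
rewrite -eigenvalue_root_char => /eigenvalueP[v vA v0].
have ReD : {morph (@complex.Re R) : p q / p + q} by case=> [? ?] [? ?].
have Re0 : complex.Re (0 : R[i]) = 0 by [].
have Im0 : complex.Im (0 : R[i]) = 0 by [].
have ImD : {morph (@complex.Im R) : p q / p + q} by case=> [? ?] [? ?].
have vAj j : \sum_i v 0 i * Complex (M i j) 0 = z * v 0 j.
  have := congr1 (fun B : 'rV_n.+1 => B 0 j) vA; rewrite !mxE => <-.
  by apply: eq_bigr => i _; rewrite mxE.
pose p j := complex.Re (v 0 j); pose q j := complex.Im (v 0 j).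
have pM j : \sum_i p i * M i j = complex.Re z * p j - complex.Im z * q j.
  have := congr1 (@complex.Re R) (vAj j); rewrite (big_morph _ ReD Re0) /p /q.
  case: z (v 0 j) {vAj vA} => [z1 z2] [v1 v2] /= <-; apply: eq_bigr => i _.
  by case: (v 0 i) => [w1 w2] /=; rewrite mulr0 subr0.
have qM j : \sum_i q i * M i j = complex.Im z * p j + complex.Re z * q j.
  have := congr1 (@complex.Im R) (vAj j); rewrite (big_morph _ ImD Im0) /p /q addrC.
  case: z (v 0 j) {vAj vA pM} => [z1 z2] [v1 v2] /= <-; apply: eq_bigr => i _.
  by case: (v 0 i) => [w1 w2] /=; rewrite mulr0 add0r.
have Sc (c : 'I_n.+1 -> R) : S (\sum_i c i *: e i).
  by apply: subspace_sum => // i; apply: subspaceZ.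
exists (complex.Re z), (complex.Im z), (\sum_i p i *: e i), (\sum_i q i *: e i); split=> //.
- apply: contraNT v0; rewrite negb_or !negbK => /andP[/eqP/fe p0 /eqP/fe q0].
  apply/eqP/rowP => j; rewrite mxE; move: (p0 j) (q0 j); rewrite /p /q.
  by case: (v 0 j) => [v1 v2] /= -> ->.
- rewrite Dcomb !scaler_sumr -sumrB; apply: eq_bigr => j _.
  by rewrite pM scalerBl !scalerA.
- rewrite Dcomb !scaler_sumr -big_split; apply: eq_bigr => j _ /=.
  by rewrite qM scalerDl !scalerA.
Qed.

End FiniteDimension.

Lemma vf_bracket_scale (R : comNzRingType) (B : comAlgType R) (D : 'I_2 -> B -> B)
    (DM : forall i f g, D i (f * g) = D i f * g + f * D i g) (X : {ffun 'I_2 -> B}) (f g : B) :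
  vf_bracket D [ffun i => f * X i] [ffun i => g * X i] =
  [ffun i => (f * vf_apply D X g - g * vf_apply D X f) * X i].
Proof.
apply/ffunP => k; rewrite !ffunE !vf_applyMl !(vf_applyM DM).
move: (vf_apply D X f) (vf_apply D X g) (vf_apply D X (X k)) (X k) => p q r s; ring.
Qed.

Section Classification.
Variable R : realType.
Implicit Types (f g h k u w : fps2 R) (X : formal_vf R) (F : set (fps2 R)).

(* F is the set of the f such that f X lies in a Lie algebra of rank 1 that
   contains X; [f X, g X] = (f X(g) - g X(f)) X. *)
Definition coef_algebra N X F := [/\ subspace F, rank_le N F, F 1 &
  forall f g, F f -> F g -> F (f * vfd X g - g * vfd X f)].

(* If k is not constant, the powers of k are linearly independent over the reals; this is
   how finite dimension is used. *)
Lemma power_const N F k h : rank_le N F -> h != 0 -> (forall n, F (k ^+ n * h)) ->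
  k = fpsC (fps_ev0 k).
Proof.
move=> FN h0 Fk; have [c [[i ci] E]] := FN (fun i => k ^+ i * h) (fun i => Fk i).
apply: (@real_horner_eq0 _ (\poly_(j < N.+1) c (inord j))).
  apply/eqP => /(congr1 (fun p : {poly R} => p`_i)); rewrite coef_poly ltn_ord inord_val poly.coef0.
  by apply/eqP.
apply: (mulIf h0); rewrite mul0r -E /real_horner.
have -> : map_poly (@fpsC R) (\poly_(j < N.+1) c (inord j)) = \poly_(j < N.+1) fpsC (c (inord j)).
  by apply/polyP => j; rewrite coef_map !coef_poly; case: ifP => // _; exact: rmorph0.
rewrite horner_poly mulr_suml; apply: eq_bigr => j _.
by rewrite inord_val scale_fpsC mulrA.
Qed.

Lemma fpsC_half (c : R) : fpsC c = fpsC (c / 2) * 2%:R :> fps2 R.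
Proof. by rewrite -(rmorph_nat (@fpsC R)) -rmorphM divfK // pnatr_eq0. Qed.

(** In lowest terms a^2 = - b^2 makes a a unit, whereas the constant terms are real numbers with sum
    of squares 0. *)
Lemma fps_sumsq_eq0 g h : g ^+ 2 + h ^+ 2 = 0 -> g = 0 /\ h = 0.
Proof.
move=> E; have [d [a [b [gE hE ab]]]] := gcd_ex g h.
have [d0|d0] := eqVneq d 0; first by rewrite gE hE d0 !mul0r.
have ab2 : a * a = - (b * b).
  apply/eqP; rewrite -addr_eq0; apply/eqP/(mulfI d0)/(mulfI d0).
  by rewrite !mulr0 -E gE hE; ring.
have au : a \is a GRing.unit.
  apply/dvd1P/(ab a (dvd_refl a))/(coprime_dvdM ab).
  by rewrite -[b * b]opprK -ab2; apply/dvdN/dvdMl/dvd_refl.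
have := congr1 (@fps_ev0 R) ab2; rewrite ev0M => /eqP.
rewrite (_ : fps_ev0 (- (b * b)) = - (fps_ev0 b * fps_ev0 b)); last first.
  by rewrite -sub0r ev0B ev00 ev0M sub0r.
rewrite -addr_eq0 -!expr2 paddr_eq0 ?sqr_ge0 // !sqrf_eq0 => /andP[/eqP a0 _].
by move: au; rewrite fps_unitE a0 eqxx.
Qed.

Section Algebra.
Variables (N : nat) (X : formal_vf R) (F : set (fps2 R)).
Hypothesis XF : coef_algebra N X F.
Local Notation D := (vfd X).

Let sF : subspace F. Proof. by case: XF. Qed.
Let FN : rank_le N F. Proof. by case: XF. Qed.
Let F1 : F 1. Proof. by case: XF. Qed.
Let FB f g : F f -> F g -> F (f * D g - g * D f). Proof. by case: XF => _ _ _; apply. Qed.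

Let D1 : D 1 = 0. Proof. exact: (vfd_nat X 1). Qed.

Lemma coef_algebraD f : F f -> F (D f).
Proof. by move=> /(FB F1); rewrite D1 mulr0 subr0 mul1r. Qed.

Lemma coef_algebraC (c : R) : F (fpsC c).
Proof. by rewrite -[fpsC c]mulr1 -scale_fpsC; apply: subspaceZ. Qed.

Lemma const_deriv0 k : k = fpsC (fps_ev0 k) -> D k = 0.
Proof. by move=> ->; rewrite vfdC. Qed.

Lemma D_linear : linear D.
Proof. by move=> a f g; rewrite vfdD vfdZ. Qed.

Lemma eigen_in S : subspace S -> S `<=` F -> (forall f, S f -> S (D f)) ->
  (exists2 f, S f & f != 0) -> exists (a b : R) g h,
  [/\ S g, S h, (g != 0) || (h != 0), D g = a *: g - b *: h & D h = b *: g + a *: h].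
Proof.
move=> sS SF SD S0; apply: (eigen_pair_ex D_linear sS _ SD S0).
by move=> e Se; apply: FN => i; apply: SF.
Qed.

(** Multiplication by a + i b is inverted through its conjugate, which only needs real
    combinations. *)
Lemma rotation_in (a b : R) g h : (a != 0) || (b != 0) ->
  F (a *: g - b *: h) -> F (b *: g + a *: h) -> F g /\ F h.
Proof.
move=> ab F1' F2'; have n0 : a * a + b * b != 0.
  by rewrite -!expr2 paddr_eq0 ?sqr_ge0 // !sqrf_eq0 negb_and.
split; apply: (subspaceZV sF n0).
  rewrite (_ : _ *: g = a *: (a *: g - b *: h) + b *: (b *: g + a *: h)).
    by apply: subspaceD => //; apply: subspaceZ.
  by rewrite !scale_fpsC !rmorphD !rmorphM /=; ring.
rewrite (_ : _ *: h = a *: (b *: g + a *: h) - b *: (a *: g - b *: h)).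
  by apply: subspaceB => //; apply: subspaceZ.
by rewrite !scale_fpsC !rmorphD !rmorphM /=; ring.
Qed.

(** * Coefficient algebras with an element of derivative 1 *)

Section UnitDerivative.
Variable w : fps2 R.
Hypotheses (Fw : F w) (Dw : D w = 1).

Let w_nconst : w <> fpsC (fps_ev0 w).
Proof. by move=> /const_deriv0; rewrite Dw; apply/eqP/oner_neq0. Qed.

Lemma coef_algebra_wD f : F f -> F (w * D f).
Proof.
move=> Ff; rewrite (_ : _ * _ = (w * D f - f * D w) + f); last by rewrite Dw; ring.
by apply: subspaceD => //; apply: FB.
Qed.

(** With a nonzero eigenvalue, applying w D to w^n g and w^n h and inverting the rotation puts
    w^(n+1) g and w^(n+1) h into F for all n, so that w would be constant. *)
Lemma nilpotent_eigen (a b : R) g h : F g -> F h -> (a != 0) || (b != 0) ->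
  D g = a *: g - b *: h -> D h = b *: g + a *: h -> g = 0 /\ h = 0.
Proof.
move=> Fg Fh ab Dg Dh; have wn n : F (w ^+ n * g) /\ F (w ^+ n * h).
  elim: n => [|n [IH1 IH2]]; first by rewrite !mul1r.
  have aux f : F (w ^+ n * f) -> F (w ^+ n.+1 * D f).
    move=> Ff; have := coef_algebra_wD Ff; rewrite vfdM.
    case: n {IH1 IH2} Ff => [|n] Ff; first by rewrite expr0 D1 mul0r add0r mul1r expr1.
    rewrite vfdX Dw => h'; rewrite (_ : _ * _ = w * (n.+1%:R * w ^+ n * 1 * f + w ^+ n.+1 * D f) -
      n.+1%:R *: (w ^+ n.+1 * f)); last first.
      by rewrite scale_fpsC rmorph_nat !exprS; ring.
    by apply: subspaceB => //; apply: subspaceZ.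
  apply: (rotation_in ab).
    rewrite (_ : _ - _ = w ^+ n.+1 * D g); first exact: aux.
    by rewrite Dg !scale_fpsC; ring.
  rewrite (_ : _ + _ = w ^+ n.+1 * D h); first exact: aux.
  by rewrite Dh !scale_fpsC; ring.
split; apply/eqP/negPn/negP => z0; apply: w_nconst.
  by apply: (power_const FN z0) => n; have [] := wn n.
by apply: (power_const FN z0) => n; have [] := wn n.
Qed.

Lemma affine_in f c : (forall k, F k -> D k = 0 -> k = fpsC (fps_ev0 k)) ->
  F f -> D f = fpsC c -> exists b, f = fpsC c * w + fpsC b.
Proof.
move=> K Ff Df; exists (fps_ev0 (f - c *: w)); rewrite -K.
- by rewrite scale_fpsC addrC subrK.
- by apply: subspaceB => //; exact: subspaceZ.
- by rewrite vfdB vfdZ Dw Df scale_fpsC mulr1 subrr.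
Qed.

(** For k in the kernel, differentiating the bracket of k and g gives k D^2 g. Hence F contains the
    powers of D^2 g, which is thus a constant; then the kernel is closed under products and consists
    of constants as well. So D g is affine in w, and w D g yields w^2. *)
Lemma second_order g : F g -> D (D g) != 0 -> D (D (D g)) = 0 ->
  (forall k, F k -> D k = 0 -> k = fpsC (fps_ev0 k)) /\ F (w ^+ 2).
Proof.
move=> Fg k0 Dk; set k1 := D (D g) in k0 Dk.
have mulk k : F k -> D k = 0 -> F (k * k1).
  move=> Fk Dk0; have := coef_algebraD (FB Fk Fg).
  by rewrite Dk0 mulr0 subr0 vfdM Dk0 mul0r add0r.
have pow n : F (k1 ^+ n * 1) /\ D (k1 ^+ n) = 0.
  elim: n => [|n [IH1 IH2]]; first by rewrite mulr1.
  rewrite mulr1 in IH1; rewrite mulr1 exprSr; split; first exact: mulk.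
  by rewrite vfdM IH2 Dk mul0r mulr0 addr0.
have k1c : k1 = fpsC (fps_ev0 k1).
  by apply: (power_const FN (oner_neq0 _)) => n; have [] := pow n.
set c := fps_ev0 k1 in k1c; have c0 : c != 0.
  by apply: contraNneq k0 => c0; rewrite k1c c0 rmorph0.
have prod k l : F k -> F l -> D k = 0 -> D l = 0 -> F (k * l).
  move=> Fk Fl Dk0 Dl0; apply: (subspaceZV sF c0).
  have Fkg : F (k * D g) by have := FB Fk Fg; rewrite Dk0 mulr0 subr0.
  have := FB Fl Fkg; rewrite vfdM Dk0 Dl0 mul0r add0r mulr0 subr0 -/k1 k1c.
  by rewrite scale_fpsC (_ : l * _ = fpsC c * (k * l)) //; ring.
have K k : F k -> D k = 0 -> k = fpsC (fps_ev0 k).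
  move=> Fk Dk0; apply: (power_const FN (oner_neq0 _)) => n; rewrite mulr1.
  suff [] : F (k ^+ n) /\ D (k ^+ n) = 0 by [].
  elim: n => [//|n [IH1 IH2]]; rewrite exprS; split; first exact: prod.
  by rewrite vfdM Dk0 IH2 mul0r mulr0 addr0.
split=> //; have Dgc : D (D g) = fpsC c by rewrite -/k1 k1c.
have [b Dg] := affine_in K (coef_algebraD Fg) Dgc.
apply: (subspaceZV sF c0); rewrite (_ : _ *: _ = w * D g - b *: w).
  by apply: subspaceB; [|exact: coef_algebra_wD|exact: subspaceZ].
by rewrite Dg !scale_fpsC; ring.
Qed.

(** Otherwise the image of D^3 contains an eigenvector, of eigenvalue 0, and integrating it puts w^2
    and w^3 into F. The bracket of w^2 and w^(n+3) is (n + 1) w^(n+4), so all powers of w would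
    follow. *)
Lemma third_order f : F f -> D (D (D f)) = 0.
Proof.
move=> Ff; apply/eqP/negPn/negP => f3.
pose S := [set y | exists2 f, F f & y = D (D (D f))].
have [||z [f' Ff' ->]||a [b [g [h [[g' Fg' gE] [h' Fh' hE] gh Dg Dh]]]]] := @eigen_in S.
- split; first by exists 0; [exact: sF.1|rewrite !vfd0].
  move=> a _ _ [p Fp ->] [q Fq ->]; exists (a *: p + q); first exact: sF.2.
  by rewrite !(vfdD, vfdZ).
- by move=> _ [p Fp ->]; do 3 apply: coef_algebraD.
- by exists (D f') => //; exact: coef_algebraD.
- by exists (D (D (D f))) => //; exists f.
have Fg : F g by rewrite gE; do 3 apply: coef_algebraD.
have Fh : F h by rewrite hE; do 3 apply: coef_algebraD.
have [/norP[/negPn/eqP a0 /negPn/eqP b0]|ab] := boolP (~~ ((a != 0) || (b != 0))); last first.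
  have [g0 h0] := nilpotent_eigen Fg Fh (negPn ab) Dg Dh.
  by rewrite g0 h0 eqxx in gh.
rewrite a0 b0 !scale0r subr0 addr0 in Dg Dh; clear a b a0 b0.
have {gh f f3 Ff} [f0 [Ff0 y0 Dy0]] : exists f0, [/\ F f0, D (D (D f0)) != 0 & D (D (D (D f0))) = 0].
  by case/orP: gh => z0; [exists g'|exists h']; rewrite -?gE -?hE.
have [K Fw2] := second_order (coef_algebraD Ff0) y0 Dy0.
have F3 : F (D (D (D f0))) by do 3 apply: coef_algebraD.
have [c cE] : exists c : R, D (D (D f0)) = fpsC c by eexists; exact: K F3 Dy0.
have c0 : c != 0 by apply: contraNneq y0 => c0; rewrite cE c0 rmorph0.
have [b D2] := affine_in K (coef_algebraD (coef_algebraD Ff0)) cE.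
pose d := c / 2.
have dE : fpsC c = fpsC d * 2%:R := fpsC_half c.
have Dw2 : D (w ^+ 2) = 2%:R * w by rewrite vfdX Dw expr1 mulr1.
have FD1 : F (D f0 - d *: w ^+ 2 - b *: w).
  by do 2 (apply: subspaceB => //; last exact: subspaceZ); exact: coef_algebraD.
have : D (D f0 - d *: w ^+ 2 - b *: w) = 0.
  by rewrite !vfdB !vfdZ Dw2 Dw D2 dE !scale_fpsC; ring.
move/(K _ FD1); move: (fps_ev0 _) => a aE.
have d0 : d != 0 by rewrite mulf_neq0 // invr_eq0 pnatr_eq0.
pose f := f0 - (b / 2) *: w ^+ 2 - a *: w.
have Df : D f = d *: w ^+ 2.
  rewrite /f !vfdB !vfdZ Dw2 Dw (_ : D f0 = fpsC a + d *: w ^+ 2 + b *: w); last by rewrite -aE; ring.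
  have -> : (b / 2) *: (2%:R * w) = b *: w.
    by rewrite !scale_fpsC (fpsC_half b) mulrA.
  by rewrite scale_fpsC [a *: 1]scale_fpsC; ring.
have Ff : F f by do 2 (apply: subspaceB => //; last exact: subspaceZ).
have Fw3 : F (w ^+ 3).
  apply: (subspaceZV sF d0); rewrite (_ : _ *: _ = w * D f); last by rewrite Df exprS scalerAr.
  exact: coef_algebra_wD.
have wn n : F (w ^+ n * w ^+ 3).
  elim: n => [|n IH]; first by rewrite mul1r.
  have n0 : n.+1%:R != 0 :> R by rewrite pnatr_eq0.
  apply: (subspaceZV sF n0); have := FB Fw2 IH; congr (F _).
  rewrite Dw2 -exprD addn3 vfdX Dw scale_fpsC (rmorph_nat (@fpsC R)).
  rewrite -[n.+3%:R]natr1 -[n.+2%:R]natr1 !exprS; ring.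
apply: w_nconst; apply: (power_const FN _ wn).
apply: expf_neq0; apply: contraPneq Dw => ->; rewrite vfd0; apply/eqP; rewrite eq_sym.
exact: oner_neq0.
Qed.

Lemma unit_derivative_class :
  (F (w ^+ 2) /\ forall f, F f -> exists a b c : R, f = a *: 1 + b *: w + c *: w ^+ 2) \/
  (forall f, F f -> exists (c : R) k, [/\ f = c *: w + k, F k & D k = 0]).
Proof.
case: (pselect (exists2 g, F g & D (D g) != 0)) => [[g Fg g2]|no2]; [left|right].
  have [K Fw2] := second_order Fg g2 (third_order Fg); split=> // f Ff.
  have [c D2] : exists c : R, D (D f) = fpsC c.
    by eexists; apply: K; [do 2 apply: coef_algebraD|exact: third_order].
  have [b D1'] := affine_in K (coef_algebraD Ff) D2.
  have Ff' : F (f - (c / 2) *: w ^+ 2) by apply: subspaceB => //; exact: subspaceZ.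
  have [|a aE] := affine_in K Ff' (c := b).
    by rewrite vfdB vfdZ vfdX Dw expr1 mulr1 D1' (fpsC_half c) scale_fpsC; ring.
  by exists a, b, (c / 2); rewrite -[f](subrK ((c / 2) *: w ^+ 2)) aE !scale_fpsC; ring.
move=> f Ff; have D2 g : F g -> D (D g) = 0.
  by move=> Fg; apply/eqP/negPn/negP => g2; apply: no2; exists g.
have mulD k : F k -> D k = 0 -> F (k * D f).
  by move=> Fk Dk; have := FB Fk Ff; rewrite Dk mulr0 subr0.
have pow n : F (D f ^+ n) /\ D (D f ^+ n) = 0.
  elim: n => [//|n [IH1 IH2]]; rewrite exprSr; split; first exact: mulD.
  by rewrite vfdM IH2 D2 // mul0r mulr0 addr0.
have Dfc : D f = fpsC (fps_ev0 (D f)).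
  by apply: (power_const FN (oner_neq0 _)) => n; rewrite mulr1; have [] := pow n.
exists (fps_ev0 (D f)), (f - fps_ev0 (D f) *: w); split; first by rewrite addrC subrK.
  by apply: subspaceB => //; exact: subspaceZ.
by rewrite vfdB vfdZ Dw scale_fpsC mulr1 -Dfc subrr.
Qed.

End UnitDerivative.

(** * Coefficient algebras without such an element, even after rescaling *)

Section NoUnitDerivative.
Hypothesis NR : forall u w, F u -> F w -> fps_ev0 u != 0 -> u * D w - w * D u <> u.

(** As (u X)(w / u) = (u X w - w X u) / u, the hypothesis [NR] says that no field u X with u a unit
    in F has an element w / u of derivative 1. Here u = 1. *)
Lemma no_const_deriv f c : F f -> D f = fpsC c -> c = 0.
Proof.
move=> Ff Df; apply/eqP/negPn/negP => c0.
have Fw : F (c^-1 *: f) by exact: subspaceZ.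
apply: (NR F1 Fw); first by rewrite ev01 oner_neq0.
by rewrite D1 mulr0 subr0 mul1r vfdZ Df scale_fpsC -rmorphM mulVf // rmorph1.
Qed.

Lemma eigen_nonunit g (m : R) : F g -> m != 0 -> D g = m *: g -> fps_ev0 g = 0.
Proof.
move=> Fg m0 Dg; apply/eqP/negPn/negP => g0.
apply: (NR Fg (coef_algebraC (- m^-1)) g0).
by rewrite vfdC mulr0 sub0r Dg rmorphN mulNr opprK -scale_fpsC scalerA mulVf // scale1r.
Qed.

(* If b != 0, then g ^ 2 + h ^ 2 is a constant s ^ 2 and 1, g, h span a copy of sl_2, on which
   NR fails for u = s + g and a multiple w of h. *)
Lemma no_complex_eigen (a b : R) g h : F g -> F h -> (g != 0) || (h != 0) ->
  D g = a *: g - b *: h -> D h = b *: g + a *: h -> b = 0.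
Proof.
move=> Fg Fh gh Dg Dh; apply/eqP/negPn/negP => b0.
pose q := g ^+ 2 + h ^+ 2.
have Dq : D q = (2 * a) *: q.
  by rewrite vfdD !vfdX Dg Dh !expr1 !scale_fpsC rmorphM (rmorph_nat (@fpsC R)) /q; ring.
have Fq : F q.
  apply: (subspaceZV sF b0); rewrite (_ : _ *: q = g * D h - h * D g); first exact: FB.
  by rewrite Dg Dh !scale_fpsC /q; ring.
have DqX n : D (q ^+ n) = (n%:R * (2 * a)) *: q ^+ n.
  case: n => [|n]; first by rewrite expr0 D1 mul0r scale0r.
  by rewrite vfdX Dq !scale_fpsC !rmorphM !(rmorph_nat (@fpsC R)) exprS; ring.
have qn n : F (q ^+ n * g) /\ F (q ^+ n * h).
  elim: n => [|n [IH1 IH2]]; first by rewrite !mul1r.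
  apply: (@rotation_in ((n%:R - 1) * (2 * a) + a) b); first by rewrite b0 orbT.
    have := FB Fq IH1; rewrite Dq vfdM DqX Dg; congr (F _).
    rewrite !scale_fpsC !(rmorphM, rmorphD, rmorphB, rmorph1) !(rmorph_nat (@fpsC R)) exprS; ring.
  have := FB Fq IH2; rewrite Dq vfdM DqX Dh; congr (F _).
  rewrite !scale_fpsC !(rmorphM, rmorphD, rmorphB, rmorph1) !(rmorph_nat (@fpsC R)) exprS; ring.
have qc : q = fpsC (fps_ev0 q).
  case/orP: gh => z0; apply: (power_const FN z0) => n; by have [] := qn n.
set c := fps_ev0 q in qc.
have cE : c = fps_ev0 g ^+ 2 + fps_ev0 h ^+ 2 by rewrite /c ev0D !ev0X.
have c0 : c != 0.
  apply: contraTneq gh => c0; have [|-> ->] := @fps_sumsq_eq0 g h; last by rewrite eqxx.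
  by rewrite -/q qc c0 rmorph0.
have cp : 0 < c by rewrite lt_def c0 cE addr_ge0 // sqr_ge0.
have q0 : q != 0 by apply: contraNneq c0 => q0; rewrite /c q0 ev00.
have a0 : a = 0.
  have := Dq; rewrite {1}qc vfdC => /esym/eqP; rewrite scaler_eq0 mulf_eq0 pnatr_eq0 /=.
  by rewrite (negPf q0) orbF => /eqP.
rewrite a0 !scale0r sub0r addr0 in Dg Dh.
(* The two square roots of c cannot both cancel the constant term of g, so for one of them s + g is
   a unit. *)
have [s sc sg] : exists2 s : R, s * s = c & s + fps_ev0 g != 0.
  have s0 : Num.sqrt c != 0 by rewrite sqrtr_eq0 -ltNge.
  have [e|e] := eqVneq (Num.sqrt c + fps_ev0 g) 0; last first.
    by exists (Num.sqrt c) => //; rewrite -expr2 sqr_sqrtr // ltW.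
  exists (- Num.sqrt c); first by rewrite mulrNN -expr2 sqr_sqrtr // ltW.
  apply: contra_eqN e => /eqP e'; apply: contraNneq s0 => e.
  by apply/eqP; lra.
have s0 : s != 0 by apply: contraNneq c0 => s0; rewrite -sc s0 mul0r.
have Fu : F (fpsC s + g) by apply: subspaceD => //; exact: coef_algebraC.
apply: (NR Fu (subspaceZ (b * s)^-1 sF Fh)); first by rewrite ev0D ev0C.
have bs0 : b * s != 0 by rewrite mulf_neq0.
apply: (scalerI bs0); rewrite scalerBr -!scalerAl !vfdZ -!scalerAr !scalerA mulfV // !scale1r.
rewrite vfdD vfdC add0r Dg Dh -scaleNr !scale_fpsC.
transitivity (fpsC b * (fpsC s * g + q)); first by rewrite /q rmorphN; ring.
by rewrite qc -sc !rmorphM; ring.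
Qed.

Lemma kernel_const g (m : R) k : F g -> g != 0 -> m != 0 -> D g = m *: g -> F k ->
  D k = 0 -> k = fpsC (fps_ev0 k).
Proof.
move=> Fg g0 m0 Dg Fk Dk; apply: (power_const FN g0); elim=> [|n IH]; first by rewrite mul1r.
have DkX : D (k ^+ n) = 0.
  by case: n {IH} => [|n]; [rewrite expr0 D1|rewrite vfdX Dk mulr0].
apply: (subspaceZV sF m0); have := FB Fk IH; rewrite vfdM DkX Dg Dk; congr (F _).
by rewrite !scale_fpsC exprS; ring.
Qed.

(** The bracket of g and g^i h is ((i - 1) m + n) g^(i+1) h; if the factor were never 0, all the g^i
    h would lie in F and g would be constant. *)
Lemma eigen_product_const g h (m n : R) : F g -> F h -> g != 0 -> h != 0 -> m != 0 ->
  D g = m *: g -> D h = n *: h -> exists i : nat, (i%:R - 1) * m + n = 0.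
Proof.
move=> Fg Fh g0 h0 m0 Dg Dh; apply: contrapT => nE.
have Fgh i : F (g ^+ i * h).
  elim: i => [|i IH]; first by rewrite mul1r.
  have i0 : (i%:R - 1) * m + n != 0 by apply/eqP => e; apply: nE; exists i.
  apply: (subspaceZV sF i0); have := FB Fg IH; congr (F _).
  have DgX : D (g ^+ i) = (i%:R * m) *: g ^+ i.
    case: i {IH i0} => [|i]; first by rewrite expr0 D1 mul0r scale0r.
    by rewrite vfdX Dg !scale_fpsC !rmorphM !(rmorph_nat (@fpsC R)) exprS; ring.
  rewrite vfdM DgX Dg Dh !scale_fpsC.
  rewrite !(rmorphM, rmorphD, rmorphB, rmorph1) !(rmorph_nat (@fpsC R)) exprS; ring.
have gc := power_const FN h0 Fgh.
have /eqP := Dg; rewrite (const_deriv0 gc) eq_sym scaler_eq0 (negPf m0) => /eqP g0'.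
by rewrite g0' eqxx in g0.
Qed.

(** Applied both ways, [eigen_product_const] leaves only m = n or n = - m. In the second case g h is
    a first integral in F, hence constant; but g vanishes at 0, so g h = 0. *)
Lemma eigen_unique g h (m n : R) : F g -> F h -> g != 0 -> h != 0 -> m != 0 -> n != 0 ->
  D g = m *: g -> D h = n *: h -> m = n.
Proof.
move=> Fg Fh g0 h0 m0 n0 Dg Dh; apply/eqP/negPn/negP => mn.
have [i iE] := eigen_product_const Fg Fh g0 h0 m0 Dg Dh.
have [j jE] := eigen_product_const Fh Fg h0 g0 n0 Dh Dg.
have nm : n = - m.
  case: i iE => [|[|i]] iE.
  - by case/eqP: mn; rewrite sub0r mulN1r in iE; lra.
  - by case/eqP: n0; rewrite subrr mul0r add0r in iE.
  case: j jE => [|[|j]] jE.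
  - by case/eqP: mn; rewrite sub0r mulN1r in jE; lra.
  - by case/eqP: m0; rewrite subrr mul0r add0r in jE.
  have E : (i.+1%:R * j.+1%:R - 1) * m = 0.
    have nE : n = - (i.+1%:R * m) by move: iE; rewrite -[i.+2%:R]natr1; lra.
    have jE' : j.+1%:R * n + m = 0 by move: jE; rewrite -[j.+2%:R]natr1 addrK.
    by transitivity (- (j.+1%:R * n + m)); [rewrite nE; ring|rewrite jE' oppr0].
  move/eqP: E; rewrite mulf_eq0 (negPf m0) orbF subr_eq0 -natrM (eqr_nat R _ 1) muln_eq1.
  by move=> /andP[/eqP[i0] _]; move: iE; rewrite i0; lra.
have Fgh : F (g * h).
  have nm0 : n - m != 0 by rewrite subr_eq0 eq_sym.
  apply: (subspaceZV sF nm0); have := FB Fg Fh; rewrite Dg Dh; congr (F _).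
  by rewrite !scale_fpsC rmorphB; ring.
have Dgh : D (g * h) = 0 by rewrite vfdM Dg Dh nm !scale_fpsC rmorphN; ring.
have := kernel_const Fg g0 m0 Dg Fgh Dgh.
rewrite ev0M (eigen_nonunit Fg m0 Dg) mul0r rmorph0 => /eqP.
by rewrite mulf_eq0 (negPf g0) (negPf h0).
Qed.

(** With P a polynomial in D, an eigenvector in the image of P is what refutes P != 0 on F. *)
Lemma eigen_in_image (P : fps2 R -> fps2 R) : linear P -> (forall f, F f -> F (P f)) ->
  (forall f, P (D f) = D (P f)) -> (exists2 f, F f & P f != 0) ->
  exists (m : R) f, [/\ F f, P f != 0 & D (P f) = m *: P f].
Proof.
move=> Pl PF PD [f Ff Pf0]; pose S := [set y | exists2 f, F f & y = P f].
have PDD p q : P (p + q) = P p + P q by have := Pl 1 p q; rewrite !scale1r.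
have P0 : P 0 = 0 by apply: (addrI (P 0)); rewrite -PDD !addr0.
have [||z [f' Ff' ->]||a [b [g [h [[g' Fg' gE] [h' Fh' hE] gh Dg Dh]]]]] := @eigen_in S.
- split; first by exists 0; [exact: sF.1|rewrite P0].
  by move=> a _ _ [p Fp ->] [q Fq ->]; exists (a *: p + q); rewrite ?Pl //; exact: sF.2.
- by move=> _ [p Fp ->]; exact: PF.
- by exists (D f'); [exact: coef_algebraD|rewrite PD].
- by exists (P f) => //; exists f.
have Fg : F g by rewrite gE; exact: PF.
have Fh : F h by rewrite hE; exact: PF.
have b0 := no_complex_eigen Fg Fh gh Dg Dh.
rewrite b0 !scale0r subr0 add0r in Dg Dh; clear b b0.
by case/orP: gh => z0; exists a; [exists g'|exists h']; rewrite -?gE -?hE.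
Qed.

Lemma no_unit_derivative_class :
  (forall f, F f -> D f = 0) \/
  exists l : R, l != 0 /\ forall f, F f ->
    exists (c : R) g, [/\ f = c *: 1 + g, F g, D g = l *: g & fps_ev0 g = 0].
Proof.
case: (pselect (exists (l : R) g, [/\ l != 0, F g, g != 0 & D g = l *: g])) =>
    [[l [y [l0 Fy y0 Dy]]]|nl]; [right|left]; last first.
  move=> f Ff; apply/eqP/negPn/negP => f0.
  have [||//||m [h [Fh h0 Dh]]] := @eigen_in_image D.
  - exact: D_linear.
  - exact: coef_algebraD.
  - by exists f.
  have [m0|m0] := eqVneq m 0; last first.
    by apply: nl; exists m, (D h); split=> //; exact: coef_algebraD.
  rewrite m0 scale0r in Dh; set k := D h in h0 Dh.
  have pow n : F (k ^+ n * 1) /\ D (k ^+ n) = 0.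
    elim: n => [|n [IH1 IH2]]; first by rewrite mulr1.
    rewrite mulr1 in IH1; rewrite mulr1 exprSr; split.
      by have := FB IH1 Fh; rewrite IH2 mulr0 subr0.
    by rewrite vfdM IH2 Dh mul0r mulr0 addr0.
  have kc := power_const FN (oner_neq0 _) (fun n => (pow n).1).
  by case/eqP: h0; rewrite kc (no_const_deriv Fh kc) rmorph0.
exists l; split=> // f Ff.
have K k : F k -> D k = 0 -> k = fpsC (fps_ev0 k) by exact: kernel_const Fy y0 l0 Dy.
have ker2 g : F g -> D (D g) = 0 -> D g = 0.
  move=> Fg Dg2; have Dgc := K _ (coef_algebraD Fg) Dg2.
  by rewrite Dgc (no_const_deriv Fg Dgc) rmorph0.
have FP g : F g -> F (D g - l *: g).
  by move=> Fg; apply: subspaceB; [|exact: coef_algebraD|exact: subspaceZ].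
(* There are no generalized eigenvectors: z = D g - l g would satisfy [g, z] = - z^2, so z^2 would
   be in F with eigenvalue 2 l, against uniqueness. *)
have gen2 g : F g -> D (D g - l *: g) = l *: (D g - l *: g) -> D g - l *: g = 0.
  move=> Fg; set z := D g - l *: g => Dz; apply/eqP/negPn/negP => z0.
  have Fz : F z by exact: FP.
  have DgE : D g = l *: g + z by rewrite addrC subrK.
  have Fz2 : F (z ^+ 2).
    rewrite -[z ^+ 2]opprK; apply: subspaceN => //; have := FB Fg Fz; congr (F _).
    by rewrite Dz DgE !scale_fpsC; ring.
  have l20 : 2 * l != 0 by rewrite mulf_neq0 // pnatr_eq0.
  have z20 : z ^+ 2 != 0 by rewrite expf_neq0.
  have := eigen_unique Fy Fz2 y0 z20 l0 l20 Dy.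
  rewrite vfdX Dz expr1 => e; suff : l = 2 * l by move=> e2; case/eqP: l0; lra.
  apply: e.
  by rewrite !scale_fpsC rmorphM (rmorph_nat (@fpsC R)); ring.
have DDf g : F g -> D (D g) - l *: D g = 0.
  move=> Fg; apply/eqP/negPn/negP => g0.
  have [||f1||m [h [Fh h0 Dh]]] := @eigen_in_image (fun f => D (D f) - l *: D f).
  - by move=> a p q; rewrite !D_linear scalerBr scalerDr !scalerA mulrC opprD addrACA.
  - by move=> p Fp; apply: FP; exact: coef_algebraD.
  - by rewrite vfdB vfdZ.
  - by exists g.
  have Fz : F (D (D h) - l *: D h) by apply: FP; exact: coef_algebraD.
  have [m0|m0] := eqVneq m 0.
    rewrite m0 scale0r in Dh; case/eqP: h0; rewrite -vfdZ -vfdB; apply: ker2; first exact: FP.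
    by move: Dh; rewrite !vfdB !vfdZ.
  have lm := eigen_unique Fy Fz y0 h0 l0 m0 Dy Dh.
  by case/eqP: h0; apply: gen2; [exact: coef_algebraD|rewrite Dh lm].
(* Since D^2 = l D on F, the series D f / l is an eigenvector and f - D f / l is a constant. *)
have FDf := coef_algebraD Ff.
pose g := l^-1 *: D f.
have Fg : F g by exact: subspaceZ.
have Dg : D g = D f.
  have /eqP := DDf f Ff; rewrite subr_eq0 => /eqP DDf'.
  by rewrite vfdZ DDf' scalerA mulVf // scale1r.
have Dgl : D g = l *: g by rewrite Dg scalerA mulfV // scale1r.
have kc : f - g = fpsC (fps_ev0 (f - g)).
  by apply: K; [exact: subspaceB|rewrite vfdB Dg subrr].
exists (fps_ev0 (f - g)), g; split=> //; last exact: eigen_nonunit Fg l0 Dgl.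
by rewrite scale_fpsC mulr1 -kc subrK.
Qed.

End NoUnitDerivative.
End Algebra.

Definition vf_multiples X F : set (formal_vf R) :=
  [set Y | exists2 f, F f & Y = [ffun i => f * X i]].

(** Rank 1 makes every Y in L proportional to X over the fractions, and the coprime coefficients of
    X clear the denominator. *)
Lemma saturable_coef_algebra (L : set (formal_vf R)) : is_lie_subalgebra L ->
  finite_dimensional L -> saturable L -> vf_rank L 1 -> exists N X F,
  [/\ fps_coprime (X ord0) (X ord_max), coef_algebra N X F & L = vf_multiples X F].
Proof.
move=> [L0 Ll Lb] [N [e LE]] [X LX Xc] [_ rk].
have X0 f : (forall i, f * X i = 0) -> f = 0.
  move=> fX; have /orP[Xn|Xn] := coprime_neq0 Xc; apply/eqP.
    by have /eqP := fX ord0; rewrite mulf_eq0 (negPf Xn) orbF.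
  by have /eqP := fX ord_max; rewrite mulf_eq0 (negPf Xn) orbF.
exists N, X, [set f | L [ffun i => f * X i]]; split=> //.
  split.
  - split; first by rewrite /= (_ : [ffun i => 0 * X i] = 0) //; apply/ffunP => i; rewrite !ffunE mul0r.
    move=> a f g /= Lf Lg; have := Ll a _ _ Lf Lg; congr (L _); apply/ffunP => i.
    by rewrite !ffunE mulrDl scalerAl.
  - move=> f /= Lf; have LN := @span_rank_le R (formal_vf R) N e; rewrite -LE in LN.
    have [c [ci E]] := LN _ Lf; exists c; split=> //; apply: X0 => i.
    have := congr1 (fun W : formal_vf R => W i) E; rewrite sum_ffunE !ffunE => Ei.
    rewrite mulr_suml -[RHS]Ei; apply: eq_bigr => j _.
    by rewrite !ffunE -scalerAl.
  - by rewrite /= (_ : [ffun i => 1 * X i] = X) //; apply/ffunP => i; rewrite !ffunE mul1r.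
  - move=> f g /= Lf Lg; have := Lb _ _ Lf Lg; congr (L _).
    exact: (vf_bracket_scale (@fps_derivM R)).
apply/seteqP; split=> [Y LY|_ [f Lf ->] //].
pose V (i : 'I_2) : formal_vf R := if i == ord0 then X else Y.
have VL i : L (V i) by rewrite /V; case: ifP.
have /existsNP[c /not_implyP[cV /existsNP[i ci]]] : ~ fps_linindep V by move=> /(rk 2%N V VL).
have E j : c ord0 * X j + c ord_max * Y j = 0.
  by rewrite -[RHS](cV j) !big_ord_recl big_ord0 addr0; congr (_ + c _ * _); apply: val_inj.
have c1 : c ord_max != 0.
  apply/eqP => c1; apply: ci; case: (ord2_cases i) => -> //; apply: X0 => j.
  by have := E j; rewrite c1 mul0r addr0.
have [||t [Y0 Y1]] := @coprime_syzygy _ (X ord_max) (X ord0) (Y ord0) (Y ord_max).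
- exact: coprime_sym.
- apply: (mulfI c1); apply/eqP; rewrite -subr_eq0; apply/eqP.
  transitivity ((c ord0 * X ord0 + c ord_max * Y ord0) * X ord_max -
    (c ord0 * X ord_max + c ord_max * Y ord_max) * X ord0); first by ring.
  by rewrite !E !mul0r subrr.
have YE : Y = [ffun i => t * X i].
  by apply/ffunP => k; rewrite ffunE; case: (ord2_cases k) => ->.
by exists t => //=; rewrite -YE.
Qed.

End Classification.

(** * Lifting to germs *)

Lemma cramer_rule (B : comNzRingType) (s a b c d p q : B) : s * (a * b - c * d) = 1 ->
  s * (p * b - q * c) * a + s * (q * a - p * d) * c = p /\
  s * (p * b - q * c) * d + s * (q * a - p * d) * b = q.
Proof.
move=> sJ; rewrite -[RHS in _ /\ _ = RHS]mul1r -[RHS in _ = RHS /\ _]mul1r -sJ.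
by split; ring.
Qed.

(* E stands for the algebra of smooth germs and T for the Taylor expansion; keeping
   them abstract isolates the four analytic facts that the lifting needs. *)

Section Lifting.
Variables (R : realType) (E : comAlgType R) (dE : 'I_2 -> E -> E).
Variable T : {rmorphism E -> fps2 R}.
Hypothesis dE_linear : forall i, linear (dE i).
Hypothesis dE_M : forall i u v, dE i (u * v) = dE i u * v + u * dE i v.
Hypothesis T_deriv : forall i u, T (dE i u) = fps_deriv i (T u).
Hypothesis T_scale : forall (a : R) u, T (a *: u) = a *: T u.
Hypothesis T_surj : forall f, exists u, T u = f.
Hypothesis E_inv : forall u, fps_ev0 (T u) != 0 -> exists w, w * u = 1.
Variables (xE yE : E).
Hypothesis T_x : T xE = fpsX R.
Hypothesis T_y : T yE = fpsY R.
Hypothesis E_flat : forall N u, T u = 0 ->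
  exists w, T w = 0 /\ u = (xE ^+ (2 * N) + yE ^+ (2 * N)) * w.
Hypothesis E_compose : forall u (c : nat -> R), fps_ev0 (T u) = 0 -> exists v w,
  (forall k, fil 1 1 k (T v - \sum_(j < k) c j *: T u ^+ j)) /\
  forall i, dE i v = w * dE i u.

Local Notation A := (fps2 R).
Implicit Types (f g q : A) (e p u v w : E) (X : formal_vf R) (om : 'I_2 -> E).

Local Notation vfE := (vf_apply dE).
Let TM : {morph T : u v / u * v} := rmorphM T.
Let TD : {morph T : u v / u + v} := rmorphD T.
Let TB : {morph T : u v / u - v} := rmorphB T.
Let TN : {morph T : u / - u} := rmorphN T.
Let T1 : T 1 = 1 := rmorph1 T.
Let TX n : {morph T : u / u ^+ n} := rmorphXn T n.

Local Notation vfE_T Z := ([ffun i => T (Z i)] : formal_vf R).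

(* The coefficient of om /\ du; the vector fields annihilated by the one-form om are the
   multiples of u |-> wedge om u. *)
Definition wedge om u := om ord0 * dE ord_max u - om ord_max * dE ord0 u.

Lemma wedgeM om u v : wedge om (u * v) = wedge om u * v + u * wedge om v.
Proof. by rewrite /wedge !dE_M; ring. Qed.

(** The curve u = 0 lifts q = 0 and is exactly invariant under the fields annihilated by om. *)
Definition invariant_lift p om q := exists u a b,
  [/\ T u = q, p = a * u & wedge om u = b * u].

Lemma unit_lift f : f \is a GRing.unit -> exists u s, T u = f /\ s * u = 1.
Proof.
have [u uf] := T_surj f; rewrite fps_unitE -uf => /E_inv[s su].
by exists u, s.
Qed.

Lemma invariant_lift_unit p om q (v : A) : v \is a GRing.unit ->
  invariant_lift p om q -> invariant_lift p om (v * q).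
Proof.
move=> /unit_lift[w [s [wv sw]]] [u [a [b [uq pE ob]]]].
exists (w * u), (a * s), (b + s * wedge om w); split.
- by rewrite TM wv uq.
- rewrite pE; transitivity (a * u * (s * w)); first by rewrite sw mulr1.
  by ring.
- rewrite wedgeM ob; transitivity (w * b * u + (s * w) * wedge om w * u); last by ring.
  by rewrite sw; ring.
Qed.

(* f = e p has logarithmic derivative om / p; here p plays the role of the
   radical of f, so that om has no common factor with p. *)
Lemma log_rep f : f != 0 -> exists e p om,
  [/\ T (e * p) = f, (forall k, dE k (e * p) = e * om k),
      (forall q, fps_irr q -> fps_dvd q (T p) ->
         ~ (fps_dvd q (T (om ord0)) /\ fps_dvd q (T (om ord_max)))),
      (forall q, fps_irr q -> fps_dvd q f -> fps_dvd q (T p)) &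
      (forall q, fps_irr q -> fps_dvd q f -> invariant_lift p om q)].
Proof.
move: f; apply: factor_ind => [f fu|r n f rirr f0 rf [e [p [om [epf dep cop rad inv]]]]].
  have [u uf] := T_surj f.
  have nq q : fps_irr q -> ~ fps_dvd q f.
    by move=> /irr_nunit /negP qn /dvd_unit /(_ fu).
  exists 1, u, (fun k => dE k u); split=> //.
  - by rewrite mul1r.
  - by move=> k; rewrite !mul1r.
  - by move=> q qi; rewrite uf => /(nq q qi).
  - by move=> q qi /(nq q qi).
  - by move=> q qi /(nq q qi).
have [u ur] := T_surj r.
have du k : T (dE k u) = fps_deriv k r by rewrite T_deriv ur.
have rTp : ~ fps_dvd r (T p).
  by move=> rp; apply: rf; rewrite -epf TM; apply: dvdMl.
(* d(u^(n+1) e p) = u^n e ((n + 1) p du + u om). *)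
exists (u ^+ n * e), (u * p), (fun k => n.+1%:R * (p * dE k u) + u * om k); split.
- by rewrite -epf -ur !TM TX exprSr; ring.
- move=> k; have -> : u ^+ n * e * (u * p) = u ^+ n.+1 * (e * p) by rewrite exprSr; ring.
  rewrite dE_M dep.
  have -> : dE k (u ^+ n.+1) = n.+1%:R * u ^+ n * dE k u.
    elim: n => [|n IH]; first by rewrite !mul1r.
    by rewrite exprS dE_M IH exprS -[n.+2]addn1 natrD; ring.
  by rewrite exprS; ring.
- move=> q qi; rewrite TM ur => /(irr_prime qi) qrp.
  have tn k : T (n.+1%:R * (p * dE k u) + u * om k) =
      n.+1%:R *: (T p * fps_deriv k r) + r * T (om k).
    rewrite TD !TM ur du; congr (_ + _).
    rewrite (_ : T n.+1%:R = n.+1%:R) ?scaler_nat ?mulr_natl //.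
    exact: rmorph_nat.
  have n0 : (n.+1%:R : R) != 0 by rewrite pnatr_eq0.
  have nN k : fps_dvd q (n.+1%:R *: (T p * fps_deriv k r)) ->
      fps_dvd q (T p * fps_deriv k r).
    by move=> qd; rewrite -[X in fps_dvd q X](scalerK n0) scale_fpsC; apply: dvdMl.
  rewrite /= !tn => -[q0 q1].
  (* If q divides r, it divides p dr and hence dr, which [irr_deriv] forbids; otherwise q divides p
     and om, against the induction hypothesis. *)
  case: (EM (fps_dvd q r)) => [qr|qr].
    have rq := irr_dvd_irr qi rirr qr.
    have aux k : fps_dvd q (n.+1%:R *: (T p * fps_deriv k r) + r * T (om k)) ->
        fps_dvd r (fps_deriv k r).
      move=> /dvd_addl qd; have /(dvd_trans rq) := nN k (qd (dvdMr _ qr)).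
      by move=> /(irr_prime rirr)[/rTp|].
    by apply: (irr_deriv rirr) => i; case: (ord2_cases i) => ->; apply: aux.
  have qp : fps_dvd q (T p) by case: qrp.
  have aux k : fps_dvd q (n.+1%:R *: (T p * fps_deriv k r) + r * T (om k)) ->
      fps_dvd q (T (om k)).
    rewrite addrC => /dvd_addl qd.
    have /(irr_prime qi)[//|] : fps_dvd q (r * T (om k)).
      by apply: qd; rewrite scale_fpsC mulrA; apply: dvdMr; apply: dvdMl.
    by [].
  by apply: (cop q qi qp); split; apply: aux.
- move=> q qi /(irr_prime qi)[/(irr_primeX qi) qr|qf]; rewrite TM.
    by rewrite ur; apply: dvdMr.
  by apply: dvdMl; apply: rad.
- move=> q qi /(irr_prime qi)[/(irr_primeX qi) qr|qf].
    have [v qv] := irr_dvd_irr qi rirr qr.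
    have vu : v \is a GRing.unit.
      have [_ _ /(_ v r qv)[//|ru]] := qi.
      by case/negP: (irr_nunit rirr).
    rewrite qv; apply: invariant_lift_unit => //.
    exists u, p, (om ord0 * dE ord_max u - om ord_max * dE ord0 u); split=> //.
      by rewrite mulrC.
    by rewrite /wedge; ring.
  have [y [a [b [yq pE ob]]]] := inv q qi qf.
  exists y, (u * a), (n.+1%:R * a * (dE ord0 u * dE ord_max y - dE ord_max u * dE ord0 y) + u * b).
  split=> //; first by rewrite pE; ring.
  transitivity (n.+1%:R * p * (dE ord0 u * dE ord_max y - dE ord_max u * dE ord0 y) +
    u * wedge om y); first by rewrite /wedge; ring.
  by rewrite ob {1}pE; ring.
Qed.

Definition mkvf (a b : E) : {ffun 'I_2 -> E} := [ffun i => if i == ord0 then a else b].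

Lemma mkvfE a b u : vfE (mkvf a b) u = a * dE ord0 u + b * dE ord_max u.
Proof. by rewrite vf_applyE !ffunE. Qed.

Lemma T_mkvf X a b : T a = X ord0 -> T b = X ord_max -> vfE_T (mkvf a b) = X.
Proof. by move=> aX bX; apply/ffunP => i; rewrite !ffunE; case: (ord2_cases i) => ->. Qed.

Lemma log_rep_coprime f e p om : f != 0 -> fps_ev0 f = 0 ->
  T (e * p) = f -> (forall k, dE k (e * p) = e * om k) ->
  (forall q, fps_irr q -> fps_dvd q (T p) ->
     ~ (fps_dvd q (T (om ord0)) /\ fps_dvd q (T (om ord_max)))) ->
  (forall q, fps_irr q -> fps_dvd q f -> fps_dvd q (T p)) ->
  fps_coprime (T (om ord0)) (T (om ord_max)).
Proof.
move=> f0 fm epf dep cop rad.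
have df k : fps_deriv k f = T e * T (om k) by rewrite -epf -T_deriv dep TM.
apply: coprime_irr.
  apply/negP => /negP; rewrite negb_or !negbK => /andP[/eqP o0 /eqP o1].
  have := f0; rewrite (deriv_eq0 (f := f)) ?fm ?rmorph0 ?eqxx // => i.
  by rewrite df; case: (ord2_cases i) => ->; rewrite (o0, o1) mulr0.
move=> q qi q0 q1; apply: (cop q qi) => //; apply: (rad q qi).
(* The Hamiltonian field of q leaves q = 0 invariant. If q divides om, it divides df, so f is
   constant on this curve, and its value there is 0. *)
pose Y : formal_vf R := [ffun i => if i == ord0 then fps_deriv ord_max q else - fps_deriv ord0 q].
have YE g : vfd Y g = fps_deriv ord_max q * fps_deriv ord0 g - fps_deriv ord0 q * fps_deriv ord_max g.
  by rewrite vf_applyE !ffunE /= mulNr.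
apply: (@curve_dvd R Y) => //.
- by rewrite YE mulrC subrr; apply: dvd0.
- rewrite !ffunE /= => -[q1' q0']; apply: (irr_deriv qi) => i.
  by case: (ord2_cases i) => -> //; rewrite -[X in fps_dvd q X]opprK; apply: dvdN.
- by rewrite YE !df; apply: dvdB; do 2 apply: dvdMl.
Qed.

Lemma invariant_lift_prod (Z : {ffun 'I_2 -> E}) p om s g : (forall u, vfE Z u = s * wedge om u) ->
  g != 0 -> (forall q, fps_irr q -> fps_dvd q g -> invariant_lift p om q) ->
  exists u c, T u = g /\ vfE Z u = c * u.
Proof.
move=> ZE g0; have lift q : fps_irr q -> invariant_lift p om q -> exists u c, T u = q /\ vfE Z u = c * u.
  move=> qi [u [a [b [uq pE ob]]]]; exists u, (s * b); split=> //.
  by rewrite ZE ob mulrA.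
move: g g0; apply: factor_ind => [g gu _|q n g qi g0 qg IH inv'].
  have [u [v [ug vu]]] := unit_lift gu; exists u, (vfE Z u * v).
  by split=> //; rewrite -mulrA vu mulr1.
have [|u [c [ug Zu]]] := IH.
  by move=> q' q'i q'g; apply: inv' => //; apply: dvdMl.
have [|y [d [yq Zy]]] := lift q qi.
  by apply: inv' => //; rewrite exprS -mulrA; apply: dvdMr; apply: dvd_refl.
exists (y ^+ n.+1 * u), (n.+1%:R * d + c); split; first by rewrite TM TX yq ug.
rewrite (vf_applyM dE_M) (vf_applyX dE_M) Zu Zy exprS.
move: (y ^+ n) => yn; move: (n.+1%:R) => nn; ring.
Qed.

Lemma first_integral_form X f e p om : f != 0 -> vfd X f = 0 ->
  T (e * p) = f -> (forall k, dE k (e * p) = e * om k) ->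
  fps_coprime (T (om ord0)) (T (om ord_max)) ->
  exists t, X ord0 = t * T (om ord_max) /\ - X ord_max = t * T (om ord0).
Proof.
move=> f0 Df epf dep omc; apply: coprime_syzygy omc _.
have df k : fps_deriv k f = T e * T (om k) by rewrite -epf -T_deriv dep TM.
have : T e * (X ord0 * T (om ord0) + X ord_max * T (om ord_max)) = 0.
  by rewrite -Df vf_applyE !df; ring.
move/eqP; rewrite mulf_eq0 => /orP[/eqP e0|]; last first.
  by rewrite addr_eq0 mulNr => /eqP.
by case/eqP: f0; rewrite -epf TM e0 mul0r.
Qed.

Lemma wedge_closed om e u v w : (forall k, dE k u = e * om k) ->
  (forall k, dE k v = w * dE k u) -> wedge om v = 0.
Proof. by move=> du dv; rewrite /wedge !dv !du; ring. Qed.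

Lemma hamiltonian_vf X om s : X ord0 = T s * T (om ord_max) ->
  - X ord_max = T s * T (om ord0) ->
  exists Z : {ffun 'I_2 -> E}, vfE_T Z = X /\ forall u, vfE Z u = - s * wedge om u.
Proof.
move=> X0 X1; exists (mkvf (s * om ord_max) (- (s * om ord0))); split.
  by apply: T_mkvf; rewrite ?TN TM // -X1 opprK.
by move=> u; rewrite mkvfE /wedge; ring.
Qed.

(** Let f generate the first integrals, with lift e p. A field proportional to [wedge om]
    annihilates e p and thus every smooth function of it. An invariant g has only irreducible
    factors of f, whose lifts are invariant too. *)
Lemma realize_first_integrals X : fps_coprime (X ord0) (X ord_max) ->
  (exists2 f, vfd X f = 0 & f <> fpsC (fps_ev0 f)) ->
  exists Z : {ffun 'I_2 -> E}, [/\ vfE_T Z = X,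
    (forall k, vfd X k = 0 -> exists2 u, T u = k & vfE Z u = 0) &
    forall g, g != 0 -> fps_dvd g (vfd X g) -> exists u c, T u = g /\ vfE Z u = c * u].
Proof.
move=> Xc /(first_integral_generator Xc)[f [Df fm f0 gen]].
have [e [p [om [epf dep cop rad inv]]]] := log_rep f0.
have omc := log_rep_coprime f0 fm epf dep cop rad.
have [t [t0 t1]] := first_integral_form f0 Df epf dep omc.
have [s sE] := T_surj t.
rewrite -sE in t0 t1.
have [Z [ZX ZE]] := hamiltonian_vf t0 t1.
exists Z; split=> //.
  move=> k Dk; have [c kc] := gen k Dk.
  have [|v [w [vc dv]]] := E_compose c (u := e * p); first by rewrite epf.
  exists v; last by rewrite ZE (wedge_closed dep dv) mulr0.
  apply: (@fil_eq R 1 1) => // n.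
  by have := vc n; rewrite epf => vn; apply: fil_trans vn (filBC (kc n)).
move=> g g0 gg; apply: (invariant_lift_prod ZE g0) => q qi qg; apply: inv => //.
exact: (curve_first_integral Xc qi g0 gg qg).
Qed.

Lemma vf_lift X : exists Z : {ffun 'I_2 -> E}, vfE_T Z = X.
Proof.
have [[a aX] [b bX]] := (T_surj (X ord0), T_surj (X ord_max)).
by exists (mkvf a b); apply: T_mkvf.
Qed.

(* Since om is coprime, x^(2N) + y^(2N) lies in the ideal of its components, so
   a flat function is a flat combination of them. *)
Lemma flat_ideal om h : fps_coprime (T (om ord0)) (T (om ord_max)) -> T h = 0 ->
  exists a b, [/\ T a = 0, T b = 0 & h = a * om ord0 + b * om ord_max].
Proof.
move=> omc h0; have [N [u1 [v1 XN]]] := X_ideal omc; have [M [u2 [v2 YM]]] := Y_ideal omc.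
pose n := (2 * (N + M))%N.
have [c cE] := T_surj (fpsX R ^+ (n - N) * u1 + fpsY R ^+ (n - M) * u2).
have [d dE'] := T_surj (fpsX R ^+ (n - N) * v1 + fpsY R ^+ (n - M) * v2).
pose r : E := xE ^+ n + yE ^+ n.
(* The combination lifts x^n + y^n up to a flat function, which is r w with w flat. So the ideal
   contains r (1 + w), and 1 + w is invertible. *)
have [|w [w0 wE]] := @E_flat (N + M) (c * om ord0 + d * om ord_max - r).
  rewrite TB TD !TM TD !TX T_x T_y cE dE'.
  have -> : fpsX R ^+ n = fpsX R ^+ (n - N) * fpsX R ^+ N by rewrite -exprD subnK // /n; lia.
  have -> : fpsY R ^+ n = fpsY R ^+ (n - M) * fpsY R ^+ M by rewrite -exprD subnK // /n; lia.
  by rewrite XN YM; ring.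
have [|s sE] := @E_inv (1 + w); first by rewrite TD T1 w0 addr0 ev01 oner_neq0.
have [y [y0 hy]] := E_flat (N + M) h0.
exists (y * s * c), (y * s * d); split; rewrite ?TM ?y0 ?mul0r //.
have cdE : c * om ord0 + d * om ord_max = r * (1 + w).
  by rewrite -[LHS](subrK r) wE mulrDr mulr1 addrC.
transitivity (y * s * (c * om ord0 + d * om ord_max)); last by ring.
rewrite cdE hy -/n -/r; transitivity (r * y * (s * (1 + w))); first by rewrite sE mulr1.
by move: (r : E) => r'; ring.
Qed.

Lemma eigen_form X g e p om (l : R) : g != 0 -> vfd X g = l *: g ->
  T (e * p) = g -> (forall k, dE k (e * p) = e * om k) ->
  T (om ord0) * X ord0 + T (om ord_max) * X ord_max = l *: T p.
Proof.
move=> g0 Dg epg dep.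
have Te0 : T e != 0 by apply: contraNneq g0 => e0; rewrite -epg TM e0 mul0r.
apply: (mulfI Te0); rewrite -scalerAr -TM epg -Dg vf_applyE.
have df k : fps_deriv k g = T e * T (om k) by rewrite -epg -T_deriv dep TM.
by rewrite !df; ring.
Qed.

Lemma eigen_form_coprime X g e p om (l : R) : l != 0 -> g != 0 -> T (e * p) = g ->
  (forall q, fps_irr q -> fps_dvd q (T p) ->
     ~ (fps_dvd q (T (om ord0)) /\ fps_dvd q (T (om ord_max)))) ->
  T (om ord0) * X ord0 + T (om ord_max) * X ord_max = l *: T p ->
  fps_coprime (T (om ord0)) (T (om ord_max)).
Proof.
move=> l0 g0 epg cop omX; apply: coprime_irr => [|q qi q0 q1].
  apply/negP => /negP; rewrite negb_or !negbK => /andP[/eqP o0 /eqP o1].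
  move/eqP: omX; rewrite o0 o1 !mul0r addr0 eq_sym scaler_eq0 (negPf l0) => /eqP p0.
  by case/eqP: g0; rewrite -epg TM p0 mulr0.
apply: (cop q qi) => //; rewrite -[T p](scalerK l0) -omX scale_fpsC.
by apply: dvdMl; apply: dvdD; apply: dvdMr.
Qed.

Lemma log_apply e p om a b : (forall k, dE k (e * p) = e * om k) ->
  vfE (mkvf a b) (e * p) = e * (om ord0 * a + om ord_max * b).
Proof. by move=> dep; rewrite mkvfE !dep; ring. Qed.

(** For an arbitrary lift of X the equation om(Z) = l p fails by a flat function. This defect is
    om(a, b) with a, b flat, and subtracting them does not change the Taylor expansion. *)
Lemma realize_eigenvector X g (l : R) : l != 0 -> g != 0 -> vfd X g = l *: g ->
  exists (Z : {ffun 'I_2 -> E}) u, [/\ vfE_T Z = X, T u = g & vfE Z u = l *: u].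
Proof.
move=> l0 g0 Dg; have [e [p [om [epg dep cop rad inv]]]] := log_rep g0.
have omX := eigen_form g0 Dg epg dep.
have omc := eigen_form_coprime l0 g0 epg cop omX.
have [[z0 z0X] [z1 z1X]] := (T_surj (X ord0), T_surj (X ord_max)).
have [|a [b [a0 b0 hE]]] := flat_ideal (h := om ord0 * z0 + om ord_max * z1 - l *: p) omc.
  by rewrite TB TD T_scale !TM -omX z0X z1X subrr.
exists (mkvf (z0 - a) (z1 - b)), (e * p); split=> //.
  by apply: T_mkvf; rewrite TB (a0, b0) subr0.
rewrite (log_apply _ _ dep) scalerAr; congr (e * _); apply/eqP.
rewrite -subr_eq0 !mulrBr -[X in _ == X](subrr (a * om ord0 + b * om ord_max)) -[X in _ == X - _]hE.
by apply/eqP; ring.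
Qed.

Lemma cramer_vfE s (u v u' v' : E) :
  s * (dE ord0 u * dE ord_max v - dE ord_max u * dE ord0 v) = 1 ->
  let Z := mkvf (s * (u' * dE ord_max v - v' * dE ord_max u))
                (s * (v' * dE ord0 u - u' * dE ord0 v)) in
  vfE Z u = u' /\ vfE Z v = v'.
Proof.
by move=> sJ Z; rewrite !mkvfE; apply: cramer_rule.
Qed.

Lemma cramer_vfd X s f g :
  s * (fps_deriv ord0 f * fps_deriv ord_max g - fps_deriv ord_max f * fps_deriv ord0 g) = 1 ->
  s * (vfd X f * fps_deriv ord_max g - vfd X g * fps_deriv ord_max f) = X ord0 /\
  s * (vfd X g * fps_deriv ord0 f - vfd X f * fps_deriv ord0 g) = X ord_max.
Proof.
rewrite !vf_applyE.
move: (fps_deriv ord0 f) (fps_deriv ord_max g) (fps_deriv ord_max f) (fps_deriv ord0 g).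
move=> a b c d sJ; rewrite -[RHS in _ /\ _ = RHS]mul1r -[RHS in _ = RHS /\ _]mul1r -sJ.
by split; ring.
Qed.

(** Lifts of coordinates have an invertible Jacobian, so a field is determined by its values on
    them, and these can be prescribed. *)
Lemma realize_eigencoordinates X f g (l m : R) :
  fps_ev0 (fps_deriv ord0 f * fps_deriv ord_max g - fps_deriv ord_max f * fps_deriv ord0 g) != 0 ->
  vfd X f = l *: f -> vfd X g = m *: g ->
  exists (Z : {ffun 'I_2 -> E}) u v, [/\ vfE_T Z = X, T u = f, T v = g, vfE Z u = l *: u & vfE Z v = m *: v].
Proof.
move=> J0 Df Dg; have [[u uf] [v vg]] := (T_surj f, T_surj g).
have TJ : T (dE ord0 u * dE ord_max v - dE ord_max u * dE ord0 v) =
    fps_deriv ord0 f * fps_deriv ord_max g - fps_deriv ord_max f * fps_deriv ord0 g.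
  by rewrite TB !TM !T_deriv uf vg.
have [|s sE] := @E_inv (dE ord0 u * dE ord_max v - dE ord_max u * dE ord0 v).
  by rewrite TJ.
have TsJ := congr1 T sE; rewrite TM TJ T1 in TsJ.
have [X0 X1] := cramer_vfd X TsJ.
have [Tlu Tmv] : T (l *: u) = vfd X f /\ T (m *: v) = vfd X g by rewrite !T_scale uf vg Df Dg.
have [Zu Zv] := cramer_vfE (l *: u) (m *: v) sE.
eexists _, u, v; split; [|done|done|exact: Zu|exact: Zv].
by apply: T_mkvf; rewrite TM TB 2!TM !T_deriv uf vg Tlu Tmv.
Qed.

(* P lifts F to multipliers of a lift Z of X, so that P Z lifts the Lie algebra F X. *)
Definition liftable X (F : set A) := exists (Z : {ffun 'I_2 -> E}) (P : set E),
  [/\ vfE_T Z = X /\ subspace P, forall u v, P u -> P v -> P (u * vfE Z v - v * vfE Z u),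
      forall u, P u -> F (T u), forall f, F f -> exists2 u, P u & T u = f &
      forall u, P u -> T u = 0 -> u = 0].

Let vEZ Z a u : vfE Z (a *: u) = a *: vfE Z u. Proof. exact: vf_applyZ. Qed.
Let vED Z u v : vfE Z (u + v) = vfE Z u + vfE Z v. Proof. exact: vf_applyD. Qed.
Let vEM Z u v : vfE Z (u * v) = vfE Z u * v + u * vfE Z v. Proof. exact: vf_applyM. Qed.
Let vE0 Z : vfE Z 0 = 0. Proof. exact: vf_apply0. Qed.
Let vE1 Z : vfE Z 1 = 0. Proof. exact: vf_apply1. Qed.
Let vEX Z u n : vfE Z (u ^+ n.+1) = n.+1%:R * u ^+ n * vfE Z u. Proof. exact: vf_applyX. Qed.

Let Tsum n (u : 'I_n -> E) : T (\sum_i u i) = \sum_i T (u i). Proof. exact: rmorph_sum. Qed.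

Lemma T_vfE (Z : {ffun 'I_2 -> E}) u : T (vfE Z u) = vfd (vfE_T Z) (T u).
Proof. by rewrite !vf_applyE TD !TM !T_deriv !ffunE. Qed.

Lemma eigen_subspace (Z : {ffun 'I_2 -> E}) l : subspace [set u | vfE Z u = l *: u].
Proof.
split=> [|a u v /= u0 v0] /=; first by rewrite vE0 scaler0.
by rewrite vED vEZ u0 v0 scalerDr !scalerA mulrC.
Qed.

Lemma kernel_subspace (Z : {ffun 'I_2 -> E}) : subspace [set u | vfE Z u = 0].
Proof. by split=> [|a u v /= u0 v0] /=; rewrite ?vE0 // vED vEZ u0 v0 scaler0 addr0. Qed.

(** P may contain flat elements; keeping only the span of lifts of a basis makes T injective. *)
Lemma section_ex N (P : set E) (F : set A) : subspace P -> subspace F -> rank_le N F ->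
  (forall f, F f -> exists2 u, P u & T u = f) -> exists P' : set E,
  [/\ subspace P', P' `<=` P, forall u, P' u -> F (T u),
      forall f, F f -> exists2 u, P' u & T u = f & forall u, P' u -> T u = 0 -> u = 0].
Proof.
move=> sP sF FN PF; have [n [e [Fe fe gen]]] := basis_ex sF FN.
have /boolp.choice[u uE] : forall i, exists u, P u /\ T u = e i.
  by move=> i; have [u Pu Tu] := PF _ (Fe i); exists u.
have Tc (c : 'I_n -> R) : T (\sum_i c i *: u i) = \sum_i c i *: e i.
  by rewrite Tsum; apply: eq_bigr => i _; rewrite T_scale (uE i).2.
exists [set v | exists c : 'I_n -> R, v = \sum_i c i *: u i]; split.
- split; first by exists (fun=> 0); rewrite big1 // => i _; rewrite scale0r.
  move=> a _ _ [c ->] [d ->]; exists (fun i => a * c i + d i).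
  rewrite scaler_sumr -big_split; apply: eq_bigr => i _ /=.
  by rewrite scalerDl scalerA.
- move=> _ [c ->]; apply: subspace_sum => // i; apply: subspaceZ => //; exact: (uE i).1.
- move=> _ [c ->]; rewrite Tc; apply: subspace_sum => // i; exact: subspaceZ.
- by move=> f /gen[c ->]; exists (\sum_i c i *: u i); [exists c|exact: Tc].
- by move=> _ [c ->]; rewrite Tc => /fe c0; apply: big1 => i _; rewrite c0 scale0r.
Qed.

Lemma kernel_lift X : fps_coprime (X ord0) (X ord_max) -> exists Z : {ffun 'I_2 -> E},
  vfE_T Z = X /\ forall k, vfd X k = 0 -> exists2 u, T u = k & vfE Z u = 0.
Proof.
move=> Xc; case: (pselect (exists2 f, vfd X f = 0 & f <> fpsC (fps_ev0 f))) => [fi|nfi].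
  by have [Z [ZX kl _]] := realize_first_integrals Xc fi; exists Z.
have [Z ZX] := vf_lift X; exists Z; split=> // k Dk.
have kc : k = fpsC (fps_ev0 k) by apply: contrapT => kc; apply: nfi; exists k.
exists (fps_ev0 k *: 1); last by rewrite vEZ vE1 scaler0.
by rewrite T_scale T1 scale_fpsC mulr1 -kc.
Qed.

Lemma vfE_rescale (Z : {ffun 'I_2 -> E}) s u : vfE [ffun i => s * Z i] u = s * vfE Z u.
Proof. exact: vf_applyMl. Qed.

Lemma T_rescale X (Z : {ffun 'I_2 -> E}) s : vfE_T Z = X -> T s = 1 ->
  vfE_T ([ffun i => s * Z i] : {ffun 'I_2 -> E}) = X.
Proof. by move=> <- s1; apply/ffunP => i; rewrite !ffunE TM s1 mul1r. Qed.

(** A lift v of w has Z v = 1 up to a flat function. Dividing Z by Z v corrects this without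
    changing its Taylor expansion or its first integrals. *)
Lemma unit_derivative_lift X (w : A) (Z : {ffun 'I_2 -> E}) : vfE_T Z = X -> vfd X w = 1 ->
  exists (Z' : {ffun 'I_2 -> E}) v, [/\ vfE_T Z' = X, T v = w, vfE Z' v = 1 &
    forall u, vfE Z u = 0 -> vfE Z' u = 0].
Proof.
move=> ZX Dw; have [v vw] := T_surj w.
have Tv : T (vfE Z v) = 1 by rewrite T_vfE ZX vw Dw.
have [|s sE] := @E_inv (vfE Z v); first by rewrite Tv ev01 oner_neq0.
exists [ffun i => s * Z i], v; split=> //.
- apply: T_rescale => //; have := congr1 T sE; by rewrite TM Tv mulr1 T1.
- by rewrite vfE_rescale.
- by move=> u u0; rewrite vfE_rescale u0 mulr0.
Qed.

Lemma liftable_quadratic X (F : set A) (w : A) : vfd X w = 1 -> subspace F -> F 1 -> F w -> F (w ^+ 2) ->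
  (forall f, F f -> exists a b c : R, f = a *: 1 + b *: w + c *: w ^+ 2) -> liftable X F.
Proof.
move=> Dw sF F1 Fw Fw2 gen; have [Z0 Z0X] := vf_lift X.
have [Z [v [ZX vw Zv _]]] := unit_derivative_lift Z0X Dw.
have TP (a b c : R) : T (a *: 1 + b *: v + c *: v ^+ 2) = a *: 1 + b *: w + c *: w ^+ 2.
  by rewrite !TD !T_scale T1 TX vw.
exists Z, [set u | exists a b c : R, u = a *: 1 + b *: v + c *: v ^+ 2]; split=> //.
- split=> //; split; first by exists 0, 0, 0; rewrite !scale0r !addr0.
  move=> r _ _ [a [b [c ->]]] [a' [b' [c' ->]]].
  exists (r * a + a'), (r * b + b'), (r * c + c').
  by rewrite !scalerDl !scalerDr !scalerA; ring.
- move=> _ _ [a [b [c ->]]] [a' [b' [c' ->]]].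
  exists (a * b' - a' * b), (2 * (a * c' - a' * c)), (b * c' - b' * c).
  rewrite !vED !vEZ vE1 vEX Zv expr1 mulr1 !scaler0 !add0r.
  rewrite -![_ *: 1]/(_%:A) -![_ *: v]mulr_algl -![_ *: v ^+ 2]mulr_algl -![_ *: (2 * v)]mulr_algl.
  have alM (r s : R) : (r * s)%:A = r%:A * s%:A :> E by exact: (rmorphM (in_alg E)).
  rewrite !scalerBl !alM scalerBl !alM scaler_nat.
  move: (a%:A) (b%:A) (c%:A) (a'%:A) (b'%:A) (c'%:A) => p q r p' q' r'; ring.
- move=> _ [a [b [c ->]]]; rewrite TP.
  by do !(apply: subspaceD => //); apply: subspaceZ.
- by move=> f /gen[a [b [c ->]]]; exists (a *: 1 + b *: v + c *: v ^+ 2) => //; exists a, b, c.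
move=> _ [a [b [c ->]]]; rewrite TP => E0.
have D1 : vfd X (1 : A) = 0 by exact: (vfd_nat X 1).
(* Differentiating the relation successively isolates c, then b, then a. *)
have E1 : b *: 1 + (2 * c) *: w = 0.
  have := congr1 (vfd X) E0; rewrite vfd0 !vfdD !vfdZ D1 vfdX Dw => <-.
  by rewrite !scale_fpsC rmorphM (rmorph_nat (@fpsC R)); ring.
have E2 : (2 * c) *: (1 : A) = 0.
  by have := congr1 (vfd X) E1; rewrite vfd0 vfdD !vfdZ D1 Dw scaler0 add0r.
have one0 (r : R) : r *: (1 : A) = 0 -> r = 0.
  by move/eqP; rewrite scaler_eq0 oner_eq0 orbF => /eqP.
have c0 : c = 0 by have /eqP := one0 _ E2; rewrite mulf_eq0 pnatr_eq0 => /eqP.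
have b0 : b = 0 by apply: one0; rewrite -[RHS]E1 c0 mulr0 scale0r addr0.
have a0 : a = 0 by apply: one0; rewrite -[RHS]E0 c0 b0 !scale0r !addr0.
by rewrite a0 b0 c0 !scale0r !addr0.
Qed.

Lemma liftable_kernel N X (F : set A) : fps_coprime (X ord0) (X ord_max) -> subspace F ->
  rank_le N F -> (forall f, F f -> vfd X f = 0) -> liftable X F.
Proof.
move=> Xc sF FN F0; have [Z [ZX kl]] := kernel_lift Xc.
have [f Ff|P [sP PD PF FP Pinj]] := section_ex (kernel_subspace Z) sF FN.
  by have [u Tu u0] := kl f (F0 f Ff); exists u.
exists Z, P; split=> // u v /PD /= u0 /PD /= v0.
by rewrite u0 v0 !mulr0 subrr; exact: sP.1.
Qed.

Lemma liftable_affine N X (F : set A) (w : A) : fps_coprime (X ord0) (X ord_max) ->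
  vfd X w = 1 -> subspace F -> rank_le N F -> F w ->
  (forall f, F f -> exists (c : R) k, [/\ f = c *: w + k, F k & vfd X k = 0]) -> liftable X F.
Proof.
move=> Xc Dw sF FN Fw gen; have [Z0 [Z0X kl]] := kernel_lift Xc.
have [Z [v [ZX vw Zv Zk]]] := unit_derivative_lift Z0X Dw.
pose K : set A := [set k | F k /\ vfd X k = 0].
have sK : subspace K.
  split=> [|a f g [Ff f0] [Fg g0]]; first by split; [exact: sF.1|rewrite vfd0].
  by split; [exact: sF.2|rewrite vfdD vfdZ f0 g0 scaler0 addr0].
have KN : rank_le N K by move=> f fK; apply: FN => i; have [] := fK i.
have [k [Fk k0]|P [sP PD PF FP Pinj]] := section_ex (kernel_subspace Z) sK KN.
  by have [u Tu u0] := kl k k0; exists u => //; exact: Zk.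
exists Z, [set u | exists (c : R) p, P p /\ u = c *: v + p]; split.
- split=> //; split; first by exists 0, 0; split; [exact: sP.1|rewrite scale0r addr0].
  move=> a _ _ [c [p [Pp ->]]] [d [q [Pq ->]]]; exists (a * c + d), (a *: p + q).
  by split; [exact: sP.2|rewrite scalerDl scalerDr scalerA; ring].
- move=> _ _ [c [p [Pp ->]]] [d [q [Pq ->]]]; exists 0, (d *: p - c *: q); split.
    by apply: subspaceB => //; apply: subspaceZ.
  have /= p0 := PD _ Pp; have /= q0 := PD _ Pq.
  rewrite !vED !vEZ Zv p0 q0 !addr0 scale0r add0r -[d%:A]/(in_alg E d) -[c%:A]/(in_alg E c).
  rewrite -![_ *: v]mulr_algl -![_ *: p]mulr_algl -![_ *: q]mulr_algl /=.
  by move: (c%:A) (d%:A) => r s; ring.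
- move=> _ [c [p [Pp ->]]]; rewrite TD T_scale vw.
  by apply: subspaceD => //; [apply: subspaceZ|have [] := PF _ Pp].
- move=> f /gen[c [k [-> Fk k0]]]; have [|p Pp pk] := FP k; first by split.
  by exists (c *: v + p); [exists c, p|rewrite TD T_scale vw pk].
move=> _ [c [p [Pp ->]]]; rewrite TD T_scale vw => E0; have [_ p0] := PF _ Pp.
have c0 : c = 0.
  have := congr1 (vfd X) E0; rewrite vfd0 vfdD vfdZ Dw p0 addr0 => /eqP.
  by rewrite scaler_eq0 oner_eq0 orbF => /eqP.
by rewrite c0 scale0r add0r in E0; rewrite c0 scale0r add0r; exact: Pinj.
Qed.

Lemma eigenspace_lift X (l : R) (G : set A) : fps_coprime (X ord0) (X ord_max) -> l != 0 ->
  eigspace X l G -> exists Z : {ffun 'I_2 -> E},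
  vfE_T Z = X /\ forall g, G g -> exists2 u, T u = g & vfE Z u = l *: u.
Proof.
move=> Xc l0 eG; have [_ _ GD] := eG.
case: (pselect (exists2 g, G g & g != 0)) => [G0|G0]; last first.
  have [Z ZX] := vf_lift X; exists Z; split=> // g Gg; exists 0.
    by rewrite rmorph0; apply/eqP; rewrite eq_sym; apply/negPn/negP => g0; apply: G0; exists g.
  by rewrite scaler0 vE0.
have [[g [Gg g0 gG]]|[f [g [a [b [J Df Dg mono]]]]]] := eigspace_dichotomy l0 eG G0.
  (* When all of G is divisible by g, the quotients are first integrals, so lifting g and the first
     integrals with one Z suffices. *)
  have Dquot h k : G h -> h = k * g -> vfd X k = 0.
    move=> Gh hE; apply: (mulIf g0); rewrite mul0r.
    have := GD h Gh; rewrite hE vfdM (GD g Gg) => E0; apply: (addIr (k * (l *: g))).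
    by rewrite E0 add0r !scale_fpsC; ring.
  case: (pselect (exists2 f, vfd X f = 0 & f <> fpsC (fps_ev0 f))) => [fi|nfi].
    have [Z [ZX kl il]] := realize_first_integrals Xc fi.
    have [|u [c [ug Zu]]] := il g g0.
      by exists (fpsC l); rewrite (GD g Gg) scale_fpsC.
    (* The first integrals already fix Z, and the lift of g has a cofactor c that equals l only up
       to a flat function; multiplying Z by l / c makes it exact and keeps the first integrals. *)
    have Tc : T c = fpsC l.
      apply: (mulIf g0); rewrite -scale_fpsC -(GD g Gg) -ug -ZX -T_vfE Zu TM //.
    have [|s sE] := @E_inv c; first by rewrite Tc ev0C.
    exists [ffun i => (l *: s) * Z i]; split.
      apply: T_rescale => //; have := congr1 T sE.
      by rewrite T_scale TM Tc T1 scale_fpsC mulrC.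
    move=> h Gh; have [k hE] := gG h Gh; have [v vk Zv] := kl k (Dquot h k Gh hE).
    exists (v * u); first by rewrite TM vk ug.
    rewrite vfE_rescale vEM Zv Zu mul0r add0r -scalerAl; congr (l *: _).
    by transitivity (s * c * (v * u)); [ring|rewrite sE mul1r].
  have [Z [u [ZX ug Zu]]] := realize_eigenvector l0 g0 (GD g Gg).
  exists Z; split=> // h Gh; have [k hE] := gG h Gh.
  have kc : k = fpsC (fps_ev0 k).
    by apply: contrapT => kc; apply: nfi; exists k => //; exact: Dquot Gh hE.
  exists (fps_ev0 k *: u); first by rewrite T_scale ug hE scale_fpsC -kc.
  by rewrite vEZ Zu !scalerA mulrC.
have [Z [u [v [ZX uf vg Zu Zv]]]] := realize_eigencoordinates J Df Dg.
exists Z; split=> // h /mono[N [c [hE cE]]].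
exists (\sum_(i < N) \sum_(j < N) fps_coef c i j *: (u ^+ i * v ^+ j)).
  rewrite Tsum hE; apply: eq_bigr => i _; rewrite Tsum; apply: eq_bigr => j _.
  by rewrite T_scale TM !TX uf vg.
have Zpow w (m : R) n : vfE Z w = m *: w -> vfE Z (w ^+ n) = (n%:R * m) *: w ^+ n.
  move=> Zw; case: n => [|n]; first by rewrite expr0 vE1 mul0r scale0r.
  by rewrite vEX Zw -scalerAr [n.+1%:R * m]mulrC -scalerA scaler_nat exprSr -mulrA mulr_natl.
rewrite (vf_apply_sum dE_linear) scaler_sumr; apply: eq_bigr => i _.
rewrite (vf_apply_sum dE_linear) scaler_sumr; apply: eq_bigr => j _ /=.
rewrite vEZ vEM (Zpow u a) // (Zpow v b) // -scalerAl -scalerAr -scalerDl.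
have [->|c0] := eqVneq (fps_coef c i j) 0; first by rewrite !scale0r scaler0.
by rewrite cE // !scalerA mulrC.
Qed.

Lemma liftable_eigen N X (F : set A) (l : R) : fps_coprime (X ord0) (X ord_max) ->
  subspace F -> rank_le N F -> F 1 -> l != 0 ->
  (forall f, F f -> exists (c : R) g, [/\ f = c *: 1 + g, F g, vfd X g = l *: g & fps_ev0 g = 0]) ->
  liftable X F.
Proof.
move=> Xc sF FN F1 l0 gen.
pose G : set A := [set g | [/\ F g, vfd X g = l *: g & fps_ev0 g = 0]].
have sG : subspace G.
  split=> [|a f g [Ff Df f0] [Fg Dg g0]].
    by split; [exact: sF.1|rewrite vfd0 scaler0|rewrite ev00].
  split; first exact: sF.2.
    by rewrite vfdD vfdZ Df Dg scalerDr !scalerA mulrC.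
  by rewrite ev0D scale_fpsC ev0M f0 g0 mulr0 addr0.
have GN : rank_le N G by move=> f fG; apply: FN => i; have [] := fG i.
have eG : eigspace X l G by split; [exact: sG.2|move=> g []|move=> g []].
have [Z [ZX lift]] := eigenspace_lift Xc l0 eG.
have [g /lift[u ug Zu]|P [sP PD PF FP Pinj]] := section_ex (eigen_subspace Z l) sG GN.
  by exists u.
exists Z, [set u | exists (c : R) p, P p /\ u = c *: 1 + p]; split.
- split=> //; split; first by exists 0, 0; split; [exact: sP.1|rewrite scale0r addr0].
  move=> a _ _ [c [p [Pp ->]]] [d [q [Pq ->]]]; exists (a * c + d), (a *: p + q).
  by split; [exact: sP.2|rewrite scalerDl scalerDr scalerA; ring].
- move=> _ _ [c [p [Pp ->]]] [d [q [Pq ->]]]; exists 0, (l *: (c *: q - d *: p)); split.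
    by apply: subspaceZ => //; apply: subspaceB => //; apply: subspaceZ.
  have /= Zp := PD _ Pp; have /= Zq := PD _ Pq.
  rewrite !vED !vEZ vE1 !scaler0 !add0r Zp Zq scale0r add0r -!scalerAr -scalerBr; congr (l *: _).
  rewrite -![_ *: q]mulr_algl -![_ *: p]mulr_algl.
  by move: (c%:A) (d%:A) => r s; ring.
- move=> _ [c [p [Pp ->]]]; rewrite TD T_scale T1.
  by apply: subspaceD => //; [apply: subspaceZ|have [] := PF _ Pp].
- move=> f /gen[c [g [-> Fg Dg gm]]]; have [|p Pp pg] := FP g; first by split.
  by exists (c *: 1 + p); [exists c, p|rewrite TD T_scale T1 pg].
move=> _ [c [p [Pp ->]]]; rewrite TD T_scale T1 => E0; have [_ Dp _] := PF _ Pp.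
have D1 : vfd X (1 : A) = 0 by exact: (vfd_nat X 1).
have Tp0 : T p = 0.
  have := congr1 (vfd X) E0; rewrite vfd0 vfdD vfdZ D1 scaler0 add0r Dp => /eqP.
  by rewrite scaler_eq0 (negPf l0) => /eqP.
move: E0; rewrite Tp0 addr0 => /eqP; rewrite scaler_eq0 oner_eq0 orbF => /eqP ->.
by rewrite scale0r add0r; exact: Pinj.
Qed.

Lemma liftable_lie X (F : set A) : fps_coprime (X ord0) (X ord_max) -> liftable X F ->
  exists M : set {ffun 'I_2 -> E},
  [/\ M 0, forall (a : R) V W, M V -> M W -> M (a *: V + W),
      forall V W, M V -> M W -> M (vf_bracket dE V W),
      (fun W : {ffun 'I_2 -> E} => vfE_T W) @` M = vf_multiples X F &
      forall V W, M V -> M W -> vfE_T V = vfE_T W -> V = W].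
Proof.
move=> Xc [Z [P [[ZX sP] Pbr PF FP Pinj]]].
exists [set W | exists2 p, P p & W = [ffun i => p * Z i]]; split.
- exists 0; first exact: sP.1.
  by apply/ffunP => i; rewrite !ffunE mul0r.
- move=> a _ _ [p Pp ->] [q Pq ->]; exists (a *: p + q); first exact: sP.2.
  by apply/ffunP => i; rewrite !ffunE mulrDl scalerAl.
- move=> _ _ [p Pp ->] [q Pq ->]; exists (p * vfE Z q - q * vfE Z p); first exact: Pbr.
  exact: vf_bracket_scale dE_M _ _ _.
- have TZ i : X i = T (Z i) by rewrite -ZX ffunE.
  apply/seteqP; split=> [_ [_ [p Pp ->] <-]|_ [f /FP[p Pp pf] ->]].
    by exists (T p); [exact: PF|apply/ffunP => i; rewrite !ffunE TM TZ].
  exists [ffun i => p * Z i]; first by exists p.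
  by apply/ffunP => i; rewrite !ffunE TM -pf TZ.
move=> _ _ [p Pp ->] [q Pq ->] TE; suff -> : p = q by [].
apply/eqP; rewrite -subr_eq0; apply/eqP/Pinj; first exact: subspaceB.
have pqX i : T (p - q) * X i = 0.
  have := congr1 (fun W : formal_vf R => W i) TE; rewrite !ffunE !TM -ZX ffunE => TEi.
  by rewrite TB mulrBl TEi subrr.
have /orP[X0|X0] := coprime_neq0 Xc; apply/eqP.
  by have /eqP := pqX ord0; rewrite mulf_eq0 (negPf X0) orbF.
by have /eqP := pqX ord_max; rewrite mulf_eq0 (negPf X0) orbF.
Qed.

Lemma coef_algebra_liftable N X (F : set A) : fps_coprime (X ord0) (X ord_max) ->
  coef_algebra N X F -> exists X' F', [/\ fps_coprime (X' ord0) (X' ord_max),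
    vf_multiples X' F' = vf_multiples X F & liftable X' F'].
Proof.
move=> Xc XF; have [sF FN F1 FB] := XF.
case: (pselect (exists u w : A, [/\ F u, F w, fps_ev0 u != 0 & u * vfd X w - w * vfd X u = u])) =>
    [[u [w [Fu Fw u0 uw]]]|nr]; last first.
  exists X, F; split=> //.
  have NR (u w : A) : F u -> F w -> fps_ev0 u != 0 -> u * vfd X w - w * vfd X u <> u.
    by move=> Fu Fw u0 uw; apply: nr; exists u, w.
  have [D0|[l [l0 gen]]] := no_unit_derivative_class XF NR.
    exact: liftable_kernel Xc sF FN D0.
  exact: liftable_eigen Xc sF FN F1 l0 gen.
have uu : u \is a GRing.unit by rewrite fps_unitE.
pose X' : formal_vf R := [ffun i => u * X i]; pose F' : set A := [set f | F (u * f)].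
have DX' f : vfd X' f = u * vfd X f by exact: vf_applyMl.
have X'c : fps_coprime (X' ord0) (X' ord_max).
  by move=> d; rewrite !ffunE => d0 d1; apply: Xc; apply: dvd_Mul_unit uu _.
have sF' : subspace F'.
  split=> [|a f g Ff Fg]; rewrite /F' /= ?mulr0; first exact: sF.1.
  by rewrite mulrDr -scalerAr; exact: sF.2.
have F'N : rank_le N F'.
  move=> f Ff; have [c [ci cE]] := FN (fun i => u * f i) Ff; exists c; split=> //.
  apply: (mulrI uu); rewrite mulr0 -[RHS]cE mulr_sumr; apply: eq_bigr => i _.
  by rewrite scalerAr.
have Dquot h : u * vfd X (u^-1 * h) = vfd X h - u^-1 * h * vfd X u.
  have := vfdM X u (u^-1 * h); rewrite mulVKr // => ->.
  by rewrite addrC; ring.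
have X'F' : coef_algebra N X' F'.
  split=> //; first by rewrite /F' /= mulr1.
  move=> f g Ff Fg; rewrite /F' /= !DX'; have := FB _ _ Ff Fg; congr (F _).
  by rewrite !vfdM; ring.
exists X', F'; split=> //.
  apply/seteqP; split=> [_ [f Ff ->]|_ [f Ff ->]].
    by exists (u * f) => //; apply/ffunP => i; rewrite !ffunE; ring.
  exists (u^-1 * f); first by rewrite /F' /= mulVKr.
  by apply/ffunP => i; rewrite !ffunE mulrA -[_ * u]mulrC mulVKr.
(* (u X)(w / u) = X w - w X u / u, which is 1 by the choice of u and w. *)
pose v := u^-1 * w; have Fv : F' v by rewrite /F' /= mulVKr.
have Dv : vfd X' v = 1.
  rewrite DX' Dquot; apply: (mulrI uu); rewrite mulr1 mulrBr !mulrA mulrV // mul1r.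
  by rewrite uw.
have [_ _ F'1 _] := X'F'.
have [[Fv2 gen]|gen] := unit_derivative_class X'F' Fv Dv.
  exact: liftable_quadratic Dv sF' F'1 Fv Fv2 gen.
exact: liftable_affine X'c Dv sF' F'N Fv gen.
Qed.

End Lifting.

Lemma taylor_scale (R : realType) (a : R) (u : germ R) : taylor (a *: u) = a *: taylor u.
Proof. by rewrite scale_germC taylorM taylorC scale_fpsC. Qed.

Lemma taylor_vf_apply (R : realType) (Z : germ_vf R) (u : germ R) :
  taylor (vf_apply (@germ_deriv R) Z u) = vf_apply (@fps_deriv R) (taylor_vf Z) (taylor u).
Proof.
rewrite /vf_apply taylor_sum; apply: eq_bigr => i _.
by rewrite taylorM taylor_deriv ffunE.
Qed.

Theorem mainTheorem2 (R : realType) (Lhat : set (formal_vf R))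
    (Lhat_sub : is_lie_subalgebra Lhat)
    (Lhat_fin : finite_dimensional Lhat)
    (Lhat_sat : saturable Lhat)
    (Lhat_rank : vf_rank Lhat 1) :
  exists L : set (germ_vf R),
    [/\ is_lie_subalgebra L,
        @taylor_vf R @` L = Lhat
      & is_lie_isomorphism L Lhat (@taylor_vf R)].
Proof.
have [N [X [F [Xc XF LE]]]] := saturable_coef_algebra Lhat_sub Lhat_fin Lhat_sat Lhat_rank.
have [X' [F' [X'c FE X'F']]] := coef_algebra_liftable (@germ_deriv_linear R) (@germ_derivM R)
  (@taylor_deriv R) (@taylor_scale R) (@taylor_surj R) (@germ_inv R) (@taylor_gX R)
  (@taylor_gY R) (@flat_divide R) (@germ_compose R) Xc XF.
have [M [M0 Ml Mb MT Minj]] := liftable_lie (@germ_derivM R) X'c X'F'.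
have TM : @taylor_vf R @` M = Lhat by rewrite LE -FE -MT.
exists M; split=> //; split.
- split.
  + by move=> W MW; rewrite -TM; exists W.
  + by move=> V W /set_mem MV /set_mem MW; exact: Minj.
  + by move=> Y; rewrite -TM => -[W MW <-]; exists W.
- by move=> a V W _ _; apply/ffunP => i; rewrite !ffunE taylorD taylor_scale.
- move=> V W _ _; apply/ffunP => i; rewrite !ffunE taylorB.
  by rewrite !taylor_vf_apply.
Qed.
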